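(* Let $(X,d,\mu)$ be a complete metric space with $\operatorname{diam}X>0$, where $\mu$ is a doubling measure with doubling constant $C_d$, and suppose $X$ supports a $(1,1)$-Poincaré inequality with constants $C_P,\lambda$. There exists a constant $c_*>0$ depending only on $C_d,C_P,\lambda$ such that the following holds. Suppose $A\subset X$ satisfies \[ \liminf_{r\to 0}\frac{\operatorname{cap}_1(A\cap B(x,r),B(x,2r))}{\operatorname{cap}_1(B(x,r),B(x,2r))}<c_*\quad\text{for }1\text{-q.e. }x\in X . \] Then $A$ is removable for $N^{1,p}(X)$ for all $1\le p<\infty$, and $X\setminus A$ supports a $(1,1)$-Poincaré inequality.
   Context: $\mu$ is a Borel regular outer measure with $0<\mu(B(x,2r))\le C_d\mu(B(x,r))<\infty$ for all balls. Curves are rectifiable, arc-length parametrized. A nonnegative Borel $g$ is an upper gradient of $u$ in $H$ if $|u(\gamma(0))-u(\gamma(\ell_\gamma))|\le\int_\gamma g\,ds$ for all nonconstant curves $\gamma$ in $H$. The $p$-modulus of a curve family $\Gamma$ is $\inf\int\rho^p\,d\mu$ over Borel $\rho\ge0$ with $\int_\gamma\rho\,ds\ge1$ for all $\gamma\in\Gamma$; $g$ is a $p$-weak upper gradient of $u$ in $H$ if the upper gradient inequality holds for all curves in $H$ outside a family of zero $p$-modulus. For measurable $H$, $N^{1,p}(H)$ is the space of pointwise defined $u$ on $H$ with $\|u\|_{N^{1,p}(H)}=\|u\|_{L^p(H)}+\inf\|g\|_{L^p(H)}<\infty$ (infimum over $p$-weak upper gradients in $H$); $g_{u,H}$ denotes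 the minimal $p$-weak upper gradient. $X$ supports a $(1,1)$-Poincaré inequality: $\frac{1}{\mu(B)}\int_{B}|u-u_B|\,d\mu\le C_P r\frac{1}{\mu(\lambda B)}\int_{\lambda B}g\,d\mu$ for every ball $B=B(x,r)$, $u\in L^1(X)$ and upper gradient $g$ of $u$. For $A$ with $\mu(A)=0$, $X\setminus A$ supports a $(1,p)$-Poincaré inequality if there are $C_P',\lambda'\ge1$ such that for all $x\in X\setminus A$, $r>0$, $u\in L^1(X)$ and every upper gradient $g$ of $u$ in $X\setminus A$: $\frac{1}{\mu(B(x,r))}\int_{B(x,r)}|u-u_{B(x,r)}|\,d\mu\le C_P' r\big(\frac{1}{\mu(B(x,\lambda' r))}\int_{B(x,\lambda' r)}g^p\,d\mu\big)^{1/p}$. $N^{1,p}_0(W)$ consists of $u\in N^{1,p}(X)$ with $u=0$ on $X\setminus W$. For bounded open $W$ and $A\subset W$, $\operatorname{cap}_p(A,W)=\inf\int_X g_u^p\,d\mu$ over $u\in N^{1,p}_0(W)$ with $u\ge1$ on $A$. The $1$-capacity is $\operatorname{Cap}_1(A)=\inf\|u\|_{N^{1,1}(X)}$ over $u\in N^{1,1}(X)$ with $u\ge1$ on $A$; ''1-q.e.'' means outside a set of zero $1$-capacity. A set $A$ with $\mu(A)=0$ is removable for $N^{1,p}(X)$ if for every $u\in N^{1,p}(X\setminus A)$ there is $v\in N^{1,p}(X)$ with $v=u$ a.e. *)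

(* Defs.v *)
From HB Require Import structures.
From mathcomp Require Import all_boot all_order all_algebra.
From mathcomp Require Import all_classical all_reals all_analysis.
From mathcomp Require Import measurable_realfun lebesgue_integral.
Set Implicit Arguments.
Unset Strict Implicit.
Unset Printing Implicit Defensive.
Import Order.TTheory GRing.Theory Num.Theory.
Local Open Scope classical_set_scope.
Local Open Scope ring_scope.

Definition is_metric (R : realType) (X : Type) (dist : X -> X -> R) : Prop :=
  (forall x y, 0 <= dist x y) /\ (forall x y, dist x y = 0 <-> x = y) /\
  (forall x y, dist x y = dist y x) /\
  (forall x y z, dist x z <= dist x y + dist y z).

Definition dball (R : realType) (X : Type) (dist : X -> X -> R) (x : X) (r : R)
  : set X := [set y | dist x y < r].

Definition dopen (R : realType) (X : Type) (dist : X -> X -> R) (U : set X) : Prop :=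
  forall x, U x -> exists2 r : R, 0 < r & dball dist x r `<=` U.

Definition borel_for (R : realType) (d : measure_display) (X : measurableType d)
  (dist : X -> X -> R) : Prop :=
  forall E : set X, measurable E <-> <<s [set U | dopen dist U] >> E.

Definition dcomplete (R : realType) (X : Type) (dist : X -> X -> R) : Prop :=
  forall s : nat -> X,
    (forall e : R, 0 < e -> exists N : nat, forall m n, (N <= m)%N -> (N <= n)%N ->
        dist (s m) (s n) < e) ->
    exists x : X, forall e : R, 0 < e -> exists N : nat, forall n, (N <= n)%N ->
        dist (s n) x < e.

Local Open Scope ereal_scope.

Definition doubling (R : realType) (d : measure_display) (X : measurableType d)
  (dist : X -> X -> R) (mu : {measure set X -> \bar R}) (Cd : R) : Prop :=
  forall (x : X) (r : R), (0 < r)%R ->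
    0 < mu (dball dist x (2 * r)) /\
    mu (dball dist x (2 * r)) <= Cd%:E * mu (dball dist x r) /\
    mu (dball dist x r) < +oo.

(* sets of (outer) measure zero: contained in a Borel null set
   (mu is Borel regular, outer measure = inf over Borel supersets) *)
Definition onull (R : realType) (d : measure_display) (X : measurableType d)
  (mu : {measure set X -> \bar R}) (A : set X) : Prop :=
  exists N : set X, [/\ measurable N, mu N = 0 & A `<=` N].

Record curve (R : realType) (X : Type) := Curve { clen : R; cmap : R -> X }.

Definition curve_len (R : realType) (X : Type) (dist : X -> X -> R)
  (g : R -> X) (s t : R) : \bar R :=
  ereal_sup [set e | exists (n : nat) (ts : nat -> R),
    [/\ ts 0%N = s, ts n = t, (forall i, (i < n)%N -> ts i <= ts i.+1)%R &
        e = (\sum_(i < n) dist (g (ts i)) (g (ts i.+1)))%:E]].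

(* nonconstant rectifiable curve, arc-length parametrized on [0, clen] *)
Definition arc_curve (R : realType) (X : Type) (dist : X -> X -> R)
  (c : curve R X) : Prop :=
  (0 < clen c)%R /\
  forall s t : R, (0 <= s)%R -> (s <= t)%R -> (t <= clen c)%R ->
    curve_len dist (cmap c) s t = (t - s)%:E.

Definition curve_in (R : realType) (X : Type) (H : set X) (c : curve R X) : Prop :=
  forall t : R, (0 <= t)%R -> (t <= clen c)%R -> H (cmap c t).

Definition line_int (R : realType) (X : Type) (rho : X -> \bar R)
  (c : curve R X) : \bar R :=
  \int[@lebesgue_measure R]_(t in `[0%R, clen c]) rho (cmap c t).

Definition borel_nonneg (R : realType) (d : measure_display) (X : measurableType d)
  (g : X -> \bar R) : Prop :=
  measurable_fun setT g /\ forall x, 0 <= g x.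

Definition modulus (R : realType) (d : measure_display) (X : measurableType d)
  (dist : X -> X -> R) (mu : {measure set X -> \bar R}) (p : R)
  (Gam : set (curve R X)) : \bar R :=
  ereal_inf [set \int[mu]_x (rho x) `^ p | rho in
    [set rho : X -> \bar R | borel_nonneg rho /\
       forall c, Gam c -> arc_curve dist c -> 1 <= line_int rho c]].

Definition ug_ineq (R : realType) (X : Type) (u : X -> R) (g : X -> \bar R)
  (c : curve R X) : Prop :=
  (`|u (cmap c 0%R) - u (cmap c (clen c))|)%:E <= line_int g c.

Definition is_ug (R : realType) (d : measure_display) (X : measurableType d)
  (dist : X -> X -> R) (H : set X) (u : X -> R) (g : X -> \bar R) : Prop :=
  borel_nonneg g /\
  forall c, arc_curve dist c -> curve_in H c -> ug_ineq u g c.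

Definition is_pwug (R : realType) (d : measure_display) (X : measurableType d)
  (dist : X -> X -> R) (mu : {measure set X -> \bar R}) (p : R)
  (H : set X) (u : X -> R) (g : X -> \bar R) : Prop :=
  borel_nonneg g /\
  exists Gam : set (curve R X), modulus dist mu p Gam = 0 /\
    forall c, arc_curve dist c -> curve_in H c -> ~ Gam c -> ug_ineq u g c.

(* H is mu-measurable, with Borel "version" E *)
Definition mversion (R : realType) (d : measure_display) (X : measurableType d)
  (mu : {measure set X -> \bar R}) (H E : set X) : Prop :=
  measurable E /\ onull mu ((H `\` E) `|` (E `\` H)).

Definition fversion (R : realType) (d : measure_display) (X : measurableType d)
  (mu : {measure set X -> \bar R}) (H : set X) (u v : X -> R) : Prop :=
  measurable_fun setT v /\ onull mu [set x | H x /\ u x <> v x].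

Definition in_Lp (R : realType) (d : measure_display) (X : measurableType d)
  (mu : {measure set X -> \bar R}) (p : R) (H : set X) (u : X -> R) : Prop :=
  exists (E : set X) (v : X -> R), [/\ mversion mu H E, fversion mu H u v &
    \int[mu]_(x in E) (`|v x|%:E) `^ p < +oo].

Definition fin_Lp (R : realType) (d : measure_display) (X : measurableType d)
  (mu : {measure set X -> \bar R}) (p : R) (H : set X) (g : X -> \bar R) : Prop :=
  exists E : set X, mversion mu H E /\ \int[mu]_(x in E) (g x) `^ p < +oo.

Definition in_N1p (R : realType) (d : measure_display) (X : measurableType d)
  (dist : X -> X -> R) (mu : {measure set X -> \bar R}) (p : R)
  (H : set X) (u : X -> R) : Prop :=
  in_Lp mu p H u /\ exists g, is_pwug dist mu p H u g /\ fin_Lp mu p H g.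

Definition in_N1p0 (R : realType) (d : measure_display) (X : measurableType d)
  (dist : X -> X -> R) (mu : {measure set X -> \bar R}) (p : R)
  (W : set X) (u : X -> R) : Prop :=
  in_N1p dist mu p setT u /\ forall x, ~ W x -> u x = 0%R.

(* cap_p(A, W) = inf int_X g_u^p, where int_X g_u^p = inf over p-weak upper
   gradients g of u of int_X g^p *)
Definition capp (R : realType) (d : measure_display) (X : measurableType d)
  (dist : X -> X -> R) (mu : {measure set X -> \bar R}) (p : R)
  (A W : set X) : \bar R :=
  ereal_inf [set e | exists (u : X -> R) (g : X -> \bar R),
    [/\ in_N1p0 dist mu p W u, (forall x, A x -> (1 <= u x)%R),
        is_pwug dist mu p setT u g & e = \int[mu]_x (g x) `^ p]].

Definition Cap1 (R : realType) (d : measure_display) (X : measurableType d)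
  (dist : X -> X -> R) (mu : {measure set X -> \bar R}) (A : set X) : \bar R :=
  ereal_inf [set e | exists (u v : X -> R) (g : X -> \bar R),
    [/\ in_N1p dist mu 1 setT u, (forall x, A x -> (1 <= u x)%R),
        fversion mu setT u v, is_pwug dist mu 1 setT u g &
        e = \int[mu]_x (`|v x|%:E) + \int[mu]_x g x]].

Definition qe1 (R : realType) (d : measure_display) (X : measurableType d)
  (dist : X -> X -> R) (mu : {measure set X -> \bar R}) (P : X -> Prop) : Prop :=
  exists E : set X, Cap1 dist mu E = 0 /\ forall x, ~ E x -> P x.

Definition liminf0 (R : realType) (f : R -> \bar R) : \bar R :=
  ereal_sup [set ereal_inf (f @` [set r | (0 < r < delta)%R]) |
             delta in [set delta | (0 < delta)%R]].

Definition removable (R : realType) (d : measure_display) (X : measurableType d)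
  (dist : X -> X -> R) (mu : {measure set X -> \bar R}) (p : R) (A : set X) : Prop :=
  onull mu A /\
  forall u : X -> R, in_N1p dist mu p (~` A) u ->
    exists v : X -> R, in_N1p dist mu p setT v /\
      onull mu [set x | ~ A x /\ v x <> u x].

(* the averaged oscillation (1/mu(B)) int_B |u - u_B|, computed with a Borel
   version v of u *)
Definition osc_avg (R : realType) (d : measure_display) (X : measurableType d)
  (mu : {measure set X -> \bar R}) (B : set X) (v : X -> R) : \bar R :=
  let uB : R := fine ((\int[mu]_(y in B) (v y)%:E) / mu B) in
  (\int[mu]_(y in B) (`|v y - uB|)%:E) / mu B.

Definition PI11 (R : realType) (d : measure_display) (X : measurableType d)
  (dist : X -> X -> R) (mu : {measure set X -> \bar R}) (CP lam : R) : Prop :=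
  forall (x : X) (r : R), (0 < r)%R ->
  forall (u v : X -> R) (g : X -> \bar R),
    fversion mu setT u v -> mu.-integrable setT (EFin \o v) ->
    is_ug dist setT u g ->
    osc_avg mu (dball dist x r) v <=
      (CP * r)%:E * ((\int[mu]_(y in dball dist x (lam * r)) g y)
                      / mu (dball dist x (lam * r))).

Definition PI_compl (R : realType) (d : measure_display) (X : measurableType d)
  (dist : X -> X -> R) (mu : {measure set X -> \bar R}) (p : R) (A : set X) : Prop :=
  onull mu A /\
  exists CP' lam' : R, (1 <= CP')%R /\ (1 <= lam')%R /\
  forall x : X, ~ A x -> forall r : R, (0 < r)%R ->
  forall (u v : X -> R) (g : X -> \bar R),
    fversion mu setT u v -> mu.-integrable setT (EFin \o v) ->
    is_ug dist (~` A) u g ->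
    osc_avg mu (dball dist x r) v <=
      (CP' * r)%:E * (((\int[mu]_(y in dball dist x (lam' * r)) (g y) `^ p)
                       / mu (dball dist x (lam' * r))) `^ (p^-1)%R).

(* Main.v *)
(** The key point is a quantile form of the Poincare inequality that only uses the gradient off A: if u has
    an upper gradient g in X \ A, and u <= t1, resp. u >= t2, on fixed fractions of a ball B of radius r,
    then (t2 - t1) mu(B) <= C r int_{L B} g.  To see this let E = {u > t}.  The capacity hypothesis yields,
    at q.e. point x and at arbitrarily small scales s, a cut-off eta of small energy which is 1 on A near x.
    Applying the Poincare inequality to a truncation of u times (1 - eta) shows that either E or its
    complement has small density in B(x, s), or int_{B(x, s)} g 1_{t < u < t + h} / h >= c mu(B(x, s)) / s for
    small h; an exceptional set of zero capacity is swallowed by a lower semicontinuous potential of small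
    energy.  The ball B is then discretized: on a fine net, E is turned into a set of boundary comparable
    to the total heavy mass by successive minimal modifications, scale after scale, in which the low
    density regions disappear for free because a boundary minimizer of low density near a point cannot
    contain it.  The Poincare inequality for the modified set gives mu(B) / r <= C (G(t + h) - G(t)) / h with
    G(t) = int_{{u <= t}} g, and integrating over t gives the quantile inequality.

    Finally let m_k(x) be the median of u on B(x, 2^-k).  By the quantile inequality m_k satisfies on curves
    longer than 2^-k an upper gradient inequality with C g + w_k, where sum_k k^p int w_k^p < oo, so
    the upper limit of the m_k equals u a.e. and has upper gradients C g + kappa rho on X for all kappa > 0. *)
Require Import Defs.
From HB Require Import structures.
From mathcomp Require Import all_boot all_order all_algebra.
From mathcomp Require Import reals.
From mathcomp Require boolp.
From mathcomp Require Import ring lra zify.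
Set Implicit Arguments.
Unset Strict Implicit.
Unset Printing Implicit Defensive.
Import Order.TTheory GRing.Theory Num.Theory.
Local Open Scope ring_scope.

(* [lra] inspects the whole context, which is slow in long proofs.  [slra] tries with none, then with the
   latest [n] of the comparisons and equations, then with all of them; it only clears hypotheses introduced
   after the marker [True], below which lie the section hypotheses. *)
Ltac real_context n :=
  let keep H := lazymatch n with
    | O => first [clear H; real_context O | revert H; real_context O]
    | S ?m => revert H; real_context m
    end in
  lazymatch goal with
  | H : ?T |- _ =>
    lazymatch T with
    | True => idtac
    | is_true (@Order.le ring_display _ _ _) => keep H
    | is_true (@Order.lt ring_display _ _ _) => keep H
    | is_true (andb _ _) => keep H
    | @eq _ _ _ => keep H
    | _ => lazymatch type of T with
           | Prop => first [clear H | revert H]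
           | _ => try clearbody H; revert H
           end; real_context n
    end
  | _ => idtac
  end.
Ltac slra := first [real_context O; intros; lra | real_context 8%nat; intros; lra | real_context 200%nat; intros; lra].

(** * Finite weighted graphs *)

(** The superlevel set of [u] has no boundary that could be measured, and the scales at which points
    are classified vary without a common lower bound. Compactness leaves finitely many classifying
    balls, hence one width [h] for all of them, and on a finite net every modification problem has a
    minimizer. A net point is of one of three types at its own dyadic level: the set is rare, its
    complement is rare, or the gradient is heavy. Near a heavy point nothing is known of the set, so
    it is cut there at a cost that the gradient pays; at the other points nothing could pay, so
    cutting must be free. The obstacle is that the set to be cut at level [j] is the one left by
    earlier levels, whose low density is not given. It is covered by cutting balls of smaller levels
    around points of the opposite type, and a Vitali argument shows that these have little mass
    here. Heavy balls only slightly smaller would destroy this estimate; points close to them are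
    therefore cut at a cost as well, charged to the same heavy ball, while much smaller heavy balls
    have negligible total mass near a point that is not heavy. *)

Section FiniteMetric.
Variables (R : realType) (V : finType) (dv : V -> V -> R).
Hypothesis dv0 : forall x, dv x x = 0.
Hypothesis dvC : forall x y, dv x y = dv y x.
Hypothesis dvT : forall x y z, dv x z <= dv x y + dv y z.

Definition vb (x : V) (r : R) : {set V} := [set y | dv x y < r]%SET.
Definition nb (S : {set V}) (t : R) : {set V} := [set x | [exists y in S, dv x y < t]]%SET.
Definition sm (f : V -> R) (A : {set V}) : R := \sum_(i in A) f i.

Lemma nbP (S : {set V}) t x : reflect (exists2 y, y \in S & dv x y < t) (x \in nb S t).
Proof.
rewrite inE; apply: (iffP existsP) => [[y /andP[yS xy]]|[y yS xy]].
  by exists y.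
by exists y; rewrite yS.
Qed.

Lemma in_vb x r y : (y \in vb x r) = (dv x y < r).
Proof. by rewrite inE. Qed.

Lemma vb_center x r : 0 < r -> x \in vb x r.
Proof. by rewrite in_vb dv0. Qed.

Lemma nb_sub (S S' : {set V}) t t' : (forall x, x \in S -> x \in S') -> t <= t' ->
  forall x, x \in nb S t -> x \in nb S' t'.
Proof.
move=> SS tt x /nbP[y yS xy]; apply/nbP; exists y; [exact: SS|lra].
Qed.

Lemma nb_self (S : {set V}) t x : x \in S -> 0 < t -> x \in nb S t.
Proof. by move=> xS t0; apply/nbP; exists x => //; rewrite dv0. Qed.

Lemma nb_step (S : {set V}) t s x y : x \in nb S t -> dv y x <= s -> y \in nb S (s + t).
Proof.
move=> /nbP[z zS xz] yx; apply/nbP; exists z => //.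
by apply: le_lt_trans (dvT y x z) _; lra.
Qed.

Section SumLemmas.
Variable f : V -> R.
Hypothesis f0 : forall x, 0 <= f x.

Lemma sm_ge0 (A : {set V}) : 0 <= sm f A.
Proof. by apply: sumr_ge0. Qed.

Lemma sm_sub (A B : {set V}) : (forall x, x \in A -> x \in B) -> sm f A <= sm f B.
Proof.
move=> AB; rewrite /sm [leRHS](big_setID A)/=.
rewrite (_ : B :&: A = A)%SET; last by apply/setIidPr/subsetP.
by rewrite lerDl sumr_ge0.
Qed.

Lemma sm_point (A : {set V}) x : x \in A -> f x <= sm f A.
Proof. by move=> xA; rewrite /sm (bigD1 x)//= lerDl sumr_ge0. Qed.

Lemma sm_cover (I : finType) (B : {set I}) (P : I -> {set V}) (U : {set V}) :
  (forall x, x \in U -> exists2 i, i \in B & x \in P i) ->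
  sm f U <= \sum_(i in B) sm f (P i).
Proof.
move=> cov; rewrite /sm.
under [leRHS]eq_bigr do rewrite big_mkcond /=.
rewrite [leRHS]exchange_big /= [leLHS]big_mkcond /=.
apply: ler_sum => x _; case: ifPn => [xU|_]; last first.
  by apply: sumr_ge0 => i _; case: ifP.
have [i iB xi] := cov x xU.
rewrite (bigD1 i)//= xi lerDl; apply: sumr_ge0 => j _; by case: ifP.
Qed.

Lemma sum_amo (I : finType) (B : pred I) (P : I -> bool) (c : R) : 0 <= c ->
  (forall i j, B i -> B j -> P i -> P j -> i = j) ->
  \sum_(i | B i) (if P i then c else 0) <= c.
Proof.
move=> c0 amo; case: (pickP [pred i | B i && P i]) => [i /andP[Bi Pi]|no].
  rewrite (bigD1 i)//= Pi big1 ?addr0// => j /andP[Bj ji].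
  by case: ifP => // Pj; move: ji; rewrite (amo _ _ Bj Bi Pj Pi) eqxx.
rewrite big1// => i Bi; case: ifP => // Pi.
by have := no i; rewrite /= Bi Pi.
Qed.

Lemma sm_packing (I : finType) (B : {set I}) (P : I -> {set V}) (C : {set V}) :
  (forall i, i \in B -> {subset P i <= C}) ->
  (forall i j x, i \in B -> j \in B -> x \in P i -> x \in P j -> i = j) ->
  \sum_(i in B) sm f (P i) <= sm f C.
Proof.
move=> PC amo; rewrite /sm.
under eq_bigr do rewrite big_mkcond /=.
rewrite exchange_big /= [leRHS]big_mkcond /=.
apply: ler_sum => x _; case: ifPn => [xC|xC].
  by apply: sum_amo => // i j iB jB; apply: amo.
rewrite big1// => i iB; case: ifP => // /(PC i iB) xC'.
by rewrite xC' in xC.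
Qed.

Lemma sm_setU (A B : {set V}) : sm f (A :|: B)%SET <= sm f A + sm f B.
Proof.
rewrite /sm [leLHS](big_setID A)/= setUK lerD2l.
by apply: sm_sub => x; rewrite !inE; case: (x \in A).
Qed.

End SumLemmas.

(** Greedy choice of a largest radius, by induction on the cardinality. The separation makes the
    selected balls of radius [rad] disjoint; the last clause records that the selected radius
    dominates, so that tripled balls cover all the original ones. *)
Lemma finite_vitali (rad : V -> R) (A : {set V}) :
  (forall x, x \in A -> 0 < rad x) ->
  exists B : {set V}, [/\ {subset B <= A},
    (forall x y, x \in B -> y \in B -> x != y -> rad x + rad y <= dv x y) &
    (forall x, x \in A -> exists2 y, y \in B & (rad x <= rad y) /\ (dv x y < rad x + rad y))].
Proof.
have [n] := ubnP #|A|; elim: n A => // n IH A nA rpos.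
have [->|[y0 y0A]] := set_0Vmem A.
  by exists set0%SET; split => // x; rewrite inE.
pose y := [arg max_(i > y0 in A) rad i]%O.
have [yA ymax] : y \in A /\ forall x, x \in A -> rad x <= rad y.
  by rewrite /y; case: arg_maxP.
pose A' := [set x in A | rad x + rad y <= dv x y]%SET.
have A'A x : x \in A' -> x \in A by rewrite inE => /andP[].
have yA' : y \notin A'.
  by rewrite inE yA /= dv0 -ltNge; have := rpos y yA; lra.
have cA' : (#|A'| < n)%N.
  rewrite ltnS in nA; apply: leq_trans nA; apply: proper_card; apply/properP.
  by split; [apply/subsetP|exists y].
have [||B [BA' Bsep Bcov]] := IH A'; first exact: cA'.
  by move=> x /A'A; apply: rpos.
exists (y |: B)%SET; split.
- by move=> x; rewrite !inE => /orP[/eqP->//|/BA'/A'A].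
- move=> x z; rewrite !in_setU1 => /orP[/eqP->|xB] /orP[/eqP->|zB].
  + by move/eqP.
  + by move=> _; have := BA' z zB; rewrite inE => /andP[_]; rewrite dvC addrC.
  + by move=> _; have := BA' x xB; rewrite inE => /andP[_].
  + exact: Bsep.
- move=> x xA; have [xA'|xnA'] := boolP (x \in A').
    have [z zB h] := Bcov x xA'; exists z => //.
    by rewrite in_setU1 zB orbT.
  exists y; first by rewrite in_setU1 eqxx.
  split; first exact: ymax.
  by move: xnA'; rewrite inE xA /= -ltNge.
Qed.

Lemma vb_disj (rad : V -> R) (B : {set V}) :
  (forall x y, x \in B -> y \in B -> x != y -> rad x + rad y <= dv x y) ->
  forall x y z, x \in B -> y \in B -> z \in vb x (rad x) -> z \in vb y (rad y) -> x = y.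
Proof.
move=> sep x y z xB yB; rewrite !in_vb => xz yz.
apply/eqP/negPn/negP => xy; have := sep x y xB yB xy.
have := dvT x z y; rewrite (dvC z y); lra.
Qed.

End FiniteMetric.

(** * Edge boundaries and their minimal modification *)

Section FiniteGraph.
Variables (R : realType) (V : finType) (dv : V -> V -> R).
Hypothesis dv0 : forall x, dv x x = 0.
Hypothesis dvC : forall x y, dv x y = dv y x.
Hypothesis dvT : forall x y z, dv x z <= dv x y + dv y z.
Variables (m : V -> R) (tau : R) (w : V -> V -> R) (M : R).
Hypothesis tau0 : 0 < tau.
Hypothesis M1 : 1 <= M.
Hypothesis m0 : forall x, 0 <= m x.
Hypothesis w0 : forall p q, 0 <= w p q.
Hypothesis wC : forall p q, w p q = w q p.
Hypothesis w_far : forall p q, 3 * tau <= dv p q -> w p q = 0.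
Hypothesis w_deg : forall p, \sum_q w p q <= M * m p / tau.

Definition es (P Q : {set V}) : R := \sum_(p in P) \sum_(q in Q) w p q.

Lemma es_ge0 P Q : 0 <= es P Q.
Proof. by apply: sumr_ge0 => p _; apply: sumr_ge0. Qed.

Lemma es_sym P Q : es P Q = es Q P.
Proof.
rewrite /es exchange_big /=; apply: eq_bigr => q _; apply: eq_bigr => p _.
exact: wC.
Qed.

(** Only pairs at distance below [3 * tau] carry weight, so the inclusion has to be checked for
    these alone. This is how all boundary estimates are localized. *)
Lemma es_sub (P P' Q Q' : {set V}) :
  (forall p q, p \in P -> q \in Q -> dv p q < 3 * tau -> (p \in P') && (q \in Q')) ->
  es P Q <= es P' Q'.
Proof.
move=> h; rewrite /es [leLHS]big_mkcond [leRHS]big_mkcond /=.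
apply: ler_sum => p _.
have -> : (if p \in P then \sum_(q in Q) w p q else 0) =
  \sum_q (if (p \in P) && (q \in Q) then w p q else 0).
  by rewrite -big_mkcond; case: ifP => pP //=; rewrite big_pred0.
have -> : (if p \in P' then \sum_(q in Q') w p q else 0) =
  \sum_q (if (p \in P') && (q \in Q') then w p q else 0).
  by rewrite -big_mkcond; case: ifP => pP //=; rewrite big_pred0.
apply: ler_sum => q _; case: ifPn => [/andP[pP qQ]|_]; last by case: ifP.
have [close|far] := ltP (dv p q) (3 * tau); first by rewrite (h p q).
by rewrite w_far//; case: ifP.
Qed.

Lemma es_addl (P P' Q : {set V}) : es (P :|: P')%SET Q <= es P Q + es P' Q.
Proof.
rewrite /es; apply: sm_setU => p; exact: sumr_ge0.
Qed.

Lemma es_addr (P Q Q' : {set V}) : es P (Q :|: Q')%SET <= es P Q + es P Q'.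
Proof. by rewrite !(es_sym P) es_addl. Qed.

Lemma es_packing (I : finType) (B : {set I}) (P : I -> {set V}) (A A' : {set V}) :
  (forall i j x, i \in B -> j \in B -> x \in P i -> x \in P j -> i = j) ->
  \sum_(i in B) es (A :&: P i)%SET (A' :&: P i)%SET <= es A A'.
Proof.
move=> amo.
apply: (@le_trans _ _ (\sum_(i in B) es (A :&: P i)%SET A')).
  apply: ler_sum => i _; apply: es_sub => p q /setIP[pA pP] /setIP[qA qP] _.
  by rewrite in_setI pA pP qA.
apply: (@sm_packing R V (fun p => \sum_(q in A') w p q) _ I B (fun i => A :&: P i)%SET A).
- by move=> p; apply: sumr_ge0.
- by move=> i _ x /setIP[].
- by move=> i j x iB jB /setIP[_ xi] /setIP[_ xj]; apply: (amo i j x).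
Qed.

(* An edge has length < 3 tau, so it crosses at most one of the 3 tau-spaced
   level sets of the family P; average over h / (3 tau) of them. *)
Lemma slice (P : R -> {set V}) (G : {set V}) (lo h : R) :
  (forall t t', t <= t' -> {subset P t <= P t'}) ->
  (forall t x y, x \in P t -> dv x y < 3 * tau -> y \in P (t + 3 * tau)) ->
  3 * tau <= h ->
  exists t, [/\ lo <= t, t <= lo + h &
    es (G :&: P t)%SET (G :\: P t)%SET <= 6 * M / h * sm m (G :&: P (lo + h))%SET].
Proof.
have local_context : True by [].
move=> Pmono Pgrow hh.
have h0 : 0 < h by have := tau0; slra.
(* [K] levels spaced by [3 * tau] fit into the window, and [K] is at least [h / (6 * tau)]; this
   turns the average over them into the factor [6 * M / h]. *)
pose K := Num.truncn (h / (3 * tau)).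
have tau3 : 0 < 3 * tau by have := tau0; slra.
have hK : (K%:R <= h / (3 * tau) < K.+1%:R).
  by apply: truncn_itv; apply: divr_ge0; slra.
have K1 : (1 <= K)%N.
  rewrite -ltnS -(ltr_nat R); case/andP: hK => _; apply: le_lt_trans.
  by rewrite ler_pdivlMr// mul1r.
have hK1 : K%:R * (3 * tau) <= h by case/andP: hK => + _; rewrite ler_pdivlMr.
have hK2 : h <= K%:R * (6 * tau).
  case/andP: hK => _; rewrite ltr_pdivrMr// => hlt.
  have : (K.+1%:R : R) <= K%:R * 2.
    by rewrite -natrM ler_nat; lia.
  move=> k2; apply: (le_trans (ltW hlt)).
  by apply: le_trans (ler_wpM2r (ltW tau3) k2) _; rewrite -mulrA; slra.
have K0 : 0 < (K%:R : R) by rewrite ltr0n.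
pose t (k : 'I_K) := lo + 3 * tau * (k.+1)%:R.
pose X := 6 * M / h * sm m (G :&: P (lo + h))%SET.
have tb (k : 'I_K) : lo <= t k <= lo + h.
  rewrite /t; have : (k.+1%:R : R) <= K%:R by rewrite ler_nat.
  have : 0 <= (k.+1%:R : R) by [].
  move=> k0 kK; apply/andP; split.
    by rewrite lerDl mulr_ge0//; slra.
  rewrite lerD2l mulrC; apply: le_trans hK1.
  by apply: ler_wpM2r => //; slra.
suff [k hk] : exists k : 'I_K, es (G :&: P (t k))%SET (G :\: P (t k))%SET <= X.
  by exists (t k); case/andP: (tb k).
apply: boolp.contrapT => /boolp.forallNP no.
have big : K%:R * X < \sum_(k < K) es (G :&: P (t k))%SET (G :\: P (t k))%SET.
  have -> : K%:R * X = \sum_(k < K) X.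
    by rewrite sumr_const card_ord mulr_natl.
  apply: ltr_sum; last by move=> k _; rewrite ltNge; apply/negP; apply: no.
  by apply/hasP; exists (Ordinal K1); rewrite ?mem_index_enum.
have small : \sum_(k < K) es (G :&: P (t k))%SET (G :\: P (t k))%SET <=
    \sum_(p in (G :&: P (lo + h))%SET) \sum_q w p q.
  rewrite /es.
  under eq_bigr do (rewrite big_mkcond /=; under eq_bigr do rewrite big_mkcond /=).
  rewrite exchange_big /= [leRHS]big_mkcond /=.
  apply: ler_sum => p _; case: ifPn => [pG|pG]; last first.
    rewrite big1// => k _; case: ifPn => // /setIP[pG' pP].
    have : p \in P (lo + h) by apply: Pmono pP; case/andP: (tb k).
    by move=> pP'; move: pG; rewrite in_setI pG' pP'.
  apply: (@le_trans _ _ (\sum_(k < K) \sum_q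
      if (p \in (G :&: P (t k))%SET) && (q \in (G :\: P (t k))%SET) then w p q else 0)).
    by apply: ler_sum => k _; case: ifP => //= _; apply: sumr_ge0.
  rewrite exchange_big /=; apply: ler_sum => q _.
  have [close|far] := ltP (dv p q) (3 * tau); last first.
    by rewrite w_far// big1// => k _; case: ifP.
  apply: sum_amo => // i j _ _ /andP[/setIP[_ pi] /setDP[_ qi]] /andP[/setIP[_ pj] /setDP[_ qj]].
  have key (a b : 'I_K) : p \in P (t a) -> q \notin P (t b) -> ~ (a < b)%N.
    move=> pa qb ab; move/negP: qb; apply; apply: Pmono (Pgrow _ _ _ pa close).
    rewrite /t -addrA lerD2l -{2}(mulr1 (3 * tau)) -mulrDr ler_wpM2l//; first slra.
    by rewrite natr1 ler_nat.
  apply/val_inj; case: (ltngtP (val i) (val j)) => [ij|ji|//].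
  - by case: (key i j pi qj ij).
  - by case: (key j i pj qi ji).
have : K%:R * X < M / tau * sm m (G :&: P (lo + h))%SET.
  apply: lt_le_trans big _; apply: le_trans small _.
  rewrite /sm mulr_sumr; apply: ler_sum => p _.
  by apply: le_trans (w_deg p) _; rewrite mulrAC.
rewrite /X; set S := sm _ _ => lt1.
have S0 : 0 <= S by apply: sm_ge0.
suff : M / tau * S <= K%:R * (6 * M / h * S) by slra.
have -> : K%:R * (6 * M / h * S) = (K%:R * (6 * tau)) / h * (M / tau * S).
  by field; rewrite !gt_eqF.
apply: ler_peMl; last by rewrite ler_pdivlMr// mul1r.
by rewrite mulr_ge0// divr_ge0// ltW//; apply: lt_le_trans M1.
Qed.

Variables (beta : V -> R -> R) (D : R).
Hypothesis D1 : 1 <= D.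
Hypothesis beta0 : forall x r, 0 < r -> 0 < beta x r.
Hypothesis betaD : forall k x y r r', 0 < r -> 0 < r' ->
  dv x y + r' <= 2 ^+ k * r -> beta y r' <= D ^+ k * beta x r.
Hypothesis m_up : forall x r, tau <= r -> sm m (vb dv x r) <= M * beta x r.
Hypothesis m_pt : forall x, beta x tau <= M * m x.

Variables (ok : {set V}) (smax Lam K : R) (kL : nat).
Hypothesis m_low : forall x r, x \in ok -> tau <= r -> r <= smax ->
  beta x r <= M * sm m (vb dv x r).
Hypothesis K0 : 0 < K.
Hypothesis Lam1 : 1 <= Lam.
Hypothesis kL_Lam : 2 * Lam <= 2 ^+ kL.
Hypothesis poincare : forall x s (A : {set V}), x \in ok -> tau <= s -> s <= smax ->
  Num.min (sm m (A :&: vb dv x s)%SET) (sm m (vb dv x s :\: A)%SET) <=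
  K * s * es (A :&: vb dv x (Lam * s))%SET (~: A :&: vb dv x (Lam * s))%SET.

Let M0 : 0 < M. Proof. exact: lt_le_trans M1. Qed.
Let D0 : 0 < D. Proof. exact: lt_le_trans D1. Qed.

(** The product of the losses in [gain]: [4 * M * D * K] at the stopping scale, [M * D ^+ kL] for
    the Vitali enlargement, and 2 because the stopping scales are at most [2 * (eta * r)]. *)
Definition gain_const : R := 8 * M ^+ 2 * D ^+ kL.+1 * K.

Lemma gain_const_gt0 : 0 < gain_const.
Proof. by rewrite !mulr_gt0// exprn_gt0. Qed.

(* A set that has small density at scales ~ eta r around each of its points has
   mass at most eta r times its boundary: stop at the smallest dyadic scale at
   which the density is small, where the Poincare inequality bites. *)
Lemma gain (U : {set V}) (eta r : R) :
  U \subset ok -> tau <= eta * r -> 2 * (eta * r) <= smax ->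
  (forall x s, x \in U -> eta * r <= s -> s <= 2 * (eta * r) ->
     4 * M * sm m (U :&: vb dv x s)%SET <= beta x s) ->
  sm m U <= gain_const * (eta * r) * es U (~: U)%SET.
Proof.
have local_context : True by [].
move=> Uok ter smx dens.
have t0 := tau0.
set er := eta * r in ter smx dens *.
have er0 : 0 < er by slra.
pose good x k := 4 * M * sm m (U :&: vb dv x (2 ^+ k * tau))%SET <= beta x (2 ^+ k * tau).
have pw k : 0 < 2 ^+ k * tau by rewrite mulr_gt0// exprn_gt0.
have exk : exists2 k, er <= 2 ^+ k * tau & 2 ^+ k * tau <= 2 * er.
  have ex : exists k, er <= 2 ^+ k * tau.
    exists (Num.truncn (er / tau)).+1.
    rewrite -ler_pdivrMr//; apply: le_trans (ltW (truncnS_gt _)) _.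
    by rewrite -natrX ler_nat ltnW// ltn_expl.
  pose k := ex_minn ex; have [kk kmin] : er <= 2 ^+ k * tau /\ forall j, er <= 2 ^+ j * tau -> (k <= j)%N.
    by rewrite /k; case: ex_minnP.
  exists k => //; case: {kk}k kmin => [|k] kmin; first by rewrite expr0; slra.
  rewrite exprS -mulrA; suff : 2 ^+ k * tau < er by slra.
  by rewrite ltNge; apply/negP => /kmin; rewrite ltnn.
have [k0 k0a k0b] := exk.
have goodex x : x \in U -> exists k, good x k.
  by move=> xU; exists k0; apply: dens.
pose kx x := if boolp.pselect (x \in U) is left xU then ex_minn (goodex x xU) else 0%N.
have kxP x : x \in U -> good x (kx x) /\ forall j, good x j -> (kx x <= j)%N.
  by move=> xU; rewrite /kx; case: boolp.pselect => // xU'; case: ex_minnP.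
pose s x := 2 ^+ (kx x) * tau.
have s0 x : 0 < s x by exact: pw.
have sle x : x \in U -> s x <= 2 * er.
  move=> xU; have [_ /(_ k0 (dens _ _ xU k0a k0b)) kxk] := kxP x xU.
  apply: le_trans k0b; rewrite ler_pM2r// ler_eXn2l//; slra.
have st x : tau <= s x.
  by rewrite /s ler_peMl ?(ltW tau0)// exprn_ege1//; slra.
have key x : x \in U ->
    beta x (s x) <= 4 * M * D * K * s x *
      es (U :&: vb dv x (Lam * s x))%SET (~: U :&: vb dv x (Lam * s x))%SET.
  move=> xU; have [gx gmin] := kxP x xU; have xok := subsetP Uok x xU.
  have bx := beta0 x (s0 x).
  have sm1 : beta x (s x) <= 4 * M * D * sm m (U :&: vb dv x (s x))%SET.
    case E : (kx x) => [|k].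
      have sE : s x = tau by rewrite /s E expr0 mul1r.
      have := m_pt x; rewrite sE.
      have : m x <= sm m (U :&: vb dv x tau)%SET.
        by apply: sm_point => //; rewrite inE xU vb_center.
      set a := m x; set b := sm m _ => ab mx.
      have b0 : 0 <= b by apply: le_trans ab; apply: m0.
      have MD : M <= 4 * M * D by have := M0; have := D1; nra.
      apply: le_trans mx _; apply: le_trans (ler_wpM2l (ltW M0) ab) _.
      exact: ler_wpM2r.
    have nb : ~ good x k by move=> /gmin; rewrite E ltnn.
    have sE : s x = 2 * (2 ^+ k * tau) by rewrite /s E exprS mulrA.
    have := betaD (pw k) (s0 x) (k := 1) (x := x) (y := x).
    rewrite dv0 add0r expr1 sE => /(_ (lexx _)) b1.
    move/negP: nb; rewrite -ltNge => nb.
    have s1 : sm m (U :&: vb dv x (2 ^+ k * tau))%SET <=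
        sm m (U :&: vb dv x (2 * (2 ^+ k * tau)))%SET.
      apply: sm_sub => // y; rewrite !inE => /andP[-> /=] yy.
      by apply: lt_le_trans yy _; have := pw k; slra.
    apply: le_trans b1 _.
    move: nb s1; set a := sm _ _; set b := sm _ _ => nb s1.
    apply: le_trans (ler_wpM2l (ltW D0) (ltW nb)) _.
    have MD4 : 0 <= 4 * M * D by rewrite !mulr_ge0// ltW.
    by apply: le_trans (ler_wpM2l MD4 s1); rewrite le_eqVlt; apply/orP; left; apply/eqP; ring.
  (* Low density of [U] at the stopping scale leaves most of the ball to the complement, so both
     terms of the Poincare minimum are large. *)
  have sm2 : beta x (s x) <= 4 * M * D * sm m (vb dv x (s x) :\: U)%SET.
    have lo := m_low xok (st x) (le_trans (sle x xU) smx).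
    have : sm m (vb dv x (s x)) <= sm m (U :&: vb dv x (s x))%SET +
        sm m (vb dv x (s x) :\: U)%SET.
      apply: le_trans (sm_setU m0 _ _); apply: sm_sub => // y yv.
      by rewrite !inE in yv *; rewrite yv; case: (y \in U).
    move: gx; rewrite /good -/(s x); set a := sm _ _; set b := sm _ (vb _ _ _); set c := sm _ _.
    move=> g1 g2; have c0 : 0 <= c by apply: sm_ge0.
    have Mb : M * b <= M * a + M * c by rewrite -mulrDr ler_pM2l.
    have MD : M * c <= M * D * c by rewrite -mulrA ler_pM2l//; have := D1; nra.
    have Mc : 0 <= M * c by rewrite mulr_ge0// ltW.
    rewrite -/b in lo.
    slra.
  have PI := poincare U xok (st x) (le_trans (sle x xU) smx).
  have mn : beta x (s x) <= 4 * M * D * Num.min (sm m (U :&: vb dv x (s x))%SET)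
      (sm m (vb dv x (s x) :\: U)%SET) by rewrite minEle; case: ifP.
  have MD4 : 0 <= 4 * M * D by rewrite !mulr_ge0// ltW.
  apply: le_trans mn _; apply: le_trans (ler_wpM2l MD4 PI) _.
  by rewrite le_eqVlt; apply/orP; left; apply/eqP; ring.
have radpos x : x \in U -> 0 < Lam * s x.
  by move=> _; rewrite mulr_gt0//; apply: lt_le_trans Lam1.
have [B [BU Bsep Bcov]] := finite_vitali dv0 dvC (rad := fun x => Lam * s x) radpos.
have smU : sm m U <= \sum_(y in B) sm m (vb dv y (2 * Lam * s y)).
  apply: sm_cover => // x xU; have [y yB [rxy dxy]] := Bcov x xU.
  exists y => //; rewrite in_vb dvC; apply: lt_le_trans dxy _; slra.
apply: le_trans smU _.
have : \sum_(y in B) sm m (vb dv y (2 * Lam * s y)) <=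
    \sum_(y in B) (gain_const * er) *
      es (U :&: vb dv y (Lam * s y))%SET (~: U :&: vb dv y (Lam * s y))%SET.
  apply: ler_sum => y yB; have yU := BU y yB.
  have L2 : tau <= 2 * Lam * s y.
    by apply: le_trans (st y) _; rewrite ler_peMl ?(ltW (s0 y))//; have := Lam1; slra.
  apply: le_trans (m_up y L2) _.
  have bb : beta y (2 * Lam * s y) <= D ^+ kL * beta y (s y).
    apply: betaD => //; first by apply: lt_le_trans L2.
    by rewrite dv0 add0r ler_pM2r.
  apply: le_trans (ler_wpM2l (ltW M0) bb) _.
  have Mk : 0 <= M * D ^+ kL by rewrite mulr_ge0 ?exprn_ge0 ?ltW.
  rewrite mulrA; apply: le_trans (ler_wpM2l Mk (key y yU)) _.
  set e := es _ _; have e0 : 0 <= e by exact: es_ge0.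
  rewrite mulrA; apply: ler_wpM2r => //.
  have C0 : 0 <= M * D ^+ kL * (4 * M * D * K).
    by rewrite !mulr_ge0 ?exprn_ge0 ?ltW.
  rewrite mulrA; apply: le_trans (ler_wpM2l C0 (sle y yU)) _.
  by rewrite /gain_const (exprS D) le_eqVlt; apply/orP; left; apply/eqP; ring.
move/le_trans; apply; rewrite -mulr_sumr ler_wpM2l//.
  by rewrite mulr_ge0// ltW// gain_const_gt0.
apply: es_packing => i j x iB jB; exact: (vb_disj dvC dvT Bsep).
Qed.

Variables (eta gam : R) (ke : nat).
Hypothesis eta0 : 0 < eta.
Hypothesis eta6 : 6 * eta <= 1.
Hypothesis ke_eta : 2 <= 2 ^+ ke * eta.
Hypothesis eta_gain : 24 * gain_const * M * D * eta <= 1.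
Hypothesis gam0 : 0 < gam.
Hypothesis gam_small : 4 * M * D ^+ ke * gam <= 1.

(* Removing balls about z does not decrease the boundary of G, so low density of
   G in B(z, r) is inherited by B(z, r/2), hence holds at scale tau, where it is
   incompatible with the mass of the point z itself. *)
Lemma density (z : V) (G : {set V}) (r0 : R) :
  vb dv z r0 \subset ok -> r0 <= smax -> tau <= eta * r0 ->
  (forall rho, rho <= r0 ->
     es (G :&: vb dv z rho)%SET (~: G)%SET <= es (G :&: vb dv z rho)%SET (G :\: vb dv z rho)%SET) ->
  sm m (G :&: vb dv z r0)%SET <= gam * beta z r0 -> z \notin G.
Proof.
have local_context : True by [].
move=> r0ok r0s r0t hmin.
have t0 := tau0; have e0 := eta0; have e6 := eta6.
have [n hn] : exists n, eta * r0 < 2 ^+ n * (2 * tau).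
  exists (Num.truncn (eta * r0 / (2 * tau))).+1.
  have t20 : 0 < 2 * tau by slra.
  rewrite -ltr_pdivrMr//; apply: lt_le_trans (truncnS_gt _) _.
  by rewrite -natrX ler_nat ltnW// ltn_expl.
suff : forall r, r <= r0 -> tau <= eta * r -> eta * r < 2 ^+ n * (2 * tau) ->
    sm m (G :&: vb dv z r)%SET <= gam * beta z r -> z \notin G by apply.
(* In the base case [eta * r < 2 * tau], so [r] is comparable to [tau], and [gam_small] makes the
   assumed mass bound smaller than [m z]. *)
move=> {hn}; elim: n => [|n IH] r rr0 tr hr dens.
  apply/negP => zG.
  have r_gt0 : 0 < r by rewrite -(pmulr_rgt0 _ eta0); slra.
  have h1 : m z <= sm m (G :&: vb dv z r)%SET.
    by apply: sm_point => //; rewrite in_setI zG vb_center.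
  have h2 : beta z r <= D ^+ ke * beta z tau.
    apply: betaD => //; rewrite dv0 add0r.
    rewrite -(ler_pM2l eta0); rewrite expr0 mul1r in hr.
    apply: (le_trans (ltW hr)).
    have -> : eta * (2 ^+ ke * tau) = 2 ^+ ke * eta * tau by ring.
    by rewrite ler_pM2r.
  have h3 := m_pt z; have b0 := beta0 z r_gt0.
  have De : 0 < D ^+ ke by rewrite exprn_gt0.
  have h4 : gam * beta z r <= gam * D ^+ ke * M * m z.
    have : gam * beta z r <= gam * (D ^+ ke * (M * m z)).
      by rewrite ler_pM2l//; apply: le_trans h2 _; rewrite ler_pM2l.
    by rewrite !mulrA.
  have mz : 0 < m z.
    rewrite -(pmulr_rgt0 _ M0); apply: lt_le_trans h3; exact: beta0.
  have : 4 * M * D ^+ ke * gam * m z <= 1 * m z by rewrite ler_pM2r.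
  have := le_trans (le_trans h1 dens) h4; slra.
have [small|big] := ltP (eta * r) (2 ^+ n * (2 * tau)); first exact: (IH r).
have r_gt0 : 0 < r by rewrite -(pmulr_rgt0 _ eta0); slra.
have p1 : 1 <= 2 ^+ n :> R by rewrite exprn_ege1//; slra.
have tr2 : 2 * tau <= eta * r.
  by apply: le_trans big; rewrite ler_peMl//; slra.
have r6 : 6 * (2 * tau) <= r.
  apply: (@le_trans _ _ (6 * (eta * r))); first slra.
  by rewrite mulrA ger_pMl.
apply: (IH (r / 2)); try slra.
  by move: hr; rewrite exprS; slra.
(* A radius between [r / 2] and [r] whose sphere cuts few edges of [G]. By [hmin] the edges leaving
   [G] inside that sphere weigh no more, so [gain] bounds the mass inside by a multiple of [eta]
   times the mass at radius [r]; [eta_gain] makes this multiple beat the doubling factor [D]. *)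
have [|||rho [rho1 rho2 hrho]] := @slice (vb dv z) G (r / 2) (r / 2).
- by move=> t t' tt' x; rewrite !in_vb => xt; slra.
- move=> t x y; rewrite !in_vb => xt xy; apply: le_lt_trans (dvT z x y) _; slra.
- slra.
have half : r / 2 + r / 2 = r by slra.
rewrite half in rho2 hrho.
pose U := (G :&: vb dv z rho)%SET.
have UG x : x \in U -> x \in (G :&: vb dv z r)%SET.
  by rewrite !inE => /andP[-> /=] h; apply: lt_le_trans h _.
have b0 := beta0 z r_gt0.
have Uok : U \subset ok.
  apply/subsetP => x /UG /setIP[_ xr]; apply: (subsetP r0ok).
  by move: xr; rewrite !in_vb => xr; apply: lt_le_trans xr _.
have gU : sm m U <= gain_const * (eta * r) * es U (~: U)%SET.
  apply: gain => //.
    by apply: le_trans (le_trans rr0 r0s); rewrite mulrA ger_pMl//; slra.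
  move=> x s xU s1 s2; have ser : 0 < s by apply: lt_le_trans s1; apply: mulr_gt0.
  have hb : beta z r <= D ^+ ke * beta x s.
    apply: betaD => //; have := UG x xU; rewrite in_setI in_vb dvC => /andP[_ xz].
    apply: (@le_trans _ _ (2 * r)); first slra.
    have : 2 ^+ ke * (eta * r) <= 2 ^+ ke * s by rewrite ler_pM2l// exprn_gt0.
    apply: le_trans; rewrite mulrA ler_pM2r//.
  have hs : sm m (U :&: vb dv x s)%SET <= gam * (D ^+ ke * beta x s).
    apply: (@le_trans _ _ (gam * beta z r)); last by rewrite ler_pM2l.
    by apply: le_trans dens; apply: sm_sub => // y /setIP[/UG].
  have M40 : 0 <= 4 * M by rewrite mulr_ge0// ltW.
  apply: le_trans (ler_wpM2l M40 hs) _.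
  have bx : 0 < beta x s by apply: beta0.
  have : 4 * M * D ^+ ke * gam * beta x s <= 1 * beta x s by rewrite ler_pM2r.
  slra.
have eU : es U (~: U)%SET <= 2 * es (G :&: vb dv z rho)%SET (G :\: vb dv z rho)%SET.
  apply: (@le_trans _ _ (es U (~: G)%SET + es U (G :\: vb dv z rho)%SET)).
    apply: le_trans (es_addr _ _ _); apply: es_sub => p q -> qU _ /=.
    by move: qU; rewrite !(in_setC, in_setI, in_setU, in_setD); case: (q \in G) => //=; rewrite !andbT.
  by have := hmin rho (le_trans rho2 rr0); rewrite -/U; slra.
have m2 : sm m (G :&: vb dv z (r / 2))%SET <= sm m U.
  by apply: sm_sub => // x; rewrite !inE => /andP[-> /=] h; apply: lt_le_trans h _.
have hb2 : beta z r <= D * beta z (r / 2).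
  by have := @betaD 1 z z (r / 2) r; rewrite dv0 !expr1; apply; slra.
set S := sm m (G :&: vb dv z r)%SET in dens hrho.
have gc := gain_const_gt0; have MM := M0; have DD := D0.
have c1 : 0 <= gain_const * (eta * r) by rewrite ltW// mulr_gt0// mulr_gt0//.
have step1 : sm m U <= gain_const * (eta * r) * (2 * (6 * M / (r / 2) * S)).
  apply: le_trans gU _; apply: ler_wpM2l => //.
  by apply: le_trans eU _; rewrite ler_pM2l.
have step2 : sm m U <= 24 * gain_const * M * eta * S.
  apply: le_trans step1 _; rewrite le_eqVlt; apply/orP; left; apply/eqP.
  by field; rewrite gt_eqF.
have c2 : 0 <= 24 * gain_const * M * eta by rewrite ltW// mulr_gt0// mulr_gt0// mulr_gt0//.
have step3 : 24 * gain_const * M * eta * S <= 24 * gain_const * M * D * eta * (gam * beta z (r / 2)).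
  apply: le_trans (ler_wpM2l c2 dens) _.
  have -> : 24 * gain_const * M * D * eta * (gam * beta z (r / 2)) =
    24 * gain_const * M * eta * (gam * (D * beta z (r / 2))) by ring.
  by apply: ler_wpM2l => //; rewrite ler_pM2l.
apply: le_trans m2 _; apply: le_trans step2 _; apply: le_trans step3 _.
apply: ler_piMl => //; apply: mulr_ge0; first exact: ltW.
by apply/ltW/beta0; slra.
Qed.

(** The edge boundary of [A] seen from the complement of [Q]. Edges that touch [Q] are ignored,
    since the set is still to be modified there. *)
Definition bd (Q A : {set V}) : R := es (A :\: Q)%SET (~: A :\: Q)%SET.

Lemma bd_setC (Q A : {set V}) : bd Q (~: A)%SET = bd Q A.
Proof. by rewrite /bd setCK es_sym. Qed.

Lemma bd_sub (Q Q' A : {set V}) : (forall x, x \in Q -> x \in Q') -> bd Q' A <= bd Q A.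
Proof.
move=> QQ; apply: es_sub => p q; rewrite !inE => /andP[pQ ->] /andP[qQ ->] _.
by rewrite !andbT; apply/andP; split; [apply: contra pQ|apply: contra qQ]; apply: QQ.
Qed.

(* A boundary minimizer G between F \ nb S 4u and F cannot enter the shell around
   S where F has low density, so cutting it there costs nothing. *)
Lemma kill (F S Q : {set V}) (u : R) :
  0 < u -> 48 * tau <= u -> tau <= eta * (u / 16) -> u / 16 <= smax ->
  (forall y, y \notin ok -> y \in Q) ->
  (forall z, z \in nb dv S (3 * u) -> z \notin nb dv S (5 / 2 * u) ->
     z \notin nb dv Q (u / 8) ->
     sm m (F :&: vb dv z (u / 16))%SET <= gam * beta z (u / 16)) ->
  exists F' : {set V}, [/\ {subset F' <= F},
    (forall x, x \in F -> x \notin nb dv S (4 * u) -> x \in F'),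
    (forall x, x \in F' -> x \notin nb dv S (2 * u)) &
    bd (nb dv Q (u / 4)) F' <= bd (Q :|: nb dv S (2 * u))%SET F].
Proof.
have local_context : True by [].
move=> u0 tu teta us okQ shell.
have t0 := tau0.
set Z := (Q :|: nb dv S (2 * u))%SET.
pose adm (G : {set V}) := (G \subset F) && (F :\: nb dv S (4 * u) \subset G)%SET.
have admF : adm F by rewrite /adm subxx subsetDl.
pose G := [arg min_(A < F | adm A) bd Z A]%O.
have [admG Gmin] : adm G /\ forall A, adm A -> bd Z G <= bd Z A.
  by rewrite /G; case: arg_minP.
have /andP[GF FG] := admG.
(* The minimizer is compared with [G :\: Bl] for small balls [Bl] about [z]. These balls and the
   edges leaving them miss [Z], so all edges lost and created by the removal are counted, which
   yields the hypothesis of [density]. *)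
have Gshell z : z \in G -> z \in nb dv S (3 * u) -> z \notin nb dv S (5 / 2 * u) ->
    z \in nb dv Q (u / 8).
  move=> zG z3 z2; apply/negPn/negP => zQ.
  move/negP: (zG); apply; apply/negP.
  have farZ p : dv z p < u / 8 -> p \notin Z.
    move=> zp; rewrite in_setU negb_or; apply/andP; split.
      by apply: contra zQ => pQ; apply/nbP; exists p.
    apply: contra z2 => /nbP[y yS py]; apply/nbP; exists y => //.
    by apply: le_lt_trans (dvT z p y) _; slra.
  apply: (@density z G (u / 16)) => //.
  - apply/subsetP => y; rewrite in_vb => zy; apply/negPn/negP => /okQ yQ.
    by move/negP: zQ; apply; apply/nbP; exists y => //; slra.
  - move=> rho rhou; set Bl := vb dv z rho.
    have admGB : adm (G :\: Bl)%SET.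
      apply/andP; split; first by apply: subset_trans GF; apply: subsetDl.
      apply/subsetP => x xF; rewrite in_setD (subsetP FG)// andbT.
      apply/negP; rewrite in_vb => zx; move: xF; rewrite in_setD => /andP[/negP x4 _]; apply: x4.
      have /nbP[y yS zy] := z3; apply/nbP; exists y => //.
      by apply: le_lt_trans (dvT x z y) _; rewrite dvC; slra.
    have e1 : bd Z G >= es (G :&: Bl)%SET (~: G)%SET + es ((G :\: Bl) :\: Z)%SET (~: G :\: Z)%SET.
      rewrite /bd /es.
      rewrite [leRHS](big_setID Bl)/=; apply: lerD; last first.
        rewrite (_ : (G :\: Z) :\: Bl = (G :\: Bl) :\: Z)%SET//.
        by apply/setP => x; rewrite !in_setD; case: (x \in G); case: (x \in Z); rewrite ?andbF ?andbT.
      apply: es_sub => p q /setIP[pG pB] qG pq; rewrite !in_setD in_setI in_setD pG pB qG !andbT /=.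
      move: pB; rewrite in_vb => zp.
      by rewrite !farZ//; [apply: le_lt_trans (dvT z p q) _; slra|slra].
    have e2 : bd Z (G :\: Bl)%SET <= es ((G :\: Bl) :\: Z)%SET (~: G :\: Z)%SET +
        es (G :&: Bl)%SET (G :\: Bl)%SET.
      apply: (@le_trans _ _ (es ((G :\: Bl) :\: Z)%SET (~: G :\: Z)%SET +
         es ((G :\: Bl) :\: Z)%SET (G :&: Bl)%SET)).
        apply: le_trans (es_addr _ _ _); apply: es_sub => p q -> + _ /=.
        rewrite !(in_setC, in_setI, in_setU, in_setD); case: (q \in G); case: (q \in Bl) => /=; rewrite ?andbF ?orbT ?orbF ?andbT //.
      rewrite lerD2l (es_sym (G :&: Bl)%SET); apply: es_sub => p q + -> _; rewrite andbT.
      by rewrite in_setD => /andP[].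
    have := Gmin _ admGB; slra.
  - apply: le_trans (shell z z3 z2 zQ); apply: sm_sub => // x /setIP[xG xz].
    by rewrite in_setI (subsetP GF).
(* The radius [11 / 4 * u] lies in the middle of the shell between [5 / 2 * u] and [3 * u], which
   [G] meets only near [Q]. An edge of [G] crossing it would have its outer endpoint in the shell,
   so away from [nb dv Q (u / 4)] the cut creates no boundary. *)
exists (G :\: nb dv S (11 / 4 * u))%SET; split.
- by move=> x; rewrite in_setD => /andP[_]; apply: (subsetP GF).
- move=> x xF x4; rewrite in_setD; apply/andP; split.
    apply: contra x4; apply: nb_sub => //; slra.
  by apply: (subsetP FG); rewrite in_setD x4.
- move=> x; rewrite in_setD => /andP[+ _]; apply: contra; apply: nb_sub => //; slra.
apply: le_trans (Gmin F admF); apply: es_sub => p q.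
rewrite !(in_setC, in_setD) => /andP[pQ /andP[p11 pG]] /andP[qQ qG] pq.
have QnQ x : x \notin nb dv Q (u / 4) -> x \notin Q.
  by apply: contra => xQ; apply: nb_self => //; slra.
have notQ p' : p' \notin nb dv Q (u / 4) -> p' \notin nb dv S (2 * u) -> p' \notin Z.
  by move=> h1 h2; rewrite in_setU negb_or QnQ.
have p2 : p \notin nb dv S (2 * u) by apply: contra p11; apply: nb_sub => //; slra.
have q2 : q \notin nb dv S (2 * u).
  apply: contra p11 => qS; have := nb_step dvT qS (ltW pq).
  apply: nb_sub => //; slra.
have qG' : q \notin G.
  apply/negP => qG'; move: qG; rewrite qG' andbT negbK => q11.
  have p3 : p \in nb dv S (3 * u).
    have := nb_step dvT q11 (ltW pq); apply: nb_sub => //; slra.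
  have p52 : p \notin nb dv S (5 / 2 * u).
    by apply: contra p11; apply: nb_sub => //; slra.
  move/negP: pQ; apply; have := Gshell p pG p3 p52; apply: nb_sub => //; slra.
by rewrite pG qG' !notQ.
Qed.

(** Without low density the cut is placed at a level of the distance to [B] found by [slice], and
    the edges created there are paid by the mass of a neighbourhood of [B]. As everything within
    [2 * u] of [B] is removed, the boundary of [F] inside [nb dv B u] does not count. *)
Lemma kill_cost (F B Q : {set V}) (u : R) : 0 < u -> 3 * tau <= u ->
  exists F' : {set V}, [/\ {subset F' <= F},
    (forall x, x \in F -> x \notin nb dv B (4 * u) -> x \in F'),
    (forall x, x \in F' -> x \notin nb dv B (2 * u)) &
    bd Q F' <= bd (Q :|: nb dv B u)%SET F + 6 * M / u * sm m (nb dv B (3 * u))].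
Proof.
have local_context : True by [].
move=> u0 tu.
have [||//|t [t1 t2 ht]] := @slice (nb dv B) setT (2 * u) u.
- by move=> t t' tt' x; apply: nb_sub.
- move=> t x y xB xy; have yx : dv y x <= 3 * tau by rewrite dvC ltW.
  by rewrite addrC; apply: nb_step xB yx.
have u3 : 2 * u + u = 3 * u by ring.
rewrite u3 in t2 ht.
exists (F :\: nb dv B t)%SET; split.
- by move=> x; rewrite in_setD => /andP[].
- move=> x xF x4; rewrite in_setD xF andbT; apply: contra x4; apply: nb_sub => //; slra.
- by move=> x; rewrite in_setD => /andP[+ _]; apply: contra; apply: nb_sub.
rewrite setTI in ht.
apply: (@le_trans _ _ (bd (Q :|: nb dv B u)%SET F + es (nb dv B t) (setT :\: nb dv B t)%SET)); last first.
  by rewrite lerD2l; apply: le_trans ht _; rewrite setTI.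
rewrite (es_sym (nb dv B t)).
apply: (@le_trans _ _ (es ((F :\: nb dv B t) :\: Q)%SET ((~: F :\: nb dv B u) :\: Q)%SET +
   es ((F :\: nb dv B t) :\: Q)%SET (nb dv B t))).
  apply: le_trans (es_addr _ _ _); apply: es_sub => p q pF + pq; rewrite pF /=.
  have pB : p \notin nb dv B t by move: pF; rewrite !in_setD => /andP[_ /andP[]].
  rewrite !(in_setC, in_setD, in_setU) => /andP[qQ]; rewrite qQ /= negb_and negbK.
  case: (boolP (q \in nb dv B t)) => //= qB qF; first by rewrite orbT.
  rewrite qF andbT orbF; apply: contra qB; apply: nb_sub => //; slra.
apply: lerD; apply: es_sub => p q.
  rewrite !(in_setC, in_setD, in_setU) => /andP[pQ /andP[pB pF]] /andP[qQ /andP[qB qF]] pq.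
  rewrite pF qF (negbTE pQ) (negbTE qQ) /= !andbT qB andbT.
  by apply: contra pB; apply: nb_sub => //; slra.
by rewrite !(in_setC, in_setD, in_setU) in_setT => /andP[pQ /andP[-> pF]] ->.
Qed.

Variables (e : V -> R) (g1 : R).
Hypothesis e_ge0 : forall x, 0 <= e x.
Hypothesis e_le : forall x, e x <= m x.
Hypothesis g1_0 : 0 < g1.
Hypothesis g1a : 4 * M * D ^+ 4 * g1 <= 1.
Hypothesis g1b : 4 * M ^+ 2 * D ^+ 13 * g1 <= gam.
Hypothesis g1c : 2 * D ^+ 11 * g1 <= gam.

Variables (lev : V -> nat) (N : nat) (lbl cl hv : pred V) (sig : R).
Let u j := sig * 2 ^+ j.
Let sg j := 64 * u j.
Hypothesis sig0 : 0 < sig.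
Hypothesis sig_tau : 48 * tau <= sig.
Hypothesis sig_eta : tau <= eta * (sig / 16).
Hypothesis sig_max : sg N <= smax.
Hypothesis okE : forall x, (x \in ok) = (lev x <= N)%N.
Hypothesis type0 : forall x, x \in ok -> ~~ hv x -> ~~ lbl x ->
  sm e (vb dv x (sg (lev x))) <= g1 * beta x (sg (lev x)).
Hypothesis type1 : forall x, x \in ok -> lbl x ->
  sm (fun y => m y - e y) (vb dv x (sg (lev x))) <= g1 * beta x (sg (lev x)).
Hypothesis hv_lbl : forall x, hv x -> ~~ lbl x.
Hypothesis cl_hv : forall x, cl x -> ~~ hv x.
Hypothesis clean : forall x, x \in ok -> cl x ->
  sm m [set y in vb dv x (sg (lev x)) |
         [exists z, [&& hv z, (lev z < lev x)%N & dv y z < 4 * u (lev z)]]]%SET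
  <= g1 * beta x (sg (lev x)).

Let u0 j : 0 < u j. Proof. by rewrite mulr_gt0// exprn_gt0. Qed.
Let u_sig j : sig <= u j.
Proof. by apply: ler_peMr; [exact: ltW|apply: exprn_ege1; lra]. Qed.
Let u_mono i j : (i <= j)%N -> u i <= u j.
Proof. by move=> ij; rewrite ler_pM2l// ler_weXn2l//; lra. Qed.
Let u_lt i j : (i < j)%N -> 2 * u i <= u j.
Proof.
move=> ij; have -> : 2 * u i = u i.+1 by rewrite /u exprS; ring.
exact: u_mono.
Qed.
Let u_max j : (j <= N)%N -> 64 * u j <= smax.
Proof. by move=> jN; apply: le_trans sig_max; rewrite ler_pM2l//; apply: u_mono. Qed.

(* Points covered by small kill balls of the type opposite to y0 have small total
   mass near y0: a Vitali subfamily of these balls is mostly made of f, of which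
   there is little around y0. *)
Lemma low_density (f : V -> R) (A : {set V}) (X : pred V) (j : nat) (y0 z : V) :
  (forall x, 0 <= f x) -> (j <= N)%N ->
  (forall x, X x -> [/\ x \in ok, (lev x < j)%N &
     sm (fun y => m y - f y) (vb dv x (sg (lev x))) <= g1 * beta x (sg (lev x))]) ->
  (forall x, f x <= m x) ->
  sm f (vb dv y0 (sg j)) <= g1 * beta y0 (sg j) ->
  dv z y0 < 3 * u j ->
  {subset A <= vb dv z (u j / 16)} ->
  (forall y, y \in A -> exists2 x, X x & dv y x < 4 * u (lev x)) ->
  sm m A <= gam / 2 * beta z (u j / 16).
Proof.
have local_context : True by [].
move=> f0 jN XP fm fy0 zy0 Az Acov.
have t0 := tau0; have MM := M0; have DD := D0; have g10 := g1_0.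
have uj := u0 j.
pose X' := [set x | X x && [exists y in A, dv y x < 4 * u (lev x)]]%SET.
have radpos x : x \in X' -> 0 < 4 * u (lev x) by move=> _; have := u0 (lev x); slra.
have [B [BX Bsep Bcov]] := finite_vitali dv0 dvC (rad := fun x => 4 * u (lev x)) radpos.
have BP y : y \in B -> [/\ X y, (exists2 a, a \in A & dv a y < 4 * u (lev y)) & 2 * u (lev y) <= u j].
  move=> /BX; rewrite inE => /andP[Xy /existsP[a /andP[aA ay]]]; split => //; first by exists a.
  by apply: u_lt; case: (XP y Xy).
have s1 : sm m A <= \sum_(y in B) sm m (vb dv y (3 * (4 * u (lev y)))).
  apply: sm_cover => // y yA; have [x Xx yx] := Acov y yA.
  have xX' : x \in X' by rewrite inE Xx; apply/existsP; exists y; rewrite yA.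
  have [b bB [ub xb]] := Bcov x xX'; exists b => //.
  rewrite in_vb dvC; apply: le_lt_trans (dvT y x b) _; slra.
have ball y : y \in B -> sm m (vb dv y (3 * (4 * u (lev y)))) <=
    2 * M ^+ 2 * D ^+ 2 * sm f (vb dv y (4 * u (lev y))).
  move=> yB; have [Xy _ uy] := BP y yB; have [yok ylev ty] := XP y Xy.
  have ul := u0 (lev y); have us := u_sig (lev y); have st := sig_tau.
  have yN : (lev y <= N)%N by rewrite -okE.
  have um := u_max yN.
  have h1 : beta y (3 * (4 * u (lev y))) <= D ^+ 2 * beta y (4 * u (lev y)).
    by apply: betaD; rewrite ?dv0; slra.
  have h2 : beta y (sg (lev y)) <= D ^+ 4 * beta y (4 * u (lev y)).
    by apply: betaD; rewrite ?dv0 /sg; slra.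
  have h3 : beta y (4 * u (lev y)) <= M * sm m (vb dv y (4 * u (lev y))).
    by apply: m_low => //; slra.
  have h4 : sm m (vb dv y (4 * u (lev y))) = sm f (vb dv y (4 * u (lev y))) +
      sm (fun y => m y - f y) (vb dv y (4 * u (lev y))).
    by rewrite /sm -big_split/=; apply: eq_bigr => i _; ring.
  have h5 : sm (fun y => m y - f y) (vb dv y (4 * u (lev y))) <= g1 * beta y (sg (lev y)).
    apply: le_trans ty; apply: sm_sub; first by move=> i; rewrite subr_ge0.
    by move=> i; rewrite !in_vb => hi; apply: lt_trans hi _; rewrite /sg; slra.
  have b4 : 0 < beta y (4 * u (lev y)) by apply: beta0; slra.
  set b := beta y (4 * u (lev y)) in h1 h2 h3 b4 *.
  set F := sm f _ in h4 *.
  have h6 : b <= 2 * M * F.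
    have : M * (g1 * beta y (sg (lev y))) <= M * (g1 * (D ^+ 4 * b)).
      by rewrite ler_pM2l// ler_pM2l.
    have : 4 * M * D ^+ 4 * g1 * b <= 1 * b by rewrite ler_pM2r.
    have : M * sm (fun y => m y - f y) (vb dv y (4 * u (lev y))) <= M * (g1 * beta y (sg (lev y))).
      by rewrite ler_pM2l.
    move: h3; rewrite h4; slra.
  apply: le_trans (m_up _ _) _; first slra.
  have MD : 0 < M * D ^+ 2 by rewrite mulr_gt0// exprn_gt0.
  apply: (@le_trans _ _ (M * (D ^+ 2 * b))); first by rewrite ler_pM2l.
  rewrite mulrA; apply: (@le_trans _ _ (M * D ^+ 2 * (2 * M * F))); first by rewrite ler_pM2l.
  by rewrite le_eqVlt; apply/orP; left; apply/eqP; ring.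
have MD : 0 < 2 * M ^+ 2 * D ^+ 2 by rewrite mulr_gt0 ?mulr_gt0 ?exprn_gt0.
have s2 : sm m A <= 2 * M ^+ 2 * D ^+ 2 * sm f (vb dv y0 (sg j)).
  apply: le_trans s1 _; apply: le_trans (ler_sum _ ball) _.
  rewrite -mulr_sumr ler_pM2l//.
  apply: sm_packing => //; last first.
    by move=> i k x iB kB; apply: (vb_disj dvC dvT Bsep).
  move=> y yB x; rewrite !in_vb => yx.
  have [_ [a aA ay] uy] := BP y yB.
  have := Az a aA; rewrite in_vb => za.
  have h1 := dvT y0 z a; have h2 := dvT y0 a y; have h3 := dvT y0 y x.
  rewrite (dvC y0 z) in h1; rewrite /sg; slra.
have h7 : beta y0 (sg j) <= D ^+ 11 * beta z (u j / 16).
  apply: betaD; rewrite /sg; try slra.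
apply: le_trans s2 _.
have bz : 0 < beta z (u j / 16) by apply: beta0; slra.
have h8 : sm f (vb dv y0 (sg j)) <= g1 * (D ^+ 11 * beta z (u j / 16)).
  by apply: le_trans fy0 _; rewrite ler_pM2l.
apply: (@le_trans _ _ (2 * M ^+ 2 * D ^+ 2 * (g1 * (D ^+ 11 * beta z (u j / 16))))).
  by rewrite ler_pM2l.
have -> : 2 * M ^+ 2 * D ^+ 2 * (g1 * (D ^+ 11 * beta z (u j / 16))) =
  (4 * M ^+ 2 * D ^+ 13 * g1) / 2 * beta z (u j / 16) by rewrite (exprD D 11 2); field.
by rewrite ler_pM2r// ler_pM2r// invr_gt0.
Qed.

(** If the points were closer, both [e] and [m - e] would be small in the ball of radius
    [32 * u (lev y1)] about [y1], against the lower bound for its mass. *)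
Lemma no_conflict (y0 y1 : V) : y0 \in ok -> y1 \in ok -> lev y0 = lev y1 ->
  ~~ hv y0 -> ~~ lbl y0 -> lbl y1 -> 8 * u (lev y0) <= dv y0 y1.
Proof.
have local_context : True by [].
move=> ok0 ok1 el h0 l0 l1; rewrite leNgt; apply/negP => close.
have MM := M0; have DD := D0; have g10 := g1_0.
have T0 := type0 ok0 h0 l0; have T1 := type1 ok1 l1.
rewrite el in T0 close.
have uj := u0 (lev y1); have us := u_sig (lev y1); have st := sig_tau; have t0 := tau0.
have um : 64 * u (lev y1) <= smax by apply: u_max; rewrite -okE.
set s := 32 * u (lev y1).
have b0 : 0 < beta y1 s by apply: beta0; rewrite /s; slra.
have h1 : beta y0 (sg (lev y1)) <= D ^+ 2 * beta y1 s.
  by apply: betaD; rewrite /s /sg ?(dvC y1); slra.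
have h2 : beta y1 (sg (lev y1)) <= D ^+ 2 * beta y1 s.
  by apply: betaD; rewrite /s /sg ?dv0; slra.
have h3 : beta y1 s <= M * sm m (vb dv y1 s) by apply: m_low => //; rewrite /s; slra.
have h4 : sm m (vb dv y1 s) = sm e (vb dv y1 s) + sm (fun y => m y - e y) (vb dv y1 s).
  by rewrite /sm -big_split/=; apply: eq_bigr => i _; ring.
have h5 : sm e (vb dv y1 s) <= sm e (vb dv y0 (sg (lev y1))).
  by apply: sm_sub => // x; rewrite !in_vb => hx; apply: le_lt_trans (dvT y0 y1 x) _; rewrite /sg /s in hx *; slra.
have h6 : sm (fun y => m y - e y) (vb dv y1 s) <= sm (fun y => m y - e y) (vb dv y1 (sg (lev y1))).
  apply: sm_sub; first by move=> i; rewrite subr_ge0.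
  by move=> x; rewrite !in_vb => hx; rewrite /sg /s in hx *; slra.
have h7 : sm m (vb dv y1 s) <= 2 * g1 * D ^+ 2 * beta y1 s.
  have : g1 * beta y0 (sg (lev y1)) <= g1 * (D ^+ 2 * beta y1 s) by rewrite ler_pM2l.
  have : g1 * beta y1 (sg (lev y1)) <= g1 * (D ^+ 2 * beta y1 s) by rewrite ler_pM2l.
  slra.
have h8 : beta y1 s <= M * (2 * g1 * D ^+ 2 * beta y1 s).
  by apply: le_trans h3 _; rewrite ler_pM2l.
have D24 : D ^+ 2 <= D ^+ 4 by rewrite ler_weXn2l.
have h9 : M * (2 * g1 * D ^+ 2 * beta y1 s) <= (4 * M * D ^+ 4 * g1) / 2 * beta y1 s.
  have -> : M * (2 * g1 * D ^+ 2 * beta y1 s) = 2 * M * g1 * beta y1 s * D ^+ 2 by ring.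
  have -> : (4 * M * D ^+ 4 * g1) / 2 * beta y1 s = 2 * M * g1 * beta y1 s * D ^+ 4 by field.
  by rewrite ler_pM2l// !mulr_gt0.
have := g1a; nra.
Qed.

(** Clean points are cut for free, [S0] out of the set and [S1] out of its complement; the cuts at
    [B0] and [B1] cost boundary. [W j] holds the points still pending before step [j]. *)
Let S0 j : {set V} := [set x | [&& lev x == j, cl x & ~~ lbl x]]%SET.
Let S1 j : {set V} := [set x | [&& lev x == j, cl x & lbl x]]%SET.
Let B0 j : {set V} := [set x | [&& lev x == j, ~~ cl x & ~~ lbl x]]%SET.
Let B1 j : {set V} := [set x | [&& lev x == j, ~~ cl x & lbl x]]%SET.
Let W j : {set V} := [set x | (j <= lev x)%N]%SET.

Definition level_cost j : R :=
  6 * M / u j * (sm m (nb dv (B0 j) (3 * u j)) + sm m (nb dv (B1 j) (3 * u j))).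

(** The invariant of the ascent. Membership of a point is explained by a centre of smaller level
    with the matching label whose cutting ball contains the point. Pending points, of level at least
    [j], may lie outside without explanation. *)
Let labelled (j : nat) (F : {set V}) :=
  (forall y, y \in F -> exists x, [/\ (lev x < j)%N, lbl x & dv y x < 4 * u (lev x)]) /\
  (forall y, y \notin F -> (lev y < j)%N ->
     exists x, [/\ (lev x < j)%N, ~~ lbl x & dv y x < 4 * u (lev x)]).

Lemma nb_setU (A B : {set V}) t x : x \in nb dv (A :|: B)%SET t ->
  x \in nb dv A t \/ x \in nb dv B t.
Proof.
by move=> /nbP[y]; rewrite in_setU => /orP[yA|yB] xy; [left|right]; apply/nbP; exists y.
Qed.

Lemma nb_nb (A : {set V}) s t x : x \in nb dv (nb dv A t) s -> x \in nb dv A (s + t).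
Proof. by move=> /nbP[y yA /ltW xy]; exact: (nb_step dvT yA xy). Qed.

(** Each of the four cuts takes its own centres off the pending set. The two free cuts each widen
    the ignored neighbourhood by [u j / 4], from [u j / 2] over [3 / 4 * u j] to [u j], which is
    half of [u j.+1] and so fits the next step. *)
Lemma level_step j F c : (j <= N)%N -> labelled j F ->
  bd (nb dv (W j) (u j / 2)) F <= c ->
  exists F', labelled j.+1 F' /\ bd (nb dv (W j.+1) (u j)) F' <= c + level_cost j.
Proof.
have local_context : True by [].
move=> jN [I1 I2] Fc.
have t0 := tau0; have uj := u0 j; have us := u_sig j; have st := sig_tau; have se := sig_eta.
have um := u_max jN; have e0 := eta0; have g10 := g1_0; have MM := M0; have DD := D0.
have ut : tau <= eta * (u j / 16).
  by apply: le_trans se _; rewrite ler_pM2l//; slra.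
have tu48 : 48 * tau <= u j by slra.
have um16 : u j / 16 <= smax by slra.
have okW y : y \notin ok -> y \in W j.+1.
  by rewrite okE inE -ltnNge; apply: leq_ltn_trans.
have S0P y : y \in S0 j -> [/\ y \in ok, lev y = j, cl y & ~~ lbl y].
  by rewrite inE => /and3P[/eqP ly cy nl]; rewrite okE ly.
have S1P y : y \in S1 j -> [/\ y \in ok, lev y = j, cl y & lbl y].
  by rewrite inE => /and3P[/eqP ly cy nl]; rewrite okE ly.
have levP y : (lev y < j)%N -> y \in ok by rewrite okE => h; apply: leq_trans (ltnW h) jN.
have Wsplit y : (y \in W j) = [|| y \in W j.+1, y \in S0 j, y \in S1 j, y \in B0 j | y \in B1 j].
  rewrite !inE leq_eqVlt (eq_sym j).
  by case: (lev y == j); case: (cl y); case: (lbl y); rewrite /= ?orbT ?orbF.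
set Q0 := nb dv (W j.+1 :|: (S1 j :|: (B0 j :|: B1 j)))%SET (u j / 2).
have [||F1 [F1F F1keep F1S F1c]] := @kill F (S0 j) Q0 (u j) uj tu48 ut um16.
- by move=> y /okW yW; apply: nb_self => //; [rewrite in_setU yW|slra].
- move=> z /nbP[y0 /S0P[ok0 l0 c0 nl0] zy0] _ _.
  apply: (@le_trans _ _ (gam / 2 * beta z (u j / 16))); last first.
    by rewrite ler_pM2r ?beta0//; have := gam0; slra.
  apply: (@low_density e _ [pred x | (lev x < j)%N && lbl x] j y0 z) => //.
  + by move=> x /andP[lx bx]; split => //; [exact: levP|apply: type1 => //; exact: levP].
  + by have := type0 ok0 (cl_hv c0) nl0; rewrite l0.
  + by move=> y /setIP[].
  + move=> y /setIP[/I1[x [lx bx yx]] _]; exists x => //=; first by rewrite lx.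
have F1c' : bd (nb dv (W j.+1 :|: (S1 j :|: (B0 j :|: B1 j)))%SET (3 / 4 * u j)) F1 <= c.
  apply: le_trans Fc; apply: (@le_trans _ _ (bd (Q0 :|: nb dv (S0 j) (2 * u j))%SET F)).
    apply: le_trans F1c; apply: bd_sub => x /nb_nb; apply: nb_sub => //; slra.
  apply: bd_sub => x /nbP[y yW xy]; move: yW; rewrite Wsplit => yW.
  have [yS|yS] := boolP (y \in S0 j).
    by rewrite in_setU; apply/orP; right; apply/nbP; exists y => //; slra.
  rewrite in_setU; apply/orP; left; apply/nbP; exists y => //; rewrite !in_setU.
  by move: yW; rewrite (negbTE yS).
set Q1 := nb dv (W j.+1 :|: (B0 j :|: B1 j))%SET (3 / 4 * u j).
have [||G1 [G1F G1keep G1S G1c]] := @kill (~: F1)%SET (S1 j) Q1 (u j) uj tu48 ut um16.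
- by move=> y /okW yW; apply: nb_self => //; [rewrite in_setU yW|slra].
- move=> z /nbP[y0 y0S zy0] z2 zQ; have [ok0 l0 c0 nl0] := S1P _ y0S.
  set A := (~: F1 :&: vb dv z (u j / 16))%SET.
  (* Near [S1] there is no point of [S0], by [no_conflict], so the complement consists here of
     points that were outside [F] already. Their explaining centres are unlabelled: [A1] collects
     those covered by non-heavy ones, treated by [low_density], and [A2] those covered by heavy
     ones, treated by [clean]. Heavy points are never labelled, so the cut at [S0] has no analogue
     of [A2]. *)
  pose A1 := [set y in A | [exists x, [&& (lev x < j)%N, ~~ lbl x, ~~ hv x & dv y x < 4 * u (lev x)]]]%SET.
  pose A2 := [set y in vb dv y0 (sg (lev y0)) | [exists x, [&& hv x, (lev x < lev y0)%N & dv y x < 4 * u (lev x)]]]%SET.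
  have Az y : y \in A -> dv z y < u j / 16 by rewrite in_setI in_vb => /andP[].
  have Aold y : y \in A -> (lev y < j)%N /\ y \notin F.
    move=> yA; have zy := Az y yA.
    have nW : y \notin (W j.+1 :|: (B0 j :|: B1 j))%SET.
      apply/negP => yW; move/negP: zQ; apply; apply/nbP; exists y; last slra.
      by apply: nb_self => //; slra.
    have nS1 : y \notin S1 j.
      by apply/negP => yS; move/negP: z2; apply; apply/nbP; exists y => //; slra.
    have nS0 x : x \in S0 j -> dv y x < 4 * u j -> False.
      move=> /S0P[okx lx cx nlx] yx.
      have := no_conflict okx ok0 (etrans lx (esym l0)) (cl_hv cx) nlx nl0; rewrite lx.
      have h1 := dvT x y y0; have h2 := dvT y z y0; rewrite (dvC x y) in h1; rewrite (dvC y z) in h2.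
      slra.
    have ly : (lev y < j)%N.
      rewrite ltnNge; apply/negP => jly; have yW : y \in W j by rewrite inE.
      move: yW nW; rewrite Wsplit !in_setU (negbTE nS1) /= => /or4P[->//|yS|->|->]; rewrite ?orbT//.
      by case: (nS0 y yS _); rewrite dv0; slra.
    split => //; apply/negP => yF.
    move: yA; rewrite in_setI in_setC => /andP[/negP yF1 _]; apply: yF1; apply: F1keep => //.
    by apply/negP => /nbP[x xS]; apply: nS0.
  have AA : {subset A <= (A1 :|: A2)%SET}.
    move=> y yA; have [ly yF] := Aold y yA; have [x [lx bx yx]] := I2 y yF ly.
    rewrite in_setU; apply/orP; have [hx|hx] := boolP (hv x).
      right; rewrite inE; apply/andP; split; last by apply/existsP; exists x; rewrite hx l0 lx.
      rewrite in_vb; have := Az y yA; have := dvT y0 z y; rewrite (dvC y0 z) /sg l0; slra.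
    by left; rewrite inE yA; apply/existsP; exists x; rewrite lx bx hx.
  have mA1 : sm m A1 <= gam / 2 * beta z (u j / 16).
    have f0 x : 0 <= m x - e x by rewrite subr_ge0.
    have fm x : m x - e x <= m x by rewrite gerBl.
    apply: (@low_density (fun x => m x - e x) A1 [pred x | [&& (lev x < j)%N, ~~ lbl x & ~~ hv x]] j y0 z) => //.
    + move=> x /and3P[lx bx hx]; split => //; first exact: levP.
      have -> : sm (fun y => m y - (m y - e y)) (vb dv x (sg (lev x))) = sm e (vb dv x (sg (lev x))).
        by apply: eq_bigr => i _; ring.
      by apply: type0 => //; exact: levP.
    + by have := type1 ok0 nl0; rewrite l0.
    + by move=> y; rewrite inE => /andP[/Az h _]; rewrite in_vb.
    + move=> y; rewrite inE => /andP[_ /existsP[x /and4P[a1 a2 a3 a4]]]; exists x => //=.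
      by rewrite a1 a2 a3.
  have mA2 : sm m A2 <= gam / 2 * beta z (u j / 16).
    apply: le_trans (clean ok0 c0) _; rewrite l0.
    have h7 : beta y0 (sg j) <= D ^+ 11 * beta z (u j / 16).
      by apply: betaD; rewrite /sg; slra.
    have bz : 0 < beta z (u j / 16) by apply: beta0; slra.
    apply: (@le_trans _ _ (g1 * (D ^+ 11 * beta z (u j / 16)))); first by rewrite ler_pM2l.
    rewrite mulrA ler_pM2r//; have := g1c; slra.
  apply: le_trans (sm_sub m0 AA) _; apply: le_trans (sm_setU m0 _ _) _; slra.
rewrite bd_setC in G1c.
have G1c' : bd (nb dv (W j.+1 :|: (B0 j :|: B1 j))%SET (u j)) (~: G1)%SET <= c.
  rewrite bd_setC; apply: le_trans F1c'; apply: le_trans (_ : bd (nb dv Q1 (u j / 4)) G1 <= _).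
    apply: bd_sub => x /nb_nb; apply: nb_sub => //; slra.
  apply: le_trans G1c _; apply: bd_sub => x /nbP[y yW xy].
  have [yS|yS] := boolP (y \in S1 j).
    by rewrite in_setU; apply/orP; right; apply/nbP; exists y => //; slra.
  rewrite in_setU; apply/orP; left; apply/nbP; exists y => //.
  by move: yW; rewrite !in_setU (negbTE yS).
have tu3 : 3 * tau <= u j by slra.
have [F3 [F3F F3keep F3B F3c]] := kill_cost (~: G1)%SET (B0 j) (nb dv (W j.+1 :|: B1 j)%SET (u j)) uj tu3.
have [G4 [G4F G4keep G4B G4c]] := kill_cost (~: F3)%SET (B1 j) (nb dv (W j.+1) (u j)) uj tu3.
rewrite bd_setC in G4c.
have nF y : y \notin F3 -> y \in F -> (exists2 x, x \in (S0 j :|: B0 j)%SET & dv y x < 4 * u j).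
  move=> yF3 yF; apply: boolp.contrapT => no.
  have yF1 : y \in F1.
    apply: F1keep => //; apply/negP => /nbP[x xS yx]; apply: no; exists x => //.
    by rewrite in_setU xS.
  move/negP: yF3; apply; apply: F3keep.
    by rewrite in_setC; apply: contraL yF1 => /G1F; rewrite in_setC.
  by apply/negP => /nbP[x xS yx]; apply: no; exists x => //; rewrite in_setU xS orbT.
exists (~: G4)%SET; split; first split.
- move=> y; rewrite in_setC => yG4.
  have [yB|yB] := boolP (y \in nb dv (B1 j) (4 * u j)).
    have /nbP[x xB yx] := yB; move: xB; rewrite inE => /and3P[/eqP lx _ bx].
    by exists x; rewrite lx.
  have yF3 : y \in F3.
    by apply/negPn/negP => yF3; move/negP: yG4; apply; apply: G4keep => //; rewrite in_setC.
  have yG1 : y \notin G1 by have := F3F y yF3; rewrite in_setC.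
  have [yS|yS] := boolP (y \in nb dv (S1 j) (4 * u j)).
    have /nbP[x /S1P[_ lx _ bx] yx] := yS; by exists x; rewrite lx.
  have yF1 : y \in F1.
    apply/negPn/negP => yF1; move/negP: yG1; apply; apply: G1keep => //; by rewrite in_setC.
  have [x [lx bx yx]] := I1 y (F1F y yF1); exists x; split => //; exact: ltnW.
- move=> y; rewrite in_setC negbK => yG4 ly.
  have yF3 : y \notin F3 by have := G4F y yG4; rewrite in_setC.
  have [yF|yF] := boolP (y \in F).
    have [x xS yx] := nF y yF3 yF; exists x.
    by move: xS; rewrite in_setU !inE => /orP[] /and3P[/eqP -> _ ->].
  move: ly; rewrite ltnS leq_eqVlt => /orP[/eqP ly|ly]; last first.
    by have [x [lx bx yx]] := I2 y yF ly; exists x; split => //; exact: ltnW.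
  have [by1|by1] := boolP (lbl y); last first.
    by exists y; rewrite ly dv0; split => //; slra.
  have [cy|cy] := boolP (cl y); last first.
    have yB : y \in B1 j by rewrite inE ly eqxx cy.
    have := G4B y yG4; rewrite (nb_self dv0 yB)//; slra.
  have yS : y \in S1 j by rewrite inE ly eqxx cy.
  have yG1 : y \in (~: G1)%SET.
    by rewrite in_setC; apply/negP => /G1S; rewrite (nb_self dv0 yS)//; slra.
  have : y \in nb dv (B0 j) (4 * u j).
    by apply/negPn/negP => h; move/negP: yF3; apply; apply: F3keep.
  move=> /nbP[x]; rewrite inE => /and3P[/eqP lx _ bx] yx; exists x; by rewrite lx.
rewrite bd_setC; apply: le_trans G4c _; rewrite /level_cost mulrDr addrA lerD2r.
apply: (@le_trans _ _ (bd (nb dv (W j.+1 :|: B1 j)%SET (u j)) F3)).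
  apply: bd_sub => x /nb_setU[h|h]; rewrite in_setU h ?orbT//.
apply: le_trans F3c _; rewrite lerD2r; apply: le_trans G1c'.
apply: bd_sub => x /nbP[y yW xy]; rewrite in_setU; apply/orP.
move: yW; rewrite !in_setU => /or3P[yW|yB|yB]; [left|right|left]; apply/nbP; exists y => //;
  by rewrite ?in_setU ?yW ?yB ?orbT.
Qed.

(** The induction starts from the empty set, which has no boundary. After level [N] the pending
    points are those off [ok], whence the neighbourhood of [~: ok] in the boundary. *)
Lemma ascend : exists F : {set V},
  [/\ (forall y, y \in F -> exists2 x, x \in ok & lbl x /\ dv y x < 4 * u (lev x)),
      (forall y, y \notin F -> y \in ok -> exists2 x, x \in ok & ~~ lbl x /\ dv y x < 4 * u (lev x)) &
      bd (nb dv (~: ok)%SET (u N)) F <= \sum_(j < N.+1) level_cost j].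
Proof.
have local_context : True by [].
suff H k : (k <= N.+1)%N -> exists2 F, labelled k F &
    bd (nb dv (W k) (u k / 2)) F <= \sum_(j < k) level_cost j.
  have [F [I1 I2] Fc] := H N.+1 (leqnn _).
  exists F; split.
  - by move=> y /I1[x [lx bx yx]]; exists x => //; rewrite okE.
  - move=> y yF; rewrite okE => ly; have [x [lx bx yx]] := I2 y yF ly.
    by exists x => //; rewrite okE.
  - apply: le_trans Fc; apply: bd_sub => x; apply: nb_sub.
      by move=> y; rewrite inE in_setC okE -ltnNge.
    by rewrite /u exprS; have := u0 N; rewrite /u; slra.
elim: k => [_|k IH kN].
  exists set0; first by split => y; rewrite inE.
  rewrite big_ord0 /bd /es set0D big_set0//.
have [F lF Fc] := IH (ltnW kN).
have [F' [lF' F'c]] := level_step kN lF Fc.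
exists F' => //; rewrite big_ord_recr /=; apply: le_trans F'c.
by apply: bd_sub => x; apply: nb_sub => //; rewrite /u exprS; have := u0 k; rewrite /u; slra.
Qed.
End FiniteGraph.

(** * Selection of heavy points and the finite inequality *)

Section FiniteCore.
Variables (R : realType) (V : finType) (dv : V -> V -> R).
Hypothesis dv0 : forall x, dv x x = 0.
Hypothesis dvC : forall x y, dv x y = dv y x.
Hypothesis dvT : forall x y z, dv x z <= dv x y + dv y z.
Variables (m : V -> R) (tau : R) (w : V -> V -> R) (M : R).
Hypothesis tau0 : 0 < tau.
Hypothesis M1 : 1 <= M.
Hypothesis m0 : forall x, 0 <= m x.
Hypothesis w0 : forall p q, 0 <= w p q.
Hypothesis wC : forall p q, w p q = w q p.
Hypothesis w_far : forall p q, 3 * tau <= dv p q -> w p q = 0.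
Hypothesis w_deg : forall p, \sum_q w p q <= M * m p / tau.
Variables (beta : V -> R -> R) (D : R).
Hypothesis D1 : 1 <= D.
Hypothesis beta0 : forall x r, 0 < r -> 0 < beta x r.
Hypothesis betaD : forall k x y r r', 0 < r -> 0 < r' ->
  dv x y + r' <= 2 ^+ k * r -> beta y r' <= D ^+ k * beta x r.
Hypothesis m_up : forall x r, tau <= r -> sm m (vb dv x r) <= M * beta x r.
Hypothesis m_pt : forall x, beta x tau <= M * m x.
Variables (ok : {set V}) (smax Lam K : R) (kL : nat).
Hypothesis m_low : forall x r, x \in ok -> tau <= r -> r <= smax ->
  beta x r <= M * sm m (vb dv x r).
Hypothesis K0 : 0 < K.
Hypothesis Lam1 : 1 <= Lam.
Hypothesis kL_Lam : 2 * Lam <= 2 ^+ kL.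
Hypothesis poincare : forall x s (A : {set V}), x \in ok -> tau <= s -> s <= smax ->
  Num.min (sm m (A :&: vb dv x s)%SET) (sm m (vb dv x s :\: A)%SET) <=
  K * s * es w (A :&: vb dv x (Lam * s))%SET (~: A :&: vb dv x (Lam * s))%SET.
Variables (eta gam : R) (ke : nat).
Hypothesis eta0 : 0 < eta.
Hypothesis eta6 : 6 * eta <= 1.
Hypothesis ke_eta : 2 <= 2 ^+ ke * eta.
Hypothesis eta_gain : 24 * gain_const M D K kL * M * D * eta <= 1.
Hypothesis gam0 : 0 < gam.
Hypothesis gam_small : 4 * M * D ^+ ke * gam <= 1.
Variables (e : V -> R) (g1 : R).
Hypothesis e_ge0 : forall x, 0 <= e x.
Hypothesis e_le : forall x, e x <= m x.
Hypothesis g1_0 : 0 < g1.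
Hypothesis g1a : 4 * M * D ^+ 4 * g1 <= 1.
Hypothesis g1b : 4 * M ^+ 2 * D ^+ 13 * g1 <= gam.
Hypothesis g1c : 2 * D ^+ 11 * g1 <= gam.

Variables (n : V -> R) (c3 L1 : R) (k3 k4 kC : nat).
Hypothesis n_ge0 : forall x, 0 <= n x.
Hypothesis c3_0 : 0 < c3.
Hypothesis L1_2 : 2 <= L1.
Hypothesis k3_L1 : 3 * L1 <= 2 ^+ k3.
Hypothesis k4_L1 : 5 * L1 <= 2 ^+ k4.
Hypothesis kC_L1 : 4 * L1 <= 2 ^+ kC.
Hypothesis kC_g1 : M * D ^+ k3 <= 2 ^+ kC * g1.

Variables (lev0 : V -> nat) (N : nat) (sig : R).
Let u j := sig * 2 ^+ j.
Let sg j := 64 * u j.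
Hypothesis sig0 : 0 < sig.
Hypothesis sig_tau : 48 * tau <= sig.
Hypothesis sig_eta : tau <= eta * (sig / 16).
Hypothesis sig_max : sg N <= smax.
Hypothesis okE : forall x, (x \in ok) = (lev0 x <= N)%N.

(** Heavy means that the mass [n] can pay: [beta / sg], the order of the boundary created by a cut
    at scale [sg], is at most [1 / c3] times the mass [n] of a nearby ball. *)
Let hv x := (x \in ok) && (c3 * beta x (sg (lev0 x)) <= sg (lev0 x) * sm n (vb dv x (L1 * sg (lev0 x)))).
Let f x := m x - e x.
Let low0 x := sm e (vb dv x (sg (lev0 x))) <= g1 * beta x (sg (lev0 x)).
Let low1 x := sm f (vb dv x (sg (lev0 x))) <= g1 * beta x (sg (lev0 x)).
Hypothesis stop : forall x, x \in ok -> [|| hv x, low0 x | low1 x].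

Let M0 : 0 < M. Proof. exact: lt_le_trans M1. Qed.
Let D0 : 0 < D. Proof. exact: lt_le_trans D1. Qed.
Let u0 j : 0 < u j. Proof. by rewrite mulr_gt0// exprn_gt0. Qed.
Let u_sig j : sig <= u j.
Proof. by apply: ler_peMr; [exact: ltW|apply: exprn_ege1; lra]. Qed.
Let u_mono i j : (i <= j)%N -> u i <= u j.
Proof. by move=> ij; rewrite ler_pM2l// ler_weXn2l//; lra. Qed.
Let u_add i k : u (i + k) = 2 ^+ k * u i.
Proof. by rewrite /u exprD; ring. Qed.
Let sg0 j : 0 < sg j. Proof. by rewrite /sg; have := u0 j; lra. Qed.
Let f0 x : 0 <= f x. Proof. by rewrite subr_ge0. Qed.

(** The factor 768 is [6 * 2 * 64]: the slicing constant, the two costly cuts of a level, and the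
    ratio of [sg j] to [u j]. The factor [kC.+1] counts the levels at which one selected heavy point
    is charged. *)
Definition cost_const : R := 768 * M ^+ 2 * D ^+ (kC + k4) * kC.+1%:R.
Definition core_const : R := M * D ^+ k3 + K * cost_const.

Section Selection.
Variable (H : {set V}) (ctr : V -> V).
Hypothesis H_hv : forall i, i \in H -> hv i.
Hypothesis H_sep : forall x y, x \in H -> y \in H -> x != y ->
  L1 * sg (lev0 x) + L1 * sg (lev0 y) <= dv x y.
Hypothesis ctrP : forall x, hv x -> [/\ ctr x \in H, sg (lev0 x) <= sg (lev0 (ctr x)) &
  dv x (ctr x) < 2 * (L1 * sg (lev0 (ctr x)))].

(** A heavy point takes the level of its Vitali centre, which is no smaller, so that all heavy
    points treated at one level lie near selected points of that level. *)
Let lev x := if hv x then lev0 (ctr x) else lev0 x.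
Let lbl x := ~~ hv x && low1 x.
(** A selected heavy point at most [kC] levels below [x] has a ball too large to be neglected near
    [x], but small enough a gap in scale to be charged for the cut at [x]. *)
Let bad x := [exists i in H, [&& (lev x <= lev0 i + kC)%N, (lev0 i <= lev x)%N &
  dv x i < 4 * (L1 * sg (lev x))]].
Let cl x := ~~ hv x && ~~ bad x.

Let H_ok i : i \in H -> (i \in ok).
Proof. by move=> /H_hv/andP[]. Qed.

Let H_beta i : i \in H -> beta i (sg (lev0 i)) / sg (lev0 i) <= sm n (vb dv i (L1 * sg (lev0 i))) / c3.
Proof.
move=> /H_hv/andP[_ h]; rewrite ler_pdivrMr ?sg0// mulrAC ler_pdivlMr//.
by rewrite mulrC (mulrC (sm _ _)).
Qed.

Let H_sum (P : pred V) (C : {set V}) :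
  (forall i, i \in H -> P i -> {subset vb dv i (L1 * sg (lev0 i)) <= C}) ->
  \sum_(i in H | P i) beta i (sg (lev0 i)) / sg (lev0 i) <= sm n C / c3.
Proof.
move=> HC.
have -> : \sum_(i in H | P i) beta i (sg (lev0 i)) / sg (lev0 i) =
    \sum_(i in [set i in H | P i]%SET) beta i (sg (lev0 i)) / sg (lev0 i).
  by apply: eq_bigl => i; rewrite inE.
apply: le_trans (_ : \sum_(i in [set i in H | P i]%SET) sm n (vb dv i (L1 * sg (lev0 i))) / c3 <= _).
  by apply: ler_sum => i; rewrite inE => /andP[iH _]; exact: H_beta.
rewrite -mulr_suml ler_pM2r ?invr_gt0//; apply: sm_packing => //.
  by move=> i; rewrite inE => /andP[iH Pi]; apply: HC.
move=> i j x; rewrite [i \in _]inE [j \in _]inE => /andP[iH _] /andP[jH _] xi xj.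
exact: (vb_disj dvC dvT (rad := fun i => L1 * sg (lev0 i)) H_sep iH jH xi xj).
Qed.

Let H_cover (P : pred V) (A C : {set V}) :
  (forall y, y \in A -> exists i, [/\ i \in H, P i & dv y i < 3 * (L1 * sg (lev0 i))]) ->
  (forall i, i \in H -> P i -> {subset vb dv i (L1 * sg (lev0 i)) <= C}) ->
  forall s, 0 < s -> (forall i, i \in H -> P i -> sg (lev0 i) <= s) ->
  sm m A <= M * D ^+ k3 * s * (sm n C / c3).
Proof.
move=> Acov HC s s0 Ps.
have t0 := tau0; have st := sig_tau; have l2 := L1_2.
have s1 : sm m A <= \sum_(i in [set i in H | P i]%SET) sm m (vb dv i (3 * (L1 * sg (lev0 i)))).
  apply: sm_cover => // y yA; have [i [iH Pi yi]] := Acov y yA.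
  by exists i; rewrite ?inE ?iH// dvC.
apply: le_trans s1 _.
have MD : 0 < M * D ^+ k3 by rewrite mulr_gt0// exprn_gt0.
apply: (@le_trans _ _ (\sum_(i in [set i in H | P i]%SET) M * D ^+ k3 * s * (beta i (sg (lev0 i)) / sg (lev0 i)))).
  apply: ler_sum => i; rewrite inE => /andP[iH Pi].
  have si := sg0 (lev0 i); have us := u_sig (lev0 i).
  have Ls : 2 * sg (lev0 i) <= L1 * sg (lev0 i) by rewrite ler_pM2r.
  have tL : tau <= 3 * (L1 * sg (lev0 i)) by rewrite /sg in Ls *; lra.
  apply: le_trans (m_up i tL) _; rewrite -!mulrA ler_pM2l//.
  have : beta i (3 * (L1 * sg (lev0 i))) <= D ^+ k3 * beta i (sg (lev0 i)).
    by apply: betaD => //; [lra|rewrite dv0 add0r mulrA ler_pM2r].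
  move=> /le_trans; apply; rewrite ler_pM2l ?exprn_gt0//.
  rewrite mulrCA ler_peMr ?(ltW (beta0 _ si))// ler_pdivlMr// mul1r; exact: Ps.
rewrite -mulr_sumr ler_pM2l; last exact: mulr_gt0.
apply: le_trans (H_sum HC); rewrite le_eqVlt; apply/orP; left; apply/eqP.
by apply: eq_bigl => i; rewrite inE.
Qed.

Let lev_ok x : (x \in ok) = (lev x <= N)%N.
Proof.
rewrite /lev; case: ifP => // hx; have [cH _ _] := ctrP hx.
by rewrite -okE (H_ok cH); move: hx => /andP[->].
Qed.

(** As [x] is not bad, every selected point that interferes has a scale smaller by the factor
    [2 ^+ kC], and its ball lies in the ball of radius [L1 * sg (lev x)]. As [x] is not heavy, the
    mass [n] of that ball is below [c3 * beta / sg]. The condition [kC_g1] is what the product of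
    the two bounds requires. *)
Let clean_hyp x : x \in ok -> cl x ->
  sm m [set y in vb dv x (sg (lev x)) |
         [exists z, [&& hv z, (lev z < lev x)%N & dv y z < 4 * u (lev z)]]]%SET
  <= g1 * beta x (sg (lev x)).
Proof.
move=> xok /andP[hx /existsPn nbad]; set A := [set y in _ | _]%SET.
have l2 := L1_2; have sx := sg0 (lev x).
have lx : lev x = lev0 x by rewrite /lev (negbTE hx).
have AH y : y \in A -> exists i, [/\ i \in H, (lev0 i + kC < lev x)%N && (dv x i < sg (lev x) + 3 * (L1 * sg (lev0 i))) & dv y i < 3 * (L1 * sg (lev0 i))].
  rewrite inE in_vb => /andP[xy /existsP[z /and3P[hz lzx yz]]].
  have [cH _ zc] := ctrP hz.
  have lz : lev z = lev0 (ctr z) by rewrite /lev hz.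
  have yc : dv y (ctr z) < 3 * (L1 * sg (lev0 (ctr z))).
    apply: le_lt_trans (dvT y z (ctr z)) _.
    have : 2 * sg (lev0 (ctr z)) <= L1 * sg (lev0 (ctr z)) by rewrite ler_pM2r// sg0.
    have := u0 (lev0 (ctr z)); rewrite lz in yz; rewrite /sg in zc *; lra.
  have xc : dv x (ctr z) < sg (lev x) + 3 * (L1 * sg (lev0 (ctr z))).
    apply: le_lt_trans (dvT x y (ctr z)) _; lra.
  exists (ctr z); split => //; rewrite xc andbT ltnNge; apply/negP => far.
  have := nbad (ctr z); rewrite cH /= far -lz (ltnW lzx) /= => /negP; apply.
  apply: lt_le_trans xc _.
  have ss : sg (lev0 (ctr z)) <= sg (lev x).
    by rewrite ler_pM2l//; apply: u_mono; rewrite -lz ltnW.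
  have : L1 * sg (lev0 (ctr z)) <= L1 * sg (lev x) by rewrite ler_pM2l//; lra.
  have : 2 * sg (lev x) <= L1 * sg (lev x) by rewrite ler_pM2r.
  lra.
pose P i := (lev0 i + kC < lev x)%N && (dv x i < sg (lev x) + 3 * (L1 * sg (lev0 i))).
pose C := vb dv x (L1 * sg (lev x)).
have sgk i : P i -> 2 ^+ kC * sg (lev0 i) <= sg (lev x).
  move=> /andP[h _]; rewrite /sg mulrCA -u_add ler_pM2l//; apply: u_mono; exact: ltnW.
have pk : 0 < 2 ^+ kC :> R by rewrite exprn_gt0.
have hC i : i \in H -> P i -> {subset vb dv i (L1 * sg (lev0 i)) <= C}.
  move=> iH Pi y; rewrite !in_vb => iy; have := sgk i Pi; case/andP: Pi => _ xi h.
  apply: le_lt_trans (dvT x i y) _.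
  have : 4 * L1 * sg (lev0 i) <= 2 ^+ kC * sg (lev0 i) by rewrite ler_pM2r// sg0.
  have : 2 * sg (lev x) <= L1 * sg (lev x) by rewrite ler_pM2r.
  lra.
have := @H_cover P A C AH hC (sg (lev x) / 2 ^+ kC) _ _.
rewrite divr_gt0// => /(_ isT) H1.
have {H1}: sm m A <= M * D ^+ k3 * (sg (lev x) / 2 ^+ kC) * (sm n C / c3).
  by apply: H1 => i iH Pi; rewrite ler_pdivlMr// mulrC; apply: sgk.
move/le_trans; apply.
have nhx : sg (lev x) * sm n C <= c3 * beta x (sg (lev x)).
  by move: hx; rewrite /hv xok /= -ltNge /C lx => /ltW.
have nhx' : sg (lev x) * sm n C / c3 <= beta x (sg (lev x)) by rewrite ler_pdivrMr// [leRHS]mulrC.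
have MD : 0 < M * D ^+ k3 by rewrite mulr_gt0// exprn_gt0.
have -> : M * D ^+ k3 * (sg (lev x) / 2 ^+ kC) * (sm n C / c3) =
  M * D ^+ k3 / 2 ^+ kC * (sg (lev x) * sm n C / c3) by ring.
apply: (@le_trans _ _ (M * D ^+ k3 / 2 ^+ kC * beta x (sg (lev x)))).
  by rewrite ler_pM2l// divr_gt0.
by rewrite ler_pM2r ?beta0// ler_pdivrMr// [leRHS]mulrC.
Qed.

(** Every centre of a costly cut at level [j] lies near a selected heavy point whose level is at
    most [j] and at least [j - kC]. Exchanging the sums, each selected point is charged at [kC.+1]
    levels only, each time a multiple of [beta / sg], and the disjointness of the selected balls
    bounds the total by the whole mass [n]. *)
Let cost_hyp : \sum_(j < N.+1) level_cost dv m M lev lbl cl sig j <= cost_const * (sm n setT / c3).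
Proof.
have t0 := tau0; have l2 := L1_2; have st := sig_tau.
pose I (j : nat) (i : V) := (lev0 i <= j)%N && (j <= lev0 i + kC)%N.
pose C0 := 768 * M ^+ 2 * D ^+ (kC + k4).
have C00 : 0 < C0 by rewrite !mulr_gt0 ?exprn_gt0.
have one (j : 'I_N.+1) : level_cost dv m M lev lbl cl sig j <=
    \sum_(i in H) (if I j i then C0 * (beta i (sg (lev0 i)) / sg (lev0 i)) else 0).
  have mB (B : {set V}) : (forall y, y \in B -> lev y == j /\ ~~ cl y) ->
      sm m (nb dv B (3 * u j)) <= \sum_(i in H) (if I j i then M * beta i (5 * (L1 * sg j)) else 0).
    move=> BP; pose HI := [set i in H | I j i]%SET.
    have cov : sm m (nb dv B (3 * u j)) <= \sum_(i in HI) sm m (vb dv i (5 * (L1 * sg j))).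
      apply: sm_cover => // y /nbP[z zB yz]; have [/eqP lz ncl] := BP z zB.
      have Ls : 2 * sg j <= L1 * sg j by rewrite ler_pM2r// sg0.
      have uj := u0 j.
      have [hz|hz] := boolP (hv z).
        have [cH _ zc] := ctrP hz; have lc : lev0 (ctr z) = j by rewrite -lz /lev hz.
        exists (ctr z); first by rewrite inE cH /I lc leqnn leq_addr.
        rewrite lc in zc; rewrite in_vb dvC; apply: le_lt_trans (dvT y z _) _.
        by move: Ls zc; rewrite {1}/sg; lra.
      move: ncl; rewrite /cl hz /= negbK => /existsP[i /and4P[iH l1 l3 zi]].
      rewrite lz in l1 l3 zi.
      exists i; first by rewrite inE iH /I l1 l3.
      rewrite in_vb dvC; apply: le_lt_trans (dvT y z _) _.
      by move: Ls zi; rewrite {1}/sg; lra.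
    apply: le_trans cov _; rewrite -big_mkcondr/=.
    rewrite (_ : \sum_(i in H | I j i) _ = \sum_(i in HI) M * beta i (5 * (L1 * sg j))); last first.
      by apply: eq_bigl => i; rewrite inE.
    apply: ler_sum => i _; apply: m_up.
    have us := u_sig j; have uj := u0 j.
    have Ls : 2 * sg j <= L1 * sg j by rewrite ler_pM2r// sg0.
    by move: Ls; rewrite {1}/sg; lra.
  rewrite /level_cost -/(u j).
  set b0 := sm m _; set b1 := sm m (nb dv _ _).
  have hb0 : b0 <= \sum_(i in H) (if I j i then M * beta i (5 * (L1 * sg j)) else 0).
    by apply: mB => y; rewrite inE => /and3P[-> -> _].
  have hb1 : b1 <= \sum_(i in H) (if I j i then M * beta i (5 * (L1 * sg j)) else 0).
    by apply: mB => y; rewrite inE => /and3P[-> -> _].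
  have c0 : 0 < 6 * M / u j by rewrite divr_gt0// mulr_gt0.
  apply: (@le_trans _ _ (6 * M / u j * (2 * \sum_(i in H) (if I j i then M * beta i (5 * (L1 * sg j)) else 0)))).
    by rewrite ler_pM2l//; lra.
  rewrite mulrA mulr_sumr; apply: ler_sum => i iH; case: ifP => [/andP[l1 l3]|_]; last by rewrite mulr0.
  have sij : sg j <= 2 ^+ kC * sg (lev0 i).
    by rewrite /sg [leRHS]mulrCA -u_add ler_pM2l//; apply: u_mono.
  have si := sg0 (lev0 i); have sj := sg0 j.
  have bi : beta i (5 * (L1 * sg j)) <= D ^+ (kC + k4) * beta i (sg (lev0 i)).
    have Lj : 0 < L1 * sg j by apply: mulr_gt0 => //; lra.
    apply: betaD => //; first by lra.
    rewrite dv0 add0r exprD (mulrC (2 ^+ kC)) -mulrA mulrA.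
    have k40 : 0 < 2 ^+ k4 :> R by rewrite exprn_gt0.
    apply: (@le_trans _ _ (2 ^+ k4 * sg j)); first by rewrite ler_pM2r.
    by rewrite ler_pM2l.
  have uij : u (lev0 i) <= u j by exact: u_mono.
  have ui := u0 (lev0 i); have bp := beta0 i si.
  have DD : 0 < D ^+ (kC + k4) by rewrite exprn_gt0.
  have e1 : C0 * (beta i (sg (lev0 i)) / sg (lev0 i)) =
     12 * M ^+ 2 * (D ^+ (kC + k4) * beta i (sg (lev0 i))) / u (lev0 i).
    by rewrite /C0 /sg; field; rewrite gt_eqF.
  have e2 : 6 * M / u j * 2 * (M * beta i (5 * (L1 * sg j))) = 12 * M ^+ 2 * beta i (5 * (L1 * sg j)) / u j.
    by field; rewrite gt_eqF.
  rewrite e1 e2.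
  apply: (@le_trans _ _ (12 * M ^+ 2 * (D ^+ (kC + k4) * beta i (sg (lev0 i))) / u j)).
    by rewrite ler_pM2r ?invr_gt0// ler_pM2l// mulr_gt0// exprn_gt0.
  rewrite ler_pM2l; first by rewrite lef_pV2 ?posrE.
  by apply: mulr_gt0; [apply: mulr_gt0; rewrite // exprn_gt0|apply: mulr_gt0].
apply: le_trans (ler_sum _ (fun j _ => one j)) _.
rewrite exchange_big /=.
apply: (@le_trans _ _ (\sum_(i in H) kC.+1%:R * (C0 * (beta i (sg (lev0 i)) / sg (lev0 i))))).
  apply: ler_sum => i iH.
  set c := C0 * _; have c0 : 0 <= c.
    by rewrite mulr_ge0 ?(ltW C00)// divr_ge0 ?(ltW (sg0 _))// ltW// beta0.
  rewrite -big_mkcond /= sumr_const -[c *+ _]mulr_natl ler_wpM2r// ler_nat.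
  pose g (j : 'I_N.+1) : 'I_kC.+1 := inord (j - lev0 i).
  rewrite -(card_ord kC.+1) -(card_in_imset (f := g) (D := [pred j : 'I_N.+1 | I j i])).
    exact: max_card.
  move=> j j'; rewrite !inE => /andP[a1 a2] /andP[b1 b2] /(congr1 val) /=.
  rewrite /g !inordK ?ltnS ?leq_subLR// => h; apply/val_inj => /=.
  by rewrite -(subnKC a1) -(subnKC b1) h.
rewrite -mulr_sumr -mulr_sumr /cost_const -/C0.
have -> : C0 * kC.+1%:R * (sm n setT / c3) = kC.+1%:R * (C0 * (sm n setT / c3)) by ring.
rewrite ler_pM2l// ler_pM2l//.
have := @H_sum predT setT; rewrite (eq_bigl (fun i => i \in H)); last by move=> i; rewrite andbT.
by apply => i _ _ x _; rewrite inE.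
Qed.
Variables (x0 : V) (r : R).
Hypothesis sgN_r : sg N <= r.
Hypothesis r_max : r <= smax.
Hypothesis ok_near : forall z, dv x0 z < 2 * Lam * r -> z \in ok.

Let r0 : 0 < r. Proof. exact: lt_le_trans (sg0 N) sgN_r. Qed.
Let u_r j : (j <= N)%N -> 64 * u j <= r.
Proof. by move=> jN; apply: le_trans sgN_r; rewrite ler_pM2l//; apply: u_mono. Qed.

(** A Vitali subfamily of the cutting balls: in each ball of the family [h] has at most the fraction
    [g1] of the volume, and the disjoint balls all lie in [vb dv x0 (2 * r)]. *)
Let low_cover (h : V -> R) (P : pred V) (A : {set V}) :
  (forall x, 0 <= h x) ->
  (forall x, x \in ok -> P x -> sm h (vb dv x (sg (lev0 x))) <= g1 * beta x (sg (lev0 x))) ->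
  (forall y, y \in A -> dv x0 y < r /\ exists2 x, x \in ok & P x /\ dv y x < 4 * u (lev0 x)) ->
  sm h A <= g1 * D ^+ 5 * M ^+ 2 * beta x0 r.
Proof.
move=> h0 hP AP; have rr := r0; have t0 := tau0; have st := sig_tau.
pose S := [set x in ok | P x && [exists y in A, dv y x < 4 * u (lev0 x)]]%SET.
have [|B [BS Bsep Bcov]] := @finite_vitali _ _ _ dv0 dvC (fun x => 4 * u (lev0 x)) S.
  by move=> x _; have := u0 (lev0 x); lra.
have Bok b : b \in B -> [/\ b \in ok, P b & exists2 y, y \in A & dv y b < 4 * u (lev0 b)].
  by move=> /BS; rewrite inE => /and3P[-> -> /existsP[y /andP[yA yb]]]; split => //; exists y.
apply: le_trans (_ : \sum_(b in B) sm h (vb dv b (sg (lev0 b))) <= _).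
  apply: sm_cover => // y yA; have [_ [x xok [Px yx]]] := AP y yA.
  have xS : x \in S by rewrite inE xok Px /=; apply/existsP; exists y; rewrite yA.
  have [b bB [ub xb]] := Bcov x xS; exists b => //.
  rewrite in_vb dvC; apply: le_lt_trans (dvT y x b) _.
  by have := u0 (lev0 b); rewrite /sg; lra.
apply: (@le_trans _ _ (\sum_(b in B) g1 * D ^+ 4 * M * sm m (vb dv b (4 * u (lev0 b))))).
  apply: ler_sum => b /Bok[bok Pb _]; apply: le_trans (hP b bok Pb) _.
  have ub := u0 (lev0 b); have us := u_sig (lev0 b).
  have lN : (lev0 b <= N)%N by rewrite -okE.
  rewrite (_ : g1 * D ^+ 4 * M * _ = g1 * (D ^+ 4 * (M * sm m (vb dv b (4 * u (lev0 b)))))); last by ring.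
  rewrite ler_pM2l//.
  apply: (@le_trans _ _ (D ^+ 4 * beta b (4 * u (lev0 b)))).
    apply: betaD; rewrite ?sg0//; first by lra.
    by rewrite dv0 add0r /sg; lra.
  have D4 : 0 < D ^+ 4 by rewrite exprn_gt0.
  rewrite (ler_pM2l D4); apply: m_low => //; first by lra.
  by have := u_r lN; have := r_max; lra.
rewrite -mulr_sumr.
apply: (@le_trans _ _ (g1 * D ^+ 4 * M * sm m (vb dv x0 (2 * r)))).
  have c0 : 0 < g1 * D ^+ 4 * M by rewrite mulr_gt0// mulr_gt0// exprn_gt0.
  rewrite ler_pM2l//; apply: sm_packing => //.
    move=> b /Bok[bok _ [y yA yb]] z; rewrite !in_vb => bz.
    have [xy _] := AP y yA; have lN : (lev0 b <= N)%N by rewrite -okE.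
    apply: le_lt_trans (dvT x0 y z) _; apply: le_lt_trans (lerD (lexx _) (dvT y b z)) _.
    by have := u_r lN; lra.
  move=> i j x iB jB; exact: (vb_disj dvC dvT Bsep iB jB).
have b2 : beta x0 (2 * r) <= D ^+ 1 * beta x0 r.
  by apply: betaD => //; [lra|rewrite dv0 add0r expr1].
have tr : tau <= 2 * r by have := u_r (leqnn N); have := u_sig N; lra.
apply: (@le_trans _ _ (g1 * D ^+ 4 * M * (M * (D ^+ 1 * beta x0 r)))).
  have c0 : 0 < g1 * D ^+ 4 * M by rewrite mulr_gt0// mulr_gt0// exprn_gt0.
  by rewrite ler_pM2l//; apply: le_trans (m_up x0 tr) _; rewrite ler_pM2l.
by rewrite le_eqVlt; apply/orP; left; apply/eqP; ring.
Qed.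

(** The set [F] of [ascend] has boundary at most the total cost, so by Poincare [F] or its
    complement is small in the ball. If [F] is small, the mass [e] of the ball lies in [F], near
    heavy points, or near points where [e] is rare. If the complement is small, [m - e] lies in it
    or near labelled points, where [m - e] is rare. The two summands of [core_const] stand for the
    heavy balls and for the boundary. *)
Lemma core_selected :
  Num.min (sm e (vb dv x0 r)) (sm f (vb dv x0 r)) <=
  g1 * D ^+ 5 * M ^+ 2 * beta x0 r + core_const * r * (sm n setT / c3).
Proof.
have local_context : True by [].
have rr := r0; have t0 := tau0; have st := sig_tau.
have lev_hv x : ~~ hv x -> lev x = lev0 x by rewrite /lev => /negbTE ->.
have [||||F [I1 I2 bdF]] := @ascend R V dv dv0 dvC dvT m tau w M tau0 M1 m0 w0 wC w_far w_deg
  beta D D1 beta0 betaD m_up m_pt ok smax Lam K kL m_low K0 Lam1 kL_Lam poincare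
  eta gam ke eta0 eta6 ke_eta eta_gain gam0 gam_small e g1 e_ge0 e_le g1_0 g1a g1b g1c
  lev N lbl cl hv sig sig0 sig_tau sig_eta sig_max lev_ok.
- move=> x xok nh; rewrite /lbl nh /= => n1; have := stop xok.
  by rewrite (negbTE nh) (negbTE n1) /= orbF /low0 lev_hv.
- by move=> x xok /andP[nh]; rewrite /low1 lev_hv.
- by move=> x /andP[].
- exact: clean_hyp.
set nV := sm n setT / c3; set B := vb dv x0 r.
have nV0 : 0 <= nV by rewrite divr_ge0 ?sm_ge0// ltW.
have MD : 0 < M * D ^+ k3 by rewrite mulr_gt0// exprn_gt0.
have x0ok : x0 \in ok by apply: ok_near; rewrite dv0 !mulr_gt0//; have := Lam1; slra.
have Bok y : y \in B -> y \in ok.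
  rewrite in_vb => xy; apply: ok_near; apply: lt_le_trans xy _.
  rewrite -mulrA; have : r <= Lam * r by rewrite ler_peMl// ltW.
  slra.
have Hmin : Num.min (sm m (F :&: B)%SET) (sm m (B :\: F)%SET) <= K * r * (cost_const * nV).
  apply: le_trans (poincare F x0ok _ r_max) _.
    by have := u_r (leqnn N); have := u_sig N; slra.
  rewrite ler_pM2l ?mulr_gt0//; apply: le_trans (le_trans bdF cost_hyp).
  apply: (es_sub w0 w_far) => p q.
  have far z : z \in vb dv x0 (Lam * r) -> z \notin nb dv (~: ok)%SET (u N).
    rewrite in_vb => xz; apply/nbP => -[y]; rewrite in_setC => /negP yok zy; apply: yok.
    apply: ok_near; apply: le_lt_trans (dvT x0 z y) _.
    have : r <= Lam * r by rewrite ler_peMl// ltW.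
    have := u_r (leqnn N); have := u0 N; slra.
  rewrite !(in_setI, in_setC, in_setD) => /andP[-> /far ->] /andP[-> /far ->] _; by [].
have heavy (A : {set V}) : (forall y, y \in A -> exists2 x, hv x & dv y x < 4 * u (lev x)) ->
    sm m A <= M * D ^+ k3 * r * nV.
  move=> Ah; apply: (@H_cover predT) => //.
  - move=> y /Ah[x hx yx]; have [cH _ xc] := ctrP hx; exists (ctr x); split => //.
    have lx : lev x = lev0 (ctr x) by rewrite /lev hx.
    apply: le_lt_trans (dvT y x _) _.
    have : 2 * sg (lev0 (ctr x)) <= L1 * sg (lev0 (ctr x)) by rewrite ler_pM2r// sg0.
    by have := u0 (lev0 (ctr x)); rewrite lx in yx; rewrite /sg in xc *; slra.
  - by move=> i _ _ z _; rewrite inE.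
  - by move=> i iH _; apply: u_r; rewrite -okE H_ok.
pose Zh := [set y in B | [exists x, hv x && (dv y x < 4 * u (lev x))]]%SET.
have Zh_m : sm m Zh <= M * D ^+ k3 * r * nV.
  apply: heavy => y; rewrite inE => /andP[_ /existsP[x /andP[hx yx]]]; by exists x.
have e_m A : sm e A <= sm m A by apply: ler_sum.
have f_m A : sm f A <= sm m A by apply: ler_sum => i _; rewrite gerBl.
have beq : core_const * r * nV = M * D ^+ k3 * r * nV + K * r * (cost_const * nV).
  by rewrite /core_const; ring.
rewrite beq; move: Hmin; rewrite ge_min => /orP[FB|FB]; rewrite ge_min; apply/orP; [left|right].
  pose Z0 := (B :\: F :\: Zh)%SET.
  have e1 : sm e B <= sm e (F :&: B)%SET + sm e Zh + sm e Z0.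
    rewrite (le_trans _ (lerD (sm_setU e_ge0 _ _) (lexx _)))// (le_trans _ (sm_setU e_ge0 _ _))//.
    apply: sm_sub => // y yB; rewrite !(in_setU, in_setI, in_setD) yB.
    by case: (y \in F); case: (y \in Zh).
  have e2 : sm e Z0 <= g1 * D ^+ 5 * M ^+ 2 * beta x0 r.
    apply: (@low_cover e (fun x => ~~ hv x && low0 x)) => //.
      by move=> x xok /andP[_].
    move=> y; rewrite !in_setD => /and3P[yZ yF yB]; split; first by rewrite in_vb in yB.
    have [x xok [lx yx]] := I2 y yF (Bok y yB); exists x => //.
    have nh : ~~ hv x.
      apply: contra yZ => hx; rewrite inE yB /=; apply/existsP; exists x; by rewrite hx.
    rewrite nh -(lev_hv x nh); split=> //=.
    by have := stop xok; move: lx; rewrite /lbl nh (negbTE nh) /= => /negbTE ->; rewrite orbF.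
  have e3 := e_m (F :&: B)%SET; have e4 := e_m Zh; slra.
have e1 : sm f B <= sm f (B :\: F)%SET + sm f (F :&: B)%SET.
  rewrite (le_trans _ (sm_setU f0 _ _))//.
  apply: sm_sub => // y yB; rewrite !(in_setU, in_setI, in_setD) yB.
  by case: (y \in F).
have e2 : sm f (F :&: B)%SET <= g1 * D ^+ 5 * M ^+ 2 * beta x0 r.
  apply: (@low_cover f (fun x => lbl x)) => //.
    by move=> x xok /andP[_].
  move=> y; rewrite !in_setI => /andP[yF yB]; split; first by rewrite in_vb in yB.
  have [x xok [lx yx]] := I1 y yF; exists x => //; split=> //.
  by rewrite -(lev_hv x)//; move: lx => /andP[].
have e3 := f_m (B :\: F)%SET; have e4 : 0 <= M * D ^+ k3 * r * nV.
  by rewrite mulr_ge0// ltW// mulr_gt0.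
slra.
Qed.
End Selection.

Theorem finite_core (x0 : V) (r : R) :
  sg N <= r -> r <= smax -> (forall z, dv x0 z < 2 * Lam * r -> z \in ok) ->
  Num.min (sm e (vb dv x0 r)) (sm f (vb dv x0 r)) <=
  g1 * D ^+ 5 * M ^+ 2 * beta x0 r + core_const * r * (sm n setT / c3).
Proof.
have local_context : True by [].
move=> h1 h2 h3; have l2 := L1_2.
have Lp j : 0 < L1 * sg j by apply: mulr_gt0; [slra|].
have [|H [HS Hsep Hcov]] := @finite_vitali _ _ _ dv0 dvC (fun x => L1 * sg (lev0 x)) [set x | hv x]%SET.
  by [].
pose ctr x := odflt x [pick y | [&& y \in H, L1 * sg (lev0 x) <= L1 * sg (lev0 y) &
  dv x y < L1 * sg (lev0 x) + L1 * sg (lev0 y)]].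
apply: (@core_selected H ctr) => //.
- by move=> i /HS; rewrite inE.
- move=> x hx; rewrite /ctr; case: pickP => [y /and3P[yH xy1 xy2]|none] /=.
    split=> //; first by move: xy1; rewrite ler_pM2l//; slra.
    slra.
  have [|y yH [xy1 xy2]] := Hcov x; first by rewrite inE.
  by have := none y; rewrite yH xy1 xy2.
Qed.
End FiniteCore.

From mathcomp Require Import all_classical all_reals all_analysis.
From mathcomp Require Import measurable_realfun lebesgue_integral.
From mathcomp Require Import ring lra.
Import Order.TTheory GRing.Theory Num.Theory.
Import numFieldNormedType.Exports.
Local Open Scope classical_set_scope.
Local Open Scope ring_scope.

(** * Regularity of Borel measures on metric spaces *)

Section Metric.
Variables (R : realType) (d : measure_display) (X : measurableType d) (dist : X -> X -> R).
Hypothesis metric : is_metric dist.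
Hypothesis borel : borel_for dist.

Lemma dist_ge0 x y : 0 <= dist x y. Proof. by case: metric. Qed.
Lemma distxx x : dist x x = 0. Proof. by case: metric => _ [/(_ x x)[_ ->]]. Qed.
Lemma distC x y : dist x y = dist y x. Proof. by case: metric => _ [_ [->]]. Qed.
Lemma dist_tri x y z : dist x z <= dist x y + dist y z.
Proof. by case: metric => _ [_ [_ ->]]. Qed.

Lemma dball_open x r : dopen dist (dball dist x r).
Proof.
move=> y; rewrite /dball /= => xy; exists (r - dist x y); first by rewrite subr_gt0.
by move=> z; rewrite /dball /= => yz; have := dist_tri x y z; lra.
Qed.

Lemma dball_sub x y r s : dist y x + r <= s -> dball dist x r `<=` dball dist y s.
Proof. by move=> h z; rewrite /dball/= => xz; have := dist_tri y x z; lra. Qed.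

Lemma dopenI (U V : set X) : dopen dist U -> dopen dist V -> dopen dist (U `&` V).
Proof.
move=> oU oV x [/oU[r r0 rU] /oV[s s0 sV]]; exists (Num.min r s); first by rewrite lt_min r0.
by move=> z; rewrite /dball /= lt_min => /andP[zr zs]; split; [exact: rU|exact: sV].
Qed.

Lemma dopen_bigcup I (P : set I) (U : I -> set X) :
  (forall i, P i -> dopen dist (U i)) -> dopen dist (\bigcup_(i in P) U i).
Proof.
move=> oU x [i Pi /(oU _ Pi)[r r0 rU]]; exists r => // z /rU zU; by exists i.
Qed.

Lemma dopenT : dopen dist setT. Proof. by move=> x _; exists 1. Qed.

Lemma dopen_measurable U : dopen dist U -> measurable U.
Proof. by move=> oU; apply/borel; apply: sub_sigma_algebra. Qed.

Lemma dball_measurable x r : measurable (dball dist x r).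
Proof. exact/dopen_measurable/dball_open. Qed.

Lemma lsc_measurable (f : X -> \bar R) :
  (forall a : R, dopen dist [set x | (a%:E < f x)%E]) -> measurable_fun setT f.
Proof.
move=> h mD; apply: (measurability _ (ErealGenOInfty.measurableE R)) => //.
move=> _ [_ [r ->] <-]; rewrite setTI; apply: dopen_measurable.
rewrite (_ : _ @^-1` _ = [set x | (r%:E < f x)%E])//.
by apply/seteqP; split=> x /=; rewrite in_itv/= andbT.
Qed.

Definition lip (f : X -> R) (L : R) := forall x y, `|f x - f y| <= L * dist x y.

Lemma lip_ge0 f L : lip f L -> lip f `|L|.
Proof. by move=> h x y; rewrite (le_trans (h x y))// ler_wpM2r ?dist_ge0// ler_norm. Qed.

Lemma lip_open f L a : lip f L -> dopen dist [set x | a < f x].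
Proof.
move=> /lip_ge0 fL x /= ax; have L1 : 0 < `|L| + 1 by rewrite ltr_wpDl.
exists ((f x - a) / (`|L| + 1)); first by rewrite divr_gt0// subr_gt0.
move=> y /=; rewrite /dball/= ltr_pdivlMr// => xy.
have := fL x y; have := ler_norm (f x - f y); have := dist_ge0 x y; nra.
Qed.

Lemma lip_measurable f L : lip f L -> measurable_fun setT f.
Proof.
move=> fL; apply/measurable_EFinP; apply: lsc_measurable => a.
by under eq_set do rewrite /= lte_fin; exact: lip_open fL.
Qed.

Lemma lip_dist x : lip (dist x) 1.
Proof.
move=> y z; rewrite mul1r ler_norml; have := dist_tri x y z; have := dist_tri x z y.
by rewrite (distC z y) => *; apply/andP; split; lra.
Qed.

(** Cut off at 1, so that the infimum runs over a nonempty set even for empty [S], as happens when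
    [S] is the complement of the whole space. *)
Definition ddist (S : set X) (x : X) : R := inf ([set dist x y | y in S] `|` [set 1]).

Lemma ddist_inf S x : has_inf ([set dist x y | y in S] `|` [set 1]).
Proof.
split; first by exists 1; right.
by exists 0 => _ [[y _ <-]|->//]; exact: dist_ge0.
Qed.

Lemma ddist_le S x y : S y -> ddist S x <= dist x y.
Proof. by move=> Sy; apply: ge_inf; [exact: (ddist_inf S x).2|left; exists y]. Qed.

Lemma ddist_le1 S x : ddist S x <= 1.
Proof. by apply: ge_inf; [exact: (ddist_inf S x).2|right]. Qed.

Lemma ddist_lb S x t : t <= 1 -> (forall y, S y -> t <= dist x y) -> t <= ddist S x.
Proof.
move=> t1 h; apply: lb_le_inf; first exact: (ddist_inf S x).1.
by move=> _ [[y Sy <-]|->//]; exact: h.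
Qed.

Lemma ddist_ge0 S x : 0 <= ddist S x.
Proof. by apply: ddist_lb => // y _; exact: dist_ge0. Qed.

Lemma lip_ddist S : lip (ddist S) 1.
Proof.
have local_context : True by [].
have h x y : ddist S x <= ddist S y + dist x y.
  rewrite -lerBlDr; apply: ddist_lb.
    by rewrite lerBlDr (le_trans (ddist_le1 _ _))// lerDl dist_ge0.
  move=> z Sz; have := ddist_le x Sz; have := dist_tri x y z; slra.
move=> x y; rewrite mul1r ler_norml; have := h x y; have := h y x.
by rewrite (distC y x) => *; apply/andP; split; slra.
Qed.

Lemma ddist_gt0 (O : set X) x : dopen dist O -> (0 < ddist (~` O) x) <-> O x.
Proof.
move=> oO; split=> [|Ox].
  by apply: contraPP => nO; rewrite ltNge; apply/negP/negPn; rewrite -(distxx x); exact: ddist_le.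
have [r r0 rO] := oO x Ox; apply: (@lt_le_trans _ _ (Num.min r 1)); first by rewrite lt_min r0/=.
apply: ddist_lb; first by rewrite ge_min lexx orbT.
move=> y nO; rewrite leNgt; apply/negP => /=; rewrite lt_min => /andP[xy _]; apply: nO; exact: rO.
Qed.

End Metric.

Lemma nneseries_geo (R : realType) (F : nat -> \bar R) (e : R) : 0 <= e ->
  (forall n, (0 <= F n)%E) ->
  (forall n, (F n <= (e / (2 ^ n.+1)%:R)%:E)%E) -> (\sum_(0 <= n <oo) F n <= e%:E)%E.
Proof.
move=> e0 F0 Fe; have := @epsilon_trick R (fun=> 0%E) e xpredT (fun=> lexx _) e0.
rewrite [X in (_ <= X + _)%E -> _]eseries0// add0e; apply: le_trans.
by apply: lee_nneseries => [n _ _|n _]; [exact: F0|rewrite add0e; exact: Fe].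
Qed.

Section SmallTail.
Variables (R : realType) (d : measure_display) (X : measurableType d) (nu : {measure set X -> \bar R}).

Lemma measure_cvg0 (F : nat -> set X) : (forall n, measurable (F n)) ->
  (nu (F 0%N) < +oo)%E -> (forall n m, (n <= m)%N -> F m `<=` F n) -> \bigcap_n F n = set0 ->
  forall e : R, 0 < e -> exists n, (nu (F n) <= e%:E)%E.
Proof.
move=> mF F0 Fd F0' e e0.
have := @nonincreasing_cvg_mu _ _ _ nu F F0 mF _ _; rewrite F0' measure0.
have mc : measurable (set0 : set X) by [].
have ni : {homo F : n m / (n <= m)%N >-> (m <= n)%O}.
  by move=> n m nm; apply/subsetPset; exact: Fd.
move=> /(_ mc ni)/fine_cvgP[fin_near cv].
have : \forall n \near \oo, fine ((nu \o F) n) < e by apply: (cvgr_lt _ cv).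
move=> H; near \oo => n; exists n.
have h1 : fine ((nu \o F) n) < e by near: n.
have h2 : (nu \o F) n \is a fin_num by near: n.
by move: h1 h2 => /= h1 h2; rewrite -(fineK h2) lee_fin ltW.
Unshelve. all: by end_near. Qed.

End SmallTail.

Section Regular.
Variables (R : realType) (d : measure_display) (X : measurableType d) (dist : X -> X -> R).
Hypothesis metric : is_metric dist.
Hypothesis borel : borel_for dist.
Variable nu : {measure set X -> \bar R}.
Hypothesis nu_fin : (nu setT < +oo)%E.

(** Sets that can be approximated from inside by closed sets and from outside by open sets form a
    sigma-algebra, and the open sets belong to it. *)
Let approx (E : set X) := measurable E /\ forall e : R, 0 < e ->
  exists F O, [/\ dopen dist (~` F), dopen dist O, F `<=` E, E `<=` O & (nu (O `\` F) <= e%:E)%E].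

Let nu_lt (A : set X) : measurable A -> (nu A < +oo)%E.
Proof. by move=> mA; apply: le_lt_trans nu_fin; apply: le_measure; rewrite ?inE. Qed.

Let approx_open O : dopen dist O -> approx O.
Proof.
move=> oO; split; first exact: (dopen_measurable borel).
move=> e e0.
pose K n := [set x | n.+1%:R^-1 <= ddist dist (~` O) x].
have oK n : dopen dist (~` K n).
  move=> x /negP; rewrite -ltNge => h.
  have := @lip_open _ _ _ _ metric (fun x => - ddist dist (~` O) x) 1 (- n.+1%:R^-1) _ x.
  have lp : lip dist (fun x => - ddist dist (~` O) x) 1.
    by move=> y z; rewrite -opprD normrN; exact: lip_ddist.
  move=> /(_ lp) /=; rewrite ltrN2 => /(_ h)[r r0 rK]; exists r => // z /rK /=.
  by rewrite ltrN2 => hz; apply/negP; rewrite -ltNge.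
have mK n : measurable (K n) by rewrite -[K n]setCK; apply/measurableC/(dopen_measurable borel).
have mO := dopen_measurable borel oO.
have [n||||n nun] := @measure_cvg0 _ _ _ nu (fun n => O `\` K n) _ _ _ _ e e0.
- exact: measurableD.
- exact/nu_lt/measurableD.
- move=> n m nm x [Ox nK]; split=> // Kn; apply: nK; rewrite /K/= in Kn *; apply: le_trans Kn.
  by rewrite lef_pV2 ?posrE// ler_nat ltnS.
- apply/seteqP; split => // x h; have [Ox _] := h 0%N I.
  have := (ddist_gt0 metric x oO).2 Ox => x0.
  have [n nx] : exists n : nat, (n.+1%:R)^-1 <= ddist dist (~` O) x.
    exists (Num.truncn (ddist dist (~` O) x)^-1); rewrite -[leRHS]invrK lef_pV2 ?posrE ?invr_gt0//.
    by rewrite ltW// truncnS_gt// invr_ge0 ltW.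
  by have [_] := h n I; apply.
exists (K n), O; split => // x; rewrite /K/= => Kx.
by apply/(ddist_gt0 metric x oO); apply: lt_le_trans Kx.
Qed.

Let approxC E : approx E -> approx (~` E).
Proof.
move=> [mE h]; split; first exact: measurableC.
move=> e /h[F [U [oF oU FE EU nuUF]]]; exists (~` U), (~` F); split => //; rewrite ?setCK//.
- exact: subsetC.
- exact: subsetC.
by rewrite setDE setCK setIC -setDE.
Qed.

Let approxU (E : nat -> set X) : (forall n, approx (E n)) -> approx (\bigcup_n E n).
Proof.
move=> h; split; first by apply: bigcup_measurable => n _; case: (h n).
move=> e e0.
have e2 : 0 < e / 2 by rewrite divr_gt0.
have ch n : exists FO : set X * set X, [/\ dopen dist (~` FO.1), dopen dist FO.2, FO.1 `<=` E n,
    E n `<=` FO.2 & (nu (FO.2 `\` FO.1) <= (e / 2 / (2 ^ n.+1)%:R)%:E)%E].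
  have [F [U ?]] := (h n).2 (e / 2 / (2 ^ n.+1)%:R) ltac:(by rewrite divr_gt0// ltr0n expn_gt0).
  by exists (F, U).
pose FO n := projT1 (cid (ch n)); have FOP n := projT2 (cid (ch n)).
rewrite -/(FO _) in FOP *.
pose F n := (FO n).1; pose O n := (FO n).2.
have mF n : measurable (F n).
  by rewrite -[F n]setCK; apply: measurableC; apply: (dopen_measurable borel); case: (FOP n).
have mO n : measurable (O n) by apply: (dopen_measurable borel); case: (FOP n).
pose UF n := \big[setU/set0]_(i < n) F i.
have mUF n : measurable (UF n) by apply: bigsetU_measurable => i _.
have mUO : measurable (\bigcup_n O n) by apply: bigcup_measurable.
have mUFo : measurable (\bigcup_n F n) by apply: bigcup_measurable.
have [n||||n nun] := @measure_cvg0 _ _ _ nu (fun n => (\bigcup_n F n) `\` UF n) _ _ _ _ _ e2.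
- exact: measurableD.
- exact/nu_lt/measurableD.
- move=> n m nm x [Fx nU]; split=> // Un; apply: nU.
  by move: Un; rewrite /UF -!bigcup_mkord => -[i /= im Fi]; exists i => //=; exact: leq_trans nm.
- apply/seteqP; split => // x hx; have [[i _ Fi] _] := hx 0%N I.
  by have [_] := hx i.+1 I; apply; rewrite /UF -bigcup_mkord; exists i => /=.
exists (UF n), (\bigcup_n O n); split.
- have : forall k, dopen dist (~` UF k).
    elim=> [|k IH]; first by rewrite /UF big_ord0 setC0; exact: dopenT.
    by rewrite /UF big_ord_recr/= setCU; apply: dopenI => //; case: (FOP k).
  exact.
- by apply: dopen_bigcup => i _; case: (FOP i).
- by rewrite /UF -bigcup_mkord => x [i _ Fx]; exists i => //; case: (FOP i) => _ _ + _ _; exact.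
- by move=> x [i _ Ex]; exists i => //; case: (FOP i) => _ _ _ + _; exact.
have sub : (\bigcup_n O n) `\` UF n `<=` (\bigcup_n (O n `\` F n)) `|` ((\bigcup_n F n) `\` UF n).
  move=> x [[i _ Ox] nU]; have [Fx|nF] := pselect ((\bigcup_n F n) x); first by right.
  by left; exists i => //; split => // Fi; apply: nF; exists i.
apply: le_trans (_ : (nu ((\bigcup_n (O n `\` F n)) `|` ((\bigcup_n F n) `\` UF n)) <= _)%E).
  by apply: le_measure => //; rewrite inE; do ?[apply: measurableU|apply: measurableD|apply: bigcup_measurable] => // k _; exact: measurableD.
have mD : measurable (\bigcup_n (O n `\` F n)) by apply: bigcup_measurable => k _; exact: measurableD.
apply: le_trans (measureU2 _ mD (measurableD mUFo (mUF n))) _.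
have -> : (e%:E = (e / 2)%:E + (e / 2)%:E)%E by rewrite -EFinD -splitr.
apply: leeD => //.
apply: le_trans (measure_sigma_subadditive nu _ mD (@subset_refl _ _)) _.
  by move=> k; exact: measurableD.
by apply: nneseries_geo; rewrite ?ltW// => k; case: (FOP k).
Qed.

Lemma regular (E : set X) (e : R) : measurable E -> 0 < e ->
  exists F O, [/\ dopen dist (~` F), dopen dist O, F `<=` E, E `<=` O & (nu (O `\` F) <= e%:E)%E].
Proof.
move=> mE e0; suff : approx E by case=> _; exact.
have /(_ E) : <<s [set U | dopen dist U] >> `<=` approx.
  apply: smallest_sub; last by move=> O; exact: approx_open.
  split.
  - by rewrite -setCT; apply/approxC/approx_open/dopenT.
  - by move=> A hA; rewrite setTD; exact: approxC.
  - exact: approxU.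
by apply; apply/borel.
Qed.

End Regular.

Lemma invS_small (R : realType) (e : R) : 0 < e -> exists n : nat, n.+1%:R^-1 < e.
Proof.
move=> e0; exists (Num.truncn e^-1); rewrite -[ltRHS]invrK ltf_pV2 ?posrE ?invr_gt0//.
by rewrite truncnS_gt.
Qed.

Lemma expr2_large (R : realType) (a : R) : exists k : nat, a <= 2 ^+ k.
Proof.
exists (Num.truncn a).+1; apply: le_trans (ltW (truncnS_gt a)) _.
by rewrite -natrX ler_nat ltnW// ltn_expl.
Qed.

(** * Packing, nets and compactness from doubling *)

Section Doubling.
Variables (R : realType) (d : measure_display) (X : measurableType d) (dist : X -> X -> R).
Hypothesis metric : is_metric dist.
Hypothesis borel : borel_for dist.
Variable mu : {measure set X -> \bar R}.
Variable Cd : R.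
Hypothesis dbl : doubling dist mu Cd.

Lemma dball_neg x r : r <= 0 -> dball dist x r = set0.
Proof.
move=> r0; apply/seteqP; split => // y; rewrite /dball/= ltNge => /negP; apply.
exact: le_trans (dist_ge0 metric x y).
Qed.

Lemma muB_fin x r : (mu (dball dist x r) < +oo)%E.
Proof.
have [r0|r0] := ltP 0 r; last by rewrite dball_neg// measure0.
by have [_ [_]] := dbl x r0.
Qed.

Definition mB x r := fine (mu (dball dist x r)).

Lemma mBE x r : mu (dball dist x r) = (mB x r)%:E.
Proof. by rewrite /mB fineK// ge0_fin_numE// muB_fin. Qed.

Lemma mB_ge0 x r : 0 <= mB x r. Proof. exact: fine_ge0. Qed.

Lemma mB_gt0 x r : 0 < r -> 0 < mB x r.
Proof.
move=> r0; have h : 0 < r / 2 by rewrite divr_gt0.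
have [+ _] := dbl x h; rewrite mulrCA divff// mulr1 mBE lte_fin; exact.
Qed.

Lemma mB_le x y r s : dist y x + r <= s -> mB x r <= mB y s.
Proof.
move=> h; rewrite -lee_fin -!mBE; apply: le_measure; rewrite ?inE.
- exact: dball_measurable.
- exact: dball_measurable.
- exact: dball_sub.
Qed.

Lemma mB_double x r : mB x (2 * r) <= Cd * mB x r.
Proof.
have [r0|r0] := ltP 0 r; last first.
  by rewrite /mB !dball_neg ?measure0/= ?mulr0// mulr_ge0_le0.
have [_ [+ _]] := dbl x r0; rewrite !mBE -EFinM lee_fin; exact.
Qed.

Lemma Cd_ge1 (x : X) : 1 <= Cd.
Proof.
have h := mB_gt0 x (@ltr01 R); rewrite -(ler_pM2r h) mul1r (le_trans _ (mB_double _ _))//.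
by apply: mB_le; rewrite distxx//; lra.
Qed.

Lemma mB_iter k x y r r' : dist x y + r' <= 2 ^+ k * r -> mB y r' <= Cd ^+ k * mB x r.
Proof.
move=> h; apply: le_trans (_ : mB x (2 ^+ k * r) <= _); first exact: mB_le.
have C1 := Cd_ge1 x; elim: k {h} => [|k IH]; first by rewrite !expr0 !mul1r.
rewrite !exprS -!mulrA (le_trans (mB_double _ _))// ler_pM2l//; lra.
Qed.

Lemma mu_sub_lty (A : set X) x r : measurable A -> A `<=` dball dist x r -> (mu A < +oo)%E.
Proof.
move=> mA AB; apply: le_lt_trans (muB_fin x r); apply: le_measure; rewrite ?inE//.
exact: dball_measurable.
Qed.

Lemma measure_disj_sum (I : finType) (P : pred I) (F : I -> set X) (B : set X) :
  (forall i, measurable (F i)) -> measurable B ->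
  (forall i j, P i -> P j -> F i `&` F j !=set0 -> i = j) ->
  (forall i, P i -> F i `<=` B) -> (\sum_(i | P i) mu (F i) <= mu B)%E.
Proof.
move=> mF mBB dj sub; pose G i := if P i then F i else set0.
have mG i : measurable (G i) by rewrite /G; case: ifP.
rewrite big_mkcond /=; rewrite (eq_bigr (fun i => mu (G i))); last first.
  by move=> i _; rewrite /G; case: ifP => // _; rewrite measure0.
have h := @measure_fin_bigcup _ R X mu I [set` index_enum I] G (finite_seq _) _ (fun i _ => mG i).
have tr : trivIset [set` index_enum I] G.
  apply/trivIsetP => i j _ _ ij; apply/eqP/negPn/negP => /set0P[x []].
  rewrite /G; case: ifP => // Pi Fi; case: ifP => // Pj Fj.
  by move/eqP: ij; apply; apply: dj => //; exists x.
rewrite fsbig_seq ?index_enum_uniq// -h//; apply: le_measure; rewrite ?inE//.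
  by apply: fin_bigcup_measurable => //; exact: finite_seq.
by move=> x [i _]; rewrite /G; case: ifP => // Pi; exact: sub.
Qed.

Lemma packing_sum n (p : 'I_n -> X) (P : pred 'I_n) t x S :
  (forall i j, i != j -> t <= dist (p i) (p j)) ->
  (forall i, P i -> dist x (p i) <= S) ->
  \sum_(i | P i) mB (p i) (t / 2) <= mB x (S + t / 2).
Proof.
move=> sep near; rewrite -lee_fin -sumEFin -mBE.
under eq_bigr do rewrite -mBE; apply: measure_disj_sum.
- by move=> i; exact: dball_measurable.
- exact: dball_measurable.
- move=> i j _ _ [y [iy jy]]; apply/eqP/negPn/negP => /sep.
  rewrite /dball/= in iy jy; have := dist_tri metric (p i) y (p j); rewrite (distC metric y); lra.
- by move=> i Pi; apply: dball_sub => //; rewrite lerD2r near.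
Qed.

(** The balls of radius [t / 2] are disjoint, lie in one larger ball, and each has a fixed share of
    its measure by doubling. *)
Lemma packing_card n (p : 'I_n -> X) (P : pred 'I_n) t x S k : 0 < t ->
  (forall i j, i != j -> t <= dist (p i) (p j)) ->
  (forall i, P i -> dist x (p i) <= S) -> 4 * S + t <= 2 ^+ k * t ->
  \sum_(i | P i) (1 : R) <= Cd ^+ k.
Proof.
have local_context : True by [].
move=> t0 sep near kS; have C1 := Cd_ge1 x; have [[i0 Pi0]|noP] := pselect (exists i, P i); last first.
  rewrite big1; first by rewrite exprn_ge0//; slra.
  by move=> i Pi; exfalso; apply: noP; exists i.
have S0 : 0 <= S by apply: le_trans (near i0 Pi0); exact: dist_ge0.
have h := mB_gt0 x (_ : 0 < S + t / 2); have {}h := h ltac:(lra).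
rewrite -(ler_pM2r h) big_distrl/= (le_trans _ (ler_wpM2l _ (packing_sum sep near)))//; last first.
  by rewrite exprn_ge0//; have := Cd_ge1 x; slra.
rewrite mulr_sumr; apply: ler_sum => i Pi; rewrite mul1r; apply: mB_iter.
by have := near i Pi; rewrite (distC metric); slra.
Qed.

(** If every separated family in the ball missed some point by at least [t], families could be
    enlarged without end, against the bound of [packing_card]. *)
Lemma ball_net x0 r t : 0 < t -> exists n (p : 'I_n -> X),
  [/\ (forall i, dist x0 (p i) < r), (forall i j, i != j -> t <= dist (p i) (p j)) &
      (forall y, dist x0 y < r -> exists i, dist y (p i) < t)].
Proof.
move=> t0; apply: contrapT => nonet.
have big m : exists n (p : 'I_n -> X), [/\ (m <= n)%N, (forall i, dist x0 (p i) < r) &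
   (forall i j, i != j -> t <= dist (p i) (p j))].
  elim: m => [|m [n [p [mn pr sep]]]].
    by exists 0%N, (fun i => x0); split => // -[].
  have [[y [xy yp]]|h] := pselect (exists y, dist x0 y < r /\ forall i, t <= dist y (p i)).
    exists n.+1, (fun i => if unlift ord0 i is Some j then p j else y); split => //.
      by move=> i; case: unliftP.
    move=> i j; case: unliftP => [i'|] ->; case: unliftP => [j'|] -> //=.
      by rewrite (inj_eq (@lift_inj _ _)) => /sep.
    by rewrite (distC metric).
  exfalso; apply: nonet; exists n, p; split => // y xy; apply: contrapT => hy.
  by apply: h; exists y; split => // i; rewrite leNgt; apply/negP => hi; apply: hy; exists i.
have [k hk] := expr2_large ((4 * `|r| + t) / t).
have [n [p [mn pr sep]]] := big (Num.truncn (Cd ^+ k)).+1.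
have := @packing_card n p xpredT t x0 `|r| k t0 sep (fun i _ => le_trans (ltW (pr i)) (ler_norm r)).
rewrite -ler_pdivrMr// => /(_ hk); rewrite sumr_const card_ord leNgt => /negP; apply.
by apply: lt_le_trans (truncnS_gt _) _; rewrite ler_nat.
Qed.

Hypothesis cplt : dcomplete dist.

(** Finite nets force the ultrafilter to contain a ball of each radius [1 / (k + 1)]; the centres
    form a Cauchy sequence, and completeness gives the limit. This is the compactness that replaces
    properness below. *)
Lemma ultra_lim (U : set_system X) x0 r : UltraFilter U -> U (dball dist x0 r) ->
  exists x, forall e, 0 < e -> U (dball dist x e).
Proof.
have local_context : True by [].
move=> UU Ur; have PU : ProperFilter U by exact: ultra_proper.
have FU : Filter U by case: PU.
have UI A B : U A -> U B -> U (A `&` B) by exact: (@filterI _ U FU).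
have US A B : A `<=` B -> U A -> U B by exact: (@filterS _ U FU).
have ex k : exists x, U (dball dist x k.+1%:R^-1).
  have [n [p [_ _ cov]]] := @ball_net x0 r k.+1%:R^-1 ltac:(by rewrite invr_gt0).
  apply: contrapT => no.
  have hc i : U (~` dball dist (p i) k.+1%:R^-1).
    by case: (in_ultra_setVsetC (dball dist (p i) k.+1%:R^-1) UU) => // h; exfalso; apply: no; exists (p i).
  have hall := filter_forall FU hc.
  apply: (@filter_not_empty _ U); apply: US (UI _ _ Ur hall) => y [/cov[i yi] /(_ i)]; apply.
  by rewrite /dball/= (distC metric).
have [c cU] := choice ex.
have cd m n : dist (c m) (c n) < m.+1%:R^-1 + n.+1%:R^-1.
  have /filter_ex[y [my ny]] := UI _ _ (cU m) (cU n).
  apply: le_lt_trans (dist_tri metric _ y _) _; rewrite (distC metric y); exact: ltrD.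
have [e e0|x xlim] := cplt (s := c).
  have [N hN] := @invS_small R (e / 2) ltac:(lra); exists N => m n mN nN.
  apply: lt_trans (cd m n) _; have inv k : (N <= k)%N -> k.+1%:R^-1 <= N.+1%:R^-1 :> R.
    by move=> Nk; rewrite lef_pV2 ?posrE// ler_nat ltnS.
  by rewrite (splitr e) ltrD// (le_lt_trans (inv _ _) hN).
exists x => e e0; have [N hN] := @invS_small R (e / 2) ltac:(lra).
have [M hM] := xlim (e / 2) ltac:(lra).
apply: US (cU (maxn M N)); apply: dball_sub => //.
have := hM _ (leq_maxl M N); rewrite (distC metric).
move=> h; rewrite [leRHS]splitr lerD ?ltW// (le_lt_trans _ hN)//.
by rewrite lef_pV2 ?posrE// ler_nat ltnS leq_maxr.
Qed.

(** Without a finite cover the uncovered parts of the ball generate a proper filter. A finer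
    ultrafilter has a limit [x], and it would contain both the ball of radius [rad x] and its
    complement. *)
Lemma finite_cover x0 r (rad : X -> R) : (forall x, 0 < rad x) ->
  exists s : seq X, forall y, dist x0 y < r -> exists2 x, x \in s & dist x y < rad x.
Proof.
move=> rad0; apply: contrapT => no.
pose cov (s : seq X) := [set y | exists2 x, x \in s & dist x y < rad x].
pose F : set_system X := fun S => exists s, dball dist x0 r `\` cov s `<=` S.
have FF : ProperFilter F.
  split; first by move=> [s hs]; apply: no; exists s => y xy; apply: contrapT => ny; exact: (hs y).
  split.
  - by exists [::].
  - move=> A B [s sA] [s' sB]; exists (s ++ s') => y [xy ny]; split.
      by apply: sA; split => // -[x xs xy']; apply: ny; exists x => //; rewrite mem_cat xs.
    by apply: sB; split => // -[x xs xy']; apply: ny; exists x => //; rewrite mem_cat xs orbT.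
  - by move=> A B AB [s sA]; exists s; apply: subset_trans AB.
have [U [UU FU]] := ultraFilterLemma FF.
have Ur : U (dball dist x0 r) by apply: FU; exists [::] => y [].
have [x hx] := ultra_lim UU Ur.
have : U (~` dball dist x (rad x)).
  by apply: FU; exists [:: x] => y [_ ny] xy; apply: ny; exists x => //; rewrite inE.
have PU : ProperFilter U by exact: ultra_proper.
have FU' : Filter U by case: PU.
move=> /(@filterI _ U FU' _ _ (hx _ (rad0 x))); rewrite setICr; exact: filter_not_empty.
Qed.

End Doubling.

(** * Curves and line integrals *)

Section Integral.
Variables (R : realType) (d : measure_display) (T : measurableType d) (nu : {measure set T -> \bar R}).

Lemma int_cvg0 (D : set T) (F : nat -> set T) (G : T -> \bar R) : measurable D ->
  (forall n, measurable (F n)) -> (forall n, F n `<=` D) -> (forall n m, (n <= m)%N -> F m `<=` F n) ->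
  nu (\bigcap_n F n) = 0%E -> measurable_fun setT G -> (forall x, (0 <= G x)%E) ->
  (\int[nu]_(x in D) G x < +oo)%E ->
  forall e : R, 0 < e -> exists n, (\int[nu]_(x in F n) G x <= e%:E)%E.
Proof.
move=> mD mF FD Fd F0 mG G0 Gfin e e0.
pose f n x := (G x * (\1_(F n) x)%:E)%E.
have mf n : measurable_fun D (f n).
  apply: emeasurable_funM; first exact: measurable_funTS.
  by apply/measurable_EFinP; exact: measurable_indic.
have iG : nu.-integrable D G.
  apply/integrableP; split; first exact: measurable_funTS.
  by under eq_integral do rewrite gee0_abs//.
have mcap : measurable (\bigcap_n F n) by apply: bigcapT_measurable.
have [] := @dominated_convergence _ _ _ nu D mD f (fun=> 0%E) G mf (measurable_cst _) _ iG _.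
- exists (\bigcap_n F n); split => // x /= nx n _; apply: contrapT => nFx; apply: nx => _.
  apply: cvg_near_cst; near=> k; rewrite /f indicE memNset ?mule0// => Fk; apply: nFx.
  by apply: Fd Fk; near: k; exact: nbhs_infty_ge.
- apply: filterE => x n _; rewrite /f gee0_abs; last by rewrite mule_ge0// lee_fin.
  by rewrite indicE; case: (_ \in _); rewrite ?mule1// mule0.
move=> _ _; rewrite integral0 => cv.
have fE n : (\int[nu]_(x in D) f n x = \int[nu]_(x in F n) G x)%E.
  rewrite [RHS]integral_mkcond [LHS]integral_mkcond; apply: eq_integral => x _.
  rewrite !patchE /f indicE; case: ifPn => [_|nD]; case: ifPn => //; rewrite ?mule1 ?mule0//.
  rewrite inE => /FD xD; by rewrite notin_setE in nD.
have : \forall n \near \oo, (\int[nu]_(x in D) f n x < e%:E)%E.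
  move/fine_cvgP: cv => [fn cv'].
  have H : \forall n \near \oo, fine (\int[nu]_(x in D) f n x)%E < e by apply: (cvgr_lt _ cv').
  near=> n.
  have h1 : fine (\int[nu]_(x in D) f n x)%E < e by near: n.
  have h2 : (\int[nu]_(x in D) f n x)%E \is a fin_num by near: n.
  by rewrite -(fineK h2) lte_fin.
move=> [N _ /(_ N (leqnn N))/= h]; exists N; rewrite -fE; exact: ltW.
Unshelve. all: by end_near. Qed.

End Integral.

Lemma integral_shift (R : realType) (f : R -> \bar R) (a b : R) :
  measurable_fun setT f -> (forall x, (0 <= f x)%E) ->
  (\int[@lebesgue_measure R]_(t in `[0%R, (b - a)%R]) f (a + t)%R =
   \int[@lebesgue_measure R]_(t in `[a, b]) f t)%E.
Proof.
move=> mf f0.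
pose s : measurableTypeR R -> measurableTypeR R := fun t => a + t.
have ms : measurable_fun setT s by apply: measurable_funD.
have E (A : set R) : measurable A -> pushforward (@lebesgue_measure R) s A = lebesgue_measure A.
  move=> mA; apply/esym; apply: (@lebesgue_measure_unique R (pushforward lebesgue_measure s)) mA.
  move=> _ [[x y] _ <-]; rewrite /= /pushforward.
  rewrite (_ : _ @^-1` _ = `]x - a, y - a]%classic); last first.
    by apply/seteqP; split => t /=; rewrite !in_itv/= ltrBlDl lerBrDl.
  rewrite !lebesgue_measure_itv/= !lte_fin ltrD2r; case: ifPn => // _.
  by rewrite -!EFinB; congr EFin; ring.
have pre : s @^-1` `[a, b]%classic = `[0, b - a]%classic.
  by apply/seteqP; split => t /=; rewrite !in_itv/= lerDl lerBrDl.
have mab : measurable (`[a, b]%classic : set R) by [].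
have := @ge0_integral_pushforward _ _ (measurableTypeR R) (measurableTypeR R) R s ms lebesgue_measure _ f mab (measurable_funTS mf) (fun x _ => f0 x).
rewrite pre => <-; apply: eq_measure_integral => A mA _; exact: E.
Qed.

Section Arcs.
Variables (R : realType) (d : measure_display) (X : measurableType d) (dist : X -> X -> R).
Hypothesis metric : is_metric dist.
Hypothesis borel : borel_for dist.
Local Notation leb := (@lebesgue_measure R).

Definition clamp (l t : R) : R := Num.max 0 (Num.min t l).

Lemma clamp_id l t : 0 <= t -> t <= l -> clamp l t = t.
Proof. by move=> t0 tl; rewrite /clamp (min_idPl tl); apply/max_idPr. Qed.

Lemma clamp_ge0 l t : 0 <= clamp l t. Proof. by rewrite le_max lexx. Qed.

Lemma clamp_le l t : 0 <= l -> clamp l t <= l.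
Proof. by move=> l0; rewrite ge_max l0 ge_min lexx orbT. Qed.

Lemma clamp_mono l s t : s <= t -> clamp l s <= clamp l t.
Proof. move=> st; rewrite /clamp ge_max le_max lexx /= le_max; apply/orP; right.
by rewrite le_min !ge_min lexx st orbT. Qed.

Lemma clamp_lip l s t : s <= t -> clamp l t - clamp l s <= t - s.
Proof. move=> st; rewrite lerBlDr; have s0 := clamp_ge0 l s.
rewrite {1}/clamp ge_max; apply/andP; split; first by lra.
have h : Num.min s l <= clamp l s by rewrite le_max lexx orbT.
have [sl|/ltW ls] := leP s l.
  rewrite (min_idPl sl) in h; rewrite ge_min; apply/orP; left; lra.
rewrite (min_idPr ls) in h; rewrite ge_min; apply/orP; right; lra. Qed.

Definition curve_lip (c : R -> X) := forall s t, s <= t -> dist (c s) (c t) <= t - s.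

(** The curve continued constantly beyond its ends. For an arc-length curve this is 1-Lipschitz,
    hence measurable, on the whole line. *)
Definition ext (c : curve R X) (t : R) : X := cmap c (clamp (clen c) t).

Lemma extE c t : 0 <= t -> t <= clen c -> ext c t = cmap c t.
Proof. by move=> t0 tl; rewrite /ext clamp_id. Qed.

Lemma arc_lip c : arc_curve dist c -> forall s t, 0 <= s -> s <= t -> t <= clen c ->
  dist (cmap c s) (cmap c t) <= t - s.
Proof.
move=> [_ h] s t s0 st tl; rewrite -lee_fin -(h s t s0 st tl).
apply: ereal_sup_ubound; exists 1%N, (fun i => if i is 0%N then s else t); split => //.
  by case.
by rewrite big_ord1.
Qed.

Lemma ext_lip c : arc_curve dist c -> curve_lip (ext c).
Proof.
move=> ac s t st; apply: le_trans (clamp_lip (clen c) st).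
have [l0 _] := ac; apply: arc_lip => //; [exact: clamp_ge0|exact: clamp_mono|exact/clamp_le/ltW].
Qed.

Lemma curve_lip_norm c s t : curve_lip c -> dist (c s) (c t) <= `|s - t|.
Proof.
move=> cl; have [st|/ltW ts] := leP s t; first by rewrite distrC ger0_norm ?subr_ge0// cl.
by rewrite (distC metric) ger0_norm ?subr_ge0// cl.
Qed.

Lemma curve_lip_measurable (c : R -> X) : curve_lip c -> measurable_fun setT c.
Proof.
move=> cl mT; apply: (measurability [set U | dopen dist U]) => //.
  by apply/seteqP; split => A; rewrite borel.
move=> _ [U oU <-]; rewrite setTI; apply: open_measurable; rewrite openE => t /= /oU[r r0 rU].
exists r => //= s /=; rewrite /ball_/= => ts; apply: rU; apply: le_lt_trans ts.
exact: curve_lip_norm.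
Qed.

Lemma line_int_ext (rho : X -> \bar R) c :
  line_int rho c = (\int[leb]_(t in `[0%R, clen c]) rho (ext c t))%E.
Proof.
by apply: eq_integral => t; rewrite inE/= in_itv/= => /andP[t0 tl]; rewrite extE.
Qed.

Lemma ext_measurable (rho : X -> \bar R) c : arc_curve dist c -> measurable_fun setT rho ->
  measurable_fun setT (fun t => rho (ext c t)).
Proof.
move=> ac mr; apply: (measurableT_comp mr); by apply: curve_lip_measurable; apply: ext_lip.
Qed.

Definition sub (c : curve R X) (a b : R) := Curve (b - a) (fun t => cmap c (a + t)).

Lemma curve_len_shift (g : R -> X) a s t :
  curve_len dist (fun t => g (a + t)) s t = curve_len dist g (a + s) (a + t).
Proof.
congr ereal_sup; apply/seteqP; split => _ [n [ts [ts0 tsn mono ->]]].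
  exists n, (fun i => a + ts i); rewrite ts0 tsn; split => // i /mono; by rewrite lerD2l.
exists n, (fun i => ts i - a); rewrite ts0 tsn; split; rewrite ?addrK//.
- by rewrite addrC addKr.
- by rewrite addrC addKr.
- by move=> i /mono; rewrite lerD2r.
by congr EFin; apply: eq_bigr => i _; rewrite !(addrC a) !subrK.
Qed.

Lemma sub_arc c a b : arc_curve dist c -> 0 <= a -> a < b -> b <= clen c -> arc_curve dist (sub c a b).
Proof.
have local_context : True by [].
move=> [l0 h] a0 ab bl; split; first by rewrite /= subr_gt0.
move=> s t s0 st; rewrite /= => tb; rewrite curve_len_shift h; [congr EFin; ring|slra|slra|slra].
Qed.

Lemma line_int_sub (rho : X -> \bar R) c a b : arc_curve dist c -> borel_nonneg rho ->
  0 <= a -> a <= b -> b <= clen c ->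
  line_int rho (sub c a b) = (\int[leb]_(t in `[a, b]) rho (ext c t))%E.
Proof.
move=> ac [mr r0] a0 ab bl; rewrite -(@integral_shift R (fun t => rho (ext c t)))//; last exact: ext_measurable.
apply: eq_integral => t; rewrite inE/= in_itv/= => /andP[t0 tl].
by rewrite extE//; lra.
Qed.

Lemma ug_sub H u g c a b : is_ug dist H u g -> arc_curve dist c -> curve_in H c ->
  0 <= a -> a <= b -> b <= clen c ->
  (`|u (ext c a) - u (ext c b)|%:E <= \int[leb]_(t in `[a, b]) g (ext c t))%E.
Proof.
have local_context : True by [].
move=> [[mg g0] ug] ac cH a0; rewrite le_eqVlt => /orP[/eqP <- al|ab bl].
  by rewrite subrr normr0 integral_ge0.
have cin : curve_in H (sub c a b) by move=> t t0; rewrite /= => tb; apply: cH; slra.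
have := ug _ (sub_arc ac a0 ab bl) cin; rewrite /ug_ineq line_int_sub ?(ltW ab)//.
by rewrite /sub/= addr0 (addrC a) subrK !extE//; slra.
Qed.

End Arcs.

Section RealCurve.
Variable R : realType.
Local Notation leb := (@lebesgue_measure R).
Variables (U : R -> R) (G : R -> \bar R) (l : R).
Hypothesis l0 : 0 <= l.
Hypothesis mG : measurable_fun setT G.
Hypothesis G0 : forall t, (0 <= G t)%E.
Hypothesis Gfin : (\int[leb]_(t in `[0%R, l]) G t < +oo)%E.
Hypothesis UG : forall a b, 0 <= a -> a <= b -> b <= l ->
  (`|U a - U b|%:E <= \int[leb]_(t in `[a, b]) G t)%E.

(** The upper gradient inequality on short subarcs bounds the oscillation near [s] by an integral
    over a shrinking interval, which tends to 0. *)
Lemma ug_continuous s : 0 <= s -> s <= l -> forall e, 0 < e -> exists2 del, 0 < del &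
  forall t, 0 <= t -> t <= l -> `|t - s| < del -> `|U t - U s| <= e.
Proof.
have local_context : True by [].
move=> s0 sl e e0.
pose F n := (`[s - n.+1%:R^-1, s + n.+1%:R^-1]%classic `&` `[0, l]%classic : set R).
have [|n|n|||n hn] := @int_cvg0 R _ (measurableTypeR R) leb `[0, l]%classic F G _ _ _ _ _ mG G0 Gfin e e0.
- by [].
- by apply: measurableI.
- by move=> x [].
- move=> i j ij x [] /=; rewrite !in_itv/= => /andP[h1 h2] h3; split => //=.
  rewrite !in_itv/=; have : j.+1%:R^-1 <= i.+1%:R^-1 :> R by rewrite lef_pV2 ?posrE// ler_nat ltnS.
  move: h1 h2; move: (j.+1%:R^-1) (i.+1%:R^-1) => a b *; apply/andP; split; slra.
- rewrite (_ : \bigcap_n _ = [set s]); first exact: lebesgue_measure_set1.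
  apply/seteqP; split => [x hx|_ -> n _] /=; last first.
    by rewrite /F/= !in_itv/= s0 sl lerBlDr lerDl invr_ge0 ler0n.
  apply/eqP; rewrite -subr_eq0 -normr_le0 leNgt; apply/negP => /invS_small[n].
  have [+ _] := hx n I; rewrite /= in_itv/= ltNge => h /negP; apply.
  by move: h; move: (n.+1%:R^-1) => a /andP[h1 h2]; rewrite ler_norml; apply/andP; split; slra.
exists n.+1%:R^-1; first by rewrite invr_gt0.
move=> t t0 tl; rewrite ltr_norml => /andP[h1 h2].
rewrite -lee_fin; apply: le_trans hn.
have mF : measurable (F n) by apply: measurableI.
have [ts|/ltW st] := leP t s.
  apply: le_trans (UG t0 ts sl) _; apply: ge0_subset_integral => //; first exact: measurable_funTS.
  move=> x /=; rewrite /F/= !in_itv/= => /andP[tx xs].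
  move: h1 h2; move: (n.+1%:R^-1) => a *; split; apply/andP; split; slra.
rewrite distrC; apply: le_trans (UG s0 st tl) _; apply: ge0_subset_integral => //; first exact: measurable_funTS.
move=> x /=; rewrite /F/= !in_itv/= => /andP[tx xs].
move: h1 h2; move: (n.+1%:R^-1) => a *; split; apply/andP; split; slra.
Qed.

(** [b] is the first time after [p] at which the value [be] is reached, and [a] the last time before
    [b] with value at most [al]; in between the function stays in the open band. *)
Let crossing (V : R -> R) p q al be :
  (forall s, 0 <= s -> s <= l -> forall e, 0 < e -> exists2 del, 0 < del &
    forall t, 0 <= t -> t <= l -> `|t - s| < del -> `|V t - V s| <= e) ->
  0 <= p -> p <= q -> q <= l -> V p <= al -> be <= V q -> al < be ->
  exists a b, [/\ 0 <= a, a <= b, b <= l, be - al <= `|V a - V b| &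
    forall s, a < s -> s < b -> al < V s < be].
Proof.
move=> cV p0 pq ql Vp Vq ab.
pose S := [set s | p <= s <= q /\ be <= V s].
have iS : has_inf S by split; [exists q; rewrite /S/= pq lexx|exists p => s [/andP[]]].
pose b := inf S.
have pb : p <= b by apply: lb_le_inf; [exact: iS.1|move=> s [/andP[]]].
have bq : b <= q by apply: ge_inf; [exact: iS.2|rewrite /S/= pq lexx].
have b0 : 0 <= b by lra.
have bl : b <= l by lra.
have Vb : be <= V b.
  rewrite leNgt; apply/negP => hb.
  have [del del0 hdel] := cV b b0 bl ((be - V b) / 2) ltac:(lra).
  have [s [/andP[ps sq] bs] sb] := inf_adherent del0 iS.
  have bs' : b <= s by apply: ge_inf; [exact: iS.2|split => //; rewrite ps].
  have := hdel s ltac:(lra) ltac:(lra) ltac:(by rewrite ger0_norm; rewrite -/b in sb; lra).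
  by rewrite ler_norml => /andP[]; lra.
have below s : p <= s -> s < b -> V s < be.
  move=> ps sb; rewrite ltNge; apply/negP => h; have : b <= s by apply: ge_inf; [exact: iS.2|split => //; rewrite ps/=; lra].
  lra.
pose T := [set s | p <= s <= b /\ V s <= al].
have sT : has_sup T by split; [exists p; rewrite /T/= lexx|exists b => s [/andP[]]].
pose a := sup T.
have pa : p <= a by apply: sup_ubound; [exact: sT.2|rewrite /T/= lexx].
have ab' : a <= b by apply: ge_sup; [exact: sT.1|move=> s [/andP[]]].
have Va : V a <= al.
  rewrite leNgt; apply/negP => ha.
  have [del del0 hdel] := cV a ltac:(lra) ltac:(lra) ((V a - al) / 2) ltac:(lra).
  have [s [/andP[ps sb] bs] sa] := sup_adherent del0 sT.
  have as' : s <= a by apply: sup_ubound; [exact: sT.2|split => //; rewrite ps].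
  have := hdel s ltac:(lra) ltac:(lra) ltac:(by rewrite ler0_norm; rewrite -/a in sa; lra).
  by rewrite ler_norml => /andP[]; lra.
exists a, b; split => //; [lra| |].
  by rewrite distrC; apply: le_trans (ler_norm _); lra.
move=> s sa sb; rewrite below ?andbT//; last lra.
rewrite ltNge; apply/negP => h.
have : s <= a by apply: sup_ubound; [exact: sT.2|split => //; apply/andP; split; lra].
lra.
Qed.

Lemma crossing_int (S : set R) al be : measurable S -> al < be ->
  (exists p q, [/\ 0 <= p, p <= l, 0 <= q & q <= l /\ (U p <= al /\ be <= U q)]) ->
  (forall s, 0 <= s -> s <= l -> al < U s -> U s < be -> S s) ->
  ((be - al)%:E <= \int[leb]_(t in `[0%R, l]) (G t * (\1_S t)%:E))%E.
Proof.
have local_context : True by [].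
move=> mS ab [p [q [p0 pl q0 [ql [Up Uq]]]]] hS.
have [a [b [a0 ab' bl osc mid]]] : exists a b, [/\ 0 <= a, a <= b, b <= l, be - al <= `|U a - U b| &
    forall s, a < s -> s < b -> al < U s < be].
  have [pq|/ltW qp] := leP p q; first exact: (crossing ug_continuous p0 pq ql Up Uq ab).
  have [||||a [b [a0 ab' bl osc mid]]] := @crossing (fun s => - U s) q p (- be) (- al) _ q0 qp pl.
  - move=> s s0 sl e e0; have [del del0 h] := ug_continuous s0 sl e0; exists del => // t t0 tl ts.
    by rewrite -opprD normrN; exact: h.
  - by rewrite lerN2.
  - by rewrite lerN2.
  - by rewrite ltrN2.
  exists a, b; split => //; first by rewrite -normrN opprD; slra.
  by move=> s sa sb; have := mid s sa sb; rewrite !ltrN2 andbC.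
have mGS : measurable_fun setT (fun t => (G t * (\1_S t)%:E)%E).
  by apply: emeasurable_funM => //; apply/measurable_EFinP; exact: measurable_indic.
have GS0 t : (0 <= G t * (\1_S t)%:E)%E by rewrite mule_ge0// lee_fin.
apply: le_trans (_ : (\int[leb]_(t in `[a, b]) G t <= _)%E).
  by apply: le_trans (UG a0 ab' bl); rewrite lee_fin.
apply: le_trans (_ : (\int[leb]_(t in `[a, b]) (G t * (\1_S t)%:E) <= _)%E); last first.
  apply: ge0_subset_integral => //; first exact: measurable_funTS.
  by move=> x /=; rewrite !in_itv/= => /andP[? ?]; apply/andP; split; slra.
rewrite le_eqVlt; apply/orP; left; apply/eqP; apply: ge0_ae_eq_integral => //.
- exact: measurable_funTS.
- exact: measurable_funTS.
exists [set a; b]; split; first by apply: measurableU.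
  apply/eqP; rewrite -measure_le0; apply: le_trans (measureU2 _ _ _) _ => //.
  by rewrite [X in (X + _ <= _)%E](lebesgue_measure_set1 a) [X in (_ + X <= _)%E](lebesgue_measure_set1 b) adde0.
move=> x /= nx; apply: contrapT => nab; apply: nx; rewrite in_itv/= => /andP[ax xb].
have ax' : a < x by rewrite lt_neqAle ax andbT; apply/eqP => h; apply: nab; left.
have xb' : x < b by rewrite lt_neqAle xb andbT; apply/eqP => h; apply: nab; right.
have /andP[h1 h2] := mid x ax' xb'.
rewrite indicE mem_set ?mule1//; apply: hS => //; slra.
Qed.

End RealCurve.

(** * Upper gradients *)

Section BorelNonneg.
Variables (R : realType) (d : measure_display) (T : measurableType d).
Implicit Types f g : T -> \bar R.
Local Open Scope ereal_scope.

Lemma bn_cst (k : \bar R) : 0 <= k -> borel_nonneg (fun _ : T => k).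
Proof. by move=> k0; split. Qed.

Lemma bn_add f g : borel_nonneg f -> borel_nonneg g -> borel_nonneg (fun x => f x + g x).
Proof. by move=> [mf f0] [mg g0]; split=> [|x]; [exact: emeasurable_funD|exact: adde_ge0]. Qed.

Lemma bn_mul f g : borel_nonneg f -> borel_nonneg g -> borel_nonneg (fun x => f x * g x).
Proof. by move=> [mf f0] [mg g0]; split=> [|x]; [exact: emeasurable_funM|exact: mule_ge0]. Qed.

Lemma bn_scale (k : \bar R) f : 0 <= k -> borel_nonneg f -> borel_nonneg (fun x => k * f x).
Proof. by move=> k0; apply: bn_mul; exact: bn_cst. Qed.

Lemma bn_indic (S : set T) : measurable S -> borel_nonneg (fun x => (\1_S x)%:E : \bar R).
Proof.
by move=> mS; split=> [|x]; [apply/measurable_EFinP; exact: measurable_indic|rewrite lee_fin].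
Qed.

Lemma bn_max f g : borel_nonneg f -> borel_nonneg g -> borel_nonneg (fun x => maxe (f x) (g x)).
Proof. by move=> [mf f0] [mg g0]; split=> [|x]; [exact: measurable_maxe|rewrite le_max f0]. Qed.

Lemma bn_pow f p : borel_nonneg f -> borel_nonneg (fun x => f x `^ p).
Proof.
move=> [mf f0]; split=> [|x]; last exact: poweR_ge0.
exact: measurableT_comp (measurable_poweR p) mf.
Qed.

Lemma bn_series (f : nat -> T -> \bar R) : (forall n, borel_nonneg (f n)) ->
  borel_nonneg (fun x => \sum_(0 <= n <oo) f n x).
Proof.
move=> h; split=> [|x]; last by apply: nneseries_ge0 => n _ _; exact: (h n).2.
by apply: ge0_emeasurable_sum => [k x _ _|k _]; [exact: (h k).2|exact: (h k).1].
Qed.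

Variable nu : {measure set T -> \bar R}.

Lemma int_mono (D : set T) f g : measurable D -> borel_nonneg f -> borel_nonneg g ->
  (forall x, D x -> f x <= g x) -> \int[nu]_(x in D) f x <= \int[nu]_(x in D) g x.
Proof. by move=> mD [mf f0] [mg g0] h; apply: ge0_le_integral => //; exact: measurable_funTS. Qed.

Lemma int_sub (A B : set T) f : measurable A -> measurable B -> borel_nonneg f -> A `<=` B ->
  \int[nu]_(x in A) f x <= \int[nu]_(x in B) f x.
Proof. by move=> mA mB_ [mf f0] AB; apply: ge0_subset_integral => //; exact: measurable_funTS. Qed.

Lemma int_add (D : set T) f g : measurable D -> borel_nonneg f -> borel_nonneg g ->
  \int[nu]_(x in D) (f x + g x) = \int[nu]_(x in D) f x + \int[nu]_(x in D) g x.
Proof. by move=> mD [mf f0] [mg g0]; rewrite ge0_integralD//; exact: measurable_funTS. Qed.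

Lemma int_scale (D : set T) (k : \bar R) f : measurable D -> 0 <= k -> borel_nonneg f ->
  \int[nu]_(x in D) (k * f x) = k * \int[nu]_(x in D) f x.
Proof. by move=> mD k0 [mf f0]; rewrite ge0_integralZl//; exact: measurable_funTS. Qed.

Lemma int_series (D : set T) (f : nat -> T -> \bar R) : measurable D -> (forall n, borel_nonneg (f n)) ->
  \int[nu]_(x in D) (\sum_(0 <= n <oo) f n x) = \sum_(0 <= n <oo) \int[nu]_(x in D) f n x.
Proof.
move=> mD h; apply: integral_nneseries => // [n|n x _]; last exact: (h n).2.
apply: measurable_funTS; exact: (h n).1.
Qed.

Lemma int_ge0 (D : set T) f : borel_nonneg f -> 0 <= \int[nu]_(x in D) f x.
Proof. by move=> [_ f0]; exact: integral_ge0. Qed.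

Lemma int_indicE (D S : set T) f : measurable D -> measurable S -> borel_nonneg f ->
  \int[nu]_(x in D) (f x * (\1_S x)%:E) = \int[nu]_(x in D `&` S) f x.
Proof.
move=> mD mS bf; rewrite [LHS]integral_mkcond [RHS]integral_mkcond; apply: eq_integral => x _.
rewrite !patchE in_setI indicE; case: (x \in D) => //=.
by case: (x \in S); rewrite ?mule1 ?mule0.
Qed.

Lemma int_null (D : set T) f : measurable D -> nu D = 0 -> borel_nonneg f ->
  \int[nu]_(x in D) f x = 0.
Proof.
move=> mD D0 bf; rewrite (@ge0_ae_eq_integral _ _ _ _ _ f (fun=> 0))//; first exact: integral0.
- apply: measurable_funTS; exact: bf.1.
- by move=> x _; exact: bf.2.
- by exists D; split => // x /= h; apply: contrapT => nD; apply: h.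
Qed.

Lemma int_oo_null (D Z : set T) : measurable D -> measurable Z -> nu Z = 0 ->
  \int[nu]_(x in D) (+oo * (\1_Z x)%:E) = 0.
Proof.
move=> mD mZ Z0; rewrite (@int_indicE D Z (fun=> +oo) mD mZ (bn_cst (leey 0))).
apply: int_null; [exact: measurableI| |exact: (bn_cst (leey 0))].
apply/eqP; rewrite -measure_le0 -Z0; apply: le_measure; rewrite ?inE//; first exact: measurableI.
Qed.

Lemma chebyshev_set (D S : set T) f (a : R) : measurable D -> measurable S -> borel_nonneg f -> (0 <= a)%R ->
  (forall x, D x -> S x -> a%:E <= f x) -> a%:E * nu (D `&` S) <= \int[nu]_(x in D) f x.
Proof.
move=> mD mS bf a0 h; have mDS : measurable (D `&` S) by exact: measurableI.
rewrite -integral_cst//; apply: le_trans (int_sub mDS mD bf _); last by move=> x [].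
have ba : borel_nonneg (fun _ : T => a%:E) by exact: bn_cst.
by apply: (int_mono mDS ba bf) => x []; exact: h.
Qed.

End BorelNonneg.

Section LpSum.
Variables (R : realType) (d : measure_display) (T : measurableType d) (nu : {measure set T -> \bar R}).
Variable (p : R).
Hypothesis p1 : 1 <= p.
Local Open Scope ereal_scope.

(** The pointwise [p]-norm of a sequence of functions. It dominates every term, and its [p]-th power
    integrates term by term, so series of small functions are summed without the triangle inequality
    in [L^p]. *)
Definition lpsum (f : nat -> T -> \bar R) (x : T) := (\sum_(0 <= n <oo) f n x `^ p) `^ (p^-1)%R.

Lemma bn_lpsum f : (forall n, borel_nonneg (f n)) -> borel_nonneg (lpsum f).
Proof. by move=> h; apply: bn_pow; apply: bn_series => n; apply: bn_pow. Qed.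

Let p0 : (p != 0)%R. Proof. by rewrite gt_eqF// (lt_le_trans _ p1). Qed.

Lemma poweRK (a : \bar R) : 0 <= a -> (a `^ (p^-1)%R) `^ p = a.
Proof. by move=> a0; rewrite -poweRrM mulVf ?p0// poweRe1. Qed.

Lemma poweRVK (a : \bar R) : 0 <= a -> (a `^ p) `^ (p^-1)%R = a.
Proof. by move=> a0; rewrite -poweRrM mulfV ?p0// poweRe1. Qed.

Lemma le_poweR (q : R) (a b : \bar R) : (0 <= q)%R -> 0 <= a -> a <= b -> a `^ q <= b `^ q.
Proof.
move=> q0 a0 ab; apply: gt0_ler_poweR => //; rewrite in_itv/= leey andbT//.
exact: le_trans ab.
Qed.

Lemma le_lpsum f n x : (forall n, borel_nonneg (f n)) -> f n x <= lpsum f x.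
Proof.
move=> h; rewrite -[f n x]poweRVK; last exact: (h n).2.
apply: le_poweR; [by rewrite invr_ge0 (le_trans _ p1)|exact: poweR_ge0|].
apply: le_trans (nneseries_lim_ge n.+1 _); last by move=> *; exact: poweR_ge0.
rewrite big_nat_recr//= leeDr// sume_ge0// => *; exact: poweR_ge0.
Qed.

Lemma int_lpsum (D : set T) f : measurable D -> (forall n, borel_nonneg (f n)) ->
  \int[nu]_(x in D) lpsum f x `^ p = \sum_(0 <= n <oo) \int[nu]_(x in D) f n x `^ p.
Proof.
move=> mD h; rewrite -int_series//; last by move=> n; exact: bn_pow.
apply: eq_integral => x _; rewrite poweRK//; apply: nneseries_ge0 => *; exact: poweR_ge0.
Qed.

End LpSum.

Section UpperGradients.
Variables (R : realType) (d : measure_display) (X : measurableType d) (dist : X -> X -> R).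
Hypothesis metric : is_metric dist.
Hypothesis borel : borel_for dist.
Variable mu : {measure set X -> \bar R}.
Local Notation leb := (@lebesgue_measure R).

Lemma bn_ext (g : X -> \bar R) c : arc_curve dist c -> borel_nonneg g ->
  borel_nonneg (fun t : measurableTypeR R => g (ext c t)).
Proof. by move=> ac [mg g0]; split => //; exact: (ext_measurable metric borel ac mg). Qed.

Lemma line_mono (f g : X -> \bar R) c : arc_curve dist c -> borel_nonneg f -> borel_nonneg g ->
  (forall x, (f x <= g x)%E) -> (line_int f c <= line_int g c)%E.
Proof.
move=> ac bf bg h; rewrite !line_int_ext; apply: (@int_mono _ _ (measurableTypeR R)) => //.
- exact: (bn_ext ac bf).
- exact: (bn_ext ac bg).
Qed.

Lemma line_add (f g : X -> \bar R) c : arc_curve dist c -> borel_nonneg f -> borel_nonneg g ->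
  line_int (fun x => f x + g x)%E c = (line_int f c + line_int g c)%E.
Proof.
move=> ac bf bg; rewrite !line_int_ext; apply: (@int_add _ _ (measurableTypeR R)) => //.
- exact: (bn_ext ac bf).
- exact: (bn_ext ac bg).
Qed.

Lemma line_scale (k : \bar R) (f : X -> \bar R) c : arc_curve dist c -> borel_nonneg f -> (0 <= k)%E ->
  line_int (fun x => k * f x)%E c = (k * line_int f c)%E.
Proof.
move=> ac bf k0; rewrite !line_int_ext; apply: (@int_scale _ _ (measurableTypeR R)) => //.
exact: (bn_ext ac bf).
Qed.

Lemma line_ge0 (f : X -> \bar R) c : borel_nonneg f -> (0 <= line_int f c)%E.
Proof. by move=> [_ f0]; exact: integral_ge0. Qed.

Lemma line_cst (k : R) c : arc_curve dist c -> line_int (fun _ : X => k%:E) c = (k * clen c)%:E.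
Proof.
move=> [l0 _]; rewrite /line_int integral_cst// EFinM; congr (_ * _)%E.
have := @lebesgue_measure_itv R `[0, clen c]; rewrite /= lte_fin l0 sube0; exact.
Qed.

Lemma ug_mono H u (f g : X -> \bar R) : is_ug dist H u f -> borel_nonneg g ->
  (forall x, (f x <= g x)%E) -> is_ug dist H u g.
Proof.
move=> [bf ug] bg h; split => // c ac cH; apply: le_trans (ug c ac cH) _; exact: line_mono.
Qed.

Lemma ug_subset (H H' : set X) u g : H `<=` H' -> is_ug dist H' u g -> is_ug dist H u g.
Proof. by move=> HH [bg ug]; split => // c ac cH; apply: ug => // t t0 tl; apply/HH/cH. Qed.

Lemma lip_ug (H : set X) u L : 0 <= L -> lip dist u L -> is_ug dist H u (fun=> L%:E).
Proof.
move=> L0 uL; split; first exact: bn_cst.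
move=> c ac _; rewrite /ug_ineq line_cst// lee_fin; apply: le_trans (uL _ _) _.
rewrite ler_wpM2l//; have [l0 _] := ac; have := arc_lip ac (lexx 0) (ltW l0) (lexx _).
by rewrite subr0.
Qed.

Definition band (v : X -> R) t h := [set x | t < v x < t + h].

Lemma band_measurable v t h : measurable_fun setT v -> measurable (band v t h).
Proof.
move=> mv; rewrite (_ : band v t h = v @^-1` `]t, t + h[); last first.
  by apply/seteqP; split => x /=; rewrite in_itv.
by rewrite -[X in measurable X]setTI; exact: mv.
Qed.

(** The band is that of the Borel version [v], so that the function is Borel; the infinite value on
    the null set [Z] takes care of the points where [u] and [v] differ. *)
Definition trunc_grad (g : X -> \bar R) v (Z : set X) t h del x : \bar R :=
  ((h^-1)%:E * (g x * (\1_(band v t h) x)%:E) + +oo * (\1_Z x)%:E + del%:E * g x)%E.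

Lemma bn_trunc g v Z t h del : borel_nonneg g -> measurable_fun setT v -> measurable Z ->
  0 < h -> 0 <= del -> borel_nonneg (trunc_grad g v Z t h del).
Proof.
move=> bg mv mZ h0 del0; have mb := band_measurable t h mv.
apply: bn_add; [apply: bn_add|apply: bn_scale => //].
  apply: bn_scale; first by rewrite lee_fin invr_ge0 ltW.
  apply: bn_mul => //; exact: bn_indic.
apply: bn_scale; [by rewrite leey|exact: bn_indic].
Qed.

Lemma clamp_between (s A B : R) : clamp 1 s = A -> (0 < A -> A <= s) /\ (A < 1 -> s <= A).
Proof.
move=> <-; rewrite /clamp; split.
  by rewrite lt_max ltxx/= => h; rewrite (max_idPr (ltW h)) ge_min lexx.
by rewrite gt_max ltr01/= gt_min ltxx orbF => h; rewrite (min_idPl (ltW h)) le_max lexx orbT.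
Qed.

(* The term [del * g] is there because [u] may jump across the band at points near which [g] is
   not integrable along the curve. *)
Lemma trunc_ug H u v Z g t h del : is_ug dist H u g -> measurable_fun setT v -> measurable Z ->
  (forall x, H x -> u x <> v x -> Z x) -> 0 < h -> 0 <= del ->
  (forall c, arc_curve dist c -> curve_in H c -> (line_int g c < +oo)%E \/ 0 < del) ->
  is_ug dist H (fun x => clamp 1 ((u x - t) / h)) (trunc_grad g v Z t h del).
Proof.
have local_context : True by [].
move=> ugu mv mZ uv h0 del0 hdel; have [bg _] := ugu.
have bt : borel_nonneg (trunc_grad g v Z t h del) by exact: bn_trunc.
split => // c ac cH; rewrite /ug_ineq.
have [fin|inf] := boolP (line_int g c < +oo)%E; last first.
  have del1 : 0 < del by case: (hdel c ac cH) => // fin; rewrite fin in inf.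
  have goo : line_int g c = +oo%E by move: inf; rewrite ltey negbK => /eqP.
  apply: (@le_trans _ _ +oo%E); first by rewrite leey.
  rewrite -(@gt0_muley _ del%:E) ?lte_fin// -goo -line_scale ?lee_fin//.
  apply: line_mono => //; first by apply: bn_scale.
  move=> x; rewrite leeDr// adde_ge0// mule_ge0// ?lee_fin ?invr_ge0 ?(ltW h0)//.
    by rewrite mule_ge0// ?lee_fin//; exact: bg.2.
have [l0 _] := ac; pose S := [set s : R | (band v t h `|` Z) (ext c s)].
have mbZ : measurable (band v t h `|` Z) by apply: measurableU => //; exact: band_measurable.
have mS : measurable S.
  have := curve_lip_measurable metric borel (ext_lip ac).
  by move=> /(_ measurableT _ mbZ); rewrite setTI.
have bgx := bn_ext ac bg.
have key A B a b : A < B -> 0 <= a -> a <= clen c -> 0 <= b -> b <= clen c ->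
    clamp 1 ((u (ext c a) - t) / h) = A -> clamp 1 ((u (ext c b) - t) / h) = B ->
    ((B - A)%:E <= line_int (trunc_grad g v Z t h del) c)%E.
  move=> AB a0 al b0 bl cA cB; have [A1 A2] := clamp_between 0 cA; have [B1 B2] := clamp_between 0 cB.
  have A0 : 0 <= A by rewrite -cA clamp_ge0.
  have B1' : B <= 1 by rewrite -cB clamp_le.
  have := @crossing_int R (fun s => u (ext c s)) (fun s => g (ext c s)) (clen c) bgx.1 bgx.2 _ _ S (t + h * A) (t + h * B) mS.
  rewrite -line_int_ext fin => /(_ isT) K.
  have {K} := K (fun x y x0 xy yl => ug_sub metric borel ugu ac cH x0 xy yl).
  rewrite ltrD2l ltr_pM2l// => /(_ AB) K.
  have {K} : ((t + h * B - (t + h * A))%:E <= \int[leb]_(t in `[0%R, clen c]) (g (ext c t) * (\1_S t)%:E))%E.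
    apply: K.
      exists a, b; split => //; split => //; split.
        have := A2 (lt_le_trans AB B1'); rewrite ler_pdivrMr//; slra.
      have := B1 (le_lt_trans A0 AB); rewrite ler_pdivlMr//; slra.
    move=> s s0 sl sA sB; have [uveq|uvne] := pselect (u (ext c s) = v (ext c s)); last first.
      by right; apply: uv => //; rewrite extE//; exact: cH.
    left; rewrite /band/= -uveq; have h1 : 0 <= h * A by rewrite mulr_ge0// ltW.
    have h2 : h * B <= h by rewrite ler_piMr// ltW.
    by apply/andP; split; slra.
  move=> K; have hi : (0 <= (h^-1)%:E)%E by rewrite lee_fin invr_ge0 ltW.
  rewrite (_ : (B - A)%:E = (h^-1)%:E * (t + h * B - (t + h * A))%:E)%E; last first.
    by rewrite -EFinM; congr EFin; field; rewrite gt_eqF.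
  apply: le_trans (lee_wpmul2l hi K) _.
  have bS : borel_nonneg (fun s : measurableTypeR R => (g (ext c s) * (\1_S s)%:E)%E).
    by apply: bn_mul => //; exact: bn_indic.
  rewrite -(@int_scale _ _ (measurableTypeR R))// line_int_ext.
  apply: (@int_mono _ _ (measurableTypeR R)) => //.
  - exact: bn_scale.
  - exact: bn_ext.
  move=> s _; rewrite /trunc_grad [leRHS]addeAC.
  have p3 : (0 <= del%:E * g (ext c s))%E by rewrite mule_ge0 ?lee_fin//; exact: bg.2.
  have p1 : (0 <= h^-1%:E * (g (ext c s) * (\1_(band v t h) (ext c s))%:E))%E.
    by rewrite mule_ge0// mule_ge0// ?lee_fin//; exact: bg.2.
  rewrite [\1_S s]indicE; case: (boolP (s \in S)); last by rewrite !mule0 => _; rewrite !adde_ge0// mule_ge0 ?leey ?lee_fin.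
  rewrite inE => -[hb|hZ].
    rewrite indicE mem_set// !mule1 -addeA leeDl// adde_ge0// mule_ge0 ?leey ?lee_fin//.
  have -> : (+oo * (\1_Z (ext c s))%:E = +oo :> \bar R)%E by rewrite indicE mem_set// mule1.
  by rewrite addey ?leey// -ltNye (lt_le_trans _ (adde_ge0 p1 p3)).
have e0 : ext c 0 = cmap c 0 by rewrite extE// ltW.
have el : ext c (clen c) = cmap c (clen c) by rewrite extE// ltW.
set A := clamp 1 ((u (cmap c 0) - t) / h); set B := clamp 1 ((u (cmap c (clen c)) - t) / h).
have [AB|BA|->] := ltgtP A B; last by rewrite subrr normr0 line_ge0.
  rewrite distrC ger0_norm ?subr_ge0 ?(ltW AB)//.
  by apply: (key A B 0 (clen c)); rewrite ?lexx ?e0 ?el ?(ltW l0).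
rewrite ger0_norm ?subr_ge0 ?(ltW BA)//.
by apply: (key B A (clen c) 0); rewrite ?lexx ?e0 ?el ?(ltW l0).
Qed.

Lemma lip_trunc_ug H u L t h : 0 <= L -> lip dist u L -> 0 < h ->
  is_ug dist H (fun x => clamp 1 ((u x - t) / h)) (fun x => (L / h)%:E * (\1_(band u t h) x)%:E)%E.
Proof.
move=> L0 uL h0; have mu_ := lip_measurable metric borel uL.
have [||b ug] := @trunc_ug H u u set0 (fun=> L%:E) t h 0 (lip_ug _ L0 uL) mu_ measurable0 _ h0 (lexx 0).
- by [].
- by move=> c ac _; left; rewrite line_cst// ltry.
have e : trunc_grad (fun=> L%:E) u set0 t h 0 = (fun x => (L / h)%:E * (\1_(band u t h) x)%:E)%E.
  apply/funext => x; rewrite /trunc_grad [\1_set0 _]indicE in_set0 mule0 adde0 mul0e adde0.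
  by rewrite muleA -EFinM (mulrC h^-1).
by rewrite -e.
Qed.

Lemma clamp_ug H u g : is_ug dist H u g -> is_ug dist H (fun x => clamp 1 (u x)) g.
Proof.
move=> [bg ug]; split => // c ac cH; apply: le_trans (ug c ac cH); rewrite lee_fin.
set a := u _; set b := u _.
have [ab|/ltW ba] := leP a b; last first.
  by rewrite !ger0_norm ?subr_ge0// ?clamp_lip// clamp_mono.
by rewrite distrC (distrC a) !ger0_norm ?subr_ge0// ?clamp_lip// clamp_mono.
Qed.

(** If [eta] equals 1 somewhere on the curve, then [1 - eta] at both ends is bounded by the integral
    of [g] alone. Otherwise the curve avoids [A] and the product rule applies. The gradient of [f]
    is thus used only on curves off [A], and the product gets an upper gradient across [A]. *)
Lemma prod_ug (W A : set X) eta f g gf : is_ug dist setT eta g -> is_ug dist (W `\` A) f gf ->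
  (forall x, 0 <= eta x <= 1) -> (forall x, 0 <= f x <= 1) -> (forall x, A x -> W x -> eta x = 1) ->
  is_ug dist W (fun x => f x * (1 - eta x)) (fun x => gf x + g x)%E.
Proof.
have local_context : True by [].
move=> uge ugf e01 f01 eA; have [bg ge] := uge; have [bf gf'] := ugf.
split; first exact: bn_add.
move=> c ac cW; rewrite /ug_ineq line_add//; have [l0 _] := ac.
set a := cmap c 0; set b := cmap c (clen c).
have e0 : ext c 0 = a by rewrite extE// ltW.
have el : ext c (clen c) = b by rewrite extE// ltW.
have [ea0 ea1] := andP (e01 a); have [eb0 eb1] := andP (e01 b).
have [fa0 fa1] := andP (f01 a); have [fb0 fb1] := andP (f01 b).
have [[t [t0 tl et]]|nz] := pselect (exists t, [/\ 0 <= t, t <= clen c & eta (ext c t) = 1]).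
  have bgx := bn_ext ac bg.
  have h1 : ((1 - eta a)%:E <= line_int g c)%E.
    rewrite line_int_ext; apply: le_trans (_ : (\int[leb]_(t in `[0%R, t]) g (ext c t) <= _)%E).
      apply: le_trans (ug_sub metric borel uge ac _ (lexx 0) t0 tl) => //; rewrite lee_fin e0 et distrC; exact: ler_norm.
    apply: (@int_sub _ _ (measurableTypeR R)) => //; by move=> s /=; rewrite !in_itv/= => /andP[? ?]; apply/andP; split; slra.
  have h2 : ((1 - eta b)%:E <= line_int g c)%E.
    rewrite line_int_ext; apply: le_trans (_ : (\int[leb]_(t in `[t, clen c]) g (ext c t) <= _)%E).
      apply: le_trans (ug_sub metric borel uge ac _ t0 tl (lexx _)) => //; rewrite lee_fin el et; exact: ler_norm.
    apply: (@int_sub _ _ (measurableTypeR R)) => //; by move=> s /=; rewrite !in_itv/= => /andP[? ?]; apply/andP; split; slra.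
  apply: le_trans (leeDr _ (line_ge0 c bf)).
  apply: le_trans (_ : (Num.max (1 - eta a) (1 - eta b))%:E <= _)%E; last first.
    by rewrite /Num.max; case: ifP.
  have x1 : f a * (1 - eta a) <= 1 - eta a by rewrite ler_piMl// subr_ge0.
  have x2 : f b * (1 - eta b) <= 1 - eta b by rewrite ler_piMl// subr_ge0.
  have x3 : 0 <= f a * (1 - eta a) by rewrite mulr_ge0// subr_ge0.
  have x4 : 0 <= f b * (1 - eta b) by rewrite mulr_ge0// subr_ge0.
  rewrite lee_fin ler_norml le_max; apply/andP; split; last by apply/orP; left; slra.
  rewrite lerNl le_max; apply/orP; right; slra.
have cA : curve_in (W `\` A) c.
  move=> t t0 tl; split; first exact: cW.
  by move=> At; apply: nz; exists t; split => //; rewrite extE//; apply: eA => //; exact: cW.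
apply: le_trans (leeD (gf' c ac cA) (ge c ac _)) => //.
rewrite /ug_ineq -EFinD lee_fin -/a -/b.
have -> : f a * (1 - eta a) - f b * (1 - eta b) = (f a - f b) * (1 - eta a) + f b * (eta b - eta a) by ring.
apply: le_trans (ler_normD _ _) _; rewrite !normrM (ger0_norm fb0) (distrC (eta b)).
apply: lerD; first by rewrite ler_piMr// ger0_norm ?subr_ge0// gerBl.
by rewrite ler_piMl.
Qed.

Lemma max_ug H u w g k : is_ug dist H u g -> is_ug dist H w k ->
  is_ug dist H (fun x => Num.max (u x) (w x)) (fun x => g x + k x)%E.
Proof.
have local_context : True by [].
move=> [bg ug] [bk wk]; split; first exact: bn_add.
move=> c ac cH; rewrite /ug_ineq line_add//.
apply: le_trans (leeD (ug c ac cH) (wk c ac cH)); rewrite -EFinD lee_fin.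
set a := cmap c 0; set b := cmap c (clen c).
have := ler_norm (u a - u b); have := ler_norm (u b - u a).
have := ler_norm (w a - w b); have := ler_norm (w b - w a).
rewrite !(distrC (u b)) !(distrC (w b)) => *.
have h1 := normr_ge0 (u a - u b); have h2 := normr_ge0 (w a - w b).
rewrite ler_norml; apply/andP; split.
  suff : Num.max (u b) (w b) <= Num.max (u a) (w a) + (`|u a - u b| + `|w a - w b|) by slra.
  rewrite ge_max; have m1 : u a <= Num.max (u a) (w a) by rewrite le_max lexx.
  have m2 : w a <= Num.max (u a) (w a) by rewrite le_max lexx orbT.
  apply/andP; split; slra.
rewrite lerBlDr ge_max; have m1 : u b <= Num.max (u b) (w b) by rewrite le_max lexx.
have m2 : w b <= Num.max (u b) (w b) by rewrite le_max lexx orbT.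
apply/andP; split; slra.
Qed.

(** Admissible functions of rapidly decreasing energy, the [k]-th one multiplied by [k + 1], are
    combined by [lpsum]. The energy stays below [e], while the integral along a curve of [Gam]
    exceeds every [k + 1]. *)
Lemma modulus0_rho p Gam : 1 <= p -> modulus dist mu p Gam = 0%E -> forall e, 0 < e ->
  exists rho, [/\ borel_nonneg rho, (\int[mu]_x rho x `^ p <= e%:E)%E &
    forall c, Gam c -> arc_curve dist c -> line_int rho c = +oo%E].
Proof.
move=> p1 mod0 e e0.
pose a k : R := e / (2 ^ k.+1)%:R / (k.+1%:R `^ p).
have kp k : 0 < (k.+1%:R : R) `^ p by rewrite powR_gt0.
have a0 k : 0 < a k by rewrite !divr_gt0// ltr0n expn_gt0.
have ch k : exists rho : X -> \bar R, [/\ borel_nonneg rho, (\int[mu]_x rho x `^ p <= (a k)%:E)%E &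
    forall c, Gam c -> arc_curve dist c -> (1 <= line_int rho c)%E].
  have : (modulus dist mu p Gam < (a k)%:E)%E by rewrite mod0 lte_fin.
  by move=> /ereal_inf_lt[_ [rho [br hr] <-] /ltW ha]; exists rho.
have [rho hrho] := choice ch.
pose f k x := (k.+1%:R%:E * rho k x)%E.
have bf k : borel_nonneg (f k) by apply: bn_scale; [rewrite lee_fin|case: (hrho k)].
exists (lpsum p f); split; first exact: bn_lpsum.
  rewrite int_lpsum//; apply: nneseries_geo; first exact: ltW.
    by move=> n; apply: int_ge0; exact: bn_pow.
  move=> k; have [br ir _] := hrho k.
  rewrite (eq_integral (fun x => (k.+1%:R `^ p)%:E * rho k x `^ p)%E); last first.
    by move=> x _; rewrite poweRM ?lee_fin ?poweR_EFin//; exact: br.2.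
  rewrite int_scale ?lee_fin ?powR_ge0//; last exact: bn_pow.
  apply: le_trans (lee_wpmul2l _ ir) _; first by rewrite lee_fin ltW.
  by rewrite -EFinM lee_fin /a mulrC divfK// gt_eqF.
move=> c Gc ac; apply/eqyP => M M0.
pose k := Num.truncn M; have [br _ hc] := hrho k.
apply: (@le_trans _ _ (k.+1%:R%:E * line_int (rho k) c)%E).
  rewrite -[M%:E]mule1; apply: lee_pmul => //; rewrite ?lee_fin ?(ltW M0)//; last exact: hc.
  by rewrite ltW// truncnS_gt// ltW.
rewrite -line_scale//; apply: (line_mono ac (bf k) (bn_lpsum p bf)).
by move=> x; exact: (le_lpsum p1 k x bf).
Qed.

(** The maximum of [g] with a function of small energy that has infinite integral along the
    exceptional curves satisfies the inequality on them trivially. *)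
Lemma pwug_ug p H u g : 1 <= p -> is_pwug dist mu p H u g -> forall e, 0 < e ->
  exists g', [/\ is_ug dist H u g', (forall x, (g x <= g' x)%E) &
    forall E, measurable E -> (\int[mu]_(x in E) g' x `^ p <= \int[mu]_(x in E) g x `^ p + e%:E)%E].
Proof.
move=> p1 [bg [Gam [m0 ug]]] e e0; have [rho [br ir hr]] := modulus0_rho p1 m0 e0.
have bm := bn_max bg br.
exists (fun x => maxe (g x) (rho x)); split.
- split => // c ac cH; have [Gc|nG] := pselect (Gam c).
    rewrite /ug_ineq; apply: (@le_trans _ _ +oo%E); first by rewrite leey.
    rewrite -(hr c Gc ac); apply: line_mono => // x; by rewrite le_max lexx orbT.
  apply: le_trans (ug c ac cH nG) _; apply: line_mono => // x; by rewrite le_max lexx.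
- by move=> x; rewrite le_max lexx.
- move=> E mE; have bp := bn_pow p bg; have bq := bn_pow p br.
  apply: (@le_trans _ _ (\int[mu]_(x in E) (g x `^ p + rho x `^ p))%E).
    apply: int_mono => //; [exact: bn_pow|exact: bn_add|].
    move=> x _; rewrite /maxe; case: ifP => _; rewrite ?leeDr ?leeDl ?poweR_ge0//.
  rewrite int_add// leeD2l//; apply: le_trans ir; exact: int_sub.
Qed.

End UpperGradients.

(** * Poincare inequality *)

Section Poincare.
Variables (R : realType) (d : measure_display) (X : measurableType d) (dist : X -> X -> R).
Hypothesis metric : is_metric dist.
Hypothesis borel : borel_for dist.
Variable mu : {measure set X -> \bar R}.
Variables Cd CP lam : R.
Hypothesis dbl : doubling dist mu Cd.
Hypothesis PI : PI11 dist mu CP lam.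
Local Notation leb := (@lebesgue_measure R).
Local Notation mB := (mB dist mu).

Definition klam : nat := projT1 (cid (expr2_large lam^-1)).
(** With [lam2] and [CP2] the Poincare inequality is used in unaveraged form and with constants at
    least 1. The power of [Cd] compares the volumes of [B(x, r)] and [B(x, lam * r)] when [lam] is
    smaller than 1. *)
Definition CP2 : R := Num.max CP 1 * Cd ^+ klam.
Definition lam2 : R := Num.max lam 1.

Lemma lam2_ge1 : 1 <= lam2. Proof. by rewrite le_max lexx orbT. Qed.

Lemma CP2_ge1 (x : X) : 1 <= CP2.
Proof.
have C1 := Cd_ge1 metric borel dbl x; rewrite /CP2 -[leLHS]mulr1 ler_pM//.
  by rewrite le_max lexx orbT.
exact: exprn_ege1.
Qed.

Lemma PI_osc x r u v g : 0 < r -> fversion mu setT u v -> mu.-integrable setT (EFin \o v) ->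
  is_ug dist setT u g -> exists m : R,
  (\int[mu]_(y in dball dist x r) (`|v y - m|)%:E <=
   (CP2 * r)%:E * \int[mu]_(y in dball dist x (lam2 * r)) g y)%E.
Proof.
move=> r0 fuv iv ug; have := PI x r0 fuv iv ug; rewrite /osc_avg.
set m := fine _; move=> h; exists m; move: h.
set I := (\int[mu]_(y in _) _)%E; set J := (\int[mu]_(y in _) _)%E; set J' := (\int[mu]_(y in _) _)%E.
have [bg _] := ug.
have b0 := mB_gt0 metric dbl x r0.
rewrite [mu (dball dist x r)](mBE metric dbl) inver gt_eqF// lee_pdivrMr//; move=> h; apply: le_trans h _.
have J'0 : (0 <= J')%E by exact: int_ge0.
have CPr : 0 <= CP2 * r by rewrite mulr_ge0 ?(ltW r0)//; have := CP2_ge1 x; lra.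
(* For [lam <= 0] the ball on the right is empty, so the right side of the given inequality is 0. *)
have [l0|l0] := leP lam 0.
  rewrite /J dball_neg//; last by rewrite mulr_le0_ge0// ltW.
  by rewrite integral_set0 mul0e mule0 mul0e mule_ge0 ?lee_fin.
have lr : 0 < lam * r by rewrite mulr_gt0.
have bl0 := mB_gt0 metric dbl x lr.
rewrite [mu _](mBE metric dbl) inver gt_eqF//.
have J0 : (0 <= J)%E by exact: int_ge0.
have JJ : (J <= J')%E.
  apply: int_sub => //; [exact: dball_measurable|exact: dball_measurable|].
  by apply: dball_sub => //; rewrite distxx// add0r ler_pM2r// le_max lexx.
rewrite (_ : (CP * r)%:E * (J * _) * _ = (CP * r * (mB x r / mB x (lam * r)))%:E * J)%E; last first.
  by rewrite (muleC J) muleA -EFinM muleAC -EFinM; congr (_%:E * _)%E; ring.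
apply: le_trans (_ : (CP2 * r)%:E * J <= _)%E; last by apply: lee_wpmul2l => //; rewrite lee_fin.
apply: lee_wpmul2r => //; rewrite lee_fin /CP2 mulrAC.
have q : mB x r / mB x (lam * r) <= Cd ^+ klam.
  rewrite ler_pdivrMr//; apply: mB_iter => //; rewrite distxx// add0r mulrA ler_peMl ?(ltW r0)//.
  by rewrite -ler_pdivrMr// div1r; exact: projT2 (cid (expr2_large lam^-1)).
have q0 : 0 <= mB x r / mB x (lam * r) by rewrite divr_ge0// ltW.
apply: (@le_trans _ _ (Num.max CP 1 * (mB x r / mB x (lam * r)) * r)).
  by rewrite ler_pM2r// ler_wpM2r// le_max lexx.
by rewrite ler_pM2r// ler_wpM2l// le_max ler01 orbT.
Qed.

(** This makes a function with an upper gradient on a ball admissible for [PI_osc]. A curve that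
    meets the complement of [B(x, t)] spends positive length outside [B(x, s)], where the gradient
    is infinite, and the Poincare inequality integrates the gradient over the inner ball only. *)
Lemma local_ug x s t u g : 0 < s -> s < t -> is_ug dist (dball dist x t) u g ->
  is_ug dist setT (fun y => u y * \1_(dball dist x t) y)
    (fun y => g y + +oo * (\1_(~` dball dist x s) y)%:E)%E.
Proof.
have local_context : True by [].
move=> s0 st [bg ug]; set W := dball dist x s; set W2 := dball dist x t.
have mW : measurable W by exact: dball_measurable.
have boo : borel_nonneg (fun y => +oo * (\1_(~` W) y)%:E : \bar R)%E.
  by apply: bn_scale; [rewrite leey|apply/bn_indic/measurableC].
split; first exact: bn_add.
move=> c ac _; rewrite /ug_ineq (line_add metric borel)//; have [l0 _] := ac.
have [cW|] := pselect (curve_in W2 c).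
  rewrite !indicE !mem_set ?mulr1; [|exact: (cW _ (ltW l0) (lexx _))|exact: (cW _ (lexx 0) (ltW l0))].
  by apply: le_trans (ug c ac cW) _; rewrite leeDl// line_ge0.
move=> ncW; have [t0 [t00 t0l nW2]] : exists t0, [/\ 0 <= t0, t0 <= clen c & ~ W2 (ext c t0)].
  apply: contrapT => no; apply: ncW => a a0 al; apply: contrapT => nWa.
  by apply: no; exists a; rewrite extE.
suff -> : line_int (fun y => +oo * (\1_(~` W) y)%:E)%E c = +oo%E.
  by rewrite addey ?leey// -ltNye (lt_le_trans _ (line_ge0 c bg)).
apply/eqP; rewrite eq_le leey/= line_int_ext.
pose a := Num.max 0 (t0 - (t - s)); pose b := Num.min (clen c) (t0 + (t - s)).
have ab : a < b.
  rewrite /a /b lt_min !gt_max l0 /=; apply/andP; split; first by slra.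
  apply/andP; split; slra.
have sub : `[a, b]%classic `<=` `[0, clen c]%classic.
  move=> z /=; rewrite !in_itv/= /a /b ge_max le_min => /andP[/andP[-> _] /andP[-> _]]; by [].
apply: le_trans (@int_sub _ _ (measurableTypeR R) leb _ _ _ _ _ (bn_ext metric borel ac boo) sub) => //.
have E : (\int[leb]_(z in `[a, b]) (+oo : \bar R) = +oo)%E.
  have L : leb `[a, b]%classic = (b - a)%:E.
    by have := @lebesgue_measure_itv R `[a, b]; rewrite /= lte_fin ab -EFinB.
  by rewrite integral_cst// [X in (_ * X)%E]L gt0_mulye// lte_fin subr_gt0.
rewrite -[X in (X <= _)%E]E.
apply: (@int_mono _ _ (measurableTypeR R)) => //.
  exact: (bn_ext metric borel ac boo).
move=> z /=; rewrite in_itv/= /a /b ge_max le_min => /andP[/andP[z0 z1] /andP[z2 z3]].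
rewrite indicE mem_set ?mule1// => Wz; apply: nW2; rewrite /W2 /W /dball/= in Wz *.
apply: le_lt_trans (dist_tri metric x (ext c z) (ext c t0)) _.
have := curve_lip_norm metric z t0 (ext_lip ac).
have : `|z - t0| <= t - s by rewrite ler_norml; apply/andP; split; slra.
by slra.
Qed.

(** The constant [m] of [PI_osc] lies on one side of the midpoint of [a] and [b], so on one of the
    two sets [v] differs from it by at least [(b - a) / 2], and Chebyshev bounds the measure of that
    set. *)
Lemma PI_sets x r (u v : X -> R) (g : X -> \bar R) Z a b M : 0 < r -> measurable_fun setT v -> measurable Z -> mu Z = 0%E ->
  (forall y, dball dist x (2 * (lam2 * r)) y -> u y <> v y -> Z y) ->
  (forall y, `|u y| <= M) ->
  is_ug dist (dball dist x (2 * (lam2 * r))) u g -> a < b ->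
  (mine (mu (dball dist x r `&` [set y | (v y <= a)%R])) (mu (dball dist x r `&` [set y | (b <= v y)%R]))
   <= (2 * CP2 * r / (b - a))%:E * \int[mu]_(y in dball dist x (lam2 * r)) g y)%E.
Proof.
have local_context : True by [].
move=> r0 mv mZ Z0 uv uM ug ab.
have l1 := lam2_ge1; have lr : 0 < lam2 * r by rewrite mulr_gt0//; slra.
set W := dball dist x (lam2 * r); set W2 := dball dist x (2 * (lam2 * r)) in uv ug *.
set B := dball dist x r.
have [mW mW2 mBB] : [/\ measurable W, measurable W2 & measurable B] by split; exact: dball_measurable.
have M0 : 0 <= M by apply: le_trans (uM x).
have bg := ug.1.
pose v1 y := v y * \1_(W2 `\` Z) y.
have mv1 : measurable_fun setT v1.
  by apply: measurable_funM => //; apply: measurable_indic; exact: measurableD.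
have v1E y : W2 y -> ~ Z y -> v1 y = v y.
  by move=> Wy nZ; rewrite /v1 indicE mem_set ?mulr1.
have v1_0 y : ~ (W2 y /\ ~ Z y) -> v1 y = 0.
  by move=> h; rewrite /v1 indicE memNset ?mulr0.
have v1M y : `|v1 y| <= M * \1_W2 y.
  have [[Wy nZ]|h] := pselect (W2 y /\ ~ Z y).
    rewrite v1E// indicE mem_set// mulr1; suff <- : u y = v y by [].
    by apply: contrapT => /(uv y Wy).
  by rewrite v1_0// normr0 mulr_ge0.
have fuv : fversion mu setT (fun y => u y * \1_W2 y) v1.
  split => //; exists Z; split => // y [_]; apply: contraPP => nZ.
  have [Wy|nW] := pselect (W2 y); last first.
    by rewrite v1_0; [rewrite indicE memNset// mulr0|case].
  by rewrite v1E// indicE mem_set// mulr1 => h; apply: nZ; exact: (uv y Wy).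
have iv : mu.-integrable setT (EFin \o v1).
  apply: (@le_integrable _ _ _ _ _ measurableT _ (fun y => (M * \1_W2 y)%:E)).
  - exact/measurable_EFinP.
  - move=> y _; rewrite /= lee_fin [leRHS]ger0_norm// mulr_ge0//.
  apply/integrableP; split.
    by apply/measurable_EFinP; apply: measurable_funM => //; exact: measurable_indic.
  under eq_integral do rewrite gee0_abs ?lee_fin ?mulr_ge0// EFinM.
  rewrite int_scale ?lee_fin//; last exact: bn_indic.
  by rewrite integral_indic// setIT (mBE metric dbl) -EFinM ltry.
have lr2 : lam2 * r < 2 * (lam2 * r) by slra.
have [m hm] := PI_osc x r0 fuv iv (local_ug lr lr2 ug).
have {}hm : (\int[mu]_(y in B) (`|v1 y - m|)%:E <= (CP2 * r)%:E * \int[mu]_(y in W) g y)%E.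
  apply: le_trans hm _; rewrite le_eqVlt; apply/orP; left; apply/eqP; congr (_ * _)%E.
  by apply: eq_integral => y; rewrite inE => Wy; rewrite indicE memNset ?mule0 ?adde0//; exact.
have bf : borel_nonneg (fun y => (`|v1 y - m|)%:E : \bar R).
  split => [|y]; last by rewrite lee_fin.
  by apply/measurable_EFinP; apply: measurableT_comp => //; apply: measurable_funB.
have ab2 : 0 < (b - a) / 2 by slra.
have mle c : measurable [set y | v y <= c].
  rewrite (_ : [set _ | _] = v @^-1` `]-oo, c]); last by apply/seteqP; split => y /=; rewrite in_itv.
  by rewrite -[X in measurable X]setTI; exact: mv.
have mge c : measurable [set y | c <= v y].
  rewrite (_ : [set _ | _] = v @^-1` `[c, +oo[); last by apply/seteqP; split => y /=; rewrite in_itv/= andbT.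
  by rewrite -[X in measurable X]setTI; exact: mv.
have BW : B `<=` W2 by apply: dball_sub => //; rewrite distxx// add0r; nra.
have key (S : set X) : measurable S -> (forall y, S y -> (b - a) / 2 <= `|v y - m|) ->
    (mu (B `&` S) <= (2 * CP2 * r / (b - a))%:E * \int[mu]_(y in W) g y)%E.
  move=> mS hS.
  have h1 : (((b - a) / 2)%:E * mu (B `&` (S `\` Z)) <= (CP2 * r)%:E * \int[mu]_(y in W) g y)%E.
    apply: le_trans hm; apply: chebyshev_set => //; [exact: measurableD|exact: ltW|].
    by move=> y By [Sy nZ]; rewrite lee_fin v1E//; [exact: hS|exact: BW].
  apply: le_trans (_ : mu ((B `&` (S `\` Z)) `|` Z) <= _)%E.
    apply: le_measure; rewrite ?inE.
    - exact: measurableI.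
    - by apply: measurableU => //; apply: measurableI => //; exact: measurableD.
    by move=> y [By Sy]; have [Zy|nZ] := pselect (Z y); [right|left].
  apply: le_trans (measureU2 _ _ mZ) _; first by apply: measurableI => //; exact: measurableD.
  rewrite [X in (_ + X <= _)%E]Z0 adde0.
  have -> : (2 * CP2 * r / (b - a))%:E = (((b - a) / 2)^-1%:E * (CP2 * r)%:E)%E.
    by rewrite -EFinM; congr EFin; field; rewrite gt_eqF//; slra.
  by rewrite -muleA lee_pdivlMl.
rewrite ge_min; have [ma|ma] := leP ((a + b) / 2) m.
  apply/orP; left; apply: key => // y /= ya; rewrite distrC; apply: le_trans (ler_norm _); slra.
apply/orP; right; apply: key => // y /= yb; apply: le_trans (ler_norm _); slra.
Qed.

(** Were the annulus empty, the truncated distance from [x] would have zero upper gradient and still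
    take the values 0 and 1 on balls about [x] and [y], against [PI_sets]. *)
Lemma annulus x s t y : 0 < s -> s < t -> t <= dist x y -> exists z, s < dist x z < t.
Proof.
have local_context : True by [].
move=> s0 st xy; apply: contrapT => no.
pose Rr := dist x y + (t - s); have Rr0 : 0 < Rr by rewrite /Rr; slra.
have ld := lip_dist metric x.
have bd0 : band (dist x) s (t - s) = set0.
  by apply/seteqP; split => // z; rewrite /band/= subrKC => h; apply: no; exists z.
have h0 : 0 < t - s by slra.
have ug0 := lip_trunc_ug metric borel (dball dist x (2 * (lam2 * Rr))) s ler01 ld h0.
have mv : measurable_fun setT (fun z => clamp 1 ((dist x z - s) / (t - s))).
  have := lip_measurable metric borel ld => md.
  apply: measurable_maxr => //; apply: measurable_minr => //; apply: measurable_funM => //.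
  exact: measurable_funB.
have := @PI_sets x Rr _ _ _ set0 0 1 1 Rr0 mv measurable0 (measure0 _) _ _ ug0 ltr01.
have -> : (\int[mu]_(y0 in dball dist x (lam2 * Rr)) ((1 / (t - s))%:E * (\1_(band (dist x) s (t - s)) y0)%:E) = 0)%E.
  by under eq_integral do rewrite bd0 indic0 mule0; exact: integral0.
rewrite mule0 => /(_ _ _)/[dup] _ => h.
have {h} := h (fun y _ e => e erefl) (fun y => _).
have c1 z : `|clamp 1 ((dist x z - s) / (t - s))| <= 1 by rewrite ger0_norm ?clamp_ge0// clamp_le.
move=> /(_ c1); rewrite ge_min => /orP[].
  rewrite leNgt => /negP; apply; apply: (@lt_le_trans _ _ (mu (dball dist x s))).
    by rewrite (mBE metric dbl) lte_fin; exact: (mB_gt0 metric dbl).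
  apply: le_measure; rewrite ?inE.
  - exact: dball_measurable.
  - apply: measurableI; first exact: dball_measurable.
    rewrite (_ : [set _ | _] = (fun z => clamp 1 ((dist x z - s) / (t - s))) @^-1` `]-oo, 0]); last by apply/seteqP; split => z /=; rewrite in_itv.
    by rewrite -[X in measurable X]setTI; exact: mv.
  move=> z; rewrite /dball/= => xz; split; first by rewrite /Rr; slra.
  rewrite /clamp ge_max lexx/= ge_min; apply/orP; left; rewrite ler_pdivrMr// mul0r; slra.
rewrite leNgt => /negP; apply; apply: (@lt_le_trans _ _ (mu (dball dist y (t - s)))).
  by rewrite (mBE metric dbl) lte_fin; exact: (mB_gt0 metric dbl).
apply: le_measure; rewrite ?inE.
- exact: dball_measurable.
- apply: measurableI; first exact: dball_measurable.
  rewrite (_ : [set _ | _] = (fun z => clamp 1 ((dist x z - s) / (t - s))) @^-1` `[1, +oo[); last by apply/seteqP; split => z /=; rewrite in_itv/= andbT.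
  by rewrite -[X in measurable X]setTI; exact: mv.
move=> z; rewrite /dball/= => yz; have := dist_tri metric x y z; have := dist_tri metric x z y.
rewrite (distC metric z) => h1 h2; split; first by rewrite /Rr; slra.
have tz : t <= dist x z by rewrite leNgt; apply/negP => zt; apply: no; exists z; apply/andP; split; slra.
rewrite /clamp le_max; apply/orP; right; rewrite le_min lexx andbT ler_pdivlMr// mul1r; slra.
Qed.

(* If a function vanishing off [B(x, 2r)] has small energy, then it is less than 1/2 on most of
   [B(x, 4r)]: it vanishes on a ball inside the annulus [B(x, 4r) \ B(x, 2r)]. *)
Lemma eta_small x r (eta v : X -> R) (g : X -> \bar R) Z y : 0 < r -> 4 * r <= dist x y ->
  measurable_fun setT v -> measurable Z -> mu Z = 0%E -> (forall y, eta y <> v y -> Z y) ->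
  (forall y, 0 <= eta y <= 1) -> (forall y, ~ dball dist x (2 * r) y -> eta y = 0) ->
  is_ug dist setT eta g ->
  ((16 * CP2 * r)%:E * \int[mu]_y g y < (mB x r / Cd ^+ 4)%:E)%E ->
  (mu (dball dist x (4 * r) `&` [set y | (2^-1 <= v y)%R]) <= (16 * CP2 * r)%:E * \int[mu]_y g y)%E.
Proof.
have local_context : True by [].
move=> r0 xy mv mZ Z0 ev e01 e0 ug small.
have r40 : 0 < 4 * r by slra.
have bg := ug.1.
have h2 : (0 : R) < 2^-1 by slra.
have := @PI_sets x (4 * r) eta v g Z 0 2^-1 1 r40 mv mZ Z0 (fun y _ => ev y) _ (ug_subset (@subsetT _ _) ug) h2.
have e1 z : `|eta z| <= 1 by have /andP[? ?] := e01 z; rewrite ger0_norm.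
move=> /(_ e1); have -> : 2 * CP2 * (4 * r) / (2^-1 - 0) = 16 * CP2 * r by field.
set I := (_ * \int[mu]_(y in dball _ _ _) _)%E; set J := (_ * \int[mu]_y _)%E in small *.
have IJ : (I <= J)%E.
  apply: lee_wpmul2l; last by apply: int_sub => //; exact: dball_measurable.
  have C2 := CP2_ge1 x; rewrite lee_fin mulr_ge0 ?(ltW r0)//; slra.
rewrite ge_min => /orP[h|h]; last exact: le_trans h IJ.
exfalso; have := le_lt_trans (le_trans h IJ) small; apply/negP; rewrite -leNgt.
have [z /andP[z1 z2]] := @annulus x (5 / 2 * r) (7 / 2 * r) y ltac:(lra) ltac:(lra) ltac:(lra).
have zb : mB x r <= Cd ^+ 4 * mB z (r / 2) by apply: mB_iter => //; rewrite (distC metric); slra.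
have C1 := Cd_ge1 metric borel dbl x.
have C40 : 0 < Cd ^+ 4 by rewrite exprn_gt0//; slra.
apply: (@le_trans _ _ (mu (dball dist z (r / 2) `\` Z))).
  rewrite measureD//; [|exact: dball_measurable|exact: muB_fin dbl _ _].
  have z0 : mu (dball dist z (r / 2) `&` Z) = 0%E.
    apply/eqP; rewrite -measure_le0 -[leRHS]Z0; apply: le_measure; rewrite ?inE//.
    by apply: measurableI => //; exact: dball_measurable.
  by rewrite [X in (_ - X)%E]z0 sube0 [leRHS](mBE metric dbl) lee_fin ler_pdivrMr// mulrC.
apply: le_measure; rewrite ?inE.
- by apply: measurableD => //; exact: dball_measurable.
- apply: measurableI; first exact: dball_measurable.
  rewrite (_ : [set _ | _] = v @^-1` `]-oo, 0]); last by apply/seteqP; split => w /=; rewrite in_itv.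
  by rewrite -[X in measurable X]setTI; exact: mv.
move=> w [zw nZ]; rewrite /dball/= in zw; have t1 := dist_tri metric x z w; have t2 := dist_tri metric x w z.
rewrite (distC metric w) in t2; split; first by rewrite /dball/=; slra.
have ew : eta w = v w by apply: contrapT => /ev.
by rewrite /= -ew e0// /dball/=; apply/negP; rewrite -leNgt; slra.
Qed.

Lemma cap_ball x r : 0 < r ->
  (capp dist mu 1 (dball dist x r) (dball dist x (2 * r)) <= (mB x (2 * r) / r)%:E)%E.
Proof.
have local_context : True by [].
move=> r0; pose u y := clamp 1 ((- dist x y - (- (2 * r))) / r).
have ld : lip dist (fun y => - dist x y) 1.
  by move=> y z; rewrite -opprD normrN; exact: lip_dist.
have ug := lip_trunc_ug metric borel setT (- (2 * r)) ler01 ld r0; rewrite -/u in ug.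
have md := lip_measurable metric borel ld.
have mu_ : measurable_fun setT u.
  apply: measurable_maxr => //; apply: measurable_minr => //; apply: measurable_funM => //.
  exact: measurable_funB.
have mb := band_measurable (- (2 * r)) r md.
have m2 : measurable (dball dist x (2 * r)) by exact: dball_measurable.
have bsub : band (fun y => - dist x y) (- (2 * r)) r `<=` dball dist x (2 * r).
  by move=> y; rewrite /band/dball/= => /andP[? _]; slra.
have r1 : 0 <= 1 / r by rewrite divr_ge0// ltW.
have u01 y : 0 <= u y <= 1 by rewrite clamp_ge0 clamp_le.
have u0 y : ~ dball dist x (2 * r) y -> u y = 0.
  rewrite /dball/= => /negP; rewrite -leNgt => h; apply/eqP; rewrite eq_le (andP (u01 y)).1 andbT.
  by rewrite ge_max lexx/= ge_min; apply/orP; left; rewrite ler_pdivrMr// mul0r; slra.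
have ig : (\int[mu]_y ((1 / r)%:E * (\1_(band (fun y => - dist x y) (- (2 * r)) r) y)%:E) `^ 1 <= (mB x (2 * r) / r)%:E)%E.
  under eq_integral do rewrite poweRe1 ?mule_ge0 ?lee_fin//.
  rewrite int_scale ?lee_fin//; last exact: bn_indic.
  have -> : ((mB x (2 * r) / r)%:E = (1 / r)%:E * mu (dball dist x (2 * r)))%E.
    by rewrite (mBE metric dbl) -EFinM mul1r mulrC.
  rewrite integral_indic// setIT; apply: lee_wpmul2l; first by rewrite lee_fin.
  by apply: le_measure; rewrite ?inE.
apply: (le_trans _ ig); apply: ereal_inf_lbound.
exists u, (fun y => ((1 / r)%:E * (\1_(band (fun y => - dist x y) (- (2 * r)) r) y)%:E)%E); split => //.
- split => //; split.
    exists setT, u; split.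
    + by split => //; exists set0; split => //; rewrite setDv setU0.
    + by split => //; exists set0; split => // y [].
    apply: (@le_lt_trans _ _ (\int[mu]_y (\1_(dball dist x (2 * r)) y)%:E)%E).
      apply: int_mono => //.
      + by apply: bn_pow; split => [|y]; [apply/measurable_EFinP; apply: measurableT_comp|rewrite lee_fin].
      + exact: bn_indic.
      move=> y _; rewrite poweRe1 ?lee_fin// indicE; have /andP[u1 u2] := u01 y.
      rewrite ger0_norm//; case: (boolP (y \in _)) => //; rewrite notin_setE => /u0 ->; by [].
    by rewrite integral_indic// setIT; exact: muB_fin dbl _ _.
  exists (fun y => ((1 / r)%:E * (\1_(band (fun y => - dist x y) (- (2 * r)) r) y)%:E)%E); split.
    split; first exact: ug.1.
    exists set0; split; last by move=> c ac cH _; exact: ug.2.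
    apply/eqP; rewrite eq_le; apply/andP; split.
      apply: ereal_inf_lbound; exists (fun=> 0%E); last by under eq_integral do rewrite poweR0r ?oner_neq0//; exact: integral0.
      by split => //; split.
    apply: le_ereal_inf_tmp => _ [rho [brho _] <-]; apply: int_ge0; exact: bn_pow.
  exists setT; split; first by split => //; exists set0; split => //; rewrite setDv setU0.
  exact: le_lt_trans ig (ltry _).
- move=> y; rewrite /dball/= => xy; rewrite /u /clamp le_max; apply/orP; right.
  by rewrite le_min lexx andbT ler_pdivlMr// mul1r; slra.
- split; first exact: ug.1.
  exists set0; split; last by move=> c ac cH _; exact: ug.2.
  apply/eqP; rewrite eq_le; apply/andP; split.
    apply: ereal_inf_lbound; exists (fun=> 0%E); last by under eq_integral do rewrite poweR0r ?oner_neq0//; exact: integral0.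
    by split => //; split.
  apply: le_ereal_inf_tmp => _ [rho [brho _] <-]; apply: int_ge0; exact: bn_pow.
Qed.

Lemma good_scale A x c : 0 < c ->
  (liminf0 (fun r : R => capp dist mu 1 (A `&` dball dist x r) (dball dist x (2 * r))
            / capp dist mu 1 (dball dist x r) (dball dist x (2 * r))) < c%:E)%E ->
  forall rho, 0 < rho -> exists r (eta v : X -> R) Z (g : X -> \bar R), [/\ 0 < r < rho,
    [/\ measurable_fun setT v, measurable Z, mu Z = 0%E & forall y, eta y <> v y -> Z y],
    (forall y, 0 <= eta y <= 1) /\ (forall y, ~ dball dist x (2 * r) y -> eta y = 0),
    (forall y, A y -> dball dist x r y -> eta y = 1) &
    is_ug dist setT eta g /\ (r%:E * \int[mu]_y g y <= (3 * c * Cd * mB x r)%:E)%E].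
Proof.
have local_context : True by [].
move=> c0 lim rho rho0.
have C1 := Cd_ge1 metric borel dbl x.
have [r /andP[r0 rrho] ratio] : exists2 r, 0 < r < rho &
  (capp dist mu 1 (A `&` dball dist x r) (dball dist x (2 * r))
            / capp dist mu 1 (dball dist x r) (dball dist x (2 * r)) < c%:E)%E.
  have : (ereal_inf [set (capp dist mu 1 (A `&` dball dist x r) (dball dist x (2 * r))
            / capp dist mu 1 (dball dist x r) (dball dist x (2 * r)))%E | r in [set r : R | (0 < r < rho)%R]] < c%:E)%E.
    by apply: le_lt_trans lim; apply: ereal_sup_ubound; exists rho.
  by move=> /ereal_inf_lt[_ [r hr <-] h]; exists r.
have b0 := mB_gt0 metric dbl x r0.
(* [K] bounds [c] times the capacity of the ball. The test function may cost [2 * K], and the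
   passage from its weak to a genuine upper gradient another [K]; hence the factor 3 in the
   energy. *)
pose K := c * Cd * mB x r / r.
have K0 : 0 < K by rewrite /K divr_gt0// !mulr_gt0//; slra.
have capge S W : (0 <= capp dist mu 1 S W)%E.
  by apply: le_ereal_inf_tmp => _ [u [g [_ _ [bg _] ->]]]; apply: int_ge0; exact: bn_pow.
have cA : (capp dist mu 1 (A `&` dball dist x r) (dball dist x (2 * r)) < (2 * K)%:E)%E.
  apply: (@le_lt_trans _ _ K%:E); last by rewrite lte_fin; slra.
  move: ratio (cap_ball x r0) (capge (A `&` dball dist x r) (dball dist x (2 * r))) (capge (dball dist x r) (dball dist x (2 * r))).
  move: (capp _ _ _ _ _) (capp _ _ _ _ _) => b a; case: b => [b||]; [|by move=> _; rewrite leye_eq|by []].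
  (* If the ball has capacity 0, the inverse is [+oo], and a quotient below [c] forces the numerator
     to be 0. *)
  rewrite inver; case: eqP => [->|/eqP bn0] h hb a0 hb0.
    move: h; have [->|an0] := eqVneq a 0%E; first by rewrite lee_fin ltW.
    by rewrite gt0_muley// lt_neqAle eq_sym an0.
  have bp : 0 < b by rewrite lt_neqAle eq_sym bn0 -lee_fin.
  move: h; rewrite lte_pdivrMr// => /ltW h; apply: le_trans h _.
  rewrite -EFinM lee_fin /K -!mulrA ler_pM2l//; rewrite lee_fin in hb; apply: le_trans hb _.
  by rewrite mulrA ler_pM2r ?invr_gt0//; exact: mB_double.
have [_ [u [g [[[uLp _] u0] uA gu ->]]] hg] := ereal_inf_lt cA.
have [E [v [_ [mv [Z [mZ Z0 uZ]]] _]]] := uLp.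
have [g' [ug' gg' ig']] := pwug_ug metric borel (lexx 1) gu K0.
exists r, (fun y => clamp 1 (u y)), (fun y => clamp 1 (v y)), Z, g'; split.
- by rewrite r0.
- split => //; first by apply: measurable_maxr => //; exact: measurable_minr.
  by move=> y uv; apply: uZ; split => // e; apply: uv; rewrite e.
- split => [y|y /u0 ->]; first by rewrite clamp_ge0 clamp_le.
  by rewrite clamp_id.
- move=> y Ay By; have := uA y (conj Ay By) => u1; apply/eqP; rewrite eq_le clamp_le//=.
  by rewrite /clamp le_max le_min u1 lexx orbT.
split; first exact: clamp_ug.
have bg' := ug'.1; have h1 := ig' setT measurableT.
have h2 : (\int[mu]_y g' y <= (3 * K)%:E)%E.
  rewrite (_ : (3 * K)%:E = (2 * K)%:E + K%:E)%E; last by rewrite -EFinD; congr EFin; ring.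
  rewrite (eq_integral (fun y => g' y `^ 1)%E) => [|y _]; last by rewrite poweRe1//; exact: bg'.2.
  by apply: le_trans h1 _; rewrite leeD2r// ltW.
apply: le_trans (lee_wpmul2l _ h2) _; first by rewrite lee_fin ltW.
by rewrite -EFinM lee_fin /K le_eqVlt; apply/orP; left; apply/eqP; field; rewrite gt_eqF.
Qed.

End Poincare.

(** * From balls to nets *)

Ltac pos := repeat first [assumption | by [] | apply: mulr_gt0 | apply: divr_gt0 | apply: exprn_gt0 | apply: addr_gt0 | rewrite invr_gt0]; try lra.

Section SetDist.
Variables (R : realType) (d : measure_display) (X : measurableType d) (dist : X -> X -> R).
Hypothesis metric : is_metric dist.
Variable S : set X.
Hypothesis S0 : S !=set0.

Definition sdist (x : X) : R := inf [set dist x y | y in S].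

Let hi x : has_inf [set dist x y | y in S].
Proof.
split; first by case: S0 => y Sy; exists (dist x y), y.
by exists 0 => _ [y _ <-]; exact: (dist_ge0 metric).
Qed.

Lemma sdist_le x y : S y -> sdist x <= dist x y.
Proof. by move=> Sy; apply: ge_inf; [exact: (hi x).2|exists y]. Qed.

Lemma sdist_lb x t : (forall y, S y -> t <= dist x y) -> t <= sdist x.
Proof. by move=> h; apply: lb_le_inf; [exact: (hi x).1|move=> _ [y Sy <-]; exact: h]. Qed.

Lemma sdist_lt x t : sdist x < t -> exists2 y, S y & dist x y < t.
Proof.
move=> h; apply: contrapT => nex; suff : t <= sdist x by rewrite leNgt h.
by apply: sdist_lb => y Sy; rewrite leNgt; apply/negP => xy; apply: nex; exists y.
Qed.

Lemma lip_sdist : lip dist sdist 1.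
Proof.
have local_context : True by [].
have h x y : sdist x <= sdist y + dist x y.
  rewrite -lerBlDr; apply: sdist_lb => z Sz.
  have := sdist_le x Sz; have := dist_tri metric x y z; slra.
move=> x y; rewrite mul1r ler_norml; have := h x y; have := h y x.
by rewrite (distC metric y x) => *; apply/andP; split; slra.
Qed.
End SetDist.

Lemma dyadic (R : realType) (a b : R) : 0 < a -> a <= b -> exists j : nat, a * 2 ^+ j <= b < a * 2 ^+ j.+1.
Proof.
have local_context : True by [].
move=> a0 ab; have [k hk] := expr2_large (b / a).
have ex : exists j : nat, b < a * 2 ^+ j.
  exists k.+1; apply: le_lt_trans (_ : a * 2 ^+ k < _); first by rewrite mulrC -ler_pdivrMr.
  by rewrite ltr_pM2l// exprS ltr_pMl ?exprn_gt0//; slra.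
case: (ex_minnP ex) => -[|j] hj jmin; first by move: hj; rewrite expr0 mulr1; slra.
exists j; rewrite hj andbT leNgt; apply/negP => /jmin; by rewrite ltnn.
Qed.

Section Net.
Variables (R : realType) (d : measure_display) (X : measurableType d) (dist : X -> X -> R).
Hypothesis metric : is_metric dist.
Hypothesis borel : borel_for dist.
Variable mu : {measure set X -> \bar R}.
Variables Cd CP lam : R.
Hypothesis dbl : doubling dist mu Cd.
Hypothesis PI : PI11 dist mu CP lam.
Local Notation mB := (mB dist mu).
Variables (x0 : X) (R1 tau : R) (n : nat) (p : 'I_n -> X).
Hypothesis tau0 : 0 < tau.
Hypothesis near : forall i, dist x0 (p i) < R1.
Hypothesis sep : forall i j, i != j -> tau <= dist (p i) (p j).
Hypothesis cov : forall y, dist x0 y < R1 -> exists i, dist y (p i) < tau.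

Let C1 : 1 <= Cd. Proof. exact: (Cd_ge1 metric borel dbl x0). Qed.
Let Cp k : 0 < Cd ^+ k. Proof. by rewrite exprn_gt0//; have := C1; lra. Qed.
Let Ck k l : (k <= l)%N -> Cd ^+ k <= Cd ^+ l. Proof. by move=> kl; rewrite ler_weXn2l. Qed.

Definition ndist (i j : 'I_n) := dist (p i) (p j).
Definition nmass (i : 'I_n) := mB (p i) tau.
(** Mass divided by length, so that an edge boundary has the dimension of a perimeter. The range
    [3 * tau] suffices to join net points whose [tau]-balls come within [tau] of each other. *)
Definition nweight (i j : 'I_n) := if ndist i j < 3 * tau then (nmass i + nmass j) / tau else 0.
Definition nbeta (i : 'I_n) r := mB (p i) r.

Lemma overlap_int (P : pred 'I_n) rho k (U : set X) (f : X -> \bar R) :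
  4 * rho + tau <= 2 ^+ k * tau -> measurable U -> borel_nonneg f ->
  (forall i, P i -> dball dist (p i) rho `<=` U) ->
  (\sum_(i | P i) \int[mu]_(y in dball dist (p i) rho) f y <= (Cd ^+ k)%:E * \int[mu]_(y in U) f y)%E.
Proof.
move=> hk mU bf sub; have mb i : measurable (dball dist (p i) rho) by exact: dball_measurable.
pose G i y := (f y * (\1_(dball dist (p i) rho) y)%:E)%E.
have bG i : borel_nonneg (G i) by apply: bn_mul => //; exact: bn_indic.
rewrite (eq_bigr (fun i => \int[mu]_(y in U) G i y)%E); last first.
  by move=> i Pi; rewrite int_indicE// setIC (setIidl (sub i Pi)).
rewrite big_mkcond /= (eq_bigr (fun i => \int[mu]_(y in U) (if P i then G i y else 0%E))%E); last first.
  by move=> i _; case: ifP => // _; rewrite integral0.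
have bG' i : borel_nonneg (fun y => if P i then G i y else 0%E) by case: (P i) => //; exact: bn_cst.
rewrite -ge0_integral_sum//; [|by move=> i; apply: measurable_funTS; exact: (bG' i).1|by move=> i y _; exact: (bG' i).2].
rewrite -int_scale//; last by rewrite lee_fin ltW.
apply: int_mono => //.
- split; first by apply: emeasurable_sum => i; exact: (bG' i).1.
  by move=> y; apply: sume_ge0 => i _; exact: (bG' i).2.
- by apply: bn_scale => //; rewrite lee_fin ltW.
move=> y Uy; rewrite -big_mkcond /= /G.
rewrite (eq_bigr (fun i => (\1_(dball dist (p i) rho) y)%:E * f y)%E); last by move=> i _; rewrite muleC.
rewrite -ge0_sume_distrl; last by move=> i _; rewrite lee_fin.
apply: lee_wpmul2r; first exact: bf.2.
rewrite sumEFin lee_fin.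
apply: le_trans (_ : \sum_(i | P i && (dist y (p i) < rho)) 1 <= _).
  rewrite [leRHS]big_mkcondr/=; apply: ler_sum => i Pi; rewrite indicE.
  case: ifPn => yi; first by case: (_ \in _).
  by rewrite memNset//= /dball/= (distC metric); exact/negP.
apply: (packing_card metric borel dbl (x := y) (S := rho) tau0 sep) => // i /andP[_ /ltW]; exact.
Qed.

Lemma half_sum (P : pred 'I_n) (U : set X) : measurable U ->
  (forall i, P i -> dball dist (p i) (tau / 2) `<=` U) -> (mu U < +oo)%E ->
  \sum_(i | P i) nmass i <= Cd * fine (mu U).
Proof.
have local_context : True by [].
move=> mU sub Ufin; apply: (@le_trans _ _ (\sum_(i | P i) Cd * mB (p i) (tau / 2))).
  by apply: ler_sum => i _; rewrite /nmass -{1}(divfK (_ : 2 != 0 :> R) tau) ?pnatr_eq0// mulrC; apply: mB_double.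
rewrite -mulr_sumr ler_pM2l; last by have := C1; slra.
rewrite -lee_fin fineK; last by rewrite ge0_fin_numE.
rewrite -sumEFin; under eq_bigr do rewrite -(mBE metric dbl).
apply: measure_disj_sum => //; first by move=> i; exact: dball_measurable.
move=> i j _ _ [y [iy jy]]; apply/eqP/negPn/negP => /sep.
rewrite /dball/= in iy jy; have := dist_tri metric (p i) y (p j); rewrite (distC metric y); slra.
Qed.

Lemma nmass_ge0 i : 0 <= nmass i. Proof. exact: mB_ge0. Qed.
Lemma nweight_ge0 i j : 0 <= nweight i j.
Proof. by rewrite /nweight; case: ifP => // _; rewrite divr_ge0 ?addr_ge0 ?nmass_ge0// ltW. Qed.
Lemma nweightC i j : nweight i j = nweight j i.
Proof. by rewrite /nweight /ndist (distC metric) addrC. Qed.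
Lemma nweight_far i j : 3 * tau <= ndist i j -> nweight i j = 0.
Proof. by move=> h; rewrite /nweight ltNge h. Qed.

Lemma nweight_deg i : \sum_j nweight i j <= 2 * Cd ^+ 6 * nmass i / tau.
Proof.
have local_context : True by [].
have t0 := tau0; rewrite /nweight -big_mkcond /=.
apply: (@le_trans _ _ (\sum_(j | ndist i j < 3 * tau) (2 * Cd ^+ 2 * nmass i / tau) * 1)).
  apply: ler_sum => j ij; rewrite mulr1 ler_pM2r ?invr_gt0//.
  have h : nmass j <= Cd ^+ 2 * nmass i by apply: mB_iter => //; rewrite /ndist in ij *; slra.
  have : nmass i <= Cd ^+ 2 * nmass i by rewrite ler_peMl ?nmass_ge0//; exact: exprn_ege1.
  slra.
rewrite -mulr_sumr.
have := @packing_card _ _ _ _ metric borel _ _ dbl n p (fun j => ndist i j < 3 * tau) tau (p i) (3 * tau) 4 tau0 sep.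
move=> /(_ (fun j h => ltW h) ltac:(lra)) h.
apply: le_trans (ler_wpM2l _ h) _; first (apply: divr_ge0; [apply: mulr_ge0; [by rewrite mulr_ge0// ltW|exact: nmass_ge0]|exact: ltW]).
by rewrite le_eqVlt; apply/orP; left; apply/eqP; rewrite (_ : Cd ^+ 6 = Cd ^+ 2 * Cd ^+ 4) -?exprD//; ring.
Qed.

Lemma nmass_up i r : tau <= r -> sm nmass (vb ndist i r) <= 2 * Cd ^+ 6 * nbeta i r.
Proof.
have local_context : True by [].
have t0 := tau0; move=> tr; have mb : measurable (dball dist (p i) (2 * r)) by exact: dball_measurable.
have h := @half_sum (fun j => j \in vb ndist i r) _ mb.
apply: (@le_trans _ _ (Cd * mB (p i) (2 * r))).
  apply: h; last exact: (muB_fin metric dbl).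
  by move=> j; rewrite in_vb /ndist => ij; apply: dball_sub => //; slra.
apply: le_trans (ler_wpM2l _ (mB_double metric dbl _ _)) _; first by have := C1; slra.
rewrite mulrA ler_wpM2r ?mB_ge0//; have := @Ck 2 6 isT; rewrite expr2; have := Cp 6; slra.
Qed.

Lemma mu_cover_sum (P : {set 'I_n}) (U : set X) : measurable U ->
  (forall y, U y -> exists2 j, j \in P & dist y (p j) < tau) -> (mu U <= (sm nmass P)%:E)%E.
Proof.
move=> mU hU; rewrite /sm -sumEFin.
under eq_bigr do rewrite -(mBE metric dbl).
have mb j : measurable (dball dist (p j) tau) by exact: dball_measurable.
rewrite -big_enum/=.
apply: le_trans (_ : mu (\big[setU/set0]_(j <- enum P) dball dist (p j) tau) <= _)%E; last first.
  elim: (enum _) => [|a s IH]; first by rewrite !big_nil measure0.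
  rewrite !big_cons; apply: le_trans (measureU2 _ _ _) _ => //; last by rewrite leeD2l.
  exact: bigsetU_measurable.
apply: le_measure; rewrite ?inE//; first exact: bigsetU_measurable.
move=> y /hU[j jP yj]; rewrite -bigcup_seq; exists j; last by rewrite /dball/= (distC metric).
by rewrite /= mem_enum.
Qed.

Lemma nmass_low i r : dist x0 (p i) + r <= R1 -> tau <= r ->
  nbeta i r <= 2 * Cd ^+ 6 * sm nmass (vb ndist i r).
Proof.
have local_context : True by [].
have t0 := tau0; move=> ir tr; have ii : i \in vb ndist i r by rewrite in_vb /ndist (distxx metric); slra.
have s0 : 0 <= sm nmass (vb ndist i r) by apply: sm_ge0; exact: nmass_ge0.
apply: (@le_trans _ _ (Cd * sm nmass (vb ndist i r))); last first.
  by rewrite ler_wpM2r//; have := @Ck 1 6 isT; rewrite expr1; have := Cp 6; slra.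
have [r2|r2] := ltP r (2 * tau).
  have := @mB_iter _ _ _ _ metric borel _ _ dbl 1 (p i) (p i) tau r.
  rewrite distxx// add0r !expr1 => /(_ (ltW r2)) h; apply: le_trans h _.
  by rewrite ler_pM2l ?(lt_le_trans ltr01 C1)//; exact: (sm_point nmass_ge0 ii).
have h : nbeta i r <= Cd * mB (p i) (r / 2).
  by rewrite /nbeta -{1}(divfK (_ : 2 != 0 :> R) r) ?pnatr_eq0// mulrC; apply: mB_double.
apply: le_trans h _; rewrite ler_pM2l ?(lt_le_trans ltr01 C1)//.
rewrite -lee_fin -(mBE metric dbl); apply: mu_cover_sum; first exact: dball_measurable.
move=> y; rewrite /dball/= => iy.
have [j yj] := cov (y := y) ltac:(have := dist_tri metric x0 (p i) y; slra).
exists j => //; rewrite in_vb /ndist; have := dist_tri metric (p i) y (p j); slra.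
Qed.

(** The function that is 1 within [tau] of [A] and 0 beyond [2 * tau] has its gradient on a layer
    covered by the balls of [bdry], net points off [A] adjacent to [A]; their mass is at most [tau]
    times the edge boundary. The points of [bdry] may escape the zero set of the function and are
    added separately, whence the [+ 1] in the constant. *)
Lemma net_poincare i s (A : {set 'I_n}) : tau <= s ->
  dist x0 (p i) + (2 * lam2 lam + 4) * s <= R1 ->
  Num.min (sm nmass (A :&: vb ndist i s)%SET) (sm nmass (vb ndist i s :\: A)%SET) <=
  (4 * Cd * CP2 Cd CP lam + 1) * s *
    es nweight (A :&: vb ndist i ((2 * lam2 lam + 4) * s))%SET (~: A :&: vb ndist i ((2 * lam2 lam + 4) * s))%SET.
Proof.
have local_context : True by [].
move=> ts isR; have t0 := tau0; have s0 : 0 < s by slra.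
set L := 2 * lam2 lam + 4; have l1 := lam2_ge1 lam; have L6 : 6 <= L by rewrite /L; slra.
have cp1 : 1 <= CP2 Cd CP lam by exact: (CP2_ge1 metric borel _ _ dbl x0).
have cp0 : 0 < CP2 Cd CP lam by slra.
have Ls : 6 * s <= L * s by rewrite ler_pM2r.
set E := es _ _ _; have E0 : 0 <= E by apply: es_ge0; exact: nweight_ge0.
have Cd1 := C1; have CC0 : 0 < Cd * CP2 Cd CP lam by apply: mulr_gt0; slra.
have RHS0 : 0 <= (4 * Cd * CP2 Cd CP lam + 1) * s * E.
  by apply: mulr_ge0 => //; apply: mulr_ge0; slra.
have [A0|[a aA]] := set_0Vmem A.
  by rewrite A0 finset.set0I {1}/sm finset.big_set0 ge_min RHS0.
pose S := [set p q | q in [set q : 'I_n | q \in A]].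
have S0 : S !=set0 by exists (p a), a.
have SA q : q \in A -> S (p q) by move=> qA; exists q.
have ld := lip_sdist metric S0.
have ldN : lip dist (fun y => - sdist dist S y) 1.
  by move=> y z; rewrite -opprD normrN; exact: ld.
pose u y := clamp 1 ((- sdist dist S y - (- (2 * tau))) / tau).
have md := lip_measurable metric borel ldN.
have mu_ : measurable_fun setT u.
  apply: measurable_maxr => //; apply: measurable_minr => //; apply: measurable_funM => //.
  exact: measurable_funB.
have s20 : 0 < 2 * s by slra.
have ug := lip_trunc_ug metric borel (dball dist (p i) (2 * (lam2 lam * (2 * s)))) (- (2 * tau)) ler01 ldN tau0.
have u1 y : `|u y| <= 1 by rewrite ger0_norm ?clamp_ge0// clamp_le.
have := PI_sets metric borel dbl PI s20 mu_ measurable0 (measure0 _) (fun y _ e => False_ind _ (e erefl)) u1 ug ltr01.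
rewrite subr0 divr1; set W := dball dist (p i) (lam2 lam * (2 * s)).
set F0 := dball _ _ _ `&` _; set F1 := dball _ _ _ `&` _.
set bnd := band _ _ _.
have mbnd : measurable bnd by exact: band_measurable.
have mW : measurable W by exact: dball_measurable.
pose bdry := [set q in (~: A :&: vb ndist i ((L - 3) * s))%SET | [exists a in A, ndist a q < 3 * tau]]%SET.
have bdryE : sm nmass bdry <= tau * E.
  rewrite mulrC -ler_pdivrMr// /sm mulr_suml /E (es_sym nweightC) /es.
  set V' := (A :&: vb ndist i (L * s))%SET.
  apply: (@le_trans _ _ (\sum_(q in bdry) sm (nweight q) V')).
    apply: ler_sum => q; rewrite inE finset.in_setI in_vb /ndist => /andP[/andP[_ iq] /existsP[b /andP[bA bq]]].
    have bV : b \in V'.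
      rewrite finset.in_setI bA in_vb /ndist; have := dist_tri metric (p i) (p q) (p b).
      by rewrite (distC metric (p q)); slra.
    apply: le_trans (sm_point (nweight_ge0 q) bV).
    by rewrite /nweight /ndist (distC metric) bq ler_pM2r ?invr_gt0// lerDl nmass_ge0.
  apply: (@sm_sub _ _ (fun q => sm (nweight q) V')).
    by move=> q; apply: sm_ge0; exact: nweight_ge0.
  move=> q; rewrite inE !finset.in_setI !in_vb => /andP[/andP[-> iq] _] /=; slra.
have Wbnd : (\int[mu]_(y in W) ((1 / tau)%:E * (\1_bnd y)%:E) <= E%:E)%E.
  rewrite int_scale ?lee_fin ?divr_ge0 ?(ltW t0)//; last exact: bn_indic.
  have eE : (E%:E = (1 / tau)%:E * (tau * E)%:E)%E by rewrite -EFinM; congr EFin; field; rewrite gt_eqF.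
  rewrite integral_indic// eE; apply: lee_wpmul2l; first by rewrite lee_fin divr_ge0// ltW.
  apply: le_trans (_ : (sm nmass bdry)%:E <= _)%E; last by rewrite lee_fin.
  apply: mu_cover_sum; first exact: measurableI.
  move=> y [/andP[b1 b2]]; rewrite /W /dball/= => iy.
  have [q yq] := cov (y := y) ltac:(have := dist_tri metric x0 (p i) y; rewrite /L in isR; slra).
  exists q => //; rewrite inE !finset.in_setI finset.in_setC in_vb /ndist.
  have sy : sdist dist S y < 2 * tau by slra.
  have [_ [b bA <-] yb] := sdist_lt metric S0 sy.
  apply/andP; split; last first.
    apply/existsP; exists b; rewrite (bA : b \in A)/=.
    by have := dist_tri metric (p b) y (p q); rewrite (distC metric _ y); slra.
  apply/andP; split.
    by apply/negP => qA; have := sdist_le metric S0 y (SA q qA); slra.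
  by have := dist_tri metric (p i) y (p q); rewrite /L; slra.
move=> h; have {h} : (mine (mu F0) (mu F1) <= (4 * CP2 Cd CP lam * s * E)%:E)%E.
  apply: le_trans h _; rewrite (_ : 4 * CP2 Cd CP lam * s * E = 2 * CP2 Cd CP lam * (2 * s) * E); last by ring.
  by rewrite [leRHS]EFinM; apply: lee_wpmul2l => //; rewrite lee_fin; apply: ltW; pos.
have m2 : measurable (dball dist (p i) (2 * s)) by exact: dball_measurable.
have mF0 : measurable F0.
  apply: measurableI => //.
  rewrite (_ : [set _ | _] = u @^-1` `]-oo, 0]); last by apply/seteqP; split => y /=; rewrite in_itv.
  by rewrite -[X in measurable X]setTI; exact: mu_.
have mF1 : measurable F1.
  apply: measurableI => //.
  rewrite (_ : [set _ | _] = u @^-1` `[1, +oo[); last by apply/seteqP; split => y /=; rewrite in_itv/= andbT.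
  by rewrite -[X in measurable X]setTI; exact: mu_.
have F0oo : (mu F0 < +oo)%E by apply: (mu_sub_lty metric borel dbl mF0 (x := p i) (r := 2 * s)) => y [].
have F1oo : (mu F1 < +oo)%E by apply: (mu_sub_lty metric borel dbl mF1 (x := p i) (r := 2 * s)) => y [].
have sE0 : 0 <= s * E by apply: mulr_ge0 => //; slra.
have tE : tau * E <= s * E by apply: ler_wpM2r.
rewrite ge_min => /orP[hF|hF]; rewrite ge_min; apply/orP; [right|left].
  apply: (@le_trans _ _ (sm nmass (vb ndist i s :\: A :\: bdry)%SET + sm nmass bdry)).
    apply: le_trans (sm_setU nmass_ge0 _ _); apply: (sm_sub nmass_ge0) => q.
    by rewrite !(finset.in_setU, finset.in_setD) => /andP[-> ->]; case: (q \in bdry).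
  have h1 : sm nmass (vb ndist i s :\: A :\: bdry)%SET <= Cd * fine (mu F0).
    apply: half_sum => // q; rewrite !finset.in_setD in_vb => /and3P[nb qA iq] y qy.
    have far b : b \in A -> 3 * tau <= ndist b q.
      move=> bA; rewrite leNgt; apply: contra nb => bq; rewrite inE finset.in_setI finset.in_setC qA in_vb/=.
      apply/andP; split; first by rewrite /L; nra.
      by apply/existsP; exists b; rewrite bA.
    rewrite /ndist/dball/= in qy iq far; split.
      by have := dist_tri metric (p i) (p q) y; rewrite /dball/=; slra.
    rewrite /= /u /clamp ge_max lexx/= ge_min; apply/orP; left; rewrite ler_pdivrMr// mul0r.
    have : 2 * tau <= sdist dist S y.
      apply: sdist_lb => // _ [b bA <-]; have := far b bA; have := dist_tri metric (p b) y (p q).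
      by rewrite (distC metric (p b) y) (distC metric y (p q)); slra.
    slra.
  have h2 : fine (mu F0) <= 4 * CP2 Cd CP lam * s * E by rewrite -lee_fin fineK// ge0_fin_numE.
  have h3 : Cd * fine (mu F0) <= Cd * (4 * CP2 Cd CP lam * s * E) by rewrite ler_wpM2l//; slra.
  rewrite (_ : (_ + 1) * s * E = Cd * (4 * CP2 Cd CP lam * s * E) + s * E); last by ring.
  slra.
have h1 : sm nmass (A :&: vb ndist i s)%SET <= Cd * fine (mu F1).
  apply: half_sum => // q; rewrite finset.in_setI in_vb /ndist => /andP[qA iq] y; rewrite /dball/= => qy; split.
    by have := dist_tri metric (p i) (p q) y; rewrite /dball/=; slra.
  rewrite /= /u /clamp le_max; apply/orP; right; rewrite le_min lexx andbT ler_pdivlMr// mul1r.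
  have := sdist_le metric S0 y (SA q qA); rewrite (distC metric y); slra.
have h2 : fine (mu F1) <= 4 * CP2 Cd CP lam * s * E by rewrite -lee_fin fineK// ge0_fin_numE.
have h3 : Cd * fine (mu F1) <= Cd * (4 * CP2 Cd CP lam * s * E) by rewrite ler_wpM2l//; slra.
rewrite (_ : (_ + 1) * s * E = Cd * (4 * CP2 Cd CP lam * s * E) + s * E); last by ring.
slra.
Qed.
End Net.

(** The constants are chosen in the order [kL], [eta], [ke], [gam], [g1], [k3], [k4], [kC], each
    condition involving earlier ones only: [eta] beats the gain constant, [gam] the volume ratio at
    scale [eta], [g1] the Vitali losses against [gam], and the level gap [kC] absorbs the mass of
    heavy balls against [g1]. *)
Lemma core_parameters (R : realType) (Cd CP lam : R) : 1 <= Cd ->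
  let Lam := 2 * lam2 lam + 4 in let L1 := 8 * lam2 lam + 8 in
  let M := 2 * Cd ^+ 6 in let K := 4 * Cd * CP2 Cd CP lam + 1 in
  exists (kL ke k3 k4 kC : nat) (eta gam g1 : R),
  [/\ 2 * Lam <= 2 ^+ kL,
      [/\ 0 < eta, 6 * eta <= 1, 2 <= 2 ^+ ke * eta & 24 * gain_const M Cd K kL * M * Cd * eta <= 1],
      [/\ 0 < gam, 4 * M * Cd ^+ ke * gam <= 1, 0 < g1 & 4 * M * Cd ^+ 4 * g1 <= 1],
      [/\ 4 * M ^+ 2 * Cd ^+ 13 * g1 <= gam, 2 * Cd ^+ 11 * g1 <= gam & 16 * Cd ^+ 8 * M ^+ 2 * g1 <= 1] &
      [/\ 3 * L1 <= 2 ^+ k3, 5 * L1 <= 2 ^+ k4, 4 * L1 <= 2 ^+ kC & M * Cd ^+ k3 <= 2 ^+ kC * g1]].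
Proof.
have local_context : True by [].
move=> C1 Lam L1 M K.
have Cp k : 0 < Cd ^+ k by rewrite exprn_gt0//; slra.
have M0 : 0 < M by rewrite mulr_gt0.
have K0 : 0 < K.
  have h : 0 <= Cd * CP2 Cd CP lam.
    by rewrite mulr_ge0//; [slra|rewrite mulr_ge0 ?exprn_ge0//; [rewrite le_max ler01 orbT|slra]].
  by rewrite /K; slra.
have [kL hL] := expr2_large (2 * Lam).
have G0 : 0 < gain_const M Cd K kL by rewrite /gain_const; pos.
have pick (a b : R) : 0 < a -> 0 < b -> exists2 e, 0 < e <= a & b * e <= 1.
  move=> a0 b0; exists (Num.min a b^-1); first by rewrite lt_min a0 invr_gt0 b0 ge_min lexx.
  by rewrite -ler_pdivlMl// mulr1 ge_min lexx orbT.
have [eta /andP[eta0 eta1] heta] := @pick 6^-1 (24 * gain_const M Cd K kL * M * Cd) ltac:(lra) ltac:(pos).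
have [ke hke] := expr2_large (2 / eta).
have [gam /andP[gam0 _] hgam] := @pick 1 (4 * M * Cd ^+ ke) ltr01 ltac:(pos).
have [g1 /andP[g10 g1g] hg1] := @pick gam (4 * M * Cd ^+ 4 + (4 * M ^+ 2 * Cd ^+ 13 + 2 * Cd ^+ 11) / gam + 16 * Cd ^+ 8 * M ^+ 2) gam0
   ltac:(pos).
have p1 : 0 < 4 * M * Cd ^+ 4 * g1 by pos.
have p2 : 0 < 4 * M ^+ 2 * Cd ^+ 13 / gam * g1 by pos.
have p3 : 0 < 2 * Cd ^+ 11 / gam * g1 by pos.
have p4 : 0 < 16 * Cd ^+ 8 * M ^+ 2 * g1 by pos.
have hsum : 4 * M * Cd ^+ 4 * g1 + 4 * M ^+ 2 * Cd ^+ 13 / gam * g1 + 2 * Cd ^+ 11 / gam * g1 + 16 * Cd ^+ 8 * M ^+ 2 * g1 <= 1.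
  by move: hg1; rewrite !mulrDl; slra.
have [k3 h3] := expr2_large (3 * L1); have [k4 h4] := expr2_large (5 * L1).
have [kC hC] := expr2_large (Num.max (4 * L1) (M * Cd ^+ k3 / g1)).
rewrite ge_max in hC; case/andP: hC => hC1 hC2.
exists kL, ke, k3, k4, kC, eta, gam, g1; split => //; split => //.
- by slra.
- by rewrite -ler_pdivrMr.
- by slra.
- have h : 4 * M ^+ 2 * Cd ^+ 13 / gam * g1 <= 1 by slra.
  by move: h; rewrite mulrAC ler_pdivrMr// mul1r.
- have h : 2 * Cd ^+ 11 / gam * g1 <= 1 by slra.
  by move: h; rewrite mulrAC ler_pdivrMr// mul1r.
- by slra.
- by rewrite -ler_pdivrMr.
Qed.

Lemma bigmin_seq (R : realType) (I : eqType) (s : seq I) (f : I -> R) (a : R) : 0 < a ->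
  (forall i, 0 < f i) -> exists2 b, 0 < b <= a & forall i, i \in s -> b <= f i.
Proof.
move=> a0 f0; elim: s => [|i s [b /andP[b0 ba] hb]]; first by exists a => //; rewrite a0 lexx.
exists (Num.min b (f i)); first by rewrite lt_min b0 f0 ge_min ba.
by move=> j; rewrite inE => /orP[/eqP->|/hb h]; rewrite ge_min ?lexx ?h ?orbT.
Qed.

Lemma core_const_gt0 (R : realType) (D M K : R) k3 k4 kC : 0 < D -> 0 < M -> 0 < K ->
  0 < core_const M D K k3 k4 kC.
Proof.
move=> D0 M0 K0; have p : (0 : R) < 768%:R by rewrite ltr0n.
have q : 0 < cost_const M D k4 kC.
  rewrite /cost_const; apply: mulr_gt0; last by rewrite ltr0n.
  apply: mulr_gt0; last exact: exprn_gt0.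
  apply: mulr_gt0; [exact: p|exact: exprn_gt0].
rewrite /core_const; apply: addr_gt0; last exact: mulr_gt0.
apply: mulr_gt0 => //; exact: exprn_gt0.
Qed.

Section NetCore.
Variables (R : realType) (d : measure_display) (X : measurableType d) (dist : X -> X -> R).
Hypothesis metric : is_metric dist.
Hypothesis borel : borel_for dist.
Variable mu : {measure set X -> \bar R}.
Variables Cd CP lam : R.
Hypothesis dbl : doubling dist mu Cd.
Hypothesis PI : PI11 dist mu CP lam.
Hypothesis C1 : 1 <= Cd.
Variables (Lam L1 M K eta gam g1 : R) (kL ke k3 k4 kC : nat).
Hypothesis LamE : Lam = 2 * lam2 lam + 4.
Hypothesis L1E : L1 = 8 * lam2 lam + 8.
Hypothesis ME : M = 2 * Cd ^+ 6.
Hypothesis KE : K = 4 * Cd * CP2 Cd CP lam + 1.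
Hypothesis hkL : 2 * Lam <= 2 ^+ kL.
Hypothesis heta : [/\ 0 < eta, 6 * eta <= 1, 2 <= 2 ^+ ke * eta & 24 * gain_const M Cd K kL * M * Cd * eta <= 1].
Hypothesis hgam : [/\ 0 < gam, 4 * M * Cd ^+ ke * gam <= 1, 0 < g1 & 4 * M * Cd ^+ 4 * g1 <= 1].
Hypothesis hg1 : [/\ 4 * M ^+ 2 * Cd ^+ 13 * g1 <= gam, 2 * Cd ^+ 11 * g1 <= gam & 16 * Cd ^+ 8 * M ^+ 2 * g1 <= 1].
Hypothesis hk : [/\ 3 * L1 <= 2 ^+ k3, 5 * L1 <= 2 ^+ k4, 4 * L1 <= 2 ^+ kC & M * Cd ^+ k3 <= 2 ^+ kC * g1].
Variables (x0 : X) (r c : R) (E : set X) (g : X -> \bar R).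
Hypothesis r0 : 0 < r.
Hypothesis c0 : 0 < c.
Hypothesis mE : measurable E.
Hypothesis bg : borel_nonneg g.
Local Notation B := (dball dist).
Local Notation mB := (mB dist mu).
Let W := B x0 (17 * Lam * r).
Hypothesis gfin : (\int[mu]_(y in W) g y < +oo)%E.
Variable s : X -> R.
Hypothesis s0 : forall x, 0 < s x.
Hypothesis sr : forall x, s x <= r.
Variables (sig tau : R).
Hypothesis sig0 : 0 < sig.
Hypothesis sigr : 512 * sig <= r.
Hypothesis tau0 : 0 < tau.
Hypothesis sigtau : 48 * tau <= sig.
Hypothesis sigeta : tau <= eta * (sig / 16).
Variables (n : nat) (p : 'I_n -> X).
Hypothesis pnear : forall i, dist x0 (p i) < 16 * Lam * r.
Hypothesis psep : forall i j, i != j -> tau <= dist (p i) (p j).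
Hypothesis pcov : forall y, dist x0 y < 16 * Lam * r -> exists i, dist y (p i) < tau.
Variables (xc : 'I_n -> X) (jc : 'I_n -> nat).
Hypothesis xcP : forall i, dist (xc i) (p i) < s (xc i) / 4.
Hypothesis hs : forall i, let x := xc i in
   [\/ (mu (E `&` B x (s x)) <= (g1 / Cd ^+ 7 * mB x (s x))%:E)%E,
          (mu (B x (s x) `\` E) <= (g1 / Cd ^+ 7 * mB x (s x))%:E)%E |
          ((c * mB x (s x))%:E <= (s x)%:E * \int[mu]_(y in B x (lam2 lam * s x)) g y)%E].
Hypothesis jcP : forall i, 64 * sig * 2 ^+ jc i <= s (xc i) / 4 < 64 * sig * 2 ^+ (jc i).+1.

Let l1 : 1 <= lam2 lam. Proof. exact: lam2_ge1. Qed.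
Let Lam6 : 6 <= Lam. Proof. by rewrite LamE; have := l1; lra. Qed.
Let Lr : 6 * r <= Lam * r. Proof. by rewrite ler_pM2r// Lam6. Qed.
Let Cd0 : 0 < Cd. Proof. exact: lt_le_trans C1. Qed.
Let Cp k : 0 < Cd ^+ k. Proof. by rewrite exprn_gt0. Qed.
Let M1 : 1 <= M. Proof. by rewrite ME; have := exprn_ege1 6 C1; lra. Qed.
Let cp0 : 0 < CP2 Cd CP lam. Proof. by rewrite /CP2 mulr_gt0// lt_max ltr01 orbT. Qed.
Let K0 : 0 < K. Proof. by rewrite KE addr_gt0// mulr_gt0// mulr_gt0. Qed.
Let L12 : 2 <= L1. Proof. by rewrite L1E; have := l1; lra. Qed.
Let taur : 48 * tau <= r / 512. Proof. by have := sigtau; have := sigr; lra. Qed.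

Definition okset : {set 'I_n} := [set i | dist x0 (p i) < 5 * Lam * r]%SET.
Let N := (\max_(i in okset) jc i)%N.
(** Points off [okset] get the level [N.+1] and thus stay pending through the whole ascent. *)
Let lev0 i := if i \in okset then jc i else N.+1.
Let sg j := 64 * (sig * 2 ^+ j).

Let okE i : (i \in okset) = (lev0 i <= N)%N.
Proof.
rewrite /lev0; case: ifP => [iok|_]; last by rewrite ltnn.
by apply/esym; rewrite /N (bigD1 i)//= leq_maxl.
Qed.

Let sgN : sg N <= r.
Proof.
rewrite /sg /N; apply: (big_ind (fun n => 64 * (sig * 2 ^+ n) <= r)).
- by rewrite expr0 mulr1; have := sigr; have := sig0; lra.
- by move=> i j hi hj; rewrite /maxn; case: ifP.
- move=> i _; have /andP[h _] := jcP i; rewrite mulrA (le_trans h)//.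
  by have := sr (xc i); have := s0 (xc i); lra.
Qed.

Let xnear i : dist x0 (xc i) < 17 * Lam * r.
Proof.
have h := xcP i; have := pnear i; have := dist_tri metric x0 (p i) (xc i).
by rewrite (distC metric (p i)); have := sr (xc i); have := s0 (xc i); have := Lr; have := r0; lra.
Qed.

Let mBall y t : measurable (B y t). Proof. exact: dball_measurable. Qed.
Let e i := fine (mu (E `&` B (p i) tau)).
Let nn i := fine (\int[mu]_(y in B (p i) tau) g y).
Let f i := nmass dist mu tau p i - e i.

Let eE i : (e i)%:E = mu (E `&` B (p i) tau).
Proof.
rewrite fineK// ge0_fin_numE//; apply: (mu_sub_lty metric borel dbl (x := p i) (r := tau)).
  exact: measurableI.
by move=> y [].
Qed.

Let fE i : (f i)%:E = mu ((~` E) `&` B (p i) tau).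
Proof.
rewrite EFinB eE /nmass -(mBE metric dbl) [in RHS]setIC -setDE measureD// 1?setIC//.
exact: (muB_fin metric dbl).
Qed.

Let pW i t : t <= Lam * r -> B (p i) t `<=` W.
Proof. by move=> ht; apply: dball_sub => //; have := pnear i; lra. Qed.

Let nE i : (nn i)%:E = (\int[mu]_(y in B (p i) tau) g y)%E.
Proof.
rewrite fineK// ge0_fin_numE; last exact: int_ge0.
apply: le_lt_trans gfin; apply: int_sub => //; first exact: mBall.
by apply: pW; have := taur; have := Lr; have := r0; have := tau0; lra.
Qed.

Let e_ge0 i : 0 <= e i. Proof. exact: fine_ge0. Qed.
Let e_le i : e i <= nmass dist mu tau p i.
Proof.
rewrite -lee_fin eE /nmass -(mBE metric dbl); apply: le_measure; rewrite ?inE//; first exact: measurableI.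
Qed.
Let n_ge0 i : 0 <= nn i. Proof. by apply: fine_ge0; exact: int_ge0. Qed.

Let overE (P : {set 'I_n}) (U F : set X) (h : 'I_n -> R) : measurable U -> measurable F ->
    (forall i, (h i)%:E = mu (F `&` B (p i) tau)) -> (forall i, i \in P -> B (p i) tau `<=` U) ->
    ((sm h P)%:E <= (Cd ^+ 3)%:E * mu (F `&` U))%E.
Proof.
move=> mU mF hE sub; rewrite /sm -sumEFin.
have -> : mu (F `&` U) = (\int[mu]_(y in U) (\1_F y)%:E)%E by rewrite integral_indic.
rewrite (eq_bigr (fun i => \int[mu]_(y in B (p i) tau) (\1_F y)%:E)%E); last first.
  by move=> i _; rewrite hE integral_indic.
have t0 := tau0.
by apply: (overlap_int metric borel dbl x0 tau0 psep) => //; [lra|exact: bn_indic].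
Qed.

Let covE (P : {set 'I_n}) (U F : set X) (h : 'I_n -> R) : measurable U -> measurable F ->
    (forall i, (h i)%:E = mu (F `&` B (p i) tau)) ->
    (forall y, U y -> exists2 i, i \in P & dist y (p i) < tau) -> (mu (F `&` U) <= (sm h P)%:E)%E.
Proof.
move=> mU mF hE hU; rewrite /sm -sumEFin.
under eq_bigr do rewrite hE.
have mb j : measurable (F `&` B (p j) tau) by exact: measurableI.
rewrite -big_enum/=.
apply: le_trans (_ : mu (\big[setU/set0]_(j <- enum P) (F `&` B (p j) tau)) <= _)%E; last first.
  elim: (enum _) => [|a q IH]; first by rewrite !big_nil measure0.
  rewrite !big_cons; apply: le_trans (measureU2 _ _ _) _ => //; last by rewrite leeD2l.
  exact: bigsetU_measurable.
apply: le_measure; rewrite ?inE; [exact: measurableI|exact: bigsetU_measurable|].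
move=> y [Fy /hU[j jP yj]]; rewrite -bigcup_seq; exists j; first by rewrite /= mem_enum.
by split => //; rewrite /dball/= (distC metric).
Qed.

Let cov_int (P : {set 'I_n}) (U : set X) : measurable U ->
    (forall y, U y -> exists2 i, i \in P & dist y (p i) < tau) -> (\int[mu]_(y in U) g y <= (sm nn P)%:E)%E.
Proof.
move=> mU hU; rewrite /sm -sumEFin; under eq_bigr do rewrite nE.
have bI i : borel_nonneg (fun y => (g y * (\1_(B (p i) tau) y)%:E)%E) by apply: bn_mul => //; exact: bn_indic.
rewrite (eq_bigr (fun i => \int[mu]_y (g y * (\1_(B (p i) tau) y)%:E))%E); last first.
  by move=> i _; rewrite int_indicE// setTI.
rewrite -big_enum/= -ge0_integral_sum//; [|by move=> i; exact: (bI i).1|by move=> i y _; exact: (bI i).2].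
have bS : borel_nonneg (fun y => (\sum_(i <- enum P) g y * (\1_(B (p i) tau) y)%:E)%E).
  split=> [|y]; first by apply: emeasurable_sum => i; exact: (bI i).1.
  by apply: sume_ge0 => i _; exact: (bI i).2.
apply: le_trans (int_sub mu mU measurableT bS (@subsetT _ _)).
apply: int_mono => // y /hU[i iP yi]; have : i \in enum P by rewrite mem_enum.
move=> /(bigD1_seq i)/(_ (enum_uniq _)) ->/=.
rewrite indicE mem_set ?mule1; last by rewrite /dball/= (distC metric).
by rewrite leeDl// sume_ge0// => j _; exact: (bI j).2.
Qed.

(** The alternative at the covering centre [xc x], transferred to the net point. By [jcP] the scale
    [sg] is more than an eighth and at most a quarter of [s (xc x)]: balls of radius [sg] stay
    inside the ball of the centre, volumes agree up to [Cd ^+ 4], and the eighth accounts for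
    [c / 8]. The overlap of the net balls costs the remaining [Cd ^+ 3] in [g1 / Cd ^+ 7]. *)
Let stop x : x \in okset -> [|| (x \in okset) && (c / 8 * nbeta dist mu p x (sg (lev0 x)) <=
     sg (lev0 x) * sm nn (vb (ndist dist p) x (L1 * sg (lev0 x)))),
     sm e (vb (ndist dist p) x (sg (lev0 x))) <= g1 * nbeta dist mu p x (sg (lev0 x)) |
     sm f (vb (ndist dist p) x (sg (lev0 x))) <= g1 * nbeta dist mu p x (sg (lev0 x))].
Proof.
move=> xok; rewrite xok /= /lev0 xok.
have xp := xcP x; have /andP[j1 j2] := jcP x; rewrite exprS in j2.
set z := xc x in xp j1 j2 *; set S := sg (jc x).
have eS : 64 * sig * 2 ^+ jc x = S by rewrite /S /sg mulrA.
have e2 : 64 * sig * (2 * 2 ^+ jc x) = 2 * S by rewrite -eS; ring.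
rewrite eS in j1; rewrite e2 in j2.
have S0 : 0 < S by rewrite /S /sg !mulr_gt0// exprn_gt0.
have tS : 48 * tau <= S.
  apply: le_trans sigtau _; rewrite /S /sg mulrCA ler_peMr ?(ltW sig0)//.
  by have : 1 <= 2 ^+ jc x :> R; [apply: exprn_ege1; lra|lra].
have sz := s0 z; have szr := sr z; have t0 := tau0.
have beta_up : mB z (s z) <= Cd ^+ 4 * nbeta dist mu p x S.
  by rewrite /nbeta; apply: mB_iter => //; rewrite (distC metric); lra.
have small (F : set X) (h : 'I_n -> R) : measurable F -> (forall i, (h i)%:E = mu (F `&` B (p i) tau)) ->
    (mu (F `&` B z (s z)) <= (g1 / Cd ^+ 7 * mB z (s z))%:E)%E ->
    sm h (vb (ndist dist p) x S) <= g1 * nbeta dist mu p x S.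
  move=> mF hF hz; rewrite -lee_fin.
  have hsub i : i \in vb (ndist dist p) x S -> B (p i) tau `<=` B z (s z).
    rewrite in_vb /ndist => ii; apply: dball_sub => //.
    by have := dist_tri metric z (p x) (p i); lra.
  apply: le_trans (overE (mBall _ _) mF hF hsub) _.
  apply: le_trans (lee_wpmul2l _ hz) _; first by rewrite lee_fin ltW.
  rewrite -EFinM lee_fin.
  have -> : Cd ^+ 3 * (g1 / Cd ^+ 7 * mB z (s z)) = g1 * (mB z (s z) / Cd ^+ 4).
    rewrite (_ : Cd ^+ 7 = Cd ^+ 3 * Cd ^+ 4); last by rewrite -exprD.
    by field; rewrite gt_eqF.
  by case: hgam => _ _ g10 _; rewrite ler_pM2l// ler_pdivrMr// mulrC.
case: (hs x) => h; apply/or3P; rewrite -/z in h.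
- by apply: Or32; apply: (small E).
- by apply: Or33; apply: (small (~` E)) => //; [exact: measurableC|rewrite setIC -setDE].
apply: Or31; rewrite -lee_fin.
have zx : nbeta dist mu p x S <= mB z (s z).
  rewrite /nbeta; apply: (mB_le metric borel dbl).
  by rewrite (distC metric) in xp *; have h0 := dist_ge0 metric z (p x); move: xp h0 j1; rewrite (distC metric z); lra.
have gS : (\int[mu]_(y in B z (lam2 lam * s z)%R) g y <= (sm nn (vb (ndist dist p) x (L1 * S)))%:E)%E.
  apply: cov_int => // y; rewrite /dball/= => zy.
  have lsz : lam2 lam * s z <= lam2 lam * r by rewrite ler_pM2l//; have := l1; lra.
  have lr2 : 2 * (lam2 lam * r) + 4 * r = Lam * r by rewrite LamE; ring.
  have xok' : dist x0 (p x) < 5 * Lam * r by move: xok; rewrite inE.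
  have tri1 := dist_tri metric x0 (p x) y; have tri2 := dist_tri metric (p x) z y.
  rewrite (distC metric (p x) z) in tri2; have r1 := r0; have Lr1 := Lr.
  have l0 : 0 < lam2 lam by have := l1; lra.
  have lr0 : 0 < lam2 lam * r by rewrite mulr_gt0.
  have [j yj] : exists i, dist y (p i) < tau by apply: pcov; lra.
  exists j => //; rewrite in_vb /ndist; apply: le_lt_trans (dist_tri metric (p x) y (p j)) _.
  have ls : lam2 lam * s z <= lam2 lam * (8 * S) by rewrite ler_pM2l//; lra.
  by rewrite L1E mulrDl; lra.
apply: (@le_trans _ _ ((8^-1)%:E * (c * mB z (s z))%:E)%E).
  rewrite -EFinM lee_fin (_ : c / 8 * _ = 8^-1 * (c * nbeta dist mu p x S)); last by ring.
  by rewrite ler_pM2l// ler_pM2l.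
apply: le_trans (lee_wpmul2l _ h) _; first by rewrite lee_fin.
rewrite muleA -EFinM [leRHS]EFinM; apply: lee_pmul => //.
- by rewrite lee_fin; lra.
- exact: int_ge0.
by rewrite lee_fin; lra.
Qed.

Lemma net_core :
  (mine (mu (E `&` B x0 r)) (mu (B x0 r `\` E)) <=
      (mB x0 r / (16 * Cd ^+ 5))%:E + (16 * Cd ^+ 3 * core_const M Cd K k3 k4 kC / c * r)%:E * \int[mu]_(y in W) g y)%E.
Proof.
have local_context : True by [].
have r1 := r0; have t0 := tau0; have tr := taur; have Lr1 := Lr.
have [i0 xi0] : exists i, dist x0 (p i) < tau by apply: pcov; rewrite distxx//; slra.
have [eta0 eta6 hke hetag] := heta; have [gam0 hgamk g10 g1a] := hgam; have [g1b g1c g1d] := hg1.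
have [hk3 hk4 hkC hkg] := hk.
have Lam1 : 1 <= Lam by have := Lam6; slra.
have c80 : 0 < c / 8 by rewrite divr_gt0.

(* The finite inequality is applied at radius [2 * r] about a net point within [tau] of [x0], so
   that the net balls counted there cover [B x0 r]. *)
have r20 : 0 < 2 * r by slra.
have mup (x : 'I_n) t : tau <= t -> sm (nmass dist mu tau p) (vb (ndist dist p) x t) <= M * nbeta dist mu p x t.
  by rewrite ME; apply: (nmass_up metric borel dbl x0 tau0 psep).
have mpt (x : 'I_n) : nbeta dist mu p x tau <= M * nmass dist mu tau p x.
  by rewrite ler_peMl// ?nmass_ge0.
have mlow (x : 'I_n) t : x \in okset -> tau <= t -> t <= 2 * r ->
    nbeta dist mu p x t <= M * sm (nmass dist mu tau p) (vb (ndist dist p) x t).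
  rewrite inE ME => xo t1 t2; apply: (nmass_low metric borel dbl tau0 pcov) => //; slra.
have deg (x : 'I_n) : \sum_q nweight dist mu tau p x q <= M * nmass dist mu tau p x / tau.
  by rewrite ME; apply: (nweight_deg metric borel dbl x0 tau0 psep).
have poin (x : 'I_n) t (P : {set 'I_n}) : x \in okset -> tau <= t -> t <= 2 * r ->
  Num.min (sm (nmass dist mu tau p) (P :&: vb (ndist dist p) x t)%SET)
    (sm (nmass dist mu tau p) (vb (ndist dist p) x t :\: P)%SET) <=
  K * t * es (nweight dist mu tau p) (P :&: vb (ndist dist p) x (Lam * t))%SET
    (~: P :&: vb (ndist dist p) x (Lam * t))%SET.
  rewrite inE => xo t1 t2; have h : Lam * t <= Lam * (2 * r) by rewrite ler_pM2l//; slra.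
  have h2 : dist x0 (p x) + Lam * t <= 16 * Lam * r by slra.
  have NP := fun H => @net_poincare _ _ _ _ metric borel mu _ _ _ dbl PI x0 (16 * Lam * r) tau n p tau0 psep pcov x t P t1 H.
  by rewrite -LamE -KE in NP; exact: NP.
have bD k (x y : 'I_n) (t t' : R) : 0 < t -> 0 < t' -> ndist dist p x y + t' <= 2 ^+ k * t ->
    nbeta dist mu p y t' <= Cd ^+ k * nbeta dist mu p x t.
  by move=> _ _ h; apply: (mB_iter metric borel dbl h).
have near0 z : ndist dist p i0 z < 2 * Lam * (2 * r) -> z \in okset.
  by rewrite inE /ndist => h; have := dist_tri metric x0 (p i0) (p z); slra.
have FC := @finite_core R 'I_n (ndist dist p) (fun i => distxx metric _) (fun i j => distC metric _ _)
  (fun i j k => dist_tri metric _ _ _) (nmass dist mu tau p) tau (nweight dist mu tau p) M tau0 M1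
  (nmass_ge0 dist mu tau p) (nweight_ge0 dist mu p tau0) (nweightC metric mu tau p)
  (@nweight_far _ _ _ _ mu tau n p) deg (nbeta dist mu p) Cd C1
  (fun i t t0 => mB_gt0 metric dbl (p i) t0) bD mup mpt okset (2 * r) Lam K kL mlow K0 Lam1 hkL poin
  eta gam ke eta0 eta6 hke hetag gam0 hgamk e g1 e_ge0 e_le g10 g1a g1b g1c
  nn (c / 8) L1 k3 k4 kC n_ge0 c80 L12 hk3 hk4 hkC hkg lev0 N sig sig0 sigtau sigeta.
have sg2 : sg N <= 2 * r by have := sgN; slra.
have {FC}FC := FC sg2 okE stop i0 (2 * r) sg2 (lexx _) near0.
have incl y : B x0 r y -> exists2 i, i \in vb (ndist dist p) i0 (2 * r) & dist y (p i) < tau.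
  rewrite /dball/= => xy; have [j yj] : exists i, dist y (p i) < tau by apply: pcov; slra.
  exists j => //; rewrite in_vb /ndist; have := dist_tri metric (p i0) x0 (p j).
  have := dist_tri metric x0 y (p j); rewrite (distC metric (p i0) x0).
  by move: yj xy xi0 t0 tr; slra.
have cE := covE (mBall x0 r) mE eE incl.
have cF := covE (mBall x0 r) (measurableC mE) fE incl.
have bt : nbeta dist mu p i0 (2 * r) <= Cd ^+ 2 * mB x0 r.
  by apply: (mB_iter metric borel dbl); rewrite expr2; slra.
have nW : ((sm nn [set: 'I_n]%SET)%:E <= (Cd ^+ 3)%:E * \int[mu]_(y in W) g y)%E.
  rewrite /sm -sumEFin; under eq_bigr do rewrite nE.
  apply: (overlap_int metric borel dbl x0 tau0 psep) => //; [slra|exact: mBall|].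
  by move=> i _; apply: pW; slra.
set cc := core_const M Cd K k3 k4 kC in FC *.
have cc0 : 0 < cc by apply: core_const_gt0 => //; have := M1; slra.
apply: le_trans (_ : (mB x0 r / (16 * Cd ^+ 5) + cc * (2 * r) / (c / 8) * sm nn [set: 'I_n]%SET)%:E <= _)%E.
  apply: le_trans (_ : mine (sm e (vb (ndist dist p) i0 (2 * r)))%:E (sm f (vb (ndist dist p) i0 (2 * r)))%:E <= _)%E.
    by rewrite setIC in cE *; rewrite setDE setIC in cF *; rewrite le_min !ge_min cE/= cF orbT.
  rewrite -EFin_min lee_fin; apply: (le_trans FC); apply: lerD; last by rewrite (_ : _ * (_ / _) = cc * (2 * r) / (c / 8) * sm nn [set: 'I_n]%SET)//; ring.
  apply: le_trans (_ : g1 * Cd ^+ 5 * M ^+ 2 * (Cd ^+ 2 * mB x0 r) <= _).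
    by rewrite ler_wpM2l// !mulr_ge0// ?exprn_ge0// ltW//; have := M1; slra.
  have m0 := mB_ge0 dist mu x0 r.
  rewrite (_ : _ * _ = (g1 * M ^+ 2) * Cd ^+ 7 * mB x0 r); last by rewrite !exprS expr0; ring.
  have MC : 1 <= M * Cd ^+ ke by rewrite mulr_ege1// exprn_ege1.
  have gam1 : 4 * gam <= 1.
    apply: le_trans hgamk; rewrite (_ : 4 * M * _ * _ = (4 * gam) * (M * Cd ^+ ke)); last by ring.
    by rewrite ler_peMr// mulr_ge0// ltW.
  have C12 : Cd ^+ 12 <= Cd ^+ 13 by apply: ler_weXn2l.
  have gM0 : 0 <= g1 * M ^+ 2 by apply: mulr_ge0; [exact: ltW|exact: sqr_ge0].
  have gM1 := ler_wpM2l gM0 C12.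
  have F0 : 0 < 16 * Cd ^+ 5 by rewrite mulr_gt0.
  rewrite ler_pdivlMr// (_ : _ * _ * _ * (16 * _) = 16 * (g1 * M ^+ 2 * Cd ^+ 12) * mB x0 r); last first.
    by rewrite (_ : Cd ^+ 12 = Cd ^+ 7 * Cd ^+ 5); [ring|rewrite -exprD].
  rewrite -[leRHS]mul1r; apply: ler_wpM2r => //.
  have : g1 * M ^+ 2 * Cd ^+ 13 = M ^+ 2 * Cd ^+ 13 * g1 by ring.
  by move: g1b gM1 gam1; slra.
rewrite EFinD leeD2l// EFinM; apply: le_trans (lee_wpmul2l _ nW) _.
  by rewrite lee_fin divr_ge0 ?mulr_ge0// ltW.
rewrite muleA -EFinM le_eqVlt; apply/orP; left; apply/eqP; congr (_%:E * _)%E.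
by field; rewrite gt_eqF.
Qed.
End NetCore.

(** Covering by balls of radius [s / 4] leaves finitely many centres, hence a positive least scale
    [sig], a net width [tau] below it, and one [h0] that serves all centres. The constants [gm],
    [Lm], [C0] depend on none of these, which is why they are fixed before the space. *)
Theorem core (R : realType) (Cd CP lam : R) : 1 <= Cd ->
  exists gm Lm C0 : R, [/\ 0 < gm, 1 <= Lm, 0 < C0 &
  forall (d : measure_display) (X : measurableType d) (dist : X -> X -> R)
     (mu : {measure set X -> \bar R}),
    is_metric dist -> borel_for dist -> dcomplete dist -> doubling dist mu Cd -> PI11 dist mu CP lam ->
  forall (x0 : X) (r c : R) (E : set X) (g : R -> X -> \bar R),
    0 < r -> 0 < c -> measurable E -> (forall h, 0 < h -> borel_nonneg (g h)) ->
    (forall h : R, 0 < h -> (\int[mu]_(y in dball dist x0 (Lm * r)) g h y < +oo)%E) ->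
    (forall x, dist x0 x < Lm * r -> exists2 s, 0 < s <= r &
       [\/ (mu (E `&` dball dist x s) <= (gm * mB dist mu x s)%:E)%E,
          (mu (dball dist x s `\` E) <= (gm * mB dist mu x s)%:E)%E |
          exists2 h0, 0 < h0 & forall h, 0 < h -> h < h0 ->
          ((c * mB dist mu x s)%:E <= s%:E * \int[mu]_(y in dball dist x (lam2 lam * s)) g h y)%E]) ->
    exists2 h0, 0 < h0 & forall h, 0 < h -> h < h0 ->
    (mine (mu (E `&` dball dist x0 r)) (mu (dball dist x0 r `\` E)) <=
      (mB dist mu x0 r / (16 * Cd ^+ 5))%:E + (C0 / c * r)%:E * \int[mu]_(y in dball dist x0 (Lm * r)) g h y)%E].
Proof.
have local_context : True by [].
move=> C1; have [kL [ke [k3 [k4 [kC [eta [gam [g1 [hkL heta hgam hg1 hk]]]]]]]]] := @core_parameters R Cd CP lam C1.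
have l1 := lam2_ge1 lam; have Cd0 : 0 < Cd by slra.
set Lam := 2 * lam2 lam + 4 in hkL heta.
have M0 : 0 < 2 * Cd ^+ 6 by rewrite mulr_gt0// exprn_gt0.
have K0 : 0 < 4 * Cd * CP2 Cd CP lam + 1 by rewrite addr_gt0// !mulr_gt0// ?exprn_gt0// lt_max ltr01 orbT.
have cc0 := core_const_gt0 k3 k4 kC Cd0 M0 K0.
have Lam6 : 6 <= Lam by rewrite /Lam; slra.
exists (g1 / Cd ^+ 7), (17 * Lam), (16 * Cd ^+ 3 * core_const (2 * Cd ^+ 6) Cd (4 * Cd * CP2 Cd CP lam + 1) k3 k4 kC).
have g10 : 0 < g1 by case: hgam.
split; [by rewrite divr_gt0// exprn_gt0|slra|by rewrite !mulr_gt0// exprn_gt0|].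
move=> d X dist mu metric borel cplt dbl PI x0 r c E g r0 c0 mE bg gfin hs.
have hs' x : exists sh : R * R, [/\ 0 < sh.1 <= r, 0 < sh.2 & dist x0 x < 17 * Lam * r -> forall h, 0 < h -> h < sh.2 ->
    [\/ (mu (E `&` dball dist x sh.1) <= (g1 / Cd ^+ 7 * mB dist mu x sh.1)%:E)%E,
          (mu (dball dist x sh.1 `\` E) <= (g1 / Cd ^+ 7 * mB dist mu x sh.1)%:E)%E |
          ((c * mB dist mu x sh.1)%:E <= sh.1%:E * \int[mu]_(y in dball dist x (lam2 lam * sh.1)) g h y)%E]].
  have [xx|xx] := ltP (dist x0 x) (17 * Lam * r); last by exists (r, 1); rewrite /= r0 lexx ltr01; split.
  have [s sr [hx|hx|[h0 h00 hx]]] := hs x xx.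
  - by exists (s, 1); rewrite ltr01; split => // _ h _ _; apply: Or31.
  - by exists (s, 1); rewrite ltr01; split => // _ h _ _; apply: Or32.
  - by exists (s, h0); split => // _ h p q; apply: Or33; exact: hx.
have [sh shP] := choice hs'; pose s x := (sh x).1.
have sP x : 0 < s x <= r by case: (shP x).
have s0 x : 0 < s x by have /andP[] := sP x.
have sr x : s x <= r by have /andP[] := sP x.
have s40 x : 0 < s x / 4 by rewrite divr_gt0.
have [q qP] := finite_cover metric borel dbl cplt x0 (16 * Lam * r) s40.
have r40 : 0 < r / 8 by rewrite divr_gt0.
have [b /andP[b0 br] hb] := bigmin_seq q r40 s40.
have sh0 x : 0 < (sh x).2 by case: (shP x).
have [h0 /andP[h00 _] hh0] := bigmin_seq q (@ltr01 R) sh0.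
exists h0 => // h hp hlt.
have [eta0 eta6 _ _] := heta.
set sig := b / 64; have sig0 : 0 < sig by rewrite divr_gt0.
set tau := Num.min (sig / 48) (eta * (sig / 16)).
have tau0 : 0 < tau by rewrite lt_min divr_gt0//= mulr_gt0// divr_gt0.
have [n [p [pnear psep pcov]]] := ball_net metric borel dbl x0 (16 * Lam * r) tau0.
have xj i : exists xj : X * nat, [/\ xj.1 \in q, dist xj.1 (p i) < s xj.1 / 4 & 64 * sig * 2 ^+ xj.2 <= s xj.1 / 4 < 64 * sig * 2 ^+ xj.2.+1].
  have [x xq xp] := qP (p i) (pnear i).
  have [||j hj] := @dyadic R (64 * sig) (s x / 4); first by rewrite mulr_gt0.
    by apply: le_trans (hb _ xq); rewrite /sig; slra.
  by exists (x, j).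
have [xj_ xjP] := choice xj.
have xq i : (xj_ i).1 \in q by case: (xjP i).
have xp i : dist (xj_ i).1 (p i) < s (xj_ i).1 / 4 by case: (xjP i).
have xl i : 64 * sig * 2 ^+ (xj_ i).2 <= s (xj_ i).1 / 4 < 64 * sig * 2 ^+ (xj_ i).2.+1 by case: (xjP i).
apply: (@net_core _ _ _ dist metric borel mu Cd CP lam dbl PI C1 Lam _ _ _ eta gam g1 kL ke k3 k4 kC
   erefl erefl erefl erefl hkL heta hgam hg1 hk x0 r c E (g h) r0 c0 mE (bg h hp) (gfin h hp) s s0 sr
   sig tau sig0 _ tau0 _ _ n p pnear psep pcov (fun i => (xj_ i).1) (fun i => (xj_ i).2)
   xp _ xl).
- by rewrite /sig; slra.
- by have : tau <= sig / 48; [rewrite /tau ge_min lexx|slra].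
- by rewrite /tau ge_min lexx orbT.
move=> i /=; have [_ _ hx] := shP (xj_ i).1; apply: hx => //; last by apply: lt_le_trans hlt (hh0 _ (xq i)).
have := dist_tri metric x0 (p i) (xj_ i).1; have := xp i; have := pnear i; rewrite (distC metric (p i)).
have := sr (xj_ i).1; have := s0 (xj_ i).1; have : 6 * r <= Lam * r by rewrite ler_pM2r.
slra.
Qed.

(** * Sets of zero capacity and the nullity of [A] *)

Lemma nneseries_small (R : realType) (F : nat -> \bar R) : (forall n, (0 <= F n)%E) ->
  (\sum_(0 <= n <oo) F n < +oo)%E -> forall e : R, 0 < e -> exists n, (F n < e%:E)%E.
Proof.
move=> F0 fin e e0; apply: contrapT => h.
have hF n : (e%:E <= F n)%E by rewrite leNgt; apply/negP => hn; apply: h; exists n.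
have S0 : (0 <= \sum_(0 <= n <oo) F n)%E by exact: nneseries_ge0.
move: fin; rewrite -ge0_fin_numE// => /fineK Sf'.
set S := fine _ in Sf'.
have eS : 0 < e / (Num.max S 0 + 1) by rewrite divr_gt0// ltr_pwDr// le_max lexx orbT.
have [k hk] := invS_small eS.
have := nneseries_lim_ge k.+1 (fun n _ _ => F0 n) : (_ <= \sum_(0 <= n <oo) F n)%E.
rewrite -Sf' => /(le_trans (lee_sum _ (fun n _ => hF n))).
rewrite sumEFin lee_fin big_const_nat subn0 iter_addr_0 => hs.
have m0 : 0 < Num.max S 0 + 1 by rewrite ltr_pwDr// le_max lexx orbT.
move: hk; rewrite ltr_pdivlMr// ltNge => /negP; apply.
rewrite mulrC ler_pdivlMr ?ltr0n//; rewrite -mulr_natr in hs; apply: le_trans hs _.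
by rewrite (le_trans (_ : S <= Num.max S 0))// ?le_max ?lexx// lerDl.
Qed.

Section Outer.
Variables (R : realType) (d : measure_display) (X : measurableType d) (dist : X -> X -> R).
Hypothesis metric : is_metric dist.
Hypothesis borel : borel_for dist.
Variable mu : {measure set X -> \bar R}.
Variable Cd : R.
Hypothesis dbl : doubling dist mu Cd.
Local Notation B := (dball dist).

Lemma outer_regular (S : set X) x0 r e : measurable S -> S `<=` B x0 r -> 0 < e ->
  exists O, [/\ dopen dist O, S `<=` O, O `<=` B x0 r & (mu O <= mu S + e%:E)%E].
Proof.
move=> mS Sb e0; have mb := dball_measurable metric borel x0 r.
have nufin : (mrestr mu mb setT < +oo)%E by rewrite /mrestr setTI; exact: (muB_fin metric dbl).
have [A0 [ O0 [oF oO AS SO small]]] := regular metric borel nufin mS e0.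
have mO := dopen_measurable borel oO.
have mA : measurable  A0 by rewrite -(setCK A0); apply: measurableC; exact: (dopen_measurable borel oF).
exists (O0 `&` B x0 r); split.
- by apply: dopenI => //; exact: dball_open.
- by move=> y Sy; split; [exact: SO|exact: Sb].
- by move=> y [].
apply: (@le_trans _ _ (mu (S `|` ((O0 `\` A0) `&` B x0 r)))%E).
  apply: le_measure; rewrite ?inE; [exact: measurableI| |].
    by apply: measurableU => //; apply: measurableI => //; exact: measurableD.
  move=> y [Oy yb]; have [Fy|nFy] := pselect (A0 y); [by left; exact: AS|by right].
apply: le_trans (measureU2 _ _ _) _ => //; first by apply: measurableI => //; exact: measurableD.
by rewrite leeD2l.
Qed.

Lemma null_of_small (S : set X) : (forall e, 0 < e -> exists T, [/\ measurable T, S `<=` T & (mu T <= e%:E)%E]) ->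
  onull mu S.
Proof.
move=> h; have h' n : exists T, [/\ measurable T, S `<=` T & (mu T <= (n.+1%:R^-1)%:E)%E] by apply: h; rewrite invr_gt0.
have [T hT] := choice h'; exists (\bigcap_n T n); split.
- by apply: bigcapT_measurable => n; case: (hT n).
- apply/eqP; rewrite eq_le measure_ge0 andbT; apply/lee_addgt0Pr => e e0; rewrite add0e.
  have [n hn] := invS_small e0; have [mT _ sT] := hT n.
  apply: le_trans (_ : mu (T n) <= _)%E.
    by apply: le_measure; rewrite ?inE//; [apply: bigcapT_measurable => k; case: (hT k)|move=> y; apply].
  by apply: (le_trans sT); rewrite lee_fin ltW.
- by move=> y Sy n _; have [_ + _] := hT n; apply.
Qed.

Lemma onull_bigcup (S : nat -> set X) : (forall n, onull mu (S n)) -> onull mu (\bigcup_n S n).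
Proof. exact: negligible_bigcup. Qed.

Lemma onull_sub (S S' : set X) : onull mu S' -> S `<=` S' -> onull mu S.
Proof. by move=> h /negligibleS; apply. Qed.

Lemma onullU (S S' : set X) : onull mu S -> onull mu S' -> onull mu (S `|` S').
Proof. exact: negligibleU. Qed.

Lemma cap1_data (N : set X) : Cap1 dist mu N = 0%E -> forall e, 0 < e ->
  exists (u v : X -> R) Z (g : X -> \bar R), [/\ is_ug dist setT u g, (forall x, N x -> 1 <= u x),
    measurable_fun setT v, [/\ measurable Z, mu Z = 0%E & forall x, u x <> v x -> Z x] &
    (\int[mu]_x (`|v x|%:E) + \int[mu]_x g x <= e%:E)%E].
Proof.
move=> N0 e e0; have e20 : 0 < e / 2 by rewrite divr_gt0.
have : (Cap1 dist mu N < (e / 2)%:E)%E by rewrite N0 lte_fin.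
rewrite /Cap1 => /ereal_inf_lt[_ [u [v [g [_ u1 [mv [Z [mZ Z0 hZ]]] pw ->]]]] small].
have [g' [ug gg' hg']] := pwug_ug metric borel (lexx 1) pw e20.
exists u, v, Z, g'; split => //; first by split => // x uv; apply: hZ.
have h1 f : borel_nonneg f -> (\int[mu]_x f x `^ 1 = \int[mu]_x f x)%E.
  by move=> bf; apply: eq_integral => x _; rewrite poweRe1//; exact: bf.2.
have := hg' _ measurableT; rewrite (h1 g' ug.1) (h1 g pw.1) => hi.
apply: le_trans (leeD2l _ hi) _; rewrite addeA.
rewrite [e in leRHS](_ : e = e / 2 + e / 2); last by field.
by rewrite EFinD leeD2r// ltW.
Qed.

Lemma cap1_null (N : set X) : Cap1 dist mu N = 0%E -> onull mu N.
Proof.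
move=> N0; apply: null_of_small => e e0.
have [u [v [Z [g [ug u1 mv [mZ Z0 hZ] small]]]]] := cap1_data N0 e0.
have mS : measurable [set x | 1 <= v x].
  by rewrite -[X in measurable X]setTI; exact: measurable_fun_le.
exists ([set x | 1 <= v x] `|` Z); split; first exact: measurableU.
  move=> x Nx; have [uv|/hZ] := pselect (u x = v x); last by right.
  by left; rewrite /= -uv; exact: u1.
rewrite (measureU0 (mu := mu) mS mZ Z0); apply: le_trans small.
have bv : borel_nonneg (fun x => `|v x|%:E : \bar R).
  by split; [apply/measurable_EFinP; exact: measurableT_comp|move=> x; rewrite lee_fin].
have := @chebyshev_set _ _ _ mu setT _ _ 1 measurableT mS bv ler01; rewrite mul1e setTI => h.
apply: le_trans (h _) _.
  by move=> x _ /=; rewrite lee_fin => v1; exact: le_trans v1 (ler_norm _).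
by rewrite leeDl// int_ge0//; exact: ug.1.
Qed.

(** [h] sums functions that are both upper gradients and majorants of test functions for [N], with
    summable integrals. If [h] had a finite integral along a curve through [N], some summand would
    have an integral below 1/2 and below half the length. Then its test function varies by less than
    1/2, so it is at least 1/2 on the whole curve, and the majorant integrates to at least half the
    length, a contradiction. *)
Lemma cap1_lines (N : set X) : Cap1 dist mu N = 0%E -> exists h : X -> \bar R,
  [/\ borel_nonneg h, (\int[mu]_x h x < +oo)%E &
   forall c t, arc_curve dist c -> 0 <= t -> t <= clen c -> N (cmap c t) -> line_int h c = +oo%E].
Proof.
have local_context : True by [].
move=> N0; have hp (i : nat) : 0 < 1 / (2 ^ i.+1)%:R :> R by rewrite divr_gt0// ltr0n expn_gt0.
have H i : exists uw : (X -> R) * (X -> \bar R), [/\ (forall x, N x -> 1 <= uw.1 x), is_ug dist setT uw.1 uw.2,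
   (forall x, (`|uw.1 x|%:E <= uw.2 x)%E) & (\int[mu]_x uw.2 x <= (1 / (2 ^ i.+1)%:R)%:E)%E].
  have [u [v [Z [g [ug u1 mv [mZ Z0 hZ] small]]]]] := cap1_data N0 (hp i).
  have bv : borel_nonneg (fun x => `|v x|%:E : \bar R).
    by split; [apply/measurable_EFinP; exact: measurableT_comp|move=> x; rewrite lee_fin].
  have bZ : borel_nonneg (fun x => +oo * (\1_Z x)%:E : \bar R)%E by apply: bn_scale => //; exact: bn_indic.
  have bvg := bn_add bv ug.1; have bw := bn_add bvg bZ.
  exists (u, fun x => (`|v x|%:E + g x + +oo * (\1_Z x)%:E)%E); split => //=.
  - apply: (ug_mono metric borel ug) => // x.
    by rewrite addeAC leeDr// adde_ge0// ?lee_fin//; exact: bZ.2.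
  - move=> x; have [->|/hZ Zx] := pselect (u x = v x).
      by rewrite -addeA leeDl// adde_ge0//; exact: ug.1.2.
    by rewrite indicE mem_set// mule1 addey ?leey// -ltNye (lt_le_trans _ (bvg.2 x)).
  rewrite (int_add _ measurableT bvg bZ) int_oo_null// adde0 (int_add _ measurableT bv ug.1)//.
have [uw hu] := choice H.
have bw i : borel_nonneg (uw i).2 by case: (hu i) => _ [].
exists (fun x => \sum_(0 <= i <oo) (uw i).2 x)%E; split; first exact: bn_series.
  rewrite int_series//; apply: le_lt_trans (nneseries_geo ler01 _ _) (ltry _).
    by move=> n; exact: int_ge0.
  by move=> n; case: (hu n).
move=> c t ac t0 tl Nt; have [l0 _] := ac.
have mI : measurable (`[0, clen c]%classic : set (measurableTypeR R)) by [].
have LE : line_int (fun x => \sum_(0 <= i <oo) (uw i).2 x)%E c = (\sum_(0 <= i <oo) line_int (uw i).2 c)%E.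
  rewrite line_int_ext (int_series _ mI (fun n => bn_ext metric borel ac (bw n))).
  by apply: eq_eseriesr => i _; rewrite line_int_ext.
have L0 i : (0 <= line_int (uw i).2 c)%E by apply: line_ge0; exact: bw.
apply/eqP; rewrite eq_le leey leNgt; apply/negP => fin.
rewrite LE in fin; have l20 : 0 < Num.min 2^-1 (clen c / 2) by rewrite lt_min divr_gt0// andbT.
have [i] := nneseries_small L0 fin l20; have [u1 ug uw_ _] := hu i.
apply/negP; rewrite -leNgt.
have [big|small] := leP (2^-1)%:E (line_int (uw i).2 c); first by apply: le_trans big; rewrite lee_fin ge_min lexx.
have half s : 0 <= s -> s <= clen c -> 2^-1 <= (uw i).1 (ext c s).
  move=> s0 sl; have ut : 1 <= (uw i).1 (ext c t) by apply: u1; rewrite extE.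
  have ci : curve_in setT c by [].
  have main a b : 0 <= a -> a <= b -> b <= clen c -> `|(uw i).1 (ext c a) - (uw i).1 (ext c b)| < 2^-1.
    move=> a0 ab bl; rewrite -lte_fin; apply: le_lt_trans small; rewrite line_int_ext.
    apply: (le_trans (ug_sub metric borel ug ac ci a0 ab bl)).
    apply: (int_sub _ _ mI (bn_ext metric borel ac (bw i))) => // y /=.
    by rewrite !in_itv/= => /andP[h1 h2]; rewrite (le_trans a0)//= (le_trans h2).
  have [st|/ltW ts] := leP s t; [have := main s t s0 st tl|have := main t s t0 ts sl];
    rewrite ltr_norml => /andP[h1 h2]; slra.
rewrite line_int_ext; apply: (@le_trans _ _ (\int[@lebesgue_measure R]_(s in `[0%R, clen c]) (2^-1)%:E)%E).
  have := line_cst 2^-1 ac; rewrite line_int_ext => ->.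
  by rewrite lee_fin ge_min; apply/orP; right; slra.
apply: (int_mono _ mI (bn_cst _ _) (bn_ext metric borel ac (bw i))); first by rewrite lee_fin.
move=> s /=; rewrite in_itv/= => /andP[s0 sl]; apply: le_trans (uw_ _); rewrite lee_fin.
by apply: (le_trans (half s s0 sl)); exact: ler_norm.
Qed.
End Outer.

Section GoodScales.
Variables (R : realType) (d : measure_display) (X : measurableType d) (dist : X -> X -> R).
Hypothesis metric : is_metric dist.
Hypothesis borel : borel_for dist.
Hypothesis cplt : dcomplete dist.
Hypothesis diam : exists x y : X, 0 < dist x y.
Variable mu : {measure set X -> \bar R}.
Variables Cd CP lam : R.
Hypothesis dbl : doubling dist mu Cd.
Hypothesis PI : PI11 dist mu CP lam.
Variables (c : R) (A : set X).
Hypothesis c0 : 0 < c.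
Hypothesis c_small : 96 * CP2 Cd CP lam * c * Cd ^+ 5 < 1.
Local Notation B := (dball dist).
Local Notation mB := (mB dist mu).
Let good x := (liminf0 (fun r : R => capp dist mu 1 (A `&` dball dist x r) (dball dist x (2 * r))
  / capp dist mu 1 (dball dist x r) (dball dist x (2 * r)))%E < c%:E)%E.

(** Scales below an eighth of a positive distance leave a point outside the ball of radius [4 * r],
    as [eta_small] requires; [c_small] brings the energy under its threshold. *)
Lemma good_eta x : good x -> forall rho, 0 < rho -> exists r (eta v : X -> R) Z (g : X -> \bar R),
  [/\ 0 < r < rho,
   [/\ measurable_fun setT v, measurable Z, mu Z = 0%E & forall y, eta y <> v y -> Z y],
   (forall y, 0 <= eta y <= 1), (forall y, A y -> B x r y -> eta y = 1) &
   [/\ is_ug dist setT eta g, (r%:E * \int[mu]_y g y <= (3 * c * Cd * mB x r)%:E)%E &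
    (mu (B x (4 * r) `&` [set y | (2^-1 <= v y)%R]) <= (48 * CP2 Cd CP lam * c * Cd * mB x r)%:E)%E]].
Proof.
have local_context : True by [].
move=> gx rho rho0; have [a [b ab]] := diam.
have D80 : 0 < Num.min rho (dist a b / 8) by rewrite lt_min rho0 divr_gt0.
have [r [eta [v [Z [g [/andP[r0 rr] [mv mZ Z0 hZ] [e01 e0] e1 [ug small]]]]]]] := good_scale metric borel dbl c0 gx D80.
have [ra rb] : r < rho /\ r < dist a b / 8 by move: rr; rewrite lt_min => /andP.
exists r, eta, v, Z, g; split => //; first by rewrite r0.
split => //.
have [y xy] : exists y, 4 * r <= dist x y.
  apply: contrapT => h; have h1 y : dist x y < 4 * r by rewrite ltNge; apply/negP => hy; apply: h; exists y.
  have := dist_tri metric a x b; rewrite (distC metric a x); have := h1 a; have := h1 b; slra.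
have C1 := Cd_ge1 metric borel dbl x; have P1 := CP2_ge1 metric borel CP lam dbl x.
have m0 := mB_gt0 metric dbl x r0.
have E1 : ((16 * CP2 Cd CP lam * r)%:E * \int[mu]_y g y <= (48 * CP2 Cd CP lam * c * Cd * mB x r)%:E)%E.
  rewrite EFinM -muleA; apply: le_trans (lee_wpmul2l _ small) _; first by rewrite lee_fin; slra.
  by rewrite -EFinM lee_fin le_eqVlt; apply/orP; left; apply/eqP; ring.
apply: (le_trans _ E1); apply: (eta_small metric borel dbl PI r0 xy mv mZ Z0 hZ e01 e0 ug).
apply: le_lt_trans E1 _; rewrite lte_fin ltr_pdivlMr ?exprn_gt0//; last by slra.
have c1 := c_small; rewrite [ltLHS](_ : _ = (96 * CP2 Cd CP lam * c * Cd ^+ 5) / 2 * mB x r); last by rewrite !exprS expr0; field.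
by rewrite -[ltRHS]mul1r ltr_pM2r//; slra.
Qed.

Variable N : set X.
Hypothesis N0 : onull mu N.
Hypothesis Ngood : forall x, ~ N x -> good x.

(** Vitali balls inside [O] carry sets of at most half their measure, namely superlevel sets of
    cut-offs, and these sets contain [A] in the tripled balls. The exceptional set and a thin layer
    along the boundary of [O] escape the argument; each is enclosed in a set of measure at most
    [e / 3], and a last [e / 3] makes the new cover open. *)
Let half x0 k (O : set X) e : 0 < k -> dopen dist O -> A `&` B x0 k `<=` O -> O `<=` B x0 k -> 0 < e ->
  exists O', [/\ dopen dist O', A `&` B x0 k `<=` O', O' `<=` B x0 k & (mu O' <= 2^-1%:E * mu O + e%:E)%E].
Proof.
move=> k0 oO AO OB e0; have mO := dopen_measurable borel oO; have mb := dball_measurable metric borel x0.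
have e30 : 0 < e / 3 by rewrite divr_gt0.
have [T [mT T0 NT]] := N0.
have [ ON [oN TN _ sN]] : exists ON, [/\ dopen dist ON, T `&` B x0 (2 * k) `<=` ON, ON `<=` B x0 (2 * k) & (mu ON <= mu (T `&` B x0 (2 * k)) + (e / 3)%:E)%E].
  by apply: (outer_regular metric borel dbl) => //; exact: measurableI.
have {}sN : (mu ON <= (e / 3)%:E)%E.
  apply: (le_trans sN); rewrite (_ : mu (_ `&` _) = 0%E) ?add0e//.
  by apply/eqP; rewrite eq_le measure_ge0 andbT -T0; apply: le_measure; rewrite ?inE//; exact: measurableI.
have mD t : measurable [set x | ddist dist (~` O) x <= t].
  rewrite -[X in measurable X]setTI; apply: measurable_fun_le => //.
  exact: (lip_measurable metric borel (lip_ddist metric _)).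
have [n hn] : exists n, (mu (O `&` [set x | (ddist dist (~` O) x <= n.+1%:R^-1)%R]) <= (e / 3)%:E)%E.
  apply: (@measure_cvg0 _ _ _ mu (fun n => O `&` [set x | ddist dist (~` O) x <= n.+1%:R^-1])) => //.
  - by move=> n; exact: measurableI.
  - by apply: (mu_sub_lty metric borel dbl (x := x0) (r := k)); [exact: measurableI|move=> y [/OB]].
  - move=> i j ij y [Oy /= h]; split => //=; apply: (le_trans h).
    by rewrite lef_pV2 ?posrE ?ltr0n// ler_nat.
  - apply/seteqP; split => // y hy; have [Oy _] := hy 0%N I.
    have := (ddist_gt0 metric y oO).2 Oy => dy; have [i hi] := invS_small dy.
    by have [_ /=] := hy i I; rewrite leNgt hi.
set K := [set x | ddist dist (~` O) x <= n.+1%:R^-1] in hn.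
have mK : measurable K by exact: mD.
have mOK : measurable (O `&` K) by exact: measurableI.
pose del : R := n.+1%:R^-1; have del0 : 0 < del by rewrite invr_gt0 ltr0n.
have [a [b _]] := diam; have C1 := Cd_ge1 metric borel dbl a.
(* The measure of the superlevel set of a cut-off relative to the ball of a third of its radius; the
   exponent 3 includes [Cd ^+ 2] for this reduction. *)
pose kap := 48 * CP2 Cd CP lam * c * Cd ^+ 3.
have P1 := CP2_ge1 metric borel CP lam dbl a.
have c1 := ltW c0.
have PC : 0 <= 48 * CP2 Cd CP lam * c by rewrite mulr_ge0//; lra.
have kap0 : 0 <= kap by rewrite /kap; apply: mulr_ge0; [exact: PC|rewrite exprn_ge0//; lra].
have kap1 : kap <= 2^-1.
  have h : Cd ^+ 3 <= Cd ^+ 5 by apply: ler_weXn2l.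
  have : 48 * CP2 Cd CP lam * c * Cd ^+ 3 <= 48 * CP2 Cd CP lam * c * Cd ^+ 5.
    exact: ler_wpM2l.
  by rewrite /kap; move: c_small; lra.
have H x : exists q : R * set X, [/\ 0 < q.1, N x -> forall z, B x0 k z -> dist x z < q.1 -> ON z &
   ~ N x -> [/\ 3 * q.1 <= del, measurable q.2, A `&` B x (3 * q.1) `<=` q.2 & (mu q.2 <= (kap * mB x q.1)%:E)%E]].
  have [Nx|nNx] := pselect (N x).
    have [xk|xk] := ltP (dist x0 x) (2 * k).
      have [r r0 hr] := oN x (TN x (conj (NT _ Nx) xk)).
      by exists (r, set0); split => // _ z _ xz; exact: hr.
    exists (k, set0); split => // _ z; rewrite /dball/= => xz zk; exfalso.
    by have := dist_tri metric x0 z x; rewrite (distC metric z x); lra.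
  have [r [eta [v [Z [g [/andP[r0 rd] [mv mZ Z0 hZ] e01 e1 [ug _ sm]]]]]]] := good_eta (Ngood nNx) del0.
  have mS : measurable (B x (4 * r) `&` [set y | 2^-1 <= v y]).
    apply: measurableI; first exact: dball_measurable.
    by rewrite -[X in measurable X]setTI; exact: measurable_fun_le.
  exists (r / 3, (B x (4 * r) `&` [set y | 2^-1 <= v y]) `|` Z); split => //=; first by rewrite divr_gt0.
  move=> _; have r3 : 3 * (r / 3) = r by field.
  rewrite r3; split; [exact: ltW|exact: measurableU| |].
    move=> y [Ay xy]; have [ev|/hZ] := pselect (eta y = v y); last by right.
    by left; split; [move: xy; rewrite /dball/=; lra|rewrite /= -ev e1//; lra].
  rewrite (measureU0 (mu := mu) mS mZ Z0); apply: (le_trans sm); rewrite lee_fin.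
  have h : mB x r <= Cd ^+ 2 * mB x (r / 3).
    by apply: (mB_iter metric borel dbl); rewrite (distxx metric) expr2; lra.
  rewrite (_ : kap * _ = (48 * CP2 Cd CP lam * c * Cd) * (Cd ^+ 2 * mB x (r / 3))); last by rewrite /kap !exprS expr0; ring.
  by apply: ler_wpM2l => //; apply: mulr_ge0; [exact: PC|lra].
have [q hq] := choice H.
have q0 x : 0 < (q x).1 by case: (hq x).
have [s hs] := finite_cover metric borel dbl cplt x0 k q0.
pose p (i : 'I_(size s)) := tnth (in_tuple s) i.
pose V0 := [set i | `[< ~ N (p i) /\ B (p i) (q (p i)).1 `<=` O >]]%SET.
have [|H0 [HS Hsep Hcov]] := @finite_vitali _ _ (fun i j => dist (p i) (p j)) (fun i => distxx metric _) (fun i j => distC metric _ _)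
  (fun i => (q (p i)).1) V0; first by [].
have HP i : i \in H0 -> ~ N (p i) /\ B (p i) (q (p i)).1 `<=` O by move=> /HS; rewrite inE => /asboolP.
pose G := \big[setU/set0]_(i <- enum H0) (q (p i)).2.
have mG : measurable G.
  rewrite /G big_seq; apply: bigsetU_measurable => i; rewrite mem_enum => /HP[nN _].
  by case: (hq (p i)) => _ _ /(_ nN)[].
have sG : (mu G <= 2^-1%:E * mu O)%E.
  apply: le_trans (_ : (\sum_(i in H0) mu (q (p i)).2 <= _)%E).
    rewrite /G -[in leRHS]big_enum/=; have : all (mem H0) (enum H0) by apply/allP => i; rewrite mem_enum.
    elim: (enum _) => [|i l IH] /=; first by rewrite !big_nil measure0.
    move=> /andP[iH lH]; rewrite !big_cons; apply: le_trans (measureU2 _ _ _) _.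
    + by case: (hq (p i)) => _ _ /(_ (HP _ iH).1)[].
    + rewrite big_seq; apply: bigsetU_measurable => j /(allP lH) jH.
      by case: (hq (p j)) => _ _ /(_ (HP _ jH).1)[].
    by rewrite leeD2l// IH.
  apply: le_trans (_ : (\sum_(i in H0) 2^-1%:E * mu (B (p i) (q (p i)).1) <= _)%E).
    apply: lee_sum => i iH; have [_ _ /(_ (HP _ iH).1)[_ _ _ h]] := hq (p i).
    apply: (le_trans h); rewrite EFinM (mBE metric dbl) -!EFinM lee_fin.
    by apply: ler_wpM2r => //; exact: mB_ge0.
  rewrite -ge0_sume_distrr; last by move=> i _; exact: measure_ge0.
  apply: lee_wpmul2l; first by rewrite lee_fin.
  apply: (@measure_disj_sum _ _ _ mu) => //.
  - by move=> i; exact: dball_measurable.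
  - move=> i j iH jH [y []]; rewrite /dball/= => yi yj; apply/eqP/negPn/negP => ij.
    by have := Hsep i j iH jH ij; have := dist_tri metric (p i) y (p j); rewrite (distC metric y (p j)); lra.
  - by move=> i /HP[].
pose S := (ON `|` (O `&` K) `|` G) `&` B x0 k.
have mON := dopen_measurable borel oN.
have mS1 : measurable (ON `|` (O `&` K)) by exact: measurableU.
have mS : measurable S by apply: measurableI => //; exact: measurableU.
have [ O' [oO' SO' OB' sO']] := outer_regular metric borel dbl mS (fun y h => h.2 : B x0 k y) e30.
exists O'; split => //.
  move=> z [Az zk]; apply: SO'; split => //.
  have [xN|nON] := pselect (ON z); first by left; left.
  have [zK|nzK] := pselect (K z); first by left; right; split => //; apply: AO.
  right; have [x xs xz] := hs z zk.
  have nNx : ~ N x by move=> Nx; apply: nON; case: (hq x) => _ /(_ Nx z zk xz).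
  have [_ _ /(_ nNx)[qd mq Aq sq]] := hq x.
  have [i ip] : exists i, p i = x by have /tnthP[i ->] : x \in in_tuple s by []; exists i.
  have iV : i \in V0.
    rewrite inE; apply/asboolP; rewrite ip; split => // y xy; apply: contrapT => nOy; apply: nzK.
    rewrite /K/=; apply: le_trans (ddist_le metric z (nOy : (~` O) y)) _.
    move: xy; rewrite /dball/= => xy; have := dist_tri metric z x y; rewrite (distC metric z x) -/del.
    by have := q0 x; lra.
  have [j jH [rij dij]] := Hcov i iV; rewrite ip in rij dij.
  rewrite /G -bigcup_seq; exists j; first by rewrite /= mem_enum.
  case: (hq (p j)) => _ _ /(_ (HP _ jH).1)[_ _ Aj _]; apply: Aj; split => //; rewrite /dball/=.
  by have := dist_tri metric (p j) x z; rewrite (distC metric (p j) x); lra.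
apply: (le_trans sO'); apply: le_trans (_ : (mu (ON `|` (O `&` K) `|` G) + (e / 3)%:E <= _)%E).
  by rewrite leeD2r//; apply: le_measure; rewrite ?inE//; [exact: measurableU|move=> y []].
apply: le_trans (_ : ((mu ON + mu (O `&` K) + mu G) + (e / 3)%:E <= _)%E).
  rewrite leeD2r//; apply: le_trans (measureU2 _ _ _) _ => //; rewrite leeD2r//.
  exact: measureU2.
rewrite [e in leRHS](_ : e = e / 3 + e / 3 + e / 3); last by field.
rewrite EFinD [leRHS]addeA leeD2r// [leRHS]addeC EFinD.
by apply: leeD => //; exact: leeD.
Qed.

(** The halving is iterated inside a ball, with errors adding up to at most [e / 2]. The set [A] is
    only ever covered, never measured. *)
Lemma A_null : onull mu A.
Proof.
have local_context : True by [].
have [x0 _] := diam.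
apply: onull_sub (_ : A `<=` \bigcup_n (A `&` B x0 n.+1%:R)); last first.
  move=> y Ay; have M0 : 0 < (Num.max 1 (dist x0 y))^-1 by rewrite invr_gt0 lt_max ltr01.
  have [n hn] := invS_small M0.
  exists n => //; split => //; rewrite /dball/=; move: hn.
  by rewrite ltf_pV2 ?posrE ?ltr0n ?lt_max ?ltr01// gt_max => /andP[].
apply: onull_bigcup => n; apply: null_of_small => e e0.
have k0 : 0 < n.+1%:R :> R by rewrite ltr0n.
have e20 : 0 < e / 4 by rewrite divr_gt0.
have step j : exists O, [/\ dopen dist O, A `&` B x0 n.+1%:R `<=` O, O `<=` B x0 n.+1%:R &
    (mu O <= (mB x0 n.+1%:R / 2 ^+ j + e / 2)%:E)%E].
  elim: j => [|j [ O [oO AO OB sO]]].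
    exists (B x0 n.+1%:R); split => //; first exact: dball_open.
    by rewrite expr0 divr1 (mBE metric dbl) lee_fin; slra.
  have [ O' [oO' AO' OB' sO']] := half k0 oO AO OB e20; exists O'; split => //.
  apply: (le_trans sO'); apply: le_trans (leeD2r _ (lee_wpmul2l _ sO)) _; first by rewrite lee_fin.
  rewrite -EFinM -EFinD lee_fin le_eqVlt; apply/orP; left; apply/eqP.
  by rewrite exprS; field; rewrite expf_neq0.
have [j hj] := expr2_large (mB x0 n.+1%:R / (e / 2)).
have [ O [oO AO OB sO]] := step j; exists O; split => //; first exact: (dopen_measurable borel).
apply: (le_trans sO); rewrite lee_fin; move: hj; rewrite ler_pdivrMr ?divr_gt0// => hj.
suff : mB x0 n.+1%:R / 2 ^+ j <= e / 2 by slra.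
by rewrite ler_pdivrMr ?exprn_gt0// mulrC.
Qed.
End GoodScales.

(** * Arc length and potentials *)

Lemma lee_step (R : realType) (A B C D : \bar R) (p q r s : R) : (A <= B + p%:E)%E -> (C <= q%:E)%E ->
  (r%:E <= D)%E -> p + q <= r + s -> (A + C <= B + D + s%:E)%E.
Proof.
move=> h1 h2 h3 h4; apply: (le_trans (leeD h1 h2)); rewrite -addeA -EFinD.
apply: (@le_trans _ _ (B + (r + s)%:E)%E); first by apply: leeD2l; rewrite lee_fin.
by rewrite EFinD addeA; apply: leeD2r; exact: leeD2l.
Qed.

Section RealIntegrals.
Variable R : realType.
Local Notation leb := (@lebesgue_measure R).

Lemma integral_reflect (f : R -> \bar R) (l : R) :
  measurable_fun setT f -> (forall x, (0 <= f x)%E) ->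
  (\int[leb]_(t in `[0%R, l]) f (l - t)%R = \int[leb]_(t in `[0%R, l]) f t)%E.
Proof.
have local_context : True by [].
move=> mf f0.
pose s : measurableTypeR R -> measurableTypeR R := fun t => l - t.
have ms : measurable_fun setT s by apply: measurable_funB.
have E (A : set R) : measurable A -> pushforward leb s A = leb A.
  move=> mA; apply/esym; apply: (@lebesgue_measure_unique R (pushforward leb s)) mA.
  move=> _ [[x y] _ <-]; rewrite /= /pushforward.
  rewrite (_ : _ @^-1` _ = `[l - y, l - x[%classic); last first.
    by apply/seteqP; split => t /=; rewrite !in_itv/= /s => /andP[h1 h2]; apply/andP; split; slra.
  rewrite !lebesgue_measure_itv/= !lte_fin ltrD2l ltrN2; case: ifPn => // _.
  by rewrite -!EFinB; congr EFin; ring.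
have pre : s @^-1` `[0, l]%classic = `[0, l]%classic.
  by apply/seteqP; split => t /=; rewrite !in_itv/= /s => /andP[h1 h2]; apply/andP; split; slra.
have mab : measurable (`[0, l]%classic : set R) by [].
have := @ge0_integral_pushforward _ _ (measurableTypeR R) (measurableTypeR R) R s ms leb _ f mab (measurable_funTS mf) (fun x _ => f0 x).
rewrite pre => <-; apply: eq_measure_integral => A mA _; exact: E.
Qed.

Lemma integral_split (f : R -> \bar R) (a b c : R) : measurable_fun setT f -> (forall x, (0 <= f x)%E) ->
  a <= b -> b <= c ->
  (\int[leb]_(t in `[a, c]) f t = \int[leb]_(t in `[a, b]) f t + \int[leb]_(t in `[b, c]) f t)%E.
Proof.
move=> mf f0 ab bc.
rewrite -[X in (_ + X)%E](@integral_itv_obnd_cbnd _ b (BRight c)); last exact: measurable_funTS.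
rewrite -ge0_integral_setU//; [congr integral| exact: measurable_funTS |].
  apply/seteqP; split => t /=; rewrite !in_itv/=.
    move=> /andP[h1 h2].
    by have [tb|bt] := leP t b; [left; rewrite h1|right].
  move=> [] /andP[h1 h2]; first by rewrite h1 (le_trans h2).
  by rewrite h2 andbT (le_trans ab)// ltW.
rewrite disj_set2E; apply/eqP/seteqP; split => // t [] /=; rewrite !in_itv/= => /andP[_ tb] /andP[bt _].
by move: tb; rewrite leNgt bt.
Qed.

Lemma integral_le_cst (f : R -> \bar R) (a b k : R) : measurable_fun setT f -> (forall x, (0 <= f x)%E) ->
  a <= b -> 0 <= k -> (forall t, a <= t -> t <= b -> (f t <= k%:E)%E) ->
  (\int[leb]_(t in `[a, b]) f t <= (k * (b - a))%:E)%E.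
Proof.
move=> mf f0 ab k0 hf.
apply: (@le_trans _ _ (\int[leb]_(t in `[a, b]) k%:E)%E).
  apply: ge0_le_integral => //; [exact: measurable_funTS|].
  by move=> t /=; rewrite in_itv/= => /andP[]; exact: hf.
rewrite integral_cst// /= lebesgue_measure_itv/= lte_fin; case: ltP => // ba.
by rewrite mule0 lee_fin mulr_ge0//; lra.
Qed.

Lemma integral_ge_cst (f : R -> \bar R) (a b k : R) : measurable_fun setT f -> (forall x, (0 <= f x)%E) ->
  a <= b -> (forall t, a <= t -> t <= b -> (k%:E <= f t)%E) ->
  ((k * (b - a))%:E <= \int[leb]_(t in `[a, b]) f t)%E.
Proof.
have local_context : True by [].
move=> mf f0 ab hf.
have [k0|k0] := leP 0 k; last first.
  apply: le_trans (_ : (0 <= _)%E); last exact: integral_ge0.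
  by rewrite lee_fin mulr_le0_ge0//; [exact: ltW|slra].
apply: (@le_trans _ _ (\int[leb]_(t in `[a, b]) k%:E)%E); last first.
  apply: ge0_le_integral => //; [exact: measurable_funTS|].
  by move=> t /=; rewrite in_itv/= => /andP[]; exact: hf.
rewrite integral_cst// /= lebesgue_measure_itv/= lte_fin; case: ltP => // ba.
by rewrite mule0 lee_fin (_ : b - a = 0) ?mulr0//; slra.
Qed.

(** Riemann sums: on a step of length [h] both integrands differ from [f (ell a)] by at most
    [K * h], and the interval on the left is no longer than the one on the right, so a step costs an
    error of [2 * K * h ^+ 2]. It compares the integral along the arc-length parametrization with
    that along the original path. *)
Lemma integral_speed (f ell : R -> R) (K l : R) : 0 <= K -> 0 <= l -> (forall t, 0 <= f t) ->
  (forall s t, `|f s - f t| <= K * `|s - t|) -> ell 0 = 0 ->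
  (forall s t, s <= t -> 0 <= ell t - ell s <= t - s) ->
  measurable_fun setT f -> measurable_fun setT ell ->
  (\int[leb]_(t in `[0%R, ell l]) (f t)%:E <= \int[leb]_(t in `[0%R, l]) (f (ell t))%:E)%E.
Proof.
have local_context : True by [].
move=> K0 l0 f0 fK e0 eL mf me.
have mf' : measurable_fun setT (EFin \o f) by exact/measurable_EFinP.
have mfe : measurable_fun setT (EFin \o (f \o ell)) by apply/measurable_EFinP; exact: measurableT_comp.
have f0' t : (0 <= (f t)%:E)%E by rewrite lee_fin.
have step h (n : nat) : 0 <= h -> (\int[leb]_(t in `[0%R, ell (n%:R * h)%R]) (f t)%:E <=
   \int[leb]_(t in `[0%R, (n%:R * h)%R]) (f (ell t))%:E + (n%:R * (2 * K * h ^+ 2))%:E)%E.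
  move=> h0; elim: n => [|n IH].
    by rewrite !mul0r e0 set_itv1 !integral_set1 adde0.
  have s1 : n%:R * h <= n.+1%:R * h by rewrite ler_wpM2r// ler_nat.
  have /andP[d0 d1] := eL _ _ s1; have dh : n.+1%:R * h - n%:R * h = h by rewrite -natr1; ring.
  have nh0 : 0 <= n%:R * h by rewrite mulr_ge0.
  have /andP[en0 _] := eL _ _ nh0; rewrite e0 subr0 in en0.
  rewrite dh in d1; have eN : n.+1%:R * (2 * K * h ^+ 2) = n%:R * (2 * K * h ^+ 2) + 2 * K * h ^+ 2.
    by rewrite -natr1; ring.
  rewrite eN; set a := n%:R * h in s1 d0 d1 dh nh0 en0 IH *; set b := n.+1%:R * h in s1 d0 d1 dh *.
  have eab : ell a <= ell b by slra.
  rewrite (integral_split mf' f0' en0 eab) (integral_split mfe (fun t => f0' _) nh0 s1).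
  have near s t : `|s - t| <= h -> f s <= f t + K * h.
    move=> st; have := fK s t; have : K * `|s - t| <= K * h by rewrite ler_wpM2l.
    by have := ler_norm (f s - f t); slra.
  have u1 : (\int[leb]_(t in `[ell a, ell b]) (f t)%:E <= ((f (ell a) + K * h) * (ell b - ell a))%:E)%E.
    apply: integral_le_cst => //; first by rewrite addr_ge0// mulr_ge0.
    by move=> t t1 t2; rewrite lee_fin; apply: near; rewrite ger0_norm; slra.
  have u2 : (((f (ell a) - K * h) * (b - a))%:E <= \int[leb]_(t in `[a, b]) (f (ell t))%:E)%E.
    apply: (integral_ge_cst mfe (fun t => f0' _) s1) => t t1 t2; rewrite lee_fin.
    have /andP[q1 q2] := eL _ _ t1.
    by rewrite lerBlDr; apply: near; rewrite ler0_norm; slra.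
  apply: (lee_step IH u1 u2).
  have fd : f (ell a) * (ell b - ell a) <= f (ell a) * h by rewrite ler_wpM2l.
  have kd : K * h * (ell b - ell a) <= K * h * h by rewrite ler_wpM2l// mulr_ge0.
  by rewrite dh mulrDl mulrBl expr2; slra.
apply/lee_addgt0Pr => e e_0.
have [->|ln0] := eqVneq l 0; first by rewrite e0 set_itv1 !integral_set1 add0e lee_fin ltW.
have lp : 0 < l by rewrite lt_def ln0.
have C0 : 0 < 2 * K * l ^+ 2 + 1 by rewrite ltr_wpDl// !mulr_ge0// sqr_ge0.
have [n hn] := invS_small (divr_gt0 e_0 C0).
have h0 : 0 <= l / n.+1%:R by rewrite divr_ge0.
have := step _ n.+1 h0; rewrite mulrC divfK ?pnatr_eq0// => /le_trans; apply; apply: leeD2l.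
rewrite lee_fin; rewrite ltr_pdivlMr// in hn.
rewrite (_ : _ * _ = n.+1%:R^-1 * (2 * K * l ^+ 2)); last by field; rewrite addrC natr1 pnatr_eq0.
apply: le_trans (ltW hn); rewrite ler_wpM2l ?invr_ge0//; slra.
Qed.
End RealIntegrals.

Section ArcLength.
Variables (R : realType) (d : measure_display) (X : measurableType d) (dist : X -> X -> R).
Hypothesis metric : is_metric dist.
Variable g : R -> X.
Hypothesis gL : curve_lip dist g.

Definition partition_sum (n : nat) (ts : nat -> R) := \sum_(i < n) dist (g (ts i)) (g (ts i.+1)).

Lemma partition_mono (n : nat) (ts : nat -> R) i j : (forall i, (i < n)%N -> ts i <= ts i.+1) ->
  (i <= j <= n)%N -> ts i <= ts j.
Proof.
move=> h /andP[]; elim: j => [|j IH]; first by rewrite leqn0 => /eqP->.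
rewrite leq_eqVlt => /orP[/eqP->//|]; rewrite ltnS => ij jn.
by apply: le_trans (IH ij (ltnW jn)) _; exact: h.
Qed.

Lemma partition_sum_le n ts : (forall i, (i < n)%N -> ts i <= ts i.+1) -> partition_sum n ts <= ts n - ts 0%N.
Proof.
rewrite /partition_sum; elim: n => [|n IH] h; first by rewrite big_ord0 subrr.
rewrite big_ord_recr/=; have := IH (fun i hi => h i (ltnW hi)); have := gL (h n (ltnSn n)); lra.
Qed.

Lemma curve_len_le s t : s <= t -> (curve_len dist g s t <= (t - s)%:E)%E.
Proof.
move=> st; apply: ge_ereal_sup => _ [n [ts [h0 hn hm ->]]]; rewrite lee_fin -h0 -hn.
exact: partition_sum_le.
Qed.

Lemma curve_len_dist s t : s <= t -> ((dist (g s) (g t))%:E <= curve_len dist g s t)%E.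
Proof.
move=> st; apply: ereal_sup_ubound; exists 1%N, (fun i => if i == 0%N then s else t); split => //.
  by move=> i; rewrite ltnS leqn0 => /eqP->.
by rewrite big_ord_recr big_ord0/= add0r.
Qed.

Lemma curve_len_fin s t : s <= t -> curve_len dist g s t \is a fin_num.
Proof.
move=> st; rewrite ge0_fin_numE; first by apply: le_lt_trans (curve_len_le st) (ltry _).
by apply: le_trans (curve_len_dist st); rewrite lee_fin; exact: (dist_ge0 metric).
Qed.

Definition clenr s t := fine (curve_len dist g s t).

Lemma clenrE s t : s <= t -> (clenr s t)%:E = curve_len dist g s t.
Proof. by move=> st; rewrite fineK// curve_len_fin. Qed.

Lemma clenr_ub s t n ts : s <= t -> ts 0%N = s -> ts n = t -> (forall i, (i < n)%N -> ts i <= ts i.+1) ->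
  partition_sum n ts <= clenr s t.
Proof. by move=> st h0 hn hm; rewrite -lee_fin clenrE//; apply: ereal_sup_ubound; exists n, ts. Qed.

Lemma clenr_lb s t k : s <= t -> (forall n ts, ts 0%N = s -> ts n = t -> (forall i, (i < n)%N -> ts i <= ts i.+1) ->
  partition_sum n ts <= k) -> clenr s t <= k.
Proof.
move=> st h; rewrite -lee_fin clenrE//; apply: ge_ereal_sup => _ [n [ts [h0 hn hm ->]]].
by rewrite lee_fin; exact: h.
Qed.

(** A partition is cut at [b] by taking minimum and maximum with [b], which loses nothing by the
    triangle inequality; conversely two partitions are concatenated. *)
Lemma clenr_add a b c : a <= b -> b <= c -> clenr a c = clenr a b + clenr b c.
Proof.
move=> ab bc; have ac := le_trans ab bc; apply/eqP; rewrite eq_le; apply/andP; split.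
  apply: clenr_lb => // n ts h0 hn hm.
  have u : partition_sum n (fun i => Num.min (ts i) b) <= clenr a b.
    apply: clenr_ub => //; [by rewrite h0; apply/min_idPl|by rewrite hn; apply/min_idPr|].
    by move=> i hi; rewrite le_min !ge_min hm//= lexx orbT.
  have v : partition_sum n (fun i => Num.max (ts i) b) <= clenr b c.
    apply: clenr_ub => //; [by rewrite h0; apply/max_idPr|by rewrite hn; apply/max_idPl|].
    by move=> i hi; rewrite ge_max !le_max hm//= lexx orbT.
  apply: le_trans (lerD u v); rewrite -big_split/=; apply: ler_sum => i _.
  have := hm i (ltn_ord i); set x := ts i; set y := ts i.+1 => xy.
  have [xb|bx] := leP x b; have [yb|yb] := leP y b; rewrite ?(distxx metric) ?addr0 ?add0r//; first exact: (dist_tri metric).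
  by move: bx; rewrite ltNge (le_trans xy yb).
rewrite -lerBrDr; apply: clenr_lb => // n ts h0 hn hm; rewrite lerBrDr -lerBrDl.
apply: clenr_lb => // m us k0 km hk; rewrite lerBrDl.
pose w i := if (i <= n)%N then ts i else us (i - n)%N.
apply: le_trans (_ : partition_sum (n + m) w <= _); last first.
  apply: clenr_ub => //.
  - rewrite /w; case: leqP => [h|_]; last by rewrite addKn.
    have m0 : m = 0%N by apply/eqP; rewrite -leqn0 -(leq_add2l n) addn0.
    by rewrite m0 addn0 hn -km m0 k0.
  - move=> i hi; rewrite /w; case: leqP => [h1|h1]; case: leqP => [h2|h2].
    + have e : i = n by apply/eqP; rewrite eqn_leq h2.
      move: hi; rewrite e subSnn hn -k0 => hi; apply: hk.
      by rewrite -(ltn_add2l n) addn0.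
    + by rewrite subSn//; apply: hk; rewrite -(ltn_add2l n) subnKC.
    + exact: hm.
    + by move: (ltn_trans h1 h2); rewrite ltnn.
rewrite /partition_sum big_split_ord/=; apply: lerD; apply: ler_sum => i _; rewrite /w.
  by rewrite /= ltnW ltn_ord.
rewrite /=; case: leqP => [h1|]; last by rewrite ltnNge leq_addr.
rewrite -addnS !addKn; case: leqP => [h2|h2].
  have i0 : (i : nat) = 0%N by apply/eqP; rewrite -leqn0 -(leq_add2l n) addn0.
  by rewrite i0 addn0 hn -k0.
by rewrite lexx.
Qed.

Variable l : R.
Hypothesis l0 : 0 <= l.
Definition arc_param (t : R) := clenr 0 (clamp l t).

Lemma arc_param_lip s t : s <= t -> 0 <= arc_param t - arc_param s <= t - s.
Proof.
move=> st; have c1 := clamp_ge0 l s; have c2 := clamp_mono l st.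
rewrite /arc_param (clenr_add c1 c2) addrAC subrr add0r; apply/andP; split.
  by rewrite -lee_fin clenrE//; apply: le_trans (curve_len_dist c2); rewrite lee_fin; exact: (dist_ge0 metric).
by apply: (@le_trans _ _ (clamp l t - clamp l s)); [rewrite -lee_fin clenrE//; exact: curve_len_le|exact: clamp_lip].
Qed.

Lemma arc_param_continuous : continuous arc_param.
Proof.
move=> x; apply/(@cvgrPdist_le _ R^o) => e e0; near=> y.
have xy : `|x - y| <= e by near: y; apply: cvgr_dist_le.
apply: le_trans xy; have [h|/ltW h] := leP x y; have /andP[h1 h2] := arc_param_lip h.
  by rewrite distrC ger0_norm// distrC (le_trans h2)// ler_norm.
by rewrite ger0_norm// (le_trans h2)// ler_norm.
Unshelve. all: by end_near.
Qed.

Lemma arc_param0 : arc_param 0 = 0.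
Proof.
rewrite /arc_param clamp_id//; apply/eqP; rewrite eq_le; apply/andP; split.
  by rewrite -lee_fin clenrE//; apply: le_trans (curve_len_le (lexx 0)) _; rewrite subrr.
by rewrite -lee_fin clenrE//; apply: le_trans (curve_len_dist (lexx 0)); rewrite lee_fin; exact: (dist_ge0 metric).
Qed.

Lemma arc_param_onto s : 0 <= s -> s <= arc_param l -> exists t, [/\ 0 <= t, t <= l & arc_param t = s].
Proof.
move=> s0 sl; have a0 := arc_param0.
have [||t tl ts] := @IVT R arc_param 0 l s l0.
- by apply: continuous_subspaceT; exact: arc_param_continuous.
- by rewrite a0 ge_min s0 le_max sl orbT.
by exists t; move: tl; rewrite in_itv/= => /andP[].
Qed.

(** [T] picks a parameter at which a given length is reached. Parameters with equal length have the
    same image, so the choice does not matter and [g \o T] has arc-length speed. *)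
Lemma reparam : g 0 <> g l -> exists c, [/\ arc_curve dist c, cmap c 0 = g 0, clen c = arc_param l &
  forall t, 0 <= t -> t <= l -> cmap c (arc_param t) = g t].
Proof.
have local_context : True by [].
move=> gl; have [T hT] : {T : R -> R & forall s, 0 <= s -> s <= arc_param l -> [/\ 0 <= T s, T s <= l & arc_param (T s) = s]}.
  apply: (@choice R R (fun s t => 0 <= s -> s <= arc_param l -> [/\ 0 <= t, t <= l & arc_param t = s])) => s.
  have [h|h] := pselect (0 <= s /\ s <= arc_param l); last by exists 0 => h1 h2; case: h.
  by case: h => h1 h2; have [t] := arc_param_onto h1 h2; exists t.
have same s t : 0 <= s -> s <= t -> t <= l -> dist (g s) (g t) <= arc_param t - arc_param s.
  move=> s0 st tl; have t0 := le_trans s0 st; rewrite /arc_param !clamp_id//; last exact: le_trans tl.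
  by rewrite (clenr_add s0 st) addrAC subrr add0r -lee_fin clenrE//; exact: curve_len_dist.
have cE t : 0 <= t -> t <= l -> g (T (arc_param t)) = g t.
  move=> t0 tl; have /andP[p1 _] := arc_param_lip t0; have /andP[p2 _] := arc_param_lip tl.
  have a0 := arc_param0.
  have [||q1 q2 q3] := hT (arc_param t); [slra|slra|].
  apply/(metric.2.1); apply/eqP; rewrite eq_le (dist_ge0 metric) andbT.
  have [h|/ltW h] := leP (T (arc_param t)) t; first by have := same _ _ q1 h tl; rewrite q3 subrr.
  by have := same _ _ t0 h q2; rewrite q3 subrr (distC metric).
have a0 := arc_param0.
exists (Curve (arc_param l) (g \o T)); split => //=.
- split => /=.
    have := same _ _ (lexx 0) l0 (lexx l); rewrite a0 subr0; apply: lt_le_trans.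
    by rewrite lt_def (dist_ge0 metric) andbT; apply/eqP => /(metric.2.1 _ _).1.
  move=> s t s0 st tl; have t0 := le_trans s0 st; have sl := le_trans st tl.
  have [p1 p2 p3] := hT s s0 sl; have [q1 q2 q3] := hT t t0 tl.
  have Tlip a b : 0 <= a -> a <= b -> b <= arc_param l -> dist (g (T a)) (g (T b)) <= b - a.
    move=> a1 ab bl; have [u1 u2 u3] := hT a a1 (le_trans ab bl); have [v1 v2 v3] := hT b (le_trans a1 ab) bl.
    have [h|h] := leP (T a) (T b); first by have := same _ _ u1 h v2; rewrite u3 v3.
    by have := same _ _ v1 (ltW h) u2; rewrite u3 v3 (distC metric); slra.
  apply/eqP; rewrite eq_le; apply/andP; split.
    apply: ge_ereal_sup => _ [n [ts [h0 hn hm ->]]]; rewrite lee_fin -h0 -hn.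
    rewrite -telescope_sumr//big_mkord; apply: ler_sum => i _.
    have m1 : s <= ts i by rewrite -h0; apply: (partition_mono hm); rewrite leq0n ltnW.
    have m2 : ts i.+1 <= t by rewrite -hn; apply: (partition_mono hm); rewrite ltn_ord leqnn.
    by apply: Tlip; [exact: le_trans m1|exact: hm|exact: le_trans m2 tl].
  have Tst : T s <= T t.
    rewrite leNgt; apply/negP => h; have /andP[w _] := arc_param_lip (ltW h); rewrite p3 q3 in w.
    have st' : s = t by slra.
    by rewrite st' ltxx in h.
  have -> : t - s = clenr (T s) (T t).
    have := clenr_add p1 Tst; move: q3 p3; rewrite /arc_param !clamp_id// => -> ->; slra.
  rewrite clenrE//; apply: ge_ereal_sup => _ [n [ts [h0 hn hm ->]]].
  apply: ereal_sup_ubound; exists n, (arc_param \o ts); split => /=; rewrite ?h0 ?hn//.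
    by move=> i /hm h; have /andP[] := arc_param_lip h; slra.
  congr EFin; apply: eq_bigr => i _.
  have m1 : T s <= ts i by rewrite -h0; apply: (partition_mono hm); rewrite leq0n ltnW.
  have m2 : ts i.+1 <= T t by rewrite -hn; apply: (partition_mono hm); rewrite ltn_ord leqnn.
  have m3 := hm i (ltn_ord i).
  by rewrite !cE//; slra.
- by have := cE 0 (lexx 0) l0; rewrite a0.
Qed.
End ArcLength.

Lemma ultra_push (T U : Type) (f : T -> U) (F : set_system T) : UltraFilter F -> UltraFilter (f @ F).
Proof.
move=> UF; apply: Build_UltraFilter => G PG FG; apply/seteqP; split => // A GA.
have [//|h] := in_ultra_setVsetC (f @^-1` A) UF.
have : G (~` A) by apply: FG.
by move=> /(filterI GA)/filter_ex[y []].
Qed.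

Section Phi.
Variables (R : realType) (d : measure_display) (X : measurableType d) (dist : X -> X -> R).
Hypothesis metric : is_metric dist.
Hypothesis borel : borel_for dist.
Hypothesis cplt : dcomplete dist.
Variable mu : {measure set X -> \bar R}.
Variable Cd : R.
Hypothesis dbl : doubling dist mu Cd.
Local Notation B := (dball dist).
Local Notation leb := (@lebesgue_measure R).

(** All parameters and the lengths converge along one ultrafilter on the indices, finer than the
    eventual filter. A grid of mesh [e / 4] and the Lipschitz bounds make a suitable index uniformly
    close. *)
Lemma arzela (x0 : X) (L r : R) (g : nat -> R -> X) (l : nat -> R) : (forall n, curve_lip dist (g n)) ->
  (forall n, 0 <= l n <= L) -> (forall n, dist x0 (g n 0) < r) ->
  exists (h : R -> X) (m : R), [/\ curve_lip dist h, 0 <= m <= L &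
   forall e, 0 < e -> forall n0, exists n, [/\ (n0 <= n)%N, `|l n - m| <= e & forall t, 0 <= t -> t <= L -> dist (g n t) (h t) <= e]].
Proof.
have local_context : True by [].
move=> gL lL gr; have [U [UF hU]] := ultraFilterLemma eventually_filter.
have UU : ProperFilter U := @ultra_proper _ U UF.
have UT : U setT by exact: filterT.
have UI (P Q : set nat) : U P -> U Q -> exists n, P n /\ Q n by move=> a b; exact: filter_ex (filterI a b).
have hlim t : exists y, forall e, 0 < e -> U [set n | dist y (g n t) < e].
  have [|y hy] := @ultra_lim _ _ _ _ metric borel mu Cd dbl cplt _ x0 (r + `|t| + 1) (ultra_push (fun n => g n t) UF).
    suff : U [set n | dist x0 (g n t) < r + `|t| + 1] by [].
    apply: filterS UT => n _ /=.
    have := dist_tri metric x0 (g n 0) (g n t); have := curve_lip_norm metric 0 t (gL n).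
    by rewrite sub0r normrN; have := gr n; slra.
  by exists y => e e0; exact: hy.
have [h hh] := choice hlim.
have [m [m0L hm]] : exists m, 0 <= m <= L /\ forall e, 0 < e -> U [set n | `|l n - m| <= e].
  have := @segment_compact R 0 L; rewrite compact_ultra => /(_ _ (ultra_push l UF)) [].
    suff : U [set n | `[0, L]%classic (l n)] by [].
    by apply: filterS UT => n _ /=; rewrite in_itv/= lL.
  move=> m [mL hm]; exists m; split; first by move: mL; rewrite /= in_itv.
  move=> e e0; have := hm _ (nbhsx_ballx m e e0); rewrite /= => hU'.
  suff : [set n | ball m e (l n)] `<=` [set n | `|l n - m| <= e] by move/filterS; apply; exact: hU'.
  by move=> n; rewrite /ball/= distrC => /ltW.
exists h, m; split => //.
  move=> s t st; apply/ler_addgt0Pr => e e0; have e20 : 0 < e / 2 by rewrite divr_gt0.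
  have [n [/= h1 h2]] := UI _ _ (hh s _ e20) (hh t _ e20).
  have := dist_tri metric (h s) (g n s) (h t); have := dist_tri metric (g n s) (g n t) (h t).
  rewrite (distC metric (g n t)); have := gL n s t st; slra.
move=> e e0 n0; have e40 : 0 < e / 4 by rewrite divr_gt0.
have L0 : 0 <= L by have /andP[/le_trans h1 /h1] := lL 0%N.
pose M := (Num.truncn (L / (e / 4))).+1.
have hgrid : U [set n | forall k : 'I_M, dist (h (k%:R * (e / 4))) (g n (k%:R * (e / 4))) < e / 4].
  apply: filter_forall => k; exact: hh.
have Un0 : U [set n | (n0 <= n)%N] by apply: hU; exact: nbhs_infty_ge.
have [n [/= [h1 h2] h3]] := UI _ _ (filterI Un0 (hm _ e0)) hgrid.
exists n; split => // t t0 tL.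
have q0 : 0 <= t / (e / 4) by rewrite divr_ge0// ltW.
have /andP[k1 k2] := truncn_itv q0.
have kM : (Num.truncn (t / (e / 4)) < M)%N by rewrite /M ltnS le_truncn// ler_pM2r// invr_gt0.
rewrite ler_pdivlMr// in k1; rewrite ltr_pdivrMr// -natr1 mulrDl mul1r in k2.
have := h3 (Ordinal kM); rewrite /=; set s := _%:R * _ in k1 k2 * => h4.
have st := k1; have := gL n s t st.
have hs : dist (h s) (h t) <= t - s.
  apply/ler_addgt0Pr => e' e'0; have e'20 : 0 < e' / 2 by rewrite divr_gt0.
  have [n' [/= w1 w2]] := UI _ _ (hh s _ e'20) (hh t _ e'20).
  have := dist_tri metric (h s) (g n' s) (h t); have := dist_tri metric (g n' s) (g n' t) (h t).
  rewrite (distC metric (g n' t)); have := gL n' s t st; slra.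
have := dist_tri metric (g n t) (g n s) (h t); have := dist_tri metric (g n s) (h s) (h t).
rewrite (distC metric (g n t) (g n s)) (distC metric (g n s) (h s)); slra.
Qed.

Variables (Psi : nat -> X -> R) (K : nat -> R) (c0 : R) (F : set X).
Hypothesis PsiL : forall j, lip dist (Psi j) (K j).
Hypothesis Psi_nd : forall x j k, (j <= k)%N -> Psi j x <= Psi k x.
Hypothesis c0_gt0 : 0 < c0.
Hypothesis Psi_c0 : forall j x, c0 <= Psi j x.
Hypothesis F_closed : dopen dist (~` F).

(** An increasing limit of Lipschitz functions is lower semicontinuous, and the approximation passes
    this on to its integrals along converging curves. *)
Definition supgrad (x : X) : \bar R := limn (fun j => (Psi j x)%:E).

Let nd x : {homo (fun j => (Psi j x)%:E) : n m / (n <= m)%N >-> (n <= m)%E}.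
Proof. by move=> j k jk; rewrite lee_fin Psi_nd. Qed.

Lemma supgradE x : supgrad x = ereal_sup (range (fun j => (Psi j x)%:E)).
Proof. by apply/cvg_lim => //; exact: ereal_nondecreasing_cvgn. Qed.

Lemma supgrad_ge j x : ((Psi j x)%:E <= supgrad x)%E.
Proof. by rewrite supgradE; apply: ereal_sup_ubound; exists j. Qed.

Lemma supgrad_le x b : (forall j, ((Psi j x)%:E <= b)%E) -> (supgrad x <= b)%E.
Proof. by move=> h; rewrite supgradE; apply: ge_ereal_sup => _ [j _ <-]. Qed.

Lemma bn_supgrad : borel_nonneg supgrad.
Proof.
split; last by move=> x; apply: le_trans (supgrad_ge 0 x); rewrite lee_fin; apply: le_trans (Psi_c0 _ _); exact: ltW.
apply: (lsc_measurable borel) => a.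
have -> : [set x | (a%:E < supgrad x)%E] = \bigcup_j [set x | a < Psi j x].
  apply/seteqP; split => x /=.
    move=> ax; apply: contrapT => h; move: ax; rewrite ltNge => /negP; apply; apply: supgrad_le => j.
    by rewrite lee_fin leNgt; apply/negP => ha; apply: h; exists j.
  by move=> [j _ /= h]; apply: lt_le_trans (supgrad_ge j x); rewrite lte_fin.
by apply: dopen_bigcup => j _; apply: lip_open => //; exact: PsiL.
Qed.

Let mg (g : R -> X) : curve_lip dist g -> measurable_fun setT g.
Proof. exact: curve_lip_measurable. Qed.
Let mP (g : R -> X) j : curve_lip dist g -> measurable_fun setT (fun t => (Psi j (g t))%:E).
Proof.
move=> gl; apply/measurable_EFinP.
by apply: (measurableT_comp (lip_measurable metric borel (PsiL j))); exact: mg.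
Qed.
Let ms (g : R -> X) : curve_lip dist g -> measurable_fun setT (fun t => supgrad (g t)).
Proof. by move=> gl; apply: (measurableT_comp bn_supgrad.1); exact: mg. Qed.
Let P0 j x : (0 <= (Psi j x)%:E)%E.
Proof. by rewrite lee_fin; apply: le_trans (Psi_c0 _ _); exact: ltW. Qed.

Lemma int_supgrad_le (g : R -> X) l b : curve_lip dist g ->
  (forall j, (\int[leb]_(t in `[0%R, l]) (Psi j (g t))%:E <= b)%E) ->
  (\int[leb]_(t in `[0%R, l]) supgrad (g t) <= b)%E.
Proof.
move=> gl h; have mI : measurable (`[0, l]%classic : set R) by [].
rewrite /supgrad (@monotone_convergence _ _ _ leb _ mI (fun j t => (Psi j (g t))%:E)).
- apply: lime_le; last by near=> j.
  apply: ereal_nondecreasing_is_cvgn => j k jk; apply: ge0_le_integral => //.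
  + exact: measurable_funTS (mP _ gl).
  + exact: measurable_funTS (mP _ gl).
  + by move=> t _; exact: nd.
- by move=> j; exact: measurable_funTS (mP _ gl).
- by [].
- by move=> t _; exact: nd.
Unshelve. all: by end_near.
Qed.

Definition pathcost (g : R -> X) (l : R) := (\int[leb]_(t in `[0%R, l]) supgrad (g t))%E.
(** The competitors are 1-Lipschitz paths and not arc-length curves: this class is closed under
    uniform limits and under concatenation. *)
Definition costs (x : X) : set (\bar R) := [set e | exists (g : R -> X) l,
  [/\ curve_lip dist g, 0 <= l, g 0 = x, F (g l) & e = pathcost g l]].
Definition potential (x : X) : R := fine (mine 1%E (ereal_inf (costs x))).

Lemma pathcost_ge0 g l : (0 <= pathcost g l)%E.
Proof. by apply: integral_ge0 => t _; exact: bn_supgrad.2. Qed.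

Lemma costs_ge0 x : (0 <= ereal_inf (costs x))%E.
Proof. by apply: le_ereal_inf_tmp => _ [g [l [_ _ _ _ ->]]]; exact: pathcost_ge0. Qed.

Lemma potentialE x : (potential x)%:E = mine 1%E (ereal_inf (costs x)).
Proof.
rewrite fineK// ge0_fin_numE; first by rewrite gt_min ltry.
by rewrite le_min lee01 costs_ge0.
Qed.

Lemma potential01 x : 0 <= potential x <= 1.
Proof. by rewrite -!lee_fin potentialE le_min lee01 costs_ge0 ge_min lexx. Qed.

Lemma potential_F x : F x -> potential x = 0.
Proof.
move=> Fx; apply/eqP; rewrite eq_le; have /andP[-> _] := potential01 x; rewrite andbT -lee_fin potentialE.
rewrite ge_min; apply/orP; right; apply: ereal_inf_lbound; exists (fun=> x), 0; split => //.
  by move=> s t st; rewrite (distxx metric) subr_ge0.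
by rewrite /pathcost set_itv1 integral_set1.
Qed.

Lemma potential_path g l : curve_lip dist g -> 0 <= l ->
  ((potential (g 0))%:E <= pathcost g l + (potential (g l))%:E)%E.
Proof.
have local_context : True by [].
move=> gl l0; rewrite !potentialE; have p0 := pathcost_ge0 g l.
have [h|h] := leP 1%E (ereal_inf (costs (g l))).
  by apply: (@le_trans _ _ 1%E); [rewrite ge_min lexx|rewrite leeDr].
have [fin|inf] := ltP (pathcost g l) +oo%E; last first.
  apply: (@le_trans _ _ +oo%E); first exact: leey.
  have -> : pathcost g l = +oo%E by apply/eqP; rewrite eq_le leey.
  by rewrite addye// -ltNye (lt_le_trans _ (costs_ge0 _))// ltNyr.
rewrite ge_min; apply/orP; right; have pf : pathcost g l \is a fin_num by rewrite ge0_fin_numE.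
rewrite -leeBlDl//; apply: le_ereal_inf_tmp => _ [g2 [l2 [gl2 l20 e2 Fl ->]]]; rewrite leeBlDl//.
pose w t := if t <= l then g t else g2 (t - l).
have wl : curve_lip dist w.
  move=> s t st; rewrite /w; have [sl|sl] := leP s l; have [tl|tl] := leP t l; last 1 first.
  - by have := gl2 (s - l) (t - l); rewrite lerB// => /(_ isT); slra.
  - exact: gl.
  - have := dist_tri metric (g s) (g l) (g2 (t - l)); have := gl s l sl.
    by have := gl2 0 (t - l); rewrite e2 subr_ge0 (ltW tl) => /(_ isT); slra.
  - by move: sl; rewrite ltNge (le_trans st tl).
have ll : 0 <= l + l2 by rewrite addr_ge0.
have l_le : l <= l + l2 by rewrite lerDl.
have w1 t : t <= l -> w t = g t by rewrite /w => ->.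
have w2 t : 0 <= t -> w (l + t) = g2 t.
  rewrite /w => t0; case: leP => h1; last by rewrite addrAC subrr add0r.
  have t00 : t = 0 by slra.
  by rewrite t00 addr0 e2.
apply: (@le_trans _ _ (pathcost w (l + l2))).
  apply: ereal_inf_lbound; exists w, (l + l2); split => //; first by rewrite w1.
  by rewrite w2.
rewrite /pathcost (integral_split (ms wl) (fun t => bn_supgrad.2 _) l0 l_le) le_eqVlt; apply/orP; left; apply/eqP.
congr (_ + _)%E.
  by apply: eq_integral => t; rewrite inE/= in_itv/= => /andP[_ tl]; rewrite w1.
have := @integral_shift R (fun t => supgrad (w t)) l (l + l2) (ms wl) (fun t => bn_supgrad.2 _).
rewrite addrAC subrr add0r => <-.
by apply: eq_integral => t; rewrite inE/= in_itv/= => /andP[t0 _]; rewrite w2.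
Qed.

Lemma potential_ug : is_ug dist setT potential supgrad.
Proof.
have local_context : True by [].
split; first exact: bn_supgrad.
move=> c ac _; have [l0 _] := ac; have cl := ext_lip ac.
have h1 := potential_path cl (ltW l0).
have rl : curve_lip dist (fun t => ext c (clen c - t)).
  by move=> s t st; rewrite (distC metric); have := cl (clen c - t) (clen c - s); rewrite lerB// => /(_ isT); slra.
have h2 := potential_path rl (ltW l0).
rewrite /pathcost (integral_reflect _ (ms cl) (fun t => bn_supgrad.2 _)) subr0 subrr in h2.
rewrite /pathcost !extE// ?(ltW l0)// in h1 h2.
rewrite /ug_ineq line_int_ext; set I := (\int[_]_(_ in _) _)%E in h1 h2 *.
have [fin|inf] := ltP I +oo%E; last by apply: le_trans inf; exact: leey.
have If : I \is a fin_num by rewrite ge0_fin_numE//; apply: integral_ge0 => t _; exact: bn_supgrad.2.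
move: h1 h2; rewrite -(fineK If) -!EFinD !lee_fin => h1 h2.
by rewrite ler_norml; apply/andP; split; slra.
Qed.

(** Nearly optimal paths from points tending to [x] have parameter length at most [b / c0], because
    the gradient is at least [c0]. A limit path given by [arzela] starts at [x], ends in the closed
    set [F], and costs at most [b], which is checked for each Lipschitz [Psi j] separately. *)
Lemma potential_lsc a : dopen dist [set x | a < potential x].
Proof.
have local_context : True by [].
move=> x /= ax; apply: contrapT => nopen.
have Hy n : exists y, dist x y < n.+1%:R^-1 /\ potential y <= a.
  apply: contrapT => hn; apply: nopen; exists n.+1%:R^-1; first by rewrite invr_gt0.
  by move=> y xy; rewrite /= ltNge; apply/negP => ya; apply: hn; exists y.
have [y hy] := choice Hy.
pose b := (a + potential x) / 2.
have [ab bx] : a < b /\ b < potential x by rewrite /b; slra.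
have /andP[_ p1] := potential01 x.
have Hg n : exists gl : (R -> X) * R, [/\ curve_lip dist gl.1, 0 <= gl.2, gl.1 0 = y n, F (gl.1 gl.2) & (pathcost gl.1 gl.2 < b%:E)%E].
  have [_ ya] := hy n; have : (ereal_inf (costs (y n)) < b%:E)%E.
    have := le_lt_trans ya ab; rewrite -lte_fin potentialE gt_min => /orP[|//].
    move=> b1; have b1' : 1 < b by rewrite -lte_fin.
    by move: (lt_le_trans (lt_trans b1' bx) p1); rewrite ltxx.
  by move=> /ereal_inf_lt[_ [g [l [gl l0 g0 Fl ->]]] h]; exists (g, l).
have [gl hg] := choice Hg.
have lip1 n : curve_lip dist (gl n).1 by case: (hg n).
have len n : 0 <= (gl n).2 <= b / c0.
  have [_ l0 _ _ hb] := hg n; rewrite l0 ler_pdivlMr//= mulrC.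
  have := integral_ge_cst (ms (lip1 n)) (fun t => bn_supgrad.2 _) l0 (k := c0).
  rewrite subr0 => h; rewrite -lee_fin; apply: le_trans (h _) (ltW hb).
  by move=> t _ _; apply: le_trans (supgrad_ge 0 _); rewrite lee_fin.
have near n : dist x ((gl n).1 0) < 1.
  have [_ _ -> _ _] := hg n; have [h _] := hy n; apply: (lt_le_trans h).
  by rewrite invf_le1 ?ler1n.
have [h [m [hl /andP[m0 mL] happ]]] := arzela lip1 len near.
set L := b / c0 in len mL happ; have L0 := le_trans m0 mL.
have hx : h 0 = x.
  apply/(metric.2.1); apply/eqP; rewrite eq_le (dist_ge0 metric) andbT; apply/ler_addgt0Pr => e e0.
  have e20 : 0 < e / 2 by rewrite divr_gt0.
  have [n0 hn0] := invS_small e20; have [n [n0n _ hn]] := happ _ e20 n0.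
  have := hn 0 (lexx 0) L0; have [_ _ -> _ _] := hg n; have [xy _] := hy n.
  have xy2 : dist x (y n) <= e / 2.
    by apply/ltW/(lt_trans xy)/(le_lt_trans _ hn0); rewrite lef_pV2 ?posrE ?ltr0n// ler_nat.
  have := dist_tri metric (h 0) (y n) x; rewrite (distC metric (h 0) (y n)) (distC metric (y n) x) add0r.
  by move: xy2; slra.
have Fh : F (h m).
  apply: contrapT => nF; have [r r0 hr] := F_closed nF.
  have r40 : 0 < r / 4 by rewrite divr_gt0.
  have [n [_ lm hn]] := happ _ r40 0%N; have [_ l0 _ Fl _] := hg n.
  apply: (hr ((gl n).1 (gl n).2)) Fl; rewrite /dball/=.
  have /andP[_ lL] := len n; have := hn _ l0 lL; have := curve_lip_norm metric m (gl n).2 hl.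
  by rewrite distrC; have := dist_tri metric (h m) (h (gl n).2) ((gl n).1 (gl n).2); rewrite (distC metric ((gl n).1 _)); slra.
have cost : (pathcost h m <= b%:E)%E.
  apply: int_supgrad_le => // j; set k := `|K j|.
  have Kj : lip dist (Psi j) k by exact: lip_ge0.
  have k0 : 0 <= k by exact: normr_ge0.
  (* [M] bounds [Psi j] along the limit path and pays for the stretch by which it may be longer than
     the approximating path. *)
  pose M := Psi j x + k * L.
  have PM t : 0 <= t -> t <= L -> Psi j (h t) <= M.
    move=> t0 tL; have := Kj (h t) x; rewrite -hx; have := ler_norm (Psi j (h t) - Psi j (h 0)).
    have : k * dist (h t) (h 0) <= k * L.
      by rewrite ler_wpM2l//; have := curve_lip_norm metric t 0 hl; rewrite subr0 ger0_norm//; slra.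
    by rewrite /M hx; slra.
  have M0 : 0 <= M by apply: le_trans (PM 0 (lexx 0) L0); apply: le_trans (Psi_c0 _ _); exact: ltW.
  have C0 : 0 < k * L + M + 1 by rewrite ltr_wpDl// addr_ge0// mulr_ge0.
  apply/lee_addgt0Pr => e e0; have e'0 : 0 < e / (k * L + M + 1) by rewrite divr_gt0.
  set e' := e / _ in e'0; have [n [_ lm hn]] := happ _ e'0 0%N; have [_ l0 _ _ hb] := hg n.
  have /andP[_ lL] := len n; set q := Num.min m (gl n).2.
  have q0 : 0 <= q by rewrite le_min m0.
  have qm : q <= m by rewrite ge_min lexx.
  have ql : q <= (gl n).2 by rewrite ge_min lexx orbT.
  rewrite (integral_split (mP j hl) (fun t => P0 j _) q0 qm).
  have i1 : (\int[leb]_(t in `[q, m]) (Psi j (h t))%:E <= (M * e')%:E)%E.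
    apply: le_trans (integral_le_cst (mP j hl) (fun t => P0 j _) qm M0 _) _.
      by move=> t t1 t2; rewrite lee_fin PM//; [exact: le_trans t1|exact: le_trans mL].
    rewrite lee_fin ler_wpM2l//; have [-> |->] : q = m \/ q = (gl n).2.
    - by rewrite /q; case: leP => _; [left|right].
    - by rewrite subrr ltW.
    by apply: le_trans lm; rewrite distrC ler_norm.
  have i2 : (\int[leb]_(t in `[0%R, q]) (Psi j (h t))%:E <= b%:E + (k * e' * L)%:E)%E.
    apply: (@le_trans _ _ (\int[leb]_(t in `[0%R, q]) ((Psi j ((gl n).1 t))%:E + (k * e')%:E))%E).
      apply: ge0_le_integral => //.
      - exact: measurable_funTS (mP _ hl).
      - apply: measurable_funTS; apply: (@emeasurable_funD _ _ _ setT _ (fun=> (k * e')%:E)); last exact: measurable_cst.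
        exact: (mP j (lip1 n)).
      move=> t /=; rewrite in_itv/= => /andP[t0 tq]; rewrite -EFinD lee_fin.
      have tL : t <= L by exact: le_trans (le_trans tq qm) mL.
      have := Kj (h t) ((gl n).1 t); have := ler_norm (Psi j (h t) - Psi j ((gl n).1 t)).
      have : k * dist (h t) ((gl n).1 t) <= k * e' by rewrite ler_wpM2l// (distC metric) hn.
      slra.
    rewrite ge0_integralD//; last 2 first.
    - exact: measurable_funTS (mP _ (lip1 n)).
    - by move=> t _; rewrite lee_fin mulr_ge0// ltW.
    apply: leeD.
      apply: (@le_trans _ _ (pathcost (gl n).1 (gl n).2)); last exact: ltW.
      apply: (@le_trans _ _ (\int[leb]_(t in `[0%R, (gl n).2]) (Psi j ((gl n).1 t))%:E)%E).
        apply: ge0_subset_integral => //; first exact: measurable_funTS (mP _ (lip1 n)).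
        by move=> t /=; rewrite !in_itv/= => /andP[-> /le_trans]; apply.
      apply: ge0_le_integral => //.
      - exact: measurable_funTS (mP _ (lip1 n)).
      - exact: measurable_funTS (ms (lip1 n)).
      - by move=> t _; exact: supgrad_ge.
    have ke0 : 0 <= k * e' by rewrite mulr_ge0// ltW.
    apply: le_trans (@integral_le_cst _ (fun=> (k * e')%:E) 0 q (k * e') _ _ q0 ke0 _) _ => //.
    by rewrite lee_fin subr0 ler_wpM2l//; exact: le_trans mL.
  apply: (le_trans (leeD i2 i1)); rewrite -addeA; apply: leeD2l; rewrite -EFinD lee_fin.
  have : (k * L + M + 1) * e' = e by rewrite /e' mulrC divfK// gt_eqF.
  slra.
have : (potential x <= b)%R.
  rewrite -lee_fin potentialE ge_min; apply/orP; right; apply: le_trans cost.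
  by apply: ereal_inf_lbound; exists h, m.
by rewrite leNgt bx.
Qed.

(** A path from [x] to [F] has distinct ends, so it can be parametrized by arc length. The resulting
    curve has infinite integral, and [integral_speed] shows that the path costs no less. *)
Lemma potential_1 x : ~ F x -> (forall c, arc_curve dist c -> cmap c 0 = x -> line_int supgrad c = +oo%E) ->
  potential x = 1.
Proof.
move=> nF hinf; apply/eqP; rewrite eq_le; have /andP[_ ->] := potential01 x; rewrite -lee_fin potentialE le_min lexx/=.
apply: le_ereal_inf_tmp => _ [g [l [gl l0 g0 Fl ->]]].
have gne : g 0 <> g l by move=> e; apply: nF; rewrite -g0 e.
have [c [ac c0x cl cg]] := reparam metric gl l0 gne.
suff : (line_int supgrad c <= pathcost g l)%E by rewrite hinf ?c0x//; apply: le_trans; exact: leey.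
have [lc _] := ac; have extl := ext_lip ac.
rewrite line_int_ext; apply: int_supgrad_le => // j.
have Kj : lip dist (Psi j) `|K j| by exact: lip_ge0.
have aL s t : s <= t -> 0 <= arc_param dist g l t - arc_param dist g l s <= t - s by apply: arc_param_lip.
have a0 : arc_param dist g l 0 = 0 by apply: arc_param0.
have ma : measurable_fun setT (arc_param dist g l).
  by apply: continuous_measurable_fun; exact: arc_param_continuous.
rewrite cl; apply: le_trans (integral_speed (normr_ge0 (K j)) l0 _ _ a0 aL _ ma) _.
- by move=> t; apply: le_trans (Psi_c0 _ _); exact: ltW.
- move=> s t; apply: (le_trans (Kj _ _)); rewrite ler_wpM2l//.
  exact: (curve_lip_norm metric).
- by have := mP j extl => /measurable_EFinP.
rewrite /pathcost; apply: le_trans (_ : (\int[leb]_(t in `[0%R, l]) (Psi j (g t))%:E <= _)%E).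
  rewrite le_eqVlt; apply/orP; left; apply/eqP; apply: eq_integral => t; rewrite inE/= in_itv/= => /andP[t0 tl].
  have /andP[u1 _] := aL _ _ t0; have /andP[u2 _] := aL _ _ tl; rewrite a0 in u1.
  by rewrite extE ?cg// ?cl; lra.
apply: ge0_le_integral => //.
- exact: measurable_funTS (mP _ gl).
- exact: measurable_funTS (ms gl).
- by move=> t _; exact: supgrad_ge.
Qed.
End Phi.

Section Count.
Variable R : realType.

(** The layer-cake count of integer levels under [y], cut at [m]. For [0 <= y <= m] it lies between
    [y] and [y + 1]. *)
Definition below (m : nat) (y : \bar R) : R := \sum_(k < m) (if ((k%:R)%:E < y)%E then 1 else 0).

Lemma below_le m y : (0 <= y)%E -> ((below m y)%:E <= y + 1)%E.
Proof.
move=> y0; suff : below m y <= m%:R /\ ((below m y)%:E <= y + 1)%E by case.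
rewrite /below; elim: m => [|m [IH1 IH2]]; first by rewrite big_ord0 adde_ge0.
rewrite big_ord_recr/=; case: ifPn => [h|_]; rewrite ?addr0.
  split; first by rewrite -natr1 lerD2r.
  by rewrite EFinD; apply: leeD2r; apply: le_trans (ltW h); rewrite lee_fin.
by split => //; apply: (le_trans IH1); rewrite ler_nat.
Qed.

Lemma below_ge (t : R) y : 0 <= t -> (t%:E < y)%E -> exists m, t <= below m y /\ forall k, (k < m)%N -> ((k%:R)%:E < y)%E.
Proof.
move=> t0 ty; have /andP[k1 k2] := truncn_itv t0.
have h k : (k < (Num.truncn t).+1)%N -> ((k%:R)%:E < y)%E.
  by move=> km; apply: le_lt_trans ty; rewrite lee_fin (le_trans _ k1)// ler_nat -ltnS.
exists (Num.truncn t).+1; split => //.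
rewrite /below (eq_bigr (fun=> 1)); first by rewrite sumr_const card_ord ltW.
by move=> i _; rewrite h.
Qed.
End Count.

Section NullPotential.
Variables (R : realType) (d : measure_display) (X : measurableType d) (dist : X -> X -> R).
Hypothesis metric : is_metric dist.
Hypothesis borel : borel_for dist.
Hypothesis cplt : dcomplete dist.
Variable mu : {measure set X -> \bar R}.
Variable Cd : R.
Hypothesis dbl : doubling dist mu Cd.
Local Notation B := (dball dist).
Local Notation mB := (mB dist mu).

Section Levels.
Variables (V : nat -> set X) (ep c0 : R).
Hypothesis oV : forall k, dopen dist (V k).
Hypothesis ep0 : 0 < ep.
Hypothesis c00 : 0 < c0.

Let bump j k x := Num.min 1 (j%:R * ddist dist (~` V k) x).
(** Lipschitz functions that increase to [c0] plus [ep] times the number of open sets [V k]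
    containing the point. If [V k] contains the set where a function exceeds [k], the limit
    dominates [ep] times that function. *)
Definition levels (j : nat) (x : X) : R := c0 + ep * \sum_(k < j) bump j k x.

Let bump_ge0 j k x : 0 <= bump j k x.
Proof. by rewrite le_min ler01 mulr_ge0// (ddist_ge0 metric). Qed.

Lemma levels_lip j : lip dist (levels j) (ep * (j%:R * j%:R)).
Proof.
move=> x y; have -> : levels j x - levels j y = ep * (\sum_(k < j) bump j k x - \sum_(k < j) bump j k y) by rewrite /levels; ring.
rewrite normrM (gtr0_norm ep0) -mulrA ler_pM2l//.
rewrite -sumrB; apply: le_trans (ler_norm_sum _ _ _) _.
apply: (@le_trans _ _ (\sum_(k < j) j%:R * dist x y)); last by rewrite sumr_const card_ord -[leLHS]mulr_natl mulrA.
apply: ler_sum => k _; have h := lip_ddist metric (~` V k) x y; rewrite mul1r in h.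
have hj : `|j%:R * ddist dist (~` V k) x - j%:R * ddist dist (~` V k) y| <= j%:R * dist x y.
  by rewrite -mulrBr normrM ger0_norm// ler_wpM2l.
move: hj; rewrite /bump; set a := _ * ddist _ _ x; set b := _ * ddist _ _ y; rewrite !ler_norml => /andP[h1 h2].
apply/andP; split; case: (leP 1 a) => ha; case: (leP 1 b) => hb; lra.
Qed.

Lemma levels_mono x j k : (j <= k)%N -> levels j x <= levels k x.
Proof.
move=> jk; rewrite /levels lerD2l ler_pM2l// -(subnKC jk) big_split_ord/=.
apply: (@le_trans _ _ (\sum_(i < j) bump (j + (k - j)) i x)); last first.
  by rewrite lerDl sumr_ge0.
apply: ler_sum => i _; rewrite /bump le_min ge_min lexx/= ge_min; apply/orP; right.
by rewrite ler_wpM2r ?(ddist_ge0 metric)// ler_nat leq_addr.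
Qed.

Lemma levels_c0 j x : c0 <= levels j x.
Proof. by rewrite /levels lerDl mulr_ge0 ?sumr_ge0// ltW. Qed.

Lemma supgrad_levels_le x : (supgrad levels x <= c0%:E + ep%:E * (\sum_(0 <= k <oo) (\1_(V k) x)%:E))%E.
Proof.
apply: (supgrad_le levels_mono) => j; rewrite /levels EFinD EFinM leeD2l//; apply: lee_wpmul2l.
  by rewrite lee_fin ltW.
apply: (@le_trans _ _ (\sum_(0 <= k < j) (\1_(V k) x)%:E)%E).
  rewrite big_mkord -sumEFin; apply: lee_sum => k _; rewrite lee_fin /bump indicE.
  have [h|h] := pselect (V k x); first by rewrite mem_set// ge_min lexx.
  rewrite memNset//= ge_min; apply/orP; right.
  have := ddist_le metric x (h : (~` V k) x); rewrite (distxx metric) => h1.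
  by rewrite mulr_ge0_le0.
by apply: nneseries_lim_ge => k _ _; rewrite lee_fin.
Qed.

Lemma supgrad_levels_ge x m : (forall k, (k < m)%N -> V k x) -> ((ep * m%:R)%:E <= supgrad levels x)%E.
Proof.
move=> h; pose f k := if (k < m)%N then ddist dist (~` V k) x else 1.
have f0 k : 0 < f k.
  rewrite /f; case: ifP => km; last exact: ltr01.
  have Vk : V k x by exact: h.
  have dd := (ddist_gt0 metric x (@oV k)).2 Vk; exact: dd.
have [b /andP[b0 _] hb] := bigmin_seq (iota 0 m) (@ltr01 R) f0.
have [n hn] := invS_small b0.
pose j := (m + n.+1)%N.
apply: le_trans (supgrad_ge levels_mono j x); rewrite lee_fin /levels.
rewrite -[leLHS]add0r lerD ?(ltW c00)// ler_pM2l// /j big_split_ord/=.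
apply: (@le_trans _ _ (\sum_(i < m) (1 : R))); first by rewrite sumr_const card_ord.
rewrite -[leLHS]addr0; apply: lerD; last exact: sumr_ge0.
apply: ler_sum => i _; rewrite /bump /= le_min lexx/=.
have := hb i; rewrite mem_iota add0n ltn_ord => /(_ isT); rewrite /f ltn_ord => hbi.
have nb : n.+1%:R^-1 <= ddist dist (~` V i) x by apply: le_trans hbi; exact: ltW.
apply: (@le_trans _ _ (n.+1%:R * n.+1%:R^-1)); first by rewrite divff// pnatr_eq0.
by apply: ler_pM => //; rewrite ?invr_ge0// ler_nat leq_addl.
Qed.
End Levels.

(** The [V k] are open sets around the superlevel sets of the function [h] of [cap1_lines], so the
    limit of [levels] dominates [ep * h] near the ball and has infinite integral along every curve
    starting in [N] there. The target of the paths is the complement of a small open set [O] around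
    [N] in the ball: the potential vanishes off [O] and is 1 on [N]. The numbers [ep] and [c0] each
    contribute at most [e / 2] to the energy. *)
Lemma null_potential (N : set X) x0 r e : Cap1 dist mu N = 0%E -> 0 < r -> 0 < e ->
  exists (phi : X -> R) (psi : X -> \bar R), [/\ is_ug dist setT phi psi,
    (\int[mu]_(y in B x0 r) psi y <= e%:E)%E, (mu [set x | (0 < phi x)%R] <= e%:E)%E,
    (forall x, 0 <= phi x <= 1) /\ (forall x, N x -> B x0 r x -> phi x = 1) &
    forall a, dopen dist [set x | a < phi x]].
Proof.
have local_context : True by [].
move=> N0 r0 e0; have [h [bh hfin hN]] := cap1_lines metric borel N0.
have mh0 k : measurable [set x | ((k%:R)%:E < h x)%E].
  by rewrite -[X in measurable X]setTI; apply: emeasurable_fun_o_infty => //; exact: bh.1.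
have mD : measurable (B x0 (2 * r)) by exact: dball_measurable.
have mh k : measurable ([set x | ((k%:R)%:E < h x)%E] `&` B x0 (2 * r)).
  exact: measurableI.
have hp (k : nat) : 0 < 1 / (2 ^ k.+1)%:R :> R by rewrite divr_gt0// ltr0n expn_gt0.
have HV k := outer_regular metric borel dbl (mh k) (fun y p => p.2 : B x0 (2 * r) y) (hp k).
have [V hV] := choice HV.
have oV k : dopen dist (V k) by case: (hV k).
have mV k : measurable (V k) by exact: (dopen_measurable borel).
have Tfin : (\sum_(0 <= k <oo) mu (V k) < +oo)%E.
  apply: le_lt_trans (_ : (\sum_(0 <= k <oo) (mu ([set x | ((k%:R)%:E < h x)%E] `&` B x0 (2 * r)) + (1 / (2 ^ k.+1)%:R)%:E) < _)%E).
    by apply: lee_nneseries => [k _ _|k _]; [exact: measure_ge0|case: (hV k)].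
  rewrite nneseriesD//.
  apply: lte_add_pinfty; last first.
    by apply: le_lt_trans (nneseries_geo ler01 _ _) (ltry _) => k; rewrite ?lee_fin// ltW.
  have bI k : borel_nonneg (fun x => (\1_([set x | ((k%:R)%:E < h x)%E]) x)%:E : \bar R).
    by apply: bn_indic; exact: mh0.
  rewrite (eq_eseriesr (g := fun k => \int[mu]_(x in B x0 (2 * r)) (\1_([set x | ((k%:R)%:E < h x)%E]) x)%:E)%E); last first.
    move=> k _; rewrite integral_indic//; exact: mh0.
  rewrite -int_series//.
  apply: le_lt_trans (_ : (\int[mu]_(x in B x0 (2 * r)) (h x + 1) < _)%E).
    apply: int_mono => //; [exact: bn_series|by apply: bn_add => //; exact: bn_cst|].
    move=> x _; apply: lime_le; first by apply: is_cvg_nneseries => k _ _; rewrite lee_fin.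
    near=> m; apply: le_trans (below_le m (bh.2 x)); rewrite big_mkord /below -sumEFin; apply: lee_sum => k _.
    by rewrite indicE; case: ifPn => hk; [rewrite mem_set|rewrite memNset//= => /(elimN idP hk)].
  have b1 : borel_nonneg (fun _ : X => 1%E : \bar R) by apply: bn_cst.
  rewrite (int_add _ mD bh b1).
  apply: lte_add_pinfty; first by apply: le_lt_trans hfin; apply: int_sub => //; exact: bh.
  by rewrite integral_cst// mul1e (muB_fin metric dbl).
pose T := fine (\sum_(0 <= k <oo) mu (V k))%E.
have TE : (\sum_(0 <= k <oo) mu (V k))%E = T%:E.
  by rewrite fineK// ge0_fin_numE// nneseries_ge0.
have T0 : 0 <= T by rewrite fine_ge0// nneseries_ge0.
have m0 := mB_ge0 dist mu x0 r.
pose ep := e / (2 * (T + 1)); pose c0 := e / (2 * (mB x0 r + 1)).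
have ep0 : 0 < ep by rewrite divr_gt0// mulr_gt0// ltr_wpDl.
have c00 : 0 < c0 by rewrite divr_gt0// mulr_gt0// ltr_wpDl.
have [N' [mN' N'0 NN']] := cap1_null metric borel N0.
have mB0 : measurable (B x0 r) by exact: dball_measurable.
have [ O [oO NO OB sO]] := outer_regular metric borel dbl (measurableI _ _ mN' mB0) (fun y p => p.2 : B x0 r y) e0.
have sO' : (mu O <= e%:E)%E.
  apply: (le_trans sO); rewrite (_ : mu (_ `&` _) = 0%E) ?add0e//.
  by apply/eqP; rewrite eq_le measure_ge0 andbT -N'0; apply: le_measure; rewrite ?inE//; exact: measurableI.
pose Psi := levels V ep c0.
have PL j : lip dist (Psi j) (ep * (j%:R * j%:R)) by exact: levels_lip.
have Pm := @levels_mono V ep c0 ep0; have Pc := @levels_c0 V ep c0 ep0.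
have Fc : dopen dist (~` (~` O)) by rewrite setCK.
have bs : borel_nonneg (supgrad Psi) := bn_supgrad metric borel PL Pm c00 Pc.
pose phi := potential dist Psi (~` O).
have p01 x : 0 <= phi x <= 1 := potential01 metric borel (~` O) PL Pm c00 Pc x.
exists phi, (supgrad Psi); split => //.
- exact: (potential_ug metric borel _ PL Pm c00 Pc).
- apply: (@le_trans _ _ (\int[mu]_(y in B x0 r) (c0%:E + ep%:E * \sum_(0 <= k <oo) (\1_(V k) y)%:E))%E).
    have bV : borel_nonneg (fun y => \sum_(0 <= k <oo) (\1_(V k) y)%:E : \bar R)%E by apply: bn_series => k; exact: bn_indic.
    apply: int_mono => //; last by move=> y _; exact: supgrad_levels_le.
    by apply: bn_add; [apply: bn_cst; rewrite lee_fin ltW|apply: bn_scale => //; rewrite lee_fin ltW].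
  have bV : borel_nonneg (fun y => \sum_(0 <= k <oo) (\1_(V k) y)%:E : \bar R)%E by apply: bn_series => k; exact: bn_indic.
  have ep0' : (0 <= ep%:E)%E by rewrite lee_fin ltW.
  have bc : borel_nonneg (fun _ : X => c0%:E : \bar R) by apply: bn_cst; rewrite lee_fin ltW.
  rewrite (int_add _ mB0 bc (bn_scale ep0' bV)).
  rewrite int_scale// integral_cst// (mBE metric dbl) -EFinM.
  apply: (@le_trans _ _ ((c0 * mB x0 r)%:E + ep%:E * T%:E)%E).
    rewrite leeD2l//; apply: lee_wpmul2l => //; rewrite -TE int_series//; last by move=> k; exact: bn_indic.
    apply: lee_nneseries => [k _ _|k _]; first by apply: integral_ge0 => y _; rewrite lee_fin.
    rewrite integral_indic//; apply: le_measure; rewrite ?inE//; exact: measurableI.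
  rewrite -EFinM -EFinD lee_fin /c0 /ep.
  have h1 : e / (2 * (mB x0 r + 1)) * mB x0 r <= e / 2.
    rewrite mulrAC ler_pdivrMr ?mulr_gt0 ?ltr_wpDl//.
    rewrite (_ : e / 2 * _ = e * (mB x0 r + 1)); last by field.
    by rewrite ler_pM2l// lerDl.
  have h2 : e / (2 * (T + 1)) * T <= e / 2.
    rewrite mulrAC ler_pdivrMr ?mulr_gt0 ?ltr_wpDl//.
    rewrite (_ : e / 2 * _ = e * (T + 1)); last by field.
    by rewrite ler_pM2l// lerDl.
  slra.
- apply: le_trans sO'; apply: le_measure; rewrite ?inE.
  + apply: (dopen_measurable borel).
    exact: (potential_lsc metric borel cplt dbl PL Pm c00 Pc Fc).
  + exact: (dopen_measurable borel).
  move=> y /= py; apply: contrapT => nO; move: py.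
  by rewrite /phi (potential_F metric borel PL Pm c00 Pc (nO : (~` O) y)) ltxx.
- split=> // x Nx xb; apply: (potential_1 metric borel PL Pm c00 Pc).
    by move=> nO; apply: nO; apply: NO; split => //; exact: NN'.
  (* An initial arc of length at most [r] stays in [B x0 (2 * r)], where the [V k] contain the
     superlevel sets of [h]. *)
  move=> c ac cx; have [l0 _] := ac; pose a := Num.min (clen c) r.
  have a0 : 0 < a by rewrite lt_min l0.
  have al : a <= clen c by rewrite ge_min lexx.
  have ar : a <= r by rewrite ge_min lexx orbT.
  have asub := sub_arc ac (lexx 0) a0 al.
  have sub0 : cmap (sub c 0 a) 0 = x by rewrite /sub/= addr0.
  have inf : line_int h (sub c 0 a) = +oo%E.
    apply: (hN _ 0 asub) => //; last by rewrite sub0.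
    by rewrite /= subr0 ltW.
  apply/eqP; rewrite eq_le leey -(_ : ep%:E * +oo = +oo)%E; last by rewrite gt0_muley// lte_fin.
  have ep_0 : (0 <= ep%:E)%E by rewrite lee_fin ltW.
  rewrite -inf -(line_scale metric borel asub bh ep_0) /=.
  apply: (@le_trans _ _ (line_int (supgrad Psi) (sub c 0 a))).
    rewrite !line_int_ext; apply: (int_mono _ _ (bn_ext metric borel asub (bn_scale _ bh)) (bn_ext metric borel asub bs)) => //.
    move=> t tI; pose y := ext (sub c 0 a) t; rewrite -/y.
    have /andP[t0 ta] : 0 <= t <= clen (sub c 0 a) by move: tI; rewrite /= in_itv.
    have yD : B x0 (2 * r) y.
      have cl := ext_lip asub; have := cl 0 t t0; rewrite -/y.
      rewrite (_ : ext (sub c 0 a) 0 = x); last by rewrite extE// /= subr0 ltW.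
      have t_r : t <= r by apply: le_trans ar; move: ta; rewrite /= subr0.
      by move: xb; rewrite /dball/= => xb; have := dist_tri metric x0 x y; slra.
    have [fin|] := ltP (h y) +oo%E; last first.
      rewrite leye_eq => /eqP hy; rewrite hy gt0_muley ?lte_fin//.
      rewrite leye_eq; apply/eqP/eqyP => A A0.
      have AE : (A%:E < h y * ep^-1%:E)%E by rewrite hy gt0_mulye ?ltry// lte_fin invr_gt0.
      have AE' : ((A / ep)%:E < h y)%E by rewrite hy ltry.
      have [m [hm1 hm2]] := below_ge (divr_ge0 (ltW A0) (ltW ep0)) AE'.
      have hVm k : (k < m)%N -> V k y.
        by move=> /hm2 hk; case: (hV k) => _ + _ _; apply; split.
      apply: le_trans (supgrad_levels_ge oV ep0 c00 hVm); rewrite lee_fin -ler_pdivrMl// mulrC.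
      apply: (le_trans hm1); rewrite /below; apply: (@le_trans _ _ (\sum_(k < m) (1 : R))).
        by apply: ler_sum => k _; case: ifP.
      by rewrite sumr_const card_ord.
    have hf : h y \is a fin_num by rewrite ge0_fin_numE//; exact: bh.2.
    rewrite -(fineK hf) -EFinM; apply/lee_addgt0Pr => q q0.
    have [hq|hq] := leP (fine (h y)) (q / ep).
      apply: (@le_trans _ _ q%:E); first by rewrite lee_fin -ler_pdivlMl// mulrC.
      by rewrite leeDr// bs.2.
    have tq : 0 <= fine (h y) - q / ep by slra.
    have lt1 : ((fine (h y) - q / ep)%:E < h y)%E by rewrite -[ltRHS](fineK hf) lte_fin gtrBl divr_gt0.
    have [m [hm1 hm2]] := below_ge tq lt1.
    have hVm k : (k < m)%N -> V k y.
      by move=> /hm2 hk; case: (hV k) => _ + _ _; apply; split.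
    apply: (@le_trans _ _ ((ep * m%:R)%:E + q%:E)%E); last first.
      by apply: leeD2r; exact: (supgrad_levels_ge oV ep0 c00 hVm).
    rewrite -EFinD lee_fin -lerBlDr.
    have bm : below m (h y) <= m%:R.
      rewrite /below; apply: (@le_trans _ _ (\sum_(k < m) (1 : R))).
        by apply: ler_sum => k _; case: ifP.
      by rewrite sumr_const card_ord.
    have : ep * (fine (h y) - q / ep) <= ep * m%:R by rewrite ler_pM2l//; exact: le_trans bm.
    by rewrite mulrBr mulrCA divff ?gt_eqF// mulr1.
  rewrite (line_int_sub metric borel ac bs (lexx 0) (ltW a0) al) line_int_ext.
  apply: (int_sub _ _ _ (bn_ext metric borel ac bs)) => // t /=; rewrite !in_itv/= => /andP[-> /le_trans]; exact.
- exact: (potential_lsc metric borel cplt dbl PL Pm c00 Pc Fc).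
Unshelve. all: by end_near.
Qed.
End NullPotential.

(** * The quantile inequality off a removable set *)

(** The supremum of the points up to which the inequality holds satisfies it by monotonicity, and
    local growth to the right would push it further. Only increments to the right enter, so jumps of
    [G] are harmless. *)
Lemma monotone_growth (R : realType) (G : R -> R) k a b : a <= b -> 0 <= k -> (forall s t, s <= t -> G s <= G t) ->
  (forall t, a <= t -> t < b -> exists2 h0, 0 < h0 & forall h, 0 < h -> h < h0 -> k * h <= G (t + h) - G t) ->
  k * (b - a) <= G b - G a.
Proof.
have local_context : True by [].
move=> ab k0 Gm hG; pose T := [set s | a <= s <= b /\ k * (s - a) <= G s - G a].
have Ta : T a by split; [rewrite lexx|rewrite !subrr mulr0].
have hs : has_sup T by split; [exists a|exists b => s [/andP[]]].
have aS : a <= sup T by apply: ub_le_sup => //; case: hs.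
have Sb : sup T <= b by apply: ge_sup; [exists a|move=> s [/andP[]]].
have TS : k * (sup T - a) <= G (sup T) - G a.
  apply/ler_addgt0Pr => e e0; have k1 : 0 < k + 1 by rewrite ltr_wpDl.
  have ek : 0 < e / (k + 1) by rewrite divr_gt0.
  have [s [/andP[s1 s2] s3] s4] := sup_adherent ek hs.
  have sS : s <= sup T by apply: ub_le_sup; [case: hs|split => //; rewrite s1].
  have h1 : k * (sup T - s) <= e.
    apply: (@le_trans _ _ ((k + 1) * (e / (k + 1)))); last by rewrite mulrC divfK// gt_eqF.
    by apply: ler_pM; slra.
  by have := Gm _ _ sS; slra.
have [Slt|bS] := ltP (sup T) b; last by have -> : b = sup T by apply/eqP; rewrite eq_le bS.
have [h0 h00 hh] := hG _ aS Slt; pose h := Num.min h0 (b - sup T) / 2.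
have m0 : 0 < Num.min h0 (b - sup T) by rewrite lt_min h00 subr_gt0.
have m1 : Num.min h0 (b - sup T) <= h0 by rewrite ge_min lexx.
have m2 : Num.min h0 (b - sup T) <= b - sup T by rewrite ge_min lexx orbT.
have hp : 0 < h by rewrite divr_gt0.
have hlt : h < h0 by rewrite /h; slra.
have := hh h hp hlt => hk.
suff : sup T + h <= sup T by slra.
apply: ub_le_sup; first by case: hs.
split; first by apply/andP; split; rewrite /h; slra.
by move: TS hk; slra.
Qed.

Section Trichotomy.
Variables (R : realType) (d : measure_display) (X : measurableType d) (dist : X -> X -> R).
Hypothesis metric : is_metric dist.
Hypothesis borel : borel_for dist.
Hypothesis cplt : dcomplete dist.
Hypothesis diam : exists x y : X, 0 < dist x y.
Variable mu : {measure set X -> \bar R}.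
Variables Cd CP lam : R.
Hypothesis dbl : doubling dist mu Cd.
Hypothesis PI : PI11 dist mu CP lam.
Variables (c : R) (A : set X).
Hypothesis c0 : 0 < c.
Hypothesis c_small : 96 * CP2 Cd CP lam * c * Cd ^+ 5 < 1.
Local Notation B := (dball dist).
Local Notation mB := (mB dist mu).

Lemma clamp_dist (a b : R) : `|clamp 1 a - clamp 1 b| <= `|a - b|.
Proof.
have local_context : True by [].
have [h|/ltW h] := leP a b.
  have h1 := clamp_mono 1 h; have h2 := clamp_lip 1 h.
  by rewrite ler0_norm ?subr_le0// ler0_norm ?subr_le0//; slra.
have h1 := clamp_mono 1 h; have h2 := clamp_lip 1 h.
by rewrite ger0_norm ?subr_ge0// ger0_norm ?subr_ge0//; slra.
Qed.

Lemma affine_clamp_ug H (u : X -> R) (g : X -> \bar R) t h : is_ug dist H u g -> 0 < h ->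
  is_ug dist H (fun x => clamp 1 ((u x - t) / h)) (fun x => (h^-1)%:E * g x)%E.
Proof.
move=> [bg ug] h0; have hi : (0 <= (h^-1)%:E)%E by rewrite lee_fin invr_ge0 ltW.
split; first exact: bn_scale.
move=> cu ac ci; rewrite /ug_ineq (line_scale metric borel ac bg hi).
apply: (le_trans _ (lee_wpmul2l hi (ug cu ac ci))); rewrite -EFinM lee_fin.
apply: (le_trans (clamp_dist _ _)); rewrite -mulrBl normrM mulrC ger0_norm ?invr_ge0 ?(ltW h0)//.
by rewrite ler_pM2l ?invr_gt0// opprB addrA subrK.
Qed.

Lemma int_trunc_grad (W Z : set X) (g : X -> \bar R) (v : X -> R) t h : measurable W -> borel_nonneg g ->
  measurable_fun setT v -> measurable Z -> mu Z = 0%E -> 0 < h ->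
  (\int[mu]_(y in W) trunc_grad g v Z t h 1 y =
   (h^-1)%:E * \int[mu]_(y in W `&` band v t h) g y + \int[mu]_(y in W) g y)%E.
Proof.
move=> mW bg mv mZ Z0 h0; have mb := band_measurable t h mv.
have b1 : borel_nonneg (fun x => g x * (\1_(band v t h) x)%:E)%E by apply: bn_mul => //; exact: bn_indic.
have hi : (0 <= (h^-1)%:E)%E by rewrite lee_fin invr_ge0 ltW.
have b2 := bn_scale hi b1.
have b3 : borel_nonneg (fun x => +oo * (\1_Z x)%:E : \bar R)%E by apply: bn_scale => //; exact: bn_indic.
have b4 : borel_nonneg (fun x => 1%:E * g x)%E by apply: bn_scale.
rewrite /trunc_grad (int_add _ mW (bn_add b2 b3) b4) (int_add _ mW b2 b3) int_oo_null// adde0.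
by rewrite int_scale// int_indicE//; congr (_ + _)%E; under eq_integral do rewrite mul1e.
Qed.

Lemma trichotomy x gm kk (u v : X -> R) (g : X -> \bar R) (Z : set X) t rho :
  (liminf0 (fun r : R => capp dist mu 1 (A `&` dball dist x r) (dball dist x (2 * r))
    / capp dist mu 1 (dball dist x r) (dball dist x (2 * r))) < c%:E)%E ->
  0 < gm -> 2 * lam2 lam <= 2 ^+ kk -> 192 * CP2 Cd CP lam * c * Cd ^+ kk.+1 <= gm ->
  is_ug dist (~` A) u g -> measurable_fun setT v -> measurable Z -> mu Z = 0%E -> (forall y, ~ Z y -> u y = v y) ->
  0 < rho -> exists2 s, 0 < s <= rho &
   [\/ (mu ([set y | (t < v y)%R] `&` B x s) <= (gm * mB x s)%:E)%E,
       (mu (B x s `\` [set y | (t < v y)%R]) <= (gm * mB x s)%:E)%E |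
       exists2 h0, 0 < h0 & forall h, 0 < h -> h < h0 ->
         ((gm / (16 * CP2 Cd CP lam) * mB x s)%:E <= s%:E * \int[mu]_(y in B x (lam2 lam * s)) trunc_grad g v Z t h 1 y)%E].
Proof.
have local_context : True by [].
move=> gx gm0 hkk hsmall ug mv mZ Z0 hZ rho0.
have [r [eta [ve [Ze [ge [/andP[r0 rr] [mve mZe Ze0 hZe] e01 e1 [uge small sm]]]]]]] :=
  good_eta metric borel diam dbl PI c0 c_small gx rho0.
have l1 := lam2_ge1 lam; have C1 := Cd_ge1 metric borel dbl x; have P1 := CP2_ge1 metric borel CP lam dbl x.
(* With this scale the Poincare inequality at [s] requires an upper gradient on exactly [B x r], the
   ball in which [eta] is 1 on [A]. *)
set s := r / (2 * lam2 lam); have s0 : 0 < s by rewrite divr_gt0//; slra.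
have lne : lam2 lam != 0 by rewrite gt_eqF// (lt_le_trans ltr01).
have rs : r = 2 * (lam2 lam * s) by rewrite /s; field.
have sr : s <= r.
  have : 1 * s <= lam2 lam * s by rewrite ler_pM2r.
  by rewrite rs; slra.
exists s; first by rewrite s0; slra.
set E := [set y | (t < v y)%R].
have mE : measurable E.
  rewrite (_ : E = ~` [set y | (v y <= t)%R]).
    by apply: measurableC; rewrite -[X in measurable X]setTI; exact: measurable_fun_le.
  by apply/seteqP; split => y; rewrite /E/= ltNge => /negP.
have mb y q : measurable (B y q) by exact: dball_measurable.
have [h1|h1] := leP (mu (E `&` B x s)) (gm * mB x s)%:E; first exact: Or31.
have [h2|h2] := leP (mu (B x s `\` E)) (gm * mB x s)%:E; first exact: Or32.
apply: Or33; have m0 := mB_gt0 metric dbl x s0; set e := gm * mB x s in h1 h2.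
have e0 : 0 < e by rewrite mulr_gt0.
have mrs : mB x r <= Cd ^+ kk * mB x s.
  apply: (mB_iter metric borel dbl); rewrite (distxx metric) add0r {1}rs mulrA.
  by rewrite ler_pM2r.
have P0 : 0 <= CP2 Cd CP lam by slra.
have Ck0 : 0 <= Cd ^+ kk by rewrite exprn_ge0//; slra.
pose K := CP2 Cd CP lam * c * Cd ^+ kk.+1.
have K0 : 0 <= K by rewrite /K exprS; apply: mulr_ge0; [apply: mulr_ge0 => //; exact: ltW|apply: mulr_ge0; slra].
have Ke : 192 * (K * mB x s) <= e.
  rewrite mulrA /e ler_pM2r//; apply: le_trans hsmall; rewrite le_eqVlt; apply/orP; left; apply/eqP.
  by rewrite /K !mulrA.
have e40 : 0 < e / 4 by rewrite divr_gt0.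
have mband n : measurable (B x s `&` band v t n.+1%:R^-1) by apply: measurableI => //; exact: band_measurable.
(* The part of the ball in a narrow band above [t] has small measure. This fixes how small [h] has
   to be, depending on the point and the scale. *)
have [n hn] : exists n, (mu (B x s `&` band v t n.+1%:R^-1) <= (e / 4)%:E)%E.
  apply: (@measure_cvg0 _ _ _ mu (fun n => B x s `&` band v t n.+1%:R^-1)) => //.
  - by apply: (mu_sub_lty metric borel dbl (x := x) (r := s)) => // y [].
  - move=> i j ij y [yb /andP[v1 v2]]; split => //; rewrite /band /= v1/=; apply: (lt_le_trans v2).
    by rewrite lerD2l lef_pV2 ?posrE ?ltr0n// ler_nat.
  - apply/seteqP; split => // y hy; have [_ /andP[v1 _]] := hy 0%N I.
    have dv : 0 < v y - t by rewrite subr_gt0.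
    have [i hi] := invS_small dv; have [_ /andP[_ v2]] := hy i I.
    by move: v2; rewrite ltNge -lerBrDl (ltW hi).
exists n.+1%:R^-1; first by rewrite invr_gt0.
move=> h hp hlt.
set G := trunc_grad g v Z t h 1.
have bG : borel_nonneg G by apply: bn_trunc => //; exact: ug.1.
have ugf : is_ug dist (B x (2 * (lam2 lam * s)) `\` A) (fun y => clamp 1 ((u y - t) / h)) G.
  apply: (trunc_ug metric borel) => //; last by move=> cu _ _; right.
    by apply: (ug_subset _ ug) => y [].
  by move=> y _ uv; apply: contrapT => nZ; apply: uv; exact: hZ.
have c01 (a : R) : 0 <= clamp 1 a <= 1 by rewrite clamp_ge0 clamp_le.
have ugw := prod_ug metric borel uge ugf e01 (fun y => c01 _) (fun y Ay yW => e1 y Ay (eq_rect_r (fun q => B x q y) yW rs)).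
pose w y := clamp 1 ((v y - t) / h) * (1 - ve y).
have mw : measurable_fun setT w.
  apply: measurable_funM; last by apply: measurable_funB.
  rewrite /clamp; apply: measurable_maxr => //; apply: measurable_minr => //.
  by apply: measurable_funM => //; apply: measurable_funB.
have PS := @PI_sets _ _ _ _ metric borel mu Cd CP lam dbl PI x s _ w _ (Z `|` Ze) 0 2^-1 1 s0 mw
  (measurableU _ _ mZ mZe) _ _ _ ugw _.
have {}PS : (mine (mu (B x s `&` [set y | (w y <= 0)%R])) (mu (B x s `&` [set y | (2^-1 <= w y)%R])) <=
   (2 * CP2 Cd CP lam * s / (2^-1 - 0))%:E * \int[mu]_(y in B x (lam2 lam * s)) (G y + ge y))%E.
  apply: PS; last by [].
  - by rewrite (measureU0 (mu := mu) mZ mZe Ze0).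
  - move=> y _ ne; apply: contrapT => /not_orP[nZ nZe]; apply: ne; rewrite /w.
    by rewrite hZ//; congr (_ * (1 - _)); apply: contrapT => q; apply: nZe; exact: hZe.
  - move=> y; have /andP[a1 a2] := c01 ((u y - t) / h); have /andP[b1 b2] := e01 y.
    by rewrite ger0_norm ?mulr_ge0 ?subr_ge0// -[leRHS]mulr1; apply: ler_pM => //; [rewrite subr_ge0|rewrite lerBlDr lerDl].
rewrite (int_add _ (mb _ _) bG uge.1) in PS.
have mS (f : X -> R) (k : R) : measurable_fun setT f -> measurable [set y | (k <= f y)%R].
  by move=> mf; rewrite -[X in measurable X]setTI; exact: measurable_fun_le.
have mS2 (f : X -> R) (k : R) : measurable_fun setT f -> measurable [set y | (f y <= k)%R].
  by move=> mf; rewrite -[X in measurable X]setTI; exact: measurable_fun_le.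
have low : (e%:E <= mu (B x s `&` [set y | (w y <= 0)%R]))%E.
  apply: le_trans (ltW h2) _; apply: le_measure; rewrite ?inE; [exact: measurableD|by apply: measurableI => //; exact: mS2|].
  move=> y [yb /negP]; rewrite -leNgt => vt; split => //=; rewrite /w.
  have -> : clamp 1 ((v y - t) / h) = 0.
    apply/max_idPl; rewrite ge_min; apply/orP; left; rewrite pmulr_lle0 ?invr_gt0//; slra.
  by rewrite mul0r.
(* From [E], of measure above [e], only the band and the set where the cut-off is at least 1/2 are
   lost, each of measure at most [e / 4]. *)
have up : ((e / 2)%:E <= mu (B x s `&` [set y | (2^-1 <= w y)%R]))%E.
  set S := mu (_ `&` [set y | (2^-1 <= w y)%R]).
  have Sfin : S \is a fin_num.
    rewrite ge0_fin_numE; last exact: measure_ge0.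
    by apply: (mu_sub_lty metric borel dbl (x := x) (r := s)); [by apply: measurableI => //; exact: mS|move=> y []].
  have sm2 : (mu (B x (4 * r) `&` [set y | (2^-1 <= ve y)%R]) <= (e / 4)%:E)%E.
    apply: (le_trans sm); rewrite lee_fin.
    apply: (@le_trans _ _ (48 * (K * mB x s))); last by slra.
    rewrite (_ : 48 * (K * _) = (48 * CP2 Cd CP lam * c * Cd) * (Cd ^+ kk * mB x s)); last by rewrite /K exprS; ring.
    by apply: ler_wpM2l => //; apply: mulr_ge0; [apply: mulr_ge0; [slra|exact: ltW]|slra].
  have : (e%:E <= (e / 4)%:E + S + (e / 4)%:E)%E.
    apply: (le_trans (ltW h1)).
    apply: le_trans (_ : (mu ((B x s `&` band v t n.+1%:R^-1) `|` (B x s `&` [set y | (2^-1 <= w y)%R]) `|`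
        (B x (4 * r) `&` [set y | (2^-1 <= ve y)%R])) <= _)%E).
      apply: le_measure; rewrite ?inE; [exact: measurableI| |].
        apply: measurableU; last by apply: measurableI => //; exact: mS.
        by apply: measurableU => //; apply: measurableI => //; exact: mS.
      move=> y [Ey yb]; have [vh|vh] := leP (t + h) (v y).
        have [q|q] := leP 2^-1 (ve y).
          by right; split => //; move: yb; rewrite /dball/=; slra.
        left; right; split => //=; rewrite /w; have -> : clamp 1 ((v y - t) / h) = 1.
          rewrite /clamp (_ : Num.min _ 1 = 1); first by apply/max_idPr.
          by apply/min_idPr; rewrite ler_pdivlMr//; slra.
        by rewrite mul1r; slra.
      by left; left; split => //; rewrite /band/= Ey/=; apply: (lt_le_trans vh); rewrite lerD2l ltW.
    apply: le_trans (measureU2 _ _ _) _; [|by apply: measurableI => //; exact: mS|].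
      by apply: measurableU => //; apply: measurableI => //; exact: mS.
    apply: leeD => //; apply: le_trans (measureU2 _ _ _) _ => //; first by apply: measurableI => //; exact: mS.
    by apply: leeD.
  by rewrite -(fineK Sfin) -!EFinD !lee_fin; slra.
have : ((e / 2)%:E <= mine (mu (B x s `&` [set y | (w y <= 0)%R])) (mu (B x s `&` [set y | (2^-1 <= w y)%R])))%E.
  by rewrite le_min up andbT; apply: le_trans low; rewrite lee_fin; slra.
move=> /le_trans/(_ PS); set IG := (\int[mu]_(x0 in _) G x0)%E; set Ie := (\int[mu]_(x0 in _) ge x0)%E => main.
have IG0 : (0 <= IG)%E by exact: int_ge0.
have Ie1 : (r%:E * Ie <= (3 * c * Cd * mB x r)%:E)%E.
  apply: le_trans small; apply: lee_wpmul2l; first by rewrite lee_fin ltW.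
  by apply: int_sub => //; exact: uge.1.
have Iefin : Ie \is a fin_num.
  rewrite ge0_fin_numE; last by apply: int_ge0; exact: uge.1.
  rewrite -(@lte_pmul2l _ r%:E)// ?lte_fin//; apply: le_lt_trans Ie1 _.
  by rewrite gt0_muley ?lte_fin// ltry.
have [IGf|IGi] := ltP IG +oo%E; last first.
  have -> : IG = +oo%E by apply/eqP; rewrite eq_le leey.
  by rewrite gt0_muley ?lte_fin// leey.
have IGfin : IG \is a fin_num by rewrite ge0_fin_numE.
move: main Ie1; rewrite -(fineK IGfin) -(fineK Iefin) -EFinD -!EFinM !lee_fin => main Ie1.
have Ie0 : 0 <= fine Ie by apply: fine_ge0; apply: int_ge0; exact: uge.1.
have sIe : s * fine Ie <= 3 * c * Cd * mB x r by apply: le_trans Ie1; exact: ler_wpM2r.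
(* The energy of the cut-off accounts for at most [e / 16] of the required [e / 2], so the truncated
   gradient supplies at least [e / 4]. *)
have k1 : CP2 Cd CP lam * (s * fine Ie) <= 3 * (K * mB x s).
  apply: le_trans (ler_wpM2l P0 sIe) _.
  rewrite (_ : 3 * (K * _) = CP2 Cd CP lam * (3 * c * Cd * (Cd ^+ kk * mB x s))); last by rewrite /K exprS; ring.
  have c0' := ltW c0; apply: ler_wpM2l => //; apply: ler_wpM2l => //; apply: mulr_ge0; [apply: mulr_ge0 => //; slra|slra].
have main2 : e / 2 <= 4 * (CP2 Cd CP lam * (s * fine IG)) + 4 * (CP2 Cd CP lam * (s * fine Ie)).
  by apply: (le_trans main); rewrite le_eqVlt; apply/orP; left; apply/eqP; rewrite subr0 invrK; ring.
have : e / 4 <= 4 * (CP2 Cd CP lam * (s * fine IG)) by slra.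
rewrite (_ : gm / _ * _ = (e / 4) / (4 * CP2 Cd CP lam)); last first.
  have Pne : CP2 Cd CP lam != 0 by rewrite gt_eqF// (lt_le_trans ltr01).
  by rewrite /e; field; rewrite Pne.
by move=> hm; rewrite ler_pdivrMr; [move: hm; slra|rewrite mulr_gt0// (lt_le_trans ltr01)].
Qed.
End Trichotomy.

Theorem quantile (R : realType) (Cd CP lam : R) : 1 <= Cd ->
  exists cs Lq Cq : R, [/\ 0 < cs, 1 <= Lq, 0 < Cq, 96 * CP2 Cd CP lam * cs * Cd ^+ 5 < 1 &
  forall (d : measure_display) (X : measurableType d) (dist : X -> X -> R)
     (mu : {measure set X -> \bar R}),
    is_metric dist -> borel_for dist -> dcomplete dist -> (exists x y : X, 0 < dist x y) ->
    doubling dist mu Cd -> PI11 dist mu CP lam ->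
  forall A N : set X, Cap1 dist mu N = 0%E ->
    (forall x, ~ N x -> (liminf0 (fun r : R => capp dist mu 1 (A `&` dball dist x r) (dball dist x (2 * r))
      / capp dist mu 1 (dball dist x r) (dball dist x (2 * r))) < cs%:E)%E) ->
  forall (x0 : X) (r : R) (u v : X -> R) (g : X -> \bar R) (Z : set X) (t1 t2 : R),
    0 < r -> is_ug dist (~` A) u g -> measurable_fun setT v -> measurable Z -> mu Z = 0%E ->
    (forall y, ~ Z y -> u y = v y) -> t1 < t2 ->
    ((mB dist mu x0 r / (4 * Cd ^+ 5))%:E <= mu (dball dist x0 r `&` [set y | (v y <= t1)%R]))%E ->
    ((mB dist mu x0 r / (4 * Cd ^+ 5))%:E <= mu (dball dist x0 r `&` [set y | (t2 <= v y)%R]))%E ->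
    (((t2 - t1) * mB dist mu x0 r)%:E <= (Cq * r)%:E * \int[mu]_(y in dball dist x0 (Lq * r)) g y)%E].
Proof.
have local_context : True by [].
move=> C1; have [gm [Lm [C0 [gm0 Lm1 C00 Hcore]]]] := @core R Cd CP lam C1.
have P0 : 0 < CP2 Cd CP lam by rewrite /CP2 mulr_gt0 ?exprn_gt0 ?lt_max ?ltr01 ?orbT//; slra.
have [kk hkk] := expr2_large (2 * lam2 lam).
have Ck1 : 0 < Cd ^+ kk.+1 by rewrite exprn_gt0//; slra.
have C5 : 0 < Cd ^+ 5 by rewrite exprn_gt0//; slra.
pose P := CP2 Cd CP lam; have P0' : 0 < P by [].
(* Two demands on the capacity threshold: the first brings the cut-offs under the density [gm] that
   [core] asks for, the second is the smallness required by [good_eta]. *)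
pose cs := Num.min (gm / (192 * P * Cd ^+ kk.+1)) (1 / (192 * P * Cd ^+ 5)).
have P192 : 0 < 192 * P by rewrite pmulr_rgt0.
have D1 : 0 < 192 * P * Cd ^+ kk.+1 by exact: mulr_gt0 P192 Ck1.
have D2 : 0 < 192 * P * Cd ^+ 5 by exact: mulr_gt0 P192 C5.
have cs0 : 0 < cs by rewrite lt_min !divr_gt0.
have cs1 : 192 * P * cs * Cd ^+ kk.+1 <= gm.
  rewrite mulrAC -ler_pdivlMl// mulrC /cs ge_min lexx//.
have cs2 : 96 * P * cs * Cd ^+ 5 < 1.
  have : 192 * P * cs * Cd ^+ 5 <= 1 by rewrite mulrAC -ler_pdivlMl// mulrC /cs ge_min lexx orbT.
  have : 0 < P * cs * Cd ^+ 5 by apply: mulr_gt0 => //; apply: mulr_gt0.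
  by slra.
pose cc := gm / (16 * P); have cc0 : 0 < cc by rewrite divr_gt0// mulr_gt0.
have Q0 : 0 < C0 / cc by rewrite divr_gt0.
pose F := Cd ^+ 5; have F0 : 0 < F by [].
exists cs, Lm, (48 * F * (C0 / cc)); split => //; first by apply: mulr_gt0 => //; apply: mulr_gt0.
move=> d X dist mu metric borel cplt diam dbl PI A N N0 Ngood x0 r u v g Z t1 t2 r0 ug mv mZ Z0 hZ t12; rewrite -/F => q1 q2.
set del := t2 - t1; have del0 : 0 < del by rewrite subr_gt0.
set B := dball dist x0 r in q1 q2 *; set W := dball dist x0 (Lm * r).
have Lr0 : 0 < Lm * r by rewrite mulr_gt0//; slra.
have mW : measurable W by exact: dball_measurable.
have mB' : measurable B by exact: dball_measurable.
have m0 := mB_gt0 metric dbl x0 r0; set m := mB dist mu x0 r in q1 q2 m0 *.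
have [Ifin|Iinf] := ltP (\int[mu]_(y in W) g y)%E +oo%E; last first.
  have -> : (\int[mu]_(y in W) g y)%E = +oo%E by apply/eqP; rewrite eq_le leey.
  rewrite gt0_muley; first exact: leey.
  by rewrite lte_fin; apply: mulr_gt0 => //; apply: mulr_gt0 => //; apply: mulr_gt0.
have If : (\int[mu]_(y in W) g y)%E \is a fin_num by rewrite ge0_fin_numE// int_ge0//; exact: ug.1.
set I := fine (\int[mu]_(y in W) g y)%E; rewrite -(fineK If) -/I -EFinM lee_fin.
have I0 : 0 <= I by apply: fine_ge0; apply: int_ge0; exact: ug.1.
(* The potential of the exceptional set adds an energy [e] and a set of measure [e]; here [e] tends
   to 0, once it is small against the quantile mass. *)
suff key e : 0 < e -> e <= m / (8 * F) -> m <= 48 * F * (C0 / cc) * r * (I / del + e).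
  rewrite mulrC -ler_pdivlMr// (_ : _ / del = 48 * F * (C0 / cc) * r * (I / del)); last by ring.
  apply/ler_addgt0Pr => e' e'0; have K0 : 0 < 48 * F * (C0 / cc) * r by apply: mulr_gt0 => //; apply: mulr_gt0 => //; apply: mulr_gt0.
  pose e := Num.min (m / (8 * F)) (e' / (48 * F * (C0 / cc) * r)).
  have e0 : 0 < e by rewrite lt_min; apply/andP; split; apply: divr_gt0 => //; apply: mulr_gt0.
  have em : e <= m / (8 * F) by rewrite ge_min lexx.
  apply: (le_trans (key e e0 em)); rewrite mulrDr lerD2l.
  by rewrite -ler_pdivlMl// mulrC ge_min lexx orbT.
move=> e0 em.
have [phi [psi [uphi ipsi mphi [phi01 phiN] phiO]]] := null_potential metric borel cplt dbl x0 N0 Lr0 e0.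
have lsc_m : measurable_fun setT phi.
  apply/measurable_EFinP; apply: (lsc_measurable borel) => a.
  by rewrite (_ : [set x | _] = [set x | a < phi x]); [exact: phiO|apply/seteqP; split => y /=; rewrite lte_fin].
pose u1 y := clamp 1 ((u y - t1) / del); pose v1 y := clamp 1 ((v y - t1) / del).
have mv1 : measurable_fun setT v1.
  rewrite /v1 /clamp; apply: measurable_maxr => //; apply: measurable_minr => //.
  by apply: measurable_funM => //; apply: measurable_funB.
have ug1 := affine_clamp_ug metric borel t1 ug del0.
(* Points of [N] satisfy no capacity condition. After taking the maximum with [phi] they are
   interior points of every superlevel set with [t < 1], so the second alternative of [core] holds
   trivially near them. *)
have ug' := max_ug metric borel ug1 (ug_subset (@subsetT _ (~` A)) uphi).
set u' := (fun x => Num.max _ _) in ug'; set g' := (fun x => _ + psi x)%E in ug'.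
pose v' y := Num.max (v1 y) (phi y).
have mv' : measurable_fun setT v' by apply: measurable_maxr.
have uv' y : ~ Z y -> u' y = v' y by move=> /hZ e'; rewrite /u' /v' /v1 e'.
have bg' : borel_nonneg g' := ug'.1.
have di0 : (0 <= (del^-1)%:E)%E by rewrite lee_fin invr_ge0 ltW.
have Jle : (\int[mu]_(y in W) g' y <= (I / del + e)%:E)%E.
  rewrite (int_add _ mW ug1.1 uphi.1) EFinD; apply: leeD => //.
  by rewrite (int_scale _ mW di0 ug.1) -(fineK If) -EFinM mulrC.
have Jf : (\int[mu]_(y in W) g' y)%E \is a fin_num.
  by rewrite ge0_fin_numE ?int_ge0//; apply: le_lt_trans Jle (ltry _).
set J := fine (\int[mu]_(y in W) g' y)%E.
have JE : (\int[mu]_(y in W) g' y)%E = J%:E by rewrite fineK.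
have J0 : 0 <= J by apply: fine_ge0; exact: int_ge0.
have JI : J <= I / del + e by rewrite -lee_fin -JE.
suff KJ : m / (16 * F) <= 3 * ((C0 / cc * r) * J).
  have K0 : 0 <= C0 / cc * r by rewrite mulr_ge0// ltW.
  have := ler_wpM2l K0 JI => h1; have : m / (16 * F) <= 3 * (C0 / cc * r * (I / del + e)) by slra.
  rewrite ler_pdivrMr; last exact: mulr_gt0.
  by move/le_trans; apply; rewrite le_eqVlt; apply/orP; left; apply/eqP; ring.
have mle t : measurable [set y | (v' y <= t)%R].
  by rewrite -[X in measurable X]setTI; exact: measurable_fun_le.
have mlt t : measurable [set y | (t < v' y)%R].
  rewrite (_ : [set y | _] = ~` [set y | (v' y <= t)%R]); first exact: measurableC.
  by apply/seteqP; split => y; rewrite /= ltNge => /negP.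
(* The gradient mass up to level [t]. The truncated gradient of a band of width [h] integrates to at
   most the difference quotient of [G] plus [J], where [J] comes from the coefficient 1 of the
   untruncated term in [trunc_grad]. *)
pose G t := fine (\int[mu]_(y in W `&` [set y | (v' y <= t)%R]) g' y)%E.
have GE t : (\int[mu]_(y in W `&` [set y | (v' y <= t)%R]) g' y)%E = (G t)%:E.
  rewrite fineK// ge0_fin_numE ?int_ge0//; apply: (@le_lt_trans _ _ J%:E); last exact: ltry.
  by rewrite -JE; apply: int_sub => //; exact: measurableI.
have Gm s t : s <= t -> G s <= G t.
  move=> st; rewrite -lee_fin -!GE; apply: int_sub => //; [exact: measurableI|exact: measurableI|].
  by move=> y [yW /= ys]; split => //=; exact: le_trans st.
have Gband t h : 0 < h -> (\int[mu]_(y in W `&` band v' t h) g' y <= (G (t + h) - G t)%:E)%E.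
  move=> h0; rewrite EFinB leeBrDr// -!GE addeC -ge0_integral_setU//.
  - apply: int_sub => //; [|exact: measurableI|].
      by apply: measurableU; apply: measurableI => //; exact: band_measurable.
    move=> y [[yW /= yt]|[yW /andP[_ yt]]]; split => //=; [slra|exact: ltW].
  - exact: measurableI.
  - by apply: measurableI => //; exact: band_measurable.
  - exact: measurable_funTS bg'.1.
  - by move=> y _; exact: bg'.2.
  - rewrite disj_set2E; apply/eqP/seteqP; split => // y [[_ /= yt] [_ /andP[ty _]]].
    by move: yt; rewrite leNgt ty.
have G34 : G (3 / 4) - G (1 / 4) <= J.
  have : 0 <= G (1 / 4) by apply: fine_ge0; exact: int_ge0.
  have : G (3 / 4) <= J.
    by rewrite -lee_fin -GE -JE; apply: int_sub => //; exact: measurableI.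
  slra.
have Q1 : 0 < C0 / cc * r by rewrite mulr_gt0.
(* The growth rate of [G] that remains after [J] is subtracted. Over the levels from 1/4 to 3/4 the
   function [G] grows by at most [J], hence [k <= 2 * J], and the subtracted [J] makes the factor
   3. *)
pose k := m / (16 * F) / (C0 / cc * r) - J.
suff kJ : k <= 2 * J.
  have : m / (16 * F) / (C0 / cc * r) <= 3 * J by rewrite /k in kJ; slra.
  rewrite (ler_pdivrMr _ _ Q1) => hh; apply: (le_trans hh); rewrite le_eqVlt; apply/orP; left; apply/eqP; ring.
have [k0|k0] := leP k 0; first by slra.
suff : k * (3 / 4 - 1 / 4) <= G (3 / 4) - G (1 / 4) by slra.
apply: monotone_growth => //; [slra|exact: ltW|].
move=> t ta tb.
have [] := Hcore d X dist mu metric borel cplt dbl PI x0 r cc [set y | (t < v' y)%R]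
  (fun h => trunc_grad g' v' Z t h 1) r0 cc0 (mlt t).
- by move=> h h0; apply: bn_trunc.
- move=> h h0; rewrite int_trunc_grad// -/W JE.
  apply: (@le_lt_trans _ _ ((h^-1)%:E * (G (t + h) - G t)%:E + J%:E)%E); last by rewrite -EFinM -EFinD ltry.
  by apply: leeD2r; apply: lee_wpmul2l; [rewrite lee_fin invr_ge0 ltW|exact: Gband].
- move=> x xW; have [Nx|nNx] := pselect (N x).
    have tphi : [set y | t < phi y] x by rewrite /= phiN//; slra.
    have [q q0 hq] := phiO t x tphi.
    exists (Num.min q r); first by rewrite lt_min q0 r0 ge_min lexx orbT.
    apply: Or32; rewrite (_ : _ `\` _ = set0) ?measure0 ?lee_fin ?mulr_ge0 ?mB_ge0 ?(ltW gm0)//.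
    apply/seteqP; split => // y [xy]; apply; rewrite /= /v' lt_max; apply/orP; right; apply: hq.
    by apply: (lt_le_trans xy); rewrite ge_min lexx.
  exact: (trichotomy metric borel diam dbl PI cs0 cs2 t (Ngood x nNx) gm0 hkk cs1 ug' mv' mZ Z0 uv' r0).
move=> h1 h10 Hh; exists h1 => // h h0 hlt.
have {Hh} := Hh h h0 hlt; rewrite -/B -/W -/m int_trunc_grad// JE => Hh.
have mF : m / (8 * F) = 2 * (m / (16 * F)) by field; rewrite gt_eqF.
have mF2 : m / (4 * F) = 2 * (m / (8 * F)) by field; rewrite gt_eqF.
have mF0 : 0 < m / (16 * F) by rewrite divr_gt0// mulr_gt0.
have m84 : m / (8 * F) <= m / (4 * F) by rewrite mF2; move: mF mF0; slra.
have big : ((m / (8 * F))%:E <= mine (mu ([set y | (t < v' y)%R] `&` B)) (mu (B `\` [set y | (t < v' y)%R])))%E.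
  have mS (f : X -> R) (a : R) : measurable_fun setT f -> measurable [set y | (f y <= a)%R].
    by move=> mf; rewrite -[X in measurable X]setTI; exact: measurable_fun_le.
  rewrite le_min; apply/andP; split.
    apply: (@le_trans _ _ (m / (4 * F))%:E); first by rewrite lee_fin; exact: m84.
    apply: (le_trans q2); apply: le_measure; rewrite ?inE.
    - apply: measurableI => //; rewrite -[X in measurable X]setTI; exact: measurable_fun_le.
    - exact: measurableI.
    move=> y [yB /= ty]; split => //=; rewrite /v' lt_max; apply/orP; left.
    rewrite /v1 (_ : clamp 1 _ = 1); first by slra.
    rewrite /clamp (_ : Num.min _ 1 = 1); first by apply/max_idPr.
    by apply/min_idPr; rewrite ler_pdivlMr// mul1r /del; slra.
  have mph : measurable [set x | (0 < phi x)%R] by apply: (dopen_measurable borel); exact: phiO.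
  have : ((m / (4 * F))%:E <= mu (B `\` [set y | (t < v' y)%R]) + (m / (8 * F))%:E)%E.
    apply: (le_trans q1); apply: le_trans (_ : (mu ((B `\` [set y | (t < v' y)%R]) `|` [set x | (0 < phi x)%R]) <= _)%E).
      apply: le_measure; rewrite ?inE; [by apply: measurableI => //; exact: mS| |].
        by apply: measurableU => //; exact: measurableD.
      move=> y [yB /= yt]; have [p|p] := ltP 0 (phi y); [by right|left; split => //=].
      apply/negP; rewrite -leNgt /v' ge_max; apply/andP; split; last by slra.
      rewrite /v1 (_ : clamp 1 _ = 0); first by slra.
      apply/max_idPl; rewrite ge_min; apply/orP; left; rewrite pmulr_lle0 ?invr_gt0//; slra.
    apply: le_trans (measureU2 _ _ _) _ => //; first exact: measurableD.
    by rewrite leeD2l//; apply: (le_trans mphi); rewrite lee_fin.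
  rewrite -leeBlDr// -EFinB; apply: le_trans; rewrite lee_fin; move: mF2; slra.
have {}Hh := le_trans big Hh.
have fin0 : ((m / (8 * F))%:E <= (m / (16 * F))%:E + (C0 / cc * r)%:E * ((h^-1)%:E * (G (t + h) - G t)%:E + J%:E))%E.
  apply: (le_trans Hh); apply: leeD2l; apply: lee_wpmul2l; first by rewrite lee_fin ltW.
  by apply: leeD2r; apply: lee_wpmul2l; [rewrite lee_fin invr_ge0 ltW|exact: Gband].
have fin : m / (8 * F) <= m / (16 * F) + C0 / cc * r * (h^-1 * (G (t + h) - G t) + J).
  by rewrite -lee_fin EFinD (EFinM (C0 / cc * r)) EFinD (EFinM h^-1).
have : m / (16 * F) <= C0 / cc * r * (h^-1 * (G (t + h) - G t) + J) by move: fin mF; slra.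
rewrite -ler_pdivrMl// mulrC -lerBlDr -/k => h3.
by rewrite -ler_pdivlMr// mulrC.
Qed.

(** * Density of Lipschitz functions *)

Lemma below_ge_real (R : realType) m (y : R) : 0 <= y -> y <= m%:R -> y <= below m y%:E.
Proof.
move=> y0; rewrite /below; elim: m => [|m IH] ym; first by rewrite big_ord0.
have [h|h] := leP y m%:R.
  by rewrite big_ord_recr/=; case: ifP => _; have := IH h; lra.
apply: (le_trans ym); rewrite (eq_bigr (fun=> 1)) ?sumr_const ?card_ord//.
move=> i _; rewrite lte_fin (_ : _ < y)//; apply: le_lt_trans h; rewrite ler_nat -ltnS.
exact: ltn_ord.
Qed.

Lemma clamp_distl (R : realType) (l a b : R) : `|clamp l a - clamp l b| <= `|a - b|.
Proof.
have local_context : True by [].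
have [h|/ltW h] := leP a b.
  have h1 := clamp_mono l h; have h2 := clamp_lip l h.
  by rewrite ler0_norm ?subr_le0// ler0_norm ?subr_le0//; slra.
have h1 := clamp_mono l h; have h2 := clamp_lip l h.
by rewrite ger0_norm ?subr_ge0// ger0_norm ?subr_ge0//; slra.
Qed.

Section Powers.
Variables (R : realType) (p : R).
Hypothesis p1 : 1 <= p.
Let p0 : 0 <= p. Proof. exact: le_trans p1. Qed.

Lemma poweRD_le (a b : \bar R) : (0 <= a)%E -> (0 <= b)%E ->
  ((a + b) `^ p <= (2 `^ p)%:E * (a `^ p + b `^ p))%E.
Proof.
move=> a0 b0; have m0 : (0 <= maxe a b)%E by rewrite le_max a0.
apply: (@le_trans _ _ ((2%:E * maxe a b) `^ p)%E).
  apply: le_poweR => //; first exact: adde_ge0.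
  rewrite (_ : 2%:E = 1%:E + 1%:E)%E; last by rewrite -EFinD.
  by rewrite ge0_muleDl// mul1e; apply: leeD; rewrite le_max lexx ?orbT.
rewrite poweRM// poweR_EFin; apply: lee_wpmul2l; first by rewrite lee_fin powR_ge0.
by rewrite /maxe; case: ifP => _; [rewrite leeDr|rewrite leeDl]; rewrite ?poweR_ge0.
Qed.

Lemma poweR_max_le (a b : \bar R) : (0 <= a)%E -> (0 <= b)%E -> ((maxe a b) `^ p <= a `^ p + b `^ p)%E.
Proof.
by move=> a0 b0; rewrite /maxe; case: ifP => _; [rewrite leeDr|rewrite leeDl]; rewrite ?poweR_ge0.
Qed.

(** The [p]-th power lies above its tangent at [a]. *)
Lemma young (t a : R) : 0 <= t -> 0 <= a -> p * (a `^ (p - 1) * t) <= t `^ p + (p - 1) * a `^ p.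
Proof.
move=> t0 a0; have [->|pn1] := eqVneq p 1.
  by rewrite subrr powRr0 mul0r addr0 !mul1r powRr1.
have pp : 0 < p by exact: lt_le_trans p1.
have q0 : 0 < p - 1 by rewrite subr_gt0 lt_def pn1.
have := @conjugate_powR R t (a `^ (p - 1)) p (p / (p - 1)) t0 (powR_ge0 _ _) pp.
rewrite divr_gt0// => /(_ isT) h.
have {}h := h _; rewrite -powRrM in h.
have e1 : p^-1 + (p / (p - 1))^-1 = 1 by field; rewrite !gt_eqF.
have e2 : (p - 1) * (p / (p - 1)) = p by field; rewrite gt_eqF.
have {}h := h e1; rewrite e2 in h.
have -> : p * (a `^ (p - 1) * t) = p * (t * a `^ (p - 1)) by ring.
apply: (le_trans (ler_wpM2l p0 h)); rewrite le_eqVlt; apply/orP; left; apply/eqP.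
by field; rewrite !gt_eqF.
Qed.

(** The tangent inequality of [young] is integrated at the mean value [a] of [q]. Used first with
    tangent point 1, it shows that this mean is finite. *)
Lemma jensen (d : measure_display) (X : measurableType d) (mu : {measure set X -> \bar R})
    (S : set X) (m : R) (q : X -> \bar R) : measurable S -> mu S = m%:E -> 0 < m -> borel_nonneg q ->
  (((m^-1)%:E * \int[mu]_(x in S) q x) `^ p <= (m^-1)%:E * \int[mu]_(x in S) (q x `^ p))%E.
Proof.
move=> mS Sm m0 bq; have pp : 0 < p by exact: lt_le_trans p1.
have bqp := bn_pow p bq.
have [fin|inf] := ltP (\int[mu]_(x in S) (q x `^ p))%E +oo%E; last first.
  have -> : (\int[mu]_(x in S) (q x `^ p))%E = +oo%E by apply/eqP; rewrite eq_le leey.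
  by rewrite gt0_muley ?leey// lte_fin invr_gt0.
have Yq a x : 0 <= a -> (p%:E * ((a `^ (p - 1))%:E * q x) <= q x `^ p + ((p - 1) * a `^ p)%:E)%E.
  move=> a0; have := bq.2 x; case: (q x) => [t|_|//]; last by rewrite poweRyr ?gt_eqF// addye// leey.
  by rewrite lee_fin poweR_EFin -!EFinM -EFinD lee_fin => t0; exact: young.
have If : (\int[mu]_(x in S) q x < +oo)%E.
  have b1 : borel_nonneg (fun _ : X => ((p - 1) * 1 `^ p)%:E : \bar R).
    by apply: bn_cst; rewrite lee_fin mulr_ge0 ?powR_ge0// subr_ge0.
  apply: (@le_lt_trans _ _ (\int[mu]_(x in S) (q x `^ p + ((p - 1) * 1 `^ p)%:E))%E).
    apply: int_mono => //; first exact: bn_add.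
    move=> x _; apply: le_trans (Yq 1 x ler01); rewrite powR1 mul1e.
    by rewrite -[leLHS]mul1e; apply: lee_wpmul2r; [exact: bq.2|rewrite lee_fin].
  by rewrite (int_add _ mS bqp b1) integral_cst// Sm -EFinM lte_add_pinfty// ltry.
have If' : (\int[mu]_(x in S) q x)%E \is a fin_num by rewrite ge0_fin_numE// int_ge0.
have Ip' : (\int[mu]_(x in S) (q x `^ p))%E \is a fin_num by rewrite ge0_fin_numE// int_ge0.
set a := fine (\int[mu]_(x in S) q x)%E / m.
have a0 : 0 <= a by rewrite divr_ge0 ?(ltW m0)// fine_ge0// int_ge0.
have b1 : borel_nonneg (fun _ : X => ((p - 1) * a `^ p)%:E : \bar R).
  by apply: bn_cst; rewrite lee_fin mulr_ge0 ?powR_ge0// subr_ge0.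
have pE : (0 <= p%:E)%E by rewrite lee_fin.
have aE : (0 <= (a `^ (p - 1))%:E)%E by rewrite lee_fin powR_ge0.
have : (\int[mu]_(x in S) (p%:E * ((a `^ (p - 1))%:E * q x)) <= \int[mu]_(x in S) (q x `^ p + ((p - 1) * a `^ p)%:E))%E.
  apply: int_mono => //; [by apply: bn_scale => //; exact: bn_scale|exact: bn_add|].
  by move=> x _; exact: Yq.
rewrite (int_add _ mS bqp b1) (int_scale _ mS pE (bn_scale aE bq)) (int_scale _ mS aE bq) integral_cst// Sm.
rewrite -(fineK If') -(fineK Ip') -!EFinM -EFinD lee_fin => main.
rewrite poweR_EFin lee_fin mulrC -/a.
have am : fine (\int[mu]_(x in S) q x)%E = a * m by rewrite /a divfK// gt_eqF.
rewrite am in main.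
have ap : a * a `^ (p - 1) = a `^ p by exact: mulr_powRB1.
rewrite ler_pdivlMl//.
have : p * (a `^ (p - 1) * (a * m)) = p * (m * a `^ p) by rewrite -ap; ring.
by lra.
Qed.
End Powers.

Section Density.
Variables (R : realType) (d : measure_display) (X : measurableType d) (dist : X -> X -> R).
Hypothesis metric : is_metric dist.
Hypothesis borel : borel_for dist.
Variable nu : {measure set X -> \bar R}.
Hypothesis nufin : (nu setT < +oo)%E.

(** The function is 0 off an open set around [E] and 1 at distance [1 / (n + 1)] from its
    complement. It differs from the indicator only in a thin layer and between the closed and the
    open approximation of [E]. *)
Lemma indic_lusin (E : set X) e : measurable E -> 0 < e -> exists (h : X -> R) L S,
  [/\ lip dist h L, 0 <= L, measurable S, (nu S <= e%:E)%E & forall x, ~ S x -> h x = \1_E x].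
Proof.
move=> mE e0; have e20 : 0 < e / 2 by rewrite divr_gt0.
have [A0 [W [oA oW AE EW small]]] := regular metric borel nufin mE e20.
have mW := dopen_measurable borel oW.
have mA : measurable A0 by rewrite -(setCK A0); apply: measurableC; exact: (dopen_measurable borel oA).
have mD t : measurable [set x | ddist dist (~` W) x <= t].
  rewrite -[X in measurable X]setTI; apply: measurable_fun_le => //.
  exact: (lip_measurable metric borel (lip_ddist metric _)).
have mF n : measurable (W `&` [set x | ddist dist (~` W) x <= n.+1%:R^-1]) by exact: measurableI.
have [n hn] : exists n, (nu (W `&` [set x | (ddist dist (~` W) x <= n.+1%:R^-1)%R]) <= (e / 2)%:E)%E.
  apply: (@measure_cvg0 _ _ _ nu (fun n => W `&` [set x | ddist dist (~` W) x <= n.+1%:R^-1])) => //.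
  - by apply: le_lt_trans nufin; apply: le_measure; rewrite ?inE.
  - move=> i j ij y [Wy /= h]; split => //=; apply: (le_trans h).
    by rewrite lef_pV2 ?posrE ?ltr0n// ler_nat.
  - apply/seteqP; split => // y hy; have [Wy _] := hy 0%N I.
    have dy := (ddist_gt0 metric y oW).2 Wy; have [i hi] := invS_small dy.
    by have [_ /=] := hy i I; rewrite leNgt hi.
exists (fun x => clamp 1 (n.+1%:R * ddist dist (~` W) x)), n.+1%:R, ((W `\` A0) `|` (W `&` [set x | ddist dist (~` W) x <= n.+1%:R^-1])).
split => //.
- move=> x y; apply: (le_trans (clamp_distl _ _ _)); rewrite -mulrBr normrM ger0_norm// ler_wpM2l//.
  by have := lip_ddist metric (~` W) x y; rewrite mul1r.
- by apply: measurableU => //; exact: measurableD.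
- apply: le_trans (measureU2 _ _ _) _ => //; first exact: measurableD.
  by rewrite (_ : e = e / 2 + e / 2)%R; [rewrite EFinD leeD|field].
move=> x /not_orP[n1 n2]; rewrite indicE; have [Wx|nW] := pselect (W x).
  have Ax : A0 x by apply: contrapT => nA; exact: n1.
  rewrite mem_set; last exact: AE.
  have dd : n.+1%:R^-1 <= ddist dist (~` W) x by apply/ltW; rewrite ltNge; apply/negP => h; exact: n2.
  rewrite /clamp (_ : Num.min _ 1 = 1); first by apply/max_idPr.
  by apply/min_idPr; rewrite -ler_pdivrMl ?ltr0n// mulr1.
rewrite memNset; last by move=> /EW.
have := ddist_le metric x (nW : (~` W) x); rewrite (distxx metric) => h.
by apply/max_idPl; rewrite ge_min; apply/orP; left; rewrite mulr_ge0_le0.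
Qed.

(** Off a small set [v] is bounded, and a bounded function is within one step of a staircase, a
    multiple of a sum of indicators of superlevel sets. Each of the [M] indicators is replaced by a
    Lipschitz function off a set of measure [e / 2 / M]. *)
Lemma lusin (v : X -> R) e : measurable_fun setT v -> 0 < e -> exists (h : X -> R) L S,
  [/\ lip dist h L, 0 <= L, measurable S, (nu S <= e%:E)%E & forall x, ~ S x -> `|v x - h x| <= e].
Proof.
have local_context : True by [].
move=> mv e0; have e20 : 0 < e / 2 by rewrite divr_gt0.
have mT n : measurable [set x | n%:R <= `|v x|].
  by rewrite -[X in measurable X]setTI; apply: measurable_fun_le => //; exact: measurableT_comp.
have [n0 hn0] : exists n, (nu [set x | (n%:R <= `|v x|)%R] <= (e / 2)%:E)%E.
  apply: (@measure_cvg0 _ _ _ nu (fun n => [set x | n%:R <= `|v x|])) => //.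
  - by apply: le_lt_trans nufin; apply: le_measure; rewrite ?inE.
  - by move=> i j ij y /=; apply: le_trans; rewrite ler_nat.
  - apply/seteqP; split => // y hy; have /andP[_ k2] := truncn_itv (normr_ge0 (v y)).
    by have := hy (Num.truncn `|v y|).+1 I; rewrite /= leNgt k2.
pose n := n0.+1; have n1 : 1 <= n%:R :> R by rewrite ler1n.
have [M0 hM0] : exists k, k.+1%:R^-1 < e / (2 * n%:R).
  by apply: invS_small; apply: divr_gt0 => //; apply: mulr_gt0 => //; exact: lt_le_trans n1.
pose M := M0.+1; have Mp : 0 < M%:R :> R by rewrite ltr0n.
pose w x := M%:R * ((v x + n%:R) / (2 * n%:R)).
have mw : measurable_fun setT w.
  by apply: measurable_funM => //; apply: measurable_funM => //; apply: measurable_funD.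
have mE (j : nat) : measurable [set x | j%:R < w x].
  rewrite (_ : [set x | _] = ~` [set x | w x <= j%:R]).
    by apply: measurableC; rewrite -[X in measurable X]setTI; exact: measurable_fun_le.
  by apply/seteqP; split => y; rewrite /= ltNge => /negP.
have eM : 0 < e / 2 / M%:R by rewrite divr_gt0.
have Hj (j : nat) : exists hLS : (X -> R) * R * set X, [/\ lip dist hLS.1.1 hLS.1.2, 0 <= hLS.1.2, measurable hLS.2,
    (nu hLS.2 <= (e / 2 / M%:R)%:E)%E & forall x, ~ hLS.2 x -> hLS.1.1 x = \1_[set x | j%:R < w x] x].
  by have [h [L [S hh]]] := indic_lusin (mE j) eM; exists (h, L, S).
have [H hH] := choice Hj.
pose h x := 2 * n%:R / M%:R * \sum_(j < M) (H j).1.1 x - n%:R.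
pose S := \big[setU/set0]_(j < M) (H j).2.
have mS : measurable S by apply: bigsetU_measurable => j _; case: (hH j).
have c0 : 0 <= 2 * n%:R / M%:R :> R by rewrite divr_ge0// mulr_ge0.
exists h, (2 * n%:R / M%:R * \sum_(j < M) (H j).1.2), ([set x | n0%:R <= `|v x|] `|` S); split.
- move=> x y; rewrite /h (_ : _ - _ = 2 * n%:R / M%:R * (\sum_(j < M) (H j).1.1 x - \sum_(j < M) (H j).1.1 y)); last by ring.
  rewrite normrM ger0_norm// -[leRHS]mulrA ler_wpM2l// -sumrB mulr_suml; apply: le_trans (ler_norm_sum _ _ _) _.
  by apply: ler_sum => j _; case: (hH j).
- by rewrite mulr_ge0// sumr_ge0// => j _; case: (hH j).
- exact: measurableU.
- apply: le_trans (measureU2 _ _ _) _ => //.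
  rewrite (_ : e = e / 2 + e / 2)%R; last by field.
  rewrite EFinD; apply: leeD; first exact: hn0.
  apply: (@le_trans _ _ (\sum_(j < M) (e / 2 / M%:R)%:E)%E); last first.
    by rewrite sumEFin lee_fin sumr_const card_ord -[leLHS]mulr_natl mulrC divfK// gt_eqF.
  apply: (@le_trans _ _ (\sum_(j < M) nu (H j).2)%E); last by apply: lee_sum => j _; case: (hH j).
  have sub k : (nu (\big[setU/set0]_(j < k) (H j).2) <= \sum_(j < k) nu (H j).2)%E.
    elim: k => [|k IH]; first by rewrite !big_ord0 measure0.
    rewrite !big_ord_recr/=; apply: le_trans (measureU2 _ _ _) _.
    - by apply: bigsetU_measurable => j _; case: (hH j).
    - by case: (hH k).
    - exact: leeD.
  exact: sub.
move=> x /not_orP[v1 nS]; have {}v1 : `|v x| < n0%:R by rewrite ltNge; apply/negP.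
have nS' (j : 'I_M) : ~ (H j).2 x by move=> hj; apply: nS; rewrite /S -(bigcup_mkord M (fun j => (H j).2)); exists j => //=; exact: ltn_ord.
have n0n : n0%:R <= n%:R :> R by rewrite ler_nat.
have hE : \sum_(j < M) (H j).1.1 x = below M (w x)%:E.
  rewrite /below; apply: eq_bigr => j _; case: (hH j) => _ _ _ _ -> //.
  rewrite indicE lte_fin; case: ifPn => hj; first by rewrite mem_set.
  by rewrite memNset//= => hj'; rewrite hj' in hj.
have [v2 v3] : - n%:R <= v x /\ v x <= n%:R.
  by move: v1; rewrite ltr_norml => /andP[]; slra.
have d2 : 0 < 2 * n%:R :> R by slra.
have w0 : 0 <= w x by rewrite mulr_ge0// divr_ge0//; slra.
have wM : w x <= M%:R.
  by rewrite /w -[leRHS]mulr1 ler_pM2l// ler_pdivrMr// mul1r; slra.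
have b1 := below_ge_real w0 wM.
have b2 : below M (w x)%:E <= w x + 1.
  by rewrite -lee_fin EFinD; apply: below_le; rewrite lee_fin.
have vE : v x = 2 * n%:R / M%:R * w x - n%:R by rewrite /w; field; rewrite !gt_eqF//; slra.
rewrite /h hE vE; set b := below _ _ in b1 b2 *; set k := 2 * n%:R / M%:R in c0 *.
have ke : k <= e.
  rewrite /k mulrC -ler_pdivlMr//; apply/ltW; exact: hM0.
have k1 : 0 <= k * (b - w x) by rewrite mulr_ge0//; slra.
have k2 : k * (b - w x) <= k * 1 by rewrite ler_wpM2l//; slra.
by rewrite ler_norml; apply/andP; split; slra.
Qed.

(** Above a height [N] the function [g] has little energy. Its truncation at [N] is approximated by
    [lusin], and clamping the approximant to [[0, N]] bounds the error on the exceptional set by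
    [N]. *)
Lemma lip_density (p : R) (g : X -> \bar R) e : 1 <= p -> borel_nonneg g -> (\int[nu]_x (g x `^ p) < +oo)%E -> 0 < e ->
  exists (h : X -> R) L, [/\ lip dist h L, 0 <= L, forall x, 0 <= h x &
    (\int[nu]_x ((`|g x - (h x)%:E|) `^ p) <= e%:E)%E].
Proof.
have local_context : True by [].
move=> p1 bg gfin e0; have p0 : 0 <= p by exact: le_trans p1.
have bgp := bn_pow p bg.
have mF (n : nat) : measurable [set x | ((n%:R)%:E < g x)%E].
  by rewrite -[X in measurable X]setTI; apply: emeasurable_fun_o_infty => //; exact: bg.1.
have e20 : 0 < e / 2 by rewrite divr_gt0.
have [n hn] : exists n : nat, (\int[nu]_(x in [set x | ((n%:R)%:E < g x)%E]) (g x `^ p) <= (e / 2)%:E)%E.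
  apply: (@int_cvg0 _ _ _ nu setT (fun n => [set x | ((n%:R)%:E < g x)%E]) (fun x => g x `^ p)%E) => //.
  - by move=> i j ij x /=; apply: le_lt_trans; rewrite lee_fin ler_nat.
  - set T := \bigcap_n _; have mT : measurable T by apply: bigcapT_measurable.
    apply/eqP/negPn/negP => T0; have Tp : (0 < nu T)%E by rewrite lt0e T0 measure_ge0.
    have : (\int[nu]_(x in T) (g x `^ p) = +oo)%E.
      rewrite (eq_integral (fun=> +oo%E)); last first.
        move=> x; rewrite inE => Tx; rewrite (_ : g x = +oo%E); first by rewrite poweRyr// gt_eqF// (lt_le_trans ltr01).
        apply/eqyP => a a0; have /andP[_ k2] := truncn_itv (ltW a0).
        by apply: le_trans (ltW (Tx (Num.truncn a).+1 I)); rewrite lee_fin ltW.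
      by rewrite integral_cst// gt0_mulye.
    move=> Tinf; have := int_sub nu mT measurableT bgp (@subsetT _ _).
    by rewrite Tinf leye_eq => /eqP h; rewrite h in gfin.
  - exact: bgp.1.
  - exact: bgp.2.
pose N : R := n%:R; have N0 : 0 <= N by [].
pose w x := fine (mine (g x) N%:E).
have wE x : (w x)%:E = mine (g x) N%:E.
  rewrite fineK// ge0_fin_numE; first by rewrite gt_min ltry orbT.
  by rewrite le_min bg.2 lee_fin.
have mw : measurable_fun setT w.
  apply/measurable_EFinP; rewrite (_ : _ \o w = fun x => mine (g x) N%:E); last by apply/funext => x /=; rewrite wE.
  by apply: measurable_mine => //; exact: bg.1.
have nuf : nu setT \is a fin_num by rewrite ge0_fin_numE.
pose V := fine (nu setT); have V0 : 0 <= V by exact: fine_ge0.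
have VE : nu setT = V%:E by rewrite fineK.
have C0 : 0 < V + N `^ p + 1 by rewrite ltr_wpDl// addr_ge0// powR_ge0.
pose e' := Num.min 1 (e / 2 / (V + N `^ p + 1)).
have e'0 : 0 < e' by rewrite lt_min ltr01 divr_gt0.
have e'1 : e' <= 1 by rewrite ge_min lexx.
have e'2 : e' * (V + N `^ p + 1) <= e / 2 by rewrite -ler_pdivlMr// ge_min lexx orbT.
have [h0 [L [S [h0L L0 mS sS hS]]]] := lusin mw e'0.
pose h x := clamp N (h0 x).
have h01 x : 0 <= h x <= N by rewrite clamp_ge0 clamp_le.
exists h, L; split => //.
- by move=> x y; apply: (le_trans (clamp_distl _ _ _)); exact: h0L.
- by move=> x; have /andP[] := h01 x.
have b1 : borel_nonneg (fun x => (e'%:E + (N `^ p)%:E * (\1_S x)%:E : \bar R)%E).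
  apply: bn_add; first by apply: bn_cst; rewrite lee_fin ltW.
  by apply: bn_scale; [rewrite lee_fin powR_ge0|exact: bn_indic].
have b2 : borel_nonneg (fun x => (g x `^ p * (\1_([set x | ((n%:R)%:E < g x)%E]) x)%:E)%E).
  by apply: bn_mul => //; exact: bn_indic.
have bgh : borel_nonneg (fun x => `|g x - (h x)%:E|)%E.
  split => //; apply: measurableT_comp => //; apply: emeasurable_funB; first exact: bg.1.
  apply/measurable_EFinP; apply: (lip_measurable metric borel (L := L)) => x y.
  by apply: (le_trans (clamp_distl _ _ _)); exact: h0L.
apply: (@le_trans _ _ (\int[nu]_x ((e'%:E + (N `^ p)%:E * (\1_S x)%:E) + (g x `^ p * (\1_([set x | ((n%:R)%:E < g x)%E]) x)%:E)))%E).
  apply: int_mono => //; [exact: bn_pow|exact: bn_add|].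
  move=> x _; have /andP[h1 h2] := h01 x; have [gN|gN] := ltP N%:E (g x).
    have -> : (\1_[set x0 | ((n%:R)%:E < g x0)%E] x : R) = 1 by rewrite indicE mem_set.
    rewrite mule1.
    apply: (@le_trans _ _ (g x `^ p)%E); last by rewrite leeDr// b1.2.
    apply: le_poweR => //; case: (g x) gN (bg.2 x) => [t| |]//.
    by rewrite lte_fin -EFinB abse_EFin !lee_fin => tN t0; rewrite ger0_norm; slra.
  have gw : g x = (w x)%:E by rewrite wE; apply/esym/min_idPl.
  have w0 : 0 <= w x by rewrite -lee_fin -gw bg.2.
  have wN : w x <= N by rewrite -lee_fin -gw.
  apply: (@le_trans _ _ (e'%:E + (N `^ p)%:E * (\1_S x)%:E)%E); last by rewrite leeDl// b2.2.
  rewrite gw -EFinB abse_EFin poweR_EFin -EFinM -EFinD lee_fin.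
  rewrite indicE; have [Sx|nS] := pselect (S x).
    rewrite mem_set// mulr1; apply: ler_wpDl; first exact: ltW.
    by apply: ge0_ler_powR => //; rewrite ?nnegrE// ler_norml; apply/andP; split; slra.
  rewrite memNset// mulr0 addr0.
  have wh : `|w x - h x| <= e'.
    by rewrite -{1}(clamp_id w0 wN); apply: (le_trans (clamp_distl _ _ _)); exact: hS.
  apply: (@le_trans _ _ (e' `^ p)); first by apply: ge0_ler_powR => //; rewrite nnegrE// ltW.
  by apply: ge1r_powR => //; rewrite e'0.
rewrite (int_add _ measurableT b1 b2) (_ : e = e / 2 + e / 2)%R; last by field.
rewrite EFinD; apply: leeD; last by rewrite int_indicE// setTI.
have c1 : (0 <= (N `^ p)%:E)%E by rewrite lee_fin powR_ge0.
have bc : borel_nonneg (fun _ : X => e'%:E : \bar R) by apply: bn_cst; rewrite lee_fin ltW.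
rewrite (int_add _ measurableT bc (bn_scale c1 (bn_indic _ mS))) (int_scale _ measurableT c1 (bn_indic _ mS)).
rewrite integral_cst// VE integral_indic// setIT.
apply: (@le_trans _ _ (e'%:E * V%:E + (N `^ p)%:E * e'%:E)%E); first by rewrite leeD2l//; exact: lee_wpmul2l.
rewrite -!EFinM -EFinD lee_fin; apply: le_trans e'2; rewrite !mulrDr mulr1 (mulrC (N `^ p)).
by rewrite lerDl ltW.
Qed.
End Density.

(** * Discrete approximation by medians *)

Lemma restr_int (R : realType) (d : measure_display) (X : measurableType d) (mu : {measure set X -> \bar R})
    (W : set X) (mW : measurable W) (f : X -> \bar R) : borel_nonneg f ->
  (\int[mrestr mu mW]_x f x = \int[mu]_(x in W) f x)%E.
Proof.
move=> bf; have mC : measurable (~` W) by exact: measurableC.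
rewrite -(setUv W) ge0_integral_setU//; last 3 first.
- exact: measurable_funTS bf.1.
- by move=> x _; exact: bf.2.
- by rewrite disj_set2E setICr.
have z : mrestr mu mW (~` W) = 0%E by rewrite /mrestr [X in mu X](_ : _ = set0) ?measure0// setICl.
rewrite (int_null mC z bf).
rewrite adde0; apply: eq_measure_integral => A mA AW; rewrite /mrestr/=.
by congr (mu _); apply/setIidPl.
Qed.

Section Median.
Variables (R : realType) (d : measure_display) (X : measurableType d) (dist : X -> X -> R).
Hypothesis metric : is_metric dist.
Hypothesis borel : borel_for dist.
Variable mu : {measure set X -> \bar R}.
Variable Cd : R.
Hypothesis dbl : doubling dist mu Cd.
Local Notation B := (dball dist).
Local Notation mB := (mB dist mu).
Variable v : X -> R.
Hypothesis mv : measurable_fun setT v.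

Lemma measurable_sub_le a : measurable [set y | (v y <= a)%R].
Proof. by rewrite -[X in measurable X]setTI; exact: measurable_fun_le. Qed.
Lemma measurable_sup_ge a : measurable [set y | (a <= v y)%R].
Proof. by rewrite -[X in measurable X]setTI; exact: measurable_fun_le. Qed.

(** The infimum of the levels under which [v] stays on at least half of the ball. The slack [del]
    allows both inequalities to be stated without one-sided limits. *)
Lemma median y s : 0 < s -> exists m, forall del, 0 < del ->
  ((mB y s / 2)%:E <= mu (B y s `&` [set z | (v z <= m + del)%R]))%E /\
  ((mB y s / 2)%:E <= mu (B y s `&` [set z | (m - del <= v z)%R]))%E.
Proof.
have local_context : True by [].
move=> s0; have m0 := mB_gt0 metric dbl y s0; have mb : measurable (B y s) by exact: dball_measurable.
have mlow a : measurable (B y s `&` [set z | (v z <= a)%R]) by apply: measurableI => //; exact: measurable_sub_le.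
have mup a : measurable (B y s `&` [set z | (a <= v z)%R]) by apply: measurableI => //; exact: measurable_sup_ge.
have m40 : 0 < mB y s / 4 by rewrite divr_gt0.
have mT n : measurable (B y s `&` [set z | (n%:R <= `|v z|)%R]).
  apply: measurableI => //; rewrite -[X in measurable X]setTI; apply: measurable_fun_le => //; exact: measurableT_comp.
have [n hn] : exists n, (mu (B y s `&` [set z | (n%:R <= `|v z|)%R]) <= (mB y s / 4)%:E)%E.
  apply: (@measure_cvg0 _ _ _ mu (fun n => B y s `&` [set z | (n%:R <= `|v z|)%R])) => //.
  - by apply: (mu_sub_lty metric borel dbl (x := y) (r := s)) => // z [].
  - by move=> i j ij z [zb /= h]; split => //=; apply: le_trans h; rewrite ler_nat.
  - apply/seteqP; split => // z hz; have /andP[_ k2] := truncn_itv (normr_ge0 (v z)).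
    by have [_] := hz (Num.truncn `|v z|).+1 I; rewrite /= leNgt k2.
have cover (a b : R) : a <= b -> ((mB y s)%:E <= mu (B y s `&` [set z | (v z <= b)%R]) + mu (B y s `&` [set z | (a <= v z)%R]))%E.
  move=> ab; rewrite -(mBE metric dbl); apply: le_trans (measureU2 _ _ _) => //.
  apply: le_measure; rewrite ?inE//; first exact: measurableU.
  by move=> z zb; have [h|h] := leP (v z) b; [left|right; split => //=; slra].
have fin a : mu (B y s `&` [set z | (v z <= a)%R]) \is a fin_num.
  by rewrite ge0_fin_numE//; apply: (mu_sub_lty metric borel dbl (x := y) (r := s)) => // z [].
have fin2 a : mu (B y s `&` [set z | (a <= v z)%R]) \is a fin_num.
  by rewrite ge0_fin_numE//; apply: (mu_sub_lty metric borel dbl (x := y) (r := s)) => // z [].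
have mono a b : a <= b -> (mu (B y s `&` [set z | (v z <= a)%R]) <= mu (B y s `&` [set z | (v z <= b)%R]))%E.
  by move=> ab; apply: le_measure; rewrite ?inE// => z [zb /= h]; split => //=; exact: le_trans ab.
pose S := [set t : R | ((mB y s / 2)%:E <= mu (B y s `&` [set z | (v z <= t)%R]))%E].
have Sn : S n%:R.
  have := cover n%:R n%:R (lexx _).
  have h : (mu (B y s `&` [set z | (n%:R <= v z)%R]) <= (mB y s / 4)%:E)%E.
    apply: le_trans hn; apply: le_measure; rewrite ?inE// => z [zb /= h]; split => //=.
    exact: le_trans (ler_norm _).
  by move: h; rewrite /S/= -(fineK (fin _)) -(fineK (fin2 _)) -EFinD !lee_fin; slra.
have Slb t : S t -> - n%:R <= t.
  move=> St; rewrite leNgt; apply/negP => tn.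
  have h : (mu (B y s `&` [set z | (v z <= t)%R]) <= (mB y s / 4)%:E)%E.
    apply: le_trans hn; apply: le_measure; rewrite ?inE// => z [zb /= h]; split => //=.
    have := ler_norm (- v z); rewrite normrN; slra.
  by have := le_trans St h; rewrite lee_fin; slra.
have hi : has_inf S by split; [exists n%:R|exists (- n%:R)].
exists (inf S) => del del0; split.
  have [t St tl] := inf_adherent del0 hi.
  by apply: le_trans St _; apply: mono; exact: ltW.
have nS : ~ S (inf S - del).
  by move=> h; have := ge_inf hi.2 h; slra.
have := cover _ _ (lexx (inf S - del)).
move: nS; rewrite /S/= -(fineK (fin _)) -(fineK (fin2 _)) -EFinD !lee_fin => /negP; rewrite -ltNge.
slra.
Qed.
End Median.

Section Step.
Variables (R : realType) (d : measure_display) (X : measurableType d) (dist : X -> X -> R).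
Hypothesis metric : is_metric dist.
Hypothesis borel : borel_for dist.
Variable mu : {measure set X -> \bar R}.
Variable Cd : R.
Hypothesis dbl : doubling dist mu Cd.
Local Notation B := (dball dist).
Local Notation mB := (mB dist mu).
Local Notation leb := (@lebesgue_measure R).
Variables (Cq Lq p : R) (kap : nat) (v : X -> R) (g : X -> \bar R) (x0 : X) (rho sigma : R).
Hypothesis p1 : 1 <= p.
Hypothesis Cq0 : 0 < Cq.
Hypothesis Lq1 : 1 <= Lq.
Hypothesis hkap : 2 * Lq + 1 <= 2 ^+ kap.
Hypothesis mv : measurable_fun setT v.
Hypothesis bg : borel_nonneg g.
Hypothesis sigma0 : 0 < sigma.
Let W := B x0 (rho + 1).
Hypothesis gfin : (\int[mu]_(x in W) (g x `^ p) < +oo)%E.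
Hypothesis HQ : forall y s t1 t2, dist x0 y < rho -> 0 < s -> s < sigma -> t1 < t2 ->
  ((mB y s / (4 * Cd ^+ 5))%:E <= mu (B y s `&` [set z | (v z <= t1)%R]))%E ->
  ((mB y s / (4 * Cd ^+ 5))%:E <= mu (B y s `&` [set z | (t2 <= v z)%R]))%E ->
  (((t2 - t1) * mB y s)%:E <= (Cq * s)%:E * \int[mu]_(z in B y (Lq * s)) g z)%E.
Let Lam := 2 * Lq + 1.
Let NN := Cd ^+ kap.
Let C1 : 1 <= Cd. Proof. exact: (Cd_ge1 metric borel dbl x0). Qed.
Let mb y s : measurable (B y s). Proof. exact: dball_measurable. Qed.
Let Cp k : 0 < Cd ^+ k. Proof. by rewrite exprn_gt0// (lt_le_trans ltr01). Qed.
Let Lam3 : 3 <= Lam. Proof. by have := Lq1; rewrite /Lam; lra. Qed.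

Section Scale.
Variables (tau : R) (m : X -> R) (n : nat) (q : 'I_n -> X).
Hypothesis tau0 : 0 < tau.
Hypothesis tau1 : Lam * tau <= 1.
Hypothesis taus : 2 * tau < sigma.
Hypothesis mP : forall y del, 0 < del ->
  ((mB y tau / 2)%:E <= mu (B y tau `&` [set z | (v z <= m y + del)%R]))%E /\
  ((mB y tau / 2)%:E <= mu (B y tau `&` [set z | (m y - del <= v z)%R]))%E.
Hypothesis qnear : forall i, dist x0 (q i) < rho.
Hypothesis qsep : forall i j, i != j -> tau <= dist (q i) (q j).
Hypothesis qcov : forall y, dist x0 y < rho -> exists i, dist y (q i) < tau.

Definition ravg (i : 'I_n) (f : X -> \bar R) : \bar R := ((mB (q i) tau)^-1%:E * \int[mu]_(z in B (q i) (Lam * tau)) f z)%E.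
(** A maximal function at the single scale [tau]. From a point of a doubled net ball it sees the
    integral over the larger ball [Lam * tau] that the quantile inequality reaches, normalized by
    the small net ball. *)
Definition amax (f : X -> \bar R) (x : X) : \bar R :=
  \big[maxe/0%E]_(i < n) (ravg i f * (\1_(B (q i) (2 * tau)) x)%:E)%E.

Let mq i : 0 < mB (q i) tau. Proof. exact: (mB_gt0 metric dbl (q i) tau0). Qed.

Lemma ravg_ge0 i f : borel_nonneg f -> (0 <= ravg i f)%E.
Proof. by move=> bf; apply: mule_ge0; [rewrite lee_fin invr_ge0 ltW// mq|exact: int_ge0]. Qed.

Lemma amax_ge i f x : B (q i) (2 * tau) x -> (ravg i f <= amax f x)%E.
Proof.
move=> xb; apply: le_trans (le_bigmax _ _ i); rewrite indicE mem_set//= mule1//.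
Qed.

Lemma bn_amax f : borel_nonneg f -> borel_nonneg (amax f).
Proof.
move=> bf; have H (s : seq 'I_n) : borel_nonneg (fun x => \big[maxe/0%E]_(i <- s) (ravg i f * (\1_(B (q i) (2 * tau)) x)%:E)%E).
  elim: s => [|i s IH].
    rewrite (_ : (fun x => _) = (fun _ => 0%E)); first by apply: bn_cst.
    by apply/funext => x; rewrite big_nil.
  rewrite (_ : (fun x => _) = (fun x => maxe (ravg i f * (\1_(B (q i) (2 * tau)) x)%:E) (\big[maxe/0%E]_(i <- s) (ravg i f * (\1_(B (q i) (2 * tau)) x)%:E)))%E); last first.
    by apply/funext => x; rewrite big_cons.
  by apply: bn_max => //; apply: bn_scale; [exact: ravg_ge0|exact: bn_indic].
exact: H.
Qed.

Let sumT f x := (\sum_(i < n) (ravg i f) `^ p * (\1_(B (q i) (2 * tau)) x)%:E)%E.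

Lemma amax_pow f x : borel_nonneg f -> ((amax f x) `^ p <= \sum_(i < n) (ravg i f) `^ p * (\1_(B (q i) (2 * tau)) x)%:E)%E.
Proof.
move=> bf; have pp : 0 < p by exact: lt_le_trans p1.
have t0 i : (0 <= ravg i f * (\1_(B (q i) (2 * tau)) x)%:E)%E by apply: mule_ge0; [exact: ravg_ge0|rewrite lee_fin].
suff : (0 <= amax f x)%E /\ ((amax f x) `^ p <= \sum_(i < n) (ravg i f) `^ p * (\1_(B (q i) (2 * tau)) x)%:E)%E by case.
rewrite /amax; elim/big_ind2: _ => //.
- by split => //; rewrite (poweR_EFin 0) powR0// gt_eqF.
- move=> a b a' b' [h1 h2] [h3 h4]; split; first by rewrite le_max h1.
  by apply: le_trans (poweR_max_le _ h1 h3) _; exact: leeD.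
- move=> i _; split => //; rewrite indicE; case: (x \in _); rewrite ?mule1// !mule0.
  by rewrite (poweR_EFin 0) powR0// gt_eqF.
Qed.

(** Jensen on each enlarged ball and their bounded overlap. As a single scale is involved, the bound
    includes [p = 1]. *)
Lemma int_amax_pow f : borel_nonneg f ->
  (\int[mu]_x (amax f x) `^ p <= ((NN `^ p) * Cd ^+ kap.+3)%:E * \int[mu]_(x in W) (f x `^ p))%E.
Proof.
have local_context : True by [].
move=> bf; have bfp := bn_pow p bf; have l3 := Lam3; have t0 := tau0; have t1 := tau1.
have bI i : borel_nonneg (fun x => (ravg i f) `^ p * (\1_(B (q i) (2 * tau)) x)%:E)%E.
  by apply: bn_scale; [exact: poweR_ge0|exact: bn_indic].
have bS : borel_nonneg (fun x => \sum_(i < n) (ravg i f) `^ p * (\1_(B (q i) (2 * tau)) x)%:E)%E.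
  split=> [|y]; first by apply: emeasurable_sum => i; exact: (bI i).1.
  by apply: sume_ge0 => i _; exact: (bI i).2.
apply: (@le_trans _ _ (\int[mu]_x (\sum_(i < n) (ravg i f) `^ p * (\1_(B (q i) (2 * tau)) x)%:E))%E).
  apply: int_mono => //; first by apply: bn_pow; exact: bn_amax.
  by move=> x _; exact: amax_pow.
rewrite ge0_integral_sum//; [|by move=> i; exact: (bI i).1|by move=> i y _; exact: (bI i).2].
apply: (@le_trans _ _ (\sum_(i < n) (NN `^ p)%:E * \int[mu]_(z in B (q i) (Lam * tau)) (f z `^ p))%E).
  apply: lee_sum => i _; rewrite (int_scale _ measurableT (poweR_ge0 _ _) (bn_indic _ (mb _ _))) integral_indic// setIT.
  have Lt0 : 0 < Lam * tau by rewrite mulr_gt0//; slra.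
  have mL := mB_gt0 metric dbl (q i) Lt0.
  set I := (\int[mu]_(z in B (q i) (Lam * tau)) f z)%E.
  have I0 : (0 <= I)%E by exact: int_ge0.
  have ratio : (mB (q i) tau)^-1 <= NN * (mB (q i) (Lam * tau))^-1.
    rewrite ler_pdivlMr// ler_pdivrMl// [X in _ <= X]mulrC; apply: (mB_iter metric borel dbl).
    by rewrite (distxx metric) add0r; apply: ler_wpM2r; [exact: ltW|exact: hkap].
  have N0 : (0 <= NN%:E)%E by rewrite lee_fin; exact: (ltW (Cp kap)).
  have v0 : (0 <= ((mB (q i) (Lam * tau))^-1)%:E)%E by rewrite lee_fin invr_ge0 ltW.
  have h1 : ((ravg i f) `^ p <= (NN `^ p)%:E * ((((mB (q i) (Lam * tau))^-1)%:E * \int[mu]_(z in B (q i) (Lam * tau)) (f z `^ p))))%E.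
    apply: (@le_trans _ _ ((NN%:E * (((mB (q i) (Lam * tau))^-1)%:E * I)) `^ p)%E).
      apply: le_poweR; [exact: le_trans p1|exact: ravg_ge0|].
      by rewrite muleA -EFinM /ravg; apply: lee_wpmul2r => //; rewrite lee_fin.
    rewrite poweRM//; last by apply: mule_ge0.
    rewrite poweR_EFin; apply: lee_wpmul2l; first by rewrite lee_fin powR_ge0.
    exact: (jensen p1 (mb _ _) (mBE metric dbl _ _) mL bf).
  apply: (@le_trans _ _ (((NN `^ p)%:E * ((((mB (q i) (Lam * tau))^-1)%:E * \int[mu]_(z in B (q i) (Lam * tau)) (f z `^ p)))) * (mB (q i) (Lam * tau))%:E)%E).
    apply: lee_pmul => //; first exact: poweR_ge0.
    rewrite (mBE metric dbl) lee_fin; apply: (mB_le metric borel dbl); rewrite (distxx metric) add0r.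
    by apply: ler_wpM2r; [exact: ltW|slra].
  rewrite -muleA; apply: lee_wpmul2l; first by rewrite lee_fin powR_ge0.
  rewrite muleAC -EFinM mulVf ?gt_eqF// mul1e//.
rewrite -ge0_sume_distrr; last by move=> i _; exact: int_ge0.
rewrite EFinM -muleA; apply: lee_wpmul2l; first by rewrite lee_fin powR_ge0.
apply: (overlap_int metric borel dbl x0 tau0 qsep) => //.
- rewrite !exprS; have : Lam * tau <= 2 ^+ kap * tau by apply: ler_wpM2r; [exact: ltW|exact: hkap].
  have : 1 * tau <= Lam * tau by apply: ler_wpM2r; [exact: ltW|slra].
  slra.
- exact: mb.
- by move=> i _; apply: dball_sub => //; have := qnear i; slra.
Qed.

(** The balls of radius [tau] about [y] and [z] lie in [B y (2 * tau)] and fill a fixed share of it,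
    so both medians are quantiles of [v] on that ball for the fraction in [HQ]. *)
Lemma median_step y z i : dist x0 y < rho -> dist y z <= tau -> dist y (q i) < tau ->
  (`|m y - m z|%:E <= (2 * Cq * tau)%:E * ravg i g)%E.
Proof.
have local_context : True by [].
move=> yr yz yq; have t0 := tau0; have c0 := Cq0; have l1 := Lq1.
have t20 : 0 < 2 * tau by slra.
have my := mB_gt0 metric dbl y t20.
set I := (\int[mu]_(w in B (q i) (Lam * tau)) g w)%E.
have I0 : (0 <= I)%E by exact: int_ge0.
have [If|Ii] := ltP I +oo%E; last first.
  rewrite /ravg -/I; case: (I) Ii => [s| |] //= _.
  rewrite gt0_muley ?lte_fin ?invr_gt0// gt0_muley ?leey// lte_fin.
  by rewrite !mulr_gt0.
have IE : I = (fine I)%:E by rewrite fineK// ge0_fin_numE.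
have i0 : 0 <= fine I by exact: fine_ge0.
have frac w (E : set X) : measurable E -> dist y w + tau <= 2 * tau -> ((mB w tau / 2)%:E <= mu (B w tau `&` E))%E ->
    ((mB y (2 * tau) / (4 * Cd ^+ 5))%:E <= mu (B y (2 * tau) `&` E))%E.
  move=> mE yw h; apply: le_trans (_ : (mu (B w tau `&` E) <= _)%E); last first.
    apply: le_measure; rewrite ?inE; [exact: measurableI|exact: measurableI|].
    by move=> a [ab Ea]; split => //; exact: (dball_sub metric yw ab).
  apply: le_trans h; rewrite lee_fin.
  have k2 : mB y (2 * tau) <= Cd ^+ 2 * mB w tau.
    apply: (mB_iter metric borel dbl); rewrite (distC metric) expr2.
    by have : 0 <= dist y w by [exact: (dist_ge0 metric)]; slra.
  have k5 : Cd ^+ 2 <= Cd ^+ 5 by apply: ler_weXn2l.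
  have w0 := mB_ge0 dist mu w tau.
  have F0 : 0 < 4 * Cd ^+ 5 by apply: mulr_gt0 => //; exact: Cp.
  rewrite ler_pdivrMr//.
  apply: (le_trans k2); apply: (@le_trans _ _ (Cd ^+ 5 * mB w tau)); first exact: ler_wpM2r.
  have := mulr_ge0 (ltW (Cp 5)) w0; slra.
have fy := @frac y; have fz := @frac z.
have yy : dist y y + tau <= 2 * tau by rewrite (distxx metric); slra.
have zz : dist y z + tau <= 2 * tau by slra.
have main lo hi : (forall del, 0 < del ->
    ((mB y (2 * tau) / (4 * Cd ^+ 5))%:E <= mu (B y (2 * tau) `&` [set w | (v w <= lo + del)%R]))%E /\
    ((mB y (2 * tau) / (4 * Cd ^+ 5))%:E <= mu (B y (2 * tau) `&` [set w | (hi - del <= v w)%R]))%E) ->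
    hi - lo <= 2 * Cq * tau * ((mB (q i) tau)^-1 * fine I).
  move=> H; have r0 : 0 <= 2 * Cq * tau * ((mB (q i) tau)^-1 * fine I).
    by rewrite !mulr_ge0 ?invr_ge0 ?mB_ge0 ?(ltW c0) ?(ltW t0).
  have [hl|lh] := leP hi lo; first by slra.
  apply/ler_addgt0Pr => e e0; pose del := Num.min (e / 2) ((hi - lo) / 4).
  have d0 : 0 < del by rewrite lt_min divr_gt0//= divr_gt0// subr_gt0.
  have d1 : del <= e / 2 by rewrite ge_min lexx.
  have d2 : del <= (hi - lo) / 4 by rewrite ge_min lexx orbT.
  have [H1 H2] := H del d0; have t12 : lo + del < hi - del by slra.
  have := HQ yr t20 taus t12 H1 H2.
  have sub : (\int[mu]_(w in B y (Lq * (2 * tau))) g w <= (fine I)%:E)%E.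
    rewrite -IE; apply: int_sub => //; apply: dball_sub => //; rewrite (distC metric) /Lam; slra.
  have cs : (0 <= (Cq * (2 * tau))%:E)%E by rewrite lee_fin !mulr_ge0 ?(ltW c0)// ltW.
  move=> /le_trans/(_ (lee_wpmul2l cs sub)); rewrite -EFinM lee_fin => h.
  have mm : mB (q i) tau <= mB y (2 * tau) by apply: (mB_le metric borel dbl); slra.
  have h3 : (hi - del - (lo + del)) * mB (q i) tau <= Cq * (2 * tau) * fine I.
    by apply: le_trans h; apply: ler_wpM2l => //; slra.
  rewrite -ler_pdivlMr// in h3.
  have eqn : 2 * Cq * tau * ((mB (q i) tau)^-1 * fine I) = Cq * (2 * tau) * fine I / mB (q i) tau by ring.
  by rewrite eqn; slra.
have mle := @measurable_sub_le _ _ _ v mv; have mge := @measurable_sup_ge _ _ _ v mv.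
rewrite /ravg -/I IE -!EFinM lee_fin ler_norml; apply/andP; split.
  have := main (m y) (m z); rewrite lerNl opprB; apply => del d0.
  by have [a1 _] := mP y d0; have [_ b2] := mP z d0; split; [exact: fy|exact: fz].
apply: main => del d0.
by have [_ a2] := mP y d0; have [b1 _] := mP z d0; split; [exact: fz|exact: fy].
Qed.

(** The curve is cut into pieces of length between [tau / 2] and [tau]. Along a piece [amax] is at
    least the average attached to its start, so its integral controls the jump of the median given
    by [median_step]; hence the factor 4 in place of 2. *)
Lemma median_chain c : arc_curve dist c -> curve_in (B x0 rho) c -> tau <= clen c ->
  (`|m (cmap c 0) - m (cmap c (clen c))|%:E <= line_int (fun x => (4 * Cq)%:E * amax g x) c)%E.
Proof.
have local_context : True by [].
move=> ac ci tl; have t0 := tau0; have c0 := Cq0; have [l0 _] := ac.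
have l_t : 0 <= clen c / tau by rewrite divr_ge0 ?(ltW l0)// ltW.
have /andP[k1 k2] := truncn_itv l_t; set k := (Num.truncn _).+1 in k2.
have kp : 0 < k%:R :> R by rewrite ltr0n.
pose s := clen c / k%:R; have s0 : 0 < s by rewrite divr_gt0.
have st : s <= tau.
  by rewrite /s ler_pdivrMr// mulrC -ler_pdivrMr// ltW.
have ts : tau <= 2 * s.
  have k3 : k%:R <= 2 * (clen c / tau) :> R.
    have : 1 <= clen c / tau by rewrite ler_pdivlMr// mul1r.
    by rewrite /k -natr1; move: k1; slra.
  rewrite mulrA ler_pdivlMr// in k3; rewrite /s mulrA ler_pdivlMr//.
  by rewrite mulrC.
have bA := bn_amax bg.
have bE := bn_ext metric borel ac (bn_scale (_ : (0 <= (4 * Cq)%:E)%E) bA).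
have {}bE : borel_nonneg (fun t : measurableTypeR R => ((4 * Cq)%:E * amax g (ext c t))%E).
  by apply: bE; rewrite lee_fin mulr_ge0// ltW.
have ks : k%:R * s = clen c by rewrite /s mulrC divfK// gt_eqF.
have inr j : (j <= k)%N -> 0 <= j%:R * s <= clen c.
  by move=> jk; rewrite mulr_ge0 ?(ltW s0)//= -ks ler_wpM2r ?(ltW s0)// ler_nat.
have step j : (j <= k)%N -> (`|m (ext c 0) - m (ext c (j%:R * s))|%:E <=
    \int[leb]_(t in `[0%R, (j%:R * s)%R]) ((4 * Cq)%:E * amax g (ext c t)))%E.
  elim: j => [|j IH] jk; first by rewrite mul0r subrr normr0; apply: integral_ge0 => t _; exact: bE.2.
  have /andP[j1 j2] := inr _ (ltnW jk); have /andP[j3 j4] := inr _ jk.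
  have jj : j%:R * s <= j.+1%:R * s by rewrite ler_wpM2r ?(ltW s0)// ler_nat.
  have jE : j.+1%:R * s - j%:R * s = s by rewrite -natr1; ring.
  rewrite (integral_split bE.1 bE.2 j1 jj).
  apply: (@le_trans _ _ (`|m (ext c 0) - m (ext c (j%:R * s))|%:E + `|m (ext c (j%:R * s)) - m (ext c (j.+1%:R * s))|%:E)%E).
    by rewrite -EFinD lee_fin ler_distD.
  apply: leeD; first exact: IH (ltnW jk).
  set y := ext c (j%:R * s); set z := ext c _; have cl := ext_lip ac.
  have yr : dist x0 y < rho by rewrite /y extE//; exact: ci.
  have yz : dist y z <= tau by apply: le_trans (cl _ _ jj) _; rewrite jE.
  have [i yi] := qcov yr.
  apply: (le_trans (median_step yr yz yi)).
  have r0 := ravg_ge0 i bg.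
  have [rf|ri] := ltP (ravg i g) +oo%E; last first.
    have rE : ravg i g = +oo%E by apply/eqP; rewrite eq_le leey.
    apply: le_trans (leey _) _; rewrite -rE.
    have A1 t : j%:R * s <= t -> t <= j.+1%:R * s -> ((4 * Cq)%:E * amax g (ext c t) = +oo)%E.
      move=> q1 q2; have : (amax g (ext c t) = +oo)%E.
        apply/eqP; rewrite eq_le leey/= -rE; apply: amax_ge; rewrite /dball/=.
        have := dist_tri metric (q i) y (ext c t); have := cl _ _ q1; rewrite -/y (distC metric (q i) y); slra.
      by move=> ->; rewrite gt0_muley// lte_fin mulr_gt0.
    rewrite rE leye_eq; apply/eqP/eqyP => A A0.
    have := integral_ge_cst bE.1 bE.2 jj (k := A / s); rewrite jE divfK ?gt_eqF//; apply.
    by move=> t q1 q2; rewrite A1// leey.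
  have rE : ravg i g = (fine (ravg i g))%:E by rewrite fineK// ge0_fin_numE.
  have rf0 : 0 <= fine (ravg i g) by exact: fine_ge0.
  rewrite rE -EFinM; apply: (@le_trans _ _ ((4 * Cq * fine (ravg i g)) * (j.+1%:R * s - j%:R * s))%:E).
    rewrite jE lee_fin (_ : 4 * Cq * _ * s = 2 * Cq * (2 * s) * fine (ravg i g)); last by ring.
    by apply: ler_wpM2r => //; apply: ler_wpM2l => //; rewrite mulr_ge0// ltW.
  apply: (integral_ge_cst bE.1 bE.2 jj) => t q1 q2; rewrite EFinM -rE.
  apply: lee_wpmul2l; first by rewrite lee_fin mulr_ge0// ltW.
  apply: amax_ge; rewrite /dball/=.
  by have := dist_tri metric (q i) y (ext c t); have := cl _ _ q1; rewrite -/y (distC metric (q i) y); slra.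
have h := step k (leqnn k); rewrite ks (extE (lexx 0) (ltW l0)) (extE (ltW l0) (lexx _)) in h.
by rewrite line_int_ext.
Qed.
End Scale.
Let mW : measurable W. Proof. exact: mb. Qed.

(** The averages in [amax] have to be traded for values of [g] with an error small in [L^p]. A
    Lipschitz approximant [h] of [g] hardly varies at scale [tau], and the remainder [q0] is small
    together with its [amax]. Likewise [v] is near a Lipschitz function off a small set, which
    brings the medians near [v] except in balls that this set fills substantially. *)
Lemma step e : 0 < e -> exists (m : X -> R) (w : X -> \bar R) (S : set X),
  [/\ borel_nonneg w, (\int[mu]_x (w x `^ p) <= e%:E)%E, measurable S /\ (mu S <= e%:E)%E,
      forall x, dist x0 x < rho -> ~ S x -> `|m x - v x| <= e &
      forall c, arc_curve dist c -> curve_in (B x0 rho) c -> e <= clen c ->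
        (`|m (cmap c 0) - m (cmap c (clen c))|%:E <= line_int (fun x => (4 * Cq * Cd ^+ kap)%:E * g x + w x) c)%E].
Proof.
have local_context : True by [].
move=> e0; have l3 := Lam3; have c0 := Cq0; have sg := sigma0; have pp : 0 <= p by exact: le_trans p1.
have N0 : 0 < NN by exact: Cp.
pose mWr := fine (mu W); have mWE : mu W = mWr%:E by rewrite /mWr fineK// ge0_fin_numE//; exact: (muB_fin metric dbl).
have mW0 : 0 <= mWr by exact: fine_ge0.
pose nu := mrestr mu mW.
have nufin : (nu setT < +oo)%E by rewrite /nu /mrestr setTI mWE ltry.
pose K1 := (4 * Cq) `^ p * (4 `^ p).
have K10 : 0 < K1 by rewrite mulr_gt0// powR_gt0// mulr_gt0.
pose K2 := NN `^ p * Cd ^+ kap.+3.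
have K20 : 0 < K2 by rewrite mulr_gt0// ?powR_gt0//; exact: Cp.
pose e1 := e / (3 * K1 * K2).
have e10 : 0 < e1 by rewrite divr_gt0// mulr_gt0// mulr_gt0.
have [h [Lh [hl Lh0 h0 hint]]] : exists (h : X -> R) L, [/\ lip dist h L, 0 <= L, forall x, 0 <= h x &
    (\int[nu]_x ((`|g x - (h x)%:E|) `^ p) <= e1%:E)%E].
  apply: (lip_density metric borel nufin p1 bg _ e10).
  by rewrite /nu restr_int//; exact: bn_pow.
(* The passage to the bad balls multiplies the measure of the exceptional set by at most
   [2 * Cd ^+ 5]. *)
pose e2 := Num.min (e / 4) (e / (1 + 2 * Cd ^+ 5)).
have c5 := Cp 5.
have e20 : 0 < e2 by rewrite lt_min !divr_gt0//; slra.
have e2a : e2 <= e / 4 by rewrite ge_min lexx.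
have e2b : e2 * (1 + 2 * Cd ^+ 5) <= e.
  by rewrite -ler_pdivlMr; [rewrite /e2 ge_min lexx orbT|slra].
clearbody e2.
have [f [Lf [Sf [fl Lf0 mSf Sfe fv]]]] := lusin metric borel nufin mv e20.
have bh : borel_nonneg (fun x => (h x)%:E).
  by split=> [|x]; [apply/measurable_EFinP; exact: (lip_measurable metric borel hl)|rewrite lee_fin].
have bgh : borel_nonneg (fun x => (`|g x - (h x)%:E|)%E).
  split=> [|x]; last exact: abse_ge0.
  by apply: measurableT_comp => //; apply: emeasurable_funB; [exact: bg.1|exact: bh.1].
pose q0 x : \bar R := (`|g x - (h x)%:E| * (\1_W x)%:E)%E.
have bq : borel_nonneg q0.
  split=> [|x]; last by apply: mule_ge0; [exact: abse_ge0|rewrite lee_fin].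
  by apply: emeasurable_funM; [exact: bgh.1|exact: (bn_indic R mW).1].
have qW x : W x -> q0 x = (`|g x - (h x)%:E|)%E by move=> wx; rewrite /q0 indicE mem_set// mule1.
have ghq x : W x -> (g x <= (h x)%:E + q0 x)%E /\ ((h x)%:E <= g x + q0 x)%E.
  move=> wx; rewrite qW//; have := bg.2 x; case: (g x) => [s| |] // s0.
    rewrite -EFinB /= -!EFinD !lee_fin; split; [have := ler_norm (s - h x)|have := ler_norm (h x - s); rewrite distrC]; slra.
  by split; [exact: (lexx +oo%E)|exact: (leey (h x)%:E)].
have qint : (\int[mu]_(x in W) (q0 x `^ p) <= e1%:E)%E.
  apply: le_trans hint; rewrite /nu restr_int; last exact: bn_pow.
  by apply: int_mono => //; [exact: bn_pow|exact: bn_pow|move=> x wx; rewrite qW].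
pose D := NN * Lh * (Lam + 2).
have D0 : 0 <= D by rewrite !mulr_ge0//; [exact: ltW|slra].
pose eta := Num.min 1 (e / (3 * K1 * (mWr + 1))).
have eta0 : 0 < eta by rewrite lt_min ltr01 divr_gt0// mulr_gt0//; [rewrite mulr_gt0|slra].
(* The last two entries make the Lipschitz approximants of [v] and of [g] nearly constant at scale
   [tau]. *)
pose tau := Num.min (1 / Lam) (Num.min (sigma / 3) (Num.min e (Num.min (e / (4 * (Lf + 1))) (eta / (D + 1))))).
have tau0 : 0 < tau.
  rewrite !lt_min !divr_gt0 ?e0//=; [slra|rewrite mulr_gt0//; slra|slra].
have ta : tau <= 1 / Lam by rewrite ge_min lexx.
have tb : tau <= sigma / 3 by rewrite /tau !ge_min lexx !orbT.
have tc : tau <= e by rewrite /tau !ge_min lexx !orbT.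
have td : tau <= e / (4 * (Lf + 1)) by rewrite /tau !ge_min lexx !orbT.
have te : tau <= eta / (D + 1) by rewrite /tau !ge_min lexx !orbT.
have tau1 : Lam * tau <= 1 by move: ta; rewrite ler_pdivlMr; [rewrite mulrC|slra].
have taus : 2 * tau < sigma by slra.
have tLf : Lf * tau <= e / 4.
  by move: td; rewrite ler_pdivlMr; [slra|rewrite mulr_gt0//; slra].
pose d0 := D * tau.
have d00 : 0 <= d0 by rewrite mulr_ge0// ltW.
have dle : d0 <= eta.
  by move: te; rewrite ler_pdivlMr; [rewrite /d0; have := tau0; slra|slra].
have d01 : d0 <= 1 by apply: (le_trans dle); rewrite ge_min lexx.
have d0m : d0 * mWr <= e / (3 * K1).
  have : d0 <= e / (3 * K1 * (mWr + 1)) by apply: (le_trans dle); rewrite ge_min lexx orbT.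
  rewrite invfM mulrA ler_pdivlMr; last by slra.
  by move: d00; slra.
clearbody tau eta; clear ta tb td te dle eta0.
have [n [pt [pnear psep pcov]]] := ball_net metric borel dbl x0 rho tau0.
have [m mP] : exists m : X -> R, forall y, forall del, 0 < del ->
  ((mB y tau / 2)%:E <= mu (B y tau `&` [set z | (v z <= m y + del)%R]))%E /\
  ((mB y tau / 2)%:E <= mu (B y tau `&` [set z | (m y - del <= v z)%R]))%E.
  by exists (fun y => projT1 (cid (median metric borel dbl mv y tau0))) => y; exact: (projT2 (cid (median metric borel dbl mv y tau0))).
have mq i : 0 < mB (pt i) tau by exact: (mB_gt0 metric dbl (pt i) tau0).
have bA f' : borel_nonneg f' -> borel_nonneg (amax tau pt f') by exact: bn_amax.
pose amx (f' : X -> \bar R) := amax tau pt f'.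
have bI : borel_nonneg (fun x => (d0%:E * (\1_W x)%:E)%E) by apply: bn_scale; [rewrite lee_fin|exact: bn_indic].
have bNq : borel_nonneg (fun x => (NN%:E * q0 x)%E) by apply: bn_scale; [rewrite lee_fin ltW|].
pose w0 x := (NN%:E * q0 x + (d0%:E * (\1_W x)%:E + amx q0 x))%E.
have bAq : borel_nonneg (amx q0) by exact: bA.
have bIA : borel_nonneg (fun x => (d0%:E * (\1_W x)%:E + amx q0 x)%E) by exact: bn_add.
have bw0 : borel_nonneg w0 by exact: bn_add.
have C40 : (0 <= (4 * Cq)%:E)%E by rewrite lee_fin mulr_ge0// ltW.
pose w x := ((4 * Cq)%:E * w0 x)%E.
have bw : borel_nonneg w by exact: bn_scale.
have ptw x : (amx g x <= NN%:E * g x + w0 x)%E.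
  clear mP pcov psep fv mSf Sfe fl tLf Lf0 e2a e2b e20 qint d01 d0m tc taus bw bIA bAq bNq bI.
  have rhs0 : (0 <= NN%:E * g x + w0 x)%E.
    by apply: adde_ge0; [apply: mule_ge0; [rewrite lee_fin ltW|exact: bg.2]|exact: bw0.2].
  rewrite /amx /amax; elim/big_ind: _ => // [a b ha hb|i _]; first by rewrite ge_max ha.
  rewrite indicE; have [xi|xi] := boolP (x \in B (pt i) (2 * tau)); last by rewrite mule0.
  rewrite mule1; move: xi; rewrite inE => xi; have xi' : dist (pt i) x < 2 * tau by exact: xi.
  have Lt : tau <= Lam * tau by rewrite ler_peMl ?(ltW tau0)//; slra.
  have Lt0 : 0 < Lam * tau by slra.
  have BW : B (pt i) (Lam * tau) `<=` W by apply: dball_sub => //; have := pnear i; slra.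
  have xW : W x.
    rewrite /W /dball/=; have := dist_tri metric x0 (pt i) x; have := pnear i.
    have : 3 * tau <= Lam * tau by rewrite ler_wpM2r// ltW.
    slra.
  have [gh hg] := ghq x xW.
  have mL := mB_gt0 metric dbl (pt i) Lt0.
  have s1 : (\int[mu]_(z in B (pt i) (Lam * tau)) g z <= ((h x + Lh * ((Lam + 2) * tau)) * mB (pt i) (Lam * tau))%:E + \int[mu]_(z in B (pt i) (Lam * tau)) q0 z)%E.
    have hx0 : (0 <= (h x + Lh * ((Lam + 2) * tau))%:E)%E.
      by rewrite lee_fin addr_ge0// mulr_ge0// mulr_ge0 ?(ltW tau0)//; slra.
    have bk : borel_nonneg (fun _ : X => (h x + Lh * ((Lam + 2) * tau))%:E) by apply: bn_cst.
    have bkq := bn_add bk bq.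
    rewrite EFinM -(mBE metric dbl) -(integral_cst mu (mb _ _)) -(int_add _ (mb _ _) bk bq).
    apply: int_mono => //.
    move=> z zb; have zW := BW z zb; have [gz _] := ghq z zW; apply: (le_trans gz); apply: leeD2r.
    rewrite lee_fin; have := hl z x; have := ler_norm (h z - h x).
    have zx : dist z x <= (Lam + 2) * tau.
      have := dist_tri metric z (pt i) x; rewrite (distC metric z (pt i)).
      have zb' : dist (pt i) z < Lam * tau by exact: zb.
      slra.
    have := ler_wpM2l Lh0 zx; slra.
  have v0 : (0 <= ((mB (pt i) tau)^-1)%:E)%E by rewrite lee_fin invr_ge0 ltW// mq.
  have ratio : (mB (pt i) tau)^-1 * mB (pt i) (Lam * tau) <= NN.
    rewrite ler_pdivrMl// [X in _ <= X]mulrC; apply: (mB_iter metric borel dbl).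
    by rewrite (distxx metric) add0r; apply: ler_wpM2r; [exact: ltW|exact: hkap].
  have hx0 : 0 <= h x + Lh * ((Lam + 2) * tau).
    by rewrite addr_ge0// mulr_ge0// mulr_ge0 ?(ltW tau0)//; slra.
  have s2 : (ravg tau pt i g <= (NN * (h x + Lh * ((Lam + 2) * tau)))%:E + amx q0 x)%E.
    apply: (le_trans (lee_wpmul2l v0 s1)); rewrite ge0_muleDr; [|by rewrite lee_fin mulr_ge0// ltW|exact: int_ge0].
    apply: leeD; last by exact: amax_ge.
    rewrite -EFinM lee_fin mulrCA mulrC; exact: ler_wpM2r.
  apply: (le_trans s2); rewrite /w0 indicE mem_set// mule1 !addeA; apply: leeD2r.
  rewrite (_ : NN * _ = NN * h x + d0); last by rewrite /d0 /D; ring.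
  rewrite EFinD; apply: leeD2r; rewrite EFinM -ge0_muleDr; [|exact: bg.2|exact: bq.2].
  by apply: lee_wpmul2l => //; rewrite lee_fin ltW.
(* Bad balls, of which [Sf] fills a fixed share; bounded overlap keeps their union small. In the
   remaining balls each of the two halves defining the median contains a point off [Sf]. *)
pose P := [pred i | ((mB (pt i) tau / (2 * Cd))%:E <= mu (Sf `&` B (pt i) (2 * tau)))%E].
pose Sb := \big[setU/set0]_(i < n | P i) B (pt i) tau.
have C10 : 0 < Cd by exact: lt_le_trans C1.
have SW : (mu (Sf `&` W) <= e2%:E)%E by exact: Sfe.
have outW x : (\1_W x = 0 :> R) -> q0 x = 0%E by move=> hx; rewrite /q0 hx mule0.
clearbody q0; clear hint bh bgh ghq qW h0 hl.
have [mSb Sb1] : measurable Sb /\ (mu Sb <= \sum_(i < n | P i) mu (B (pt i) tau))%E.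
  rewrite /Sb; elim/big_ind2: _ => [|U1 a1 U2 a2 [mU1 h1] [mU2 h2]|i _].
  - by split; [exact: measurable0|rewrite measure0].
  - split; first exact: measurableU.
    by apply: le_trans (measureU2 _ _ _) _ => //; exact: leeD.
  - by split => //; exact: mb.
have Sbe : (mu Sb <= (2 * Cd ^+ 5 * e2)%:E)%E.
  apply: (le_trans Sb1).
  apply: (@le_trans _ _ (\sum_(i < n | P i) (2 * Cd)%:E * \int[mu]_(y in B (pt i) (2 * tau)) (\1_Sf y)%:E)%E).
    apply: lee_sum => i Pi; rewrite integral_indic// (mBE metric dbl).
    rewrite (_ : mB (pt i) tau = 2 * Cd * (mB (pt i) tau / (2 * Cd))); last by rewrite mulrC divfK// gt_eqF// mulr_gt0.
    by rewrite EFinM; apply: lee_wpmul2l => //; rewrite lee_fin mulr_ge0// ltW.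
  rewrite -ge0_sume_distrr; last by move=> i _; apply: int_ge0; exact: bn_indic.
  have := overlap_int metric borel dbl x0 tau0 psep (P := P) (rho := 2 * tau) (k := 4) (U := W) (f := fun y => (\1_Sf y)%:E) _ mW (bn_indic R mSf) _.
  move=> ov; apply: (@le_trans _ _ ((2 * Cd)%:E * ((Cd ^+ 4)%:E * \int[mu]_(y in W) (\1_Sf y)%:E))%E).
    apply: lee_wpmul2l; first by rewrite lee_fin mulr_ge0// ltW.
    apply: ov; first by rewrite !exprS; have := tau0; slra.
    move=> i _; apply: dball_sub => //; have := pnear i.
    have : 3 * tau <= Lam * tau by rewrite ler_wpM2r// ltW.
    have := tau0; slra.
  rewrite integral_indic// muleA -EFinM.
  apply: (@le_trans _ _ ((2 * Cd * Cd ^+ 4)%:E * e2%:E)%E).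
    by apply: lee_wpmul2l => //; rewrite lee_fin !mulr_ge0// ltW//; exact: Cp.
  by rewrite -EFinM lee_fin (exprS _ 4) mulrA.
exists m, w, ((Sf `&` W) `|` Sb); split => //.
- clear mP pcov fv Sbe Sb1 mSb SW Sfe mSf fl ptw tLf Lf0 e2a e2b e20 Sb P.
  have wle x : ((w x) `^ p <= K1%:E * ((NN `^ p)%:E * (q0 x `^ p) + (((d0%:E * (\1_W x)%:E) `^ p) + (amx q0 x) `^ p)))%E.
    rewrite /w poweRM//; last exact: bw0.2.
    rewrite poweR_EFin /K1 EFinM -muleA; apply: lee_wpmul2l; first by rewrite lee_fin powR_ge0.
    have a0 := bNq.2 x; have b0 := bI.2 x; have cc0 := bAq.2 x.
    have P2 : (0 <= (2 `^ p)%:E :> \bar R)%E by rewrite lee_fin powR_ge0.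
    apply: (le_trans (poweRD_le p1 a0 (adde_ge0 b0 cc0))).
    rewrite (_ : 4 = 2 * 2); last by ring.
    rewrite powRM// (EFinM (2 `^ p)) -muleA; apply: lee_wpmul2l => //.
    have qx := bq.2 x.
    have hq : ((NN%:E * q0 x) `^ p = (NN `^ p)%:E * (q0 x `^ p))%E.
      by rewrite poweRM ?poweR_EFin//; rewrite lee_fin ltW.
    have hq0 : (0 <= (NN `^ p)%:E * (q0 x `^ p))%E.
      by apply: mule_ge0; [rewrite lee_fin powR_ge0|exact: poweR_ge0].
    rewrite ge0_muleDr//; last by rewrite adde_ge0// poweR_ge0.
    apply: leeD; last exact: poweRD_le.
    have h2 : (1%:E <= (2 `^ p)%:E :> \bar R)%E.
      have h1 : (1 : R) `^ p = 1 by rewrite powR1.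
      by rewrite lee_fin -[leLHS]h1; apply: ge0_ler_powR; rewrite ?nnegrE ?ler1n.
    have := lee_wpmul2r hq0 h2; rewrite mul1e hq; exact.
  have bq' := bn_pow p bq; have bA' := bn_pow p bAq; have bI' := bn_pow p bI.
  have bNq' : borel_nonneg (fun x => ((NN `^ p)%:E * (q0 x `^ p))%E) by apply: bn_scale => //; rewrite lee_fin powR_ge0.
  have bIA' : borel_nonneg (fun x => ((d0%:E * (\1_W x)%:E) `^ p + (amx q0 x) `^ p)%E) by exact: bn_add.
  have bsum : borel_nonneg (fun x => ((NN `^ p)%:E * (q0 x `^ p) + (((d0%:E * (\1_W x)%:E) `^ p) + (amx q0 x) `^ p))%E) by exact: bn_add.
  have K1E : (0 <= K1%:E)%E by rewrite lee_fin ltW.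
  apply: (le_trans (int_mono _ measurableT (bn_pow p bw) (bn_scale K1E bsum) (fun x _ => wle x))).
  rewrite int_scale// int_add// int_add// int_scale//; last by rewrite lee_fin powR_ge0.
  have pne : p != 0 by rewrite gt_eqF// (lt_le_trans ltr01).
  have i1 : (\int[mu]_x (q0 x `^ p) <= e1%:E)%E.
    apply: le_trans qint; rewrite [X in (_ <= X)%E]integral_mkcond le_eqVlt; apply/orP; left; apply/eqP; apply: eq_integral => x _.
    by rewrite patchE; case: ifPn => // hx; rewrite outW ?(poweR_EFin 0) ?powR0// indicE (negbTE hx).
  have d0p : d0 `^ p <= d0.
    have [->|z] := eqVneq d0 0; first by rewrite powR0.
    by rewrite -[leRHS]powRr1//; apply: ger_powR => //; rewrite lt_def z d00 d01.
  have i2 : (\int[mu]_x ((d0%:E * (\1_W x)%:E) `^ p) <= (d0 * mWr)%:E)%E.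
    apply: (@le_trans _ _ (\int[mu]_x (d0%:E * (\1_W x)%:E))%E).
      apply: int_mono => // x _; rewrite indicE; case: (x \in W); rewrite ?mule1 ?mule0 poweR_EFin.
        by rewrite lee_fin; exact: d0p.
      by rewrite powR0.
    rewrite int_scale//; last by exact: bn_indic.
    by rewrite integral_indic// setIT mWE.
  have i3 : (\int[mu]_x ((amx q0 x) `^ p) <= K2%:E * e1%:E)%E.
    apply: (le_trans (int_amax_pow tau0 tau1 pnear psep bq)).
    by apply: lee_wpmul2l => //; rewrite lee_fin ltW.
  apply: (@le_trans _ _ (K1%:E * ((NN `^ p)%:E * e1%:E + ((d0 * mWr)%:E + K2%:E * e1%:E)))%E).
    apply: lee_wpmul2l => //; apply: leeD; first by apply: lee_wpmul2l => //; rewrite lee_fin powR_ge0.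
    exact: leeD.
  change ((K1 * (NN `^ p * e1 + (d0 * mWr + K2 * e1)))%:E <= e%:E)%E; rewrite lee_fin.
  have K2N : NN `^ p <= K2 by rewrite /K2 ler_peMr ?powR_ge0// exprn_ege1.
  have : NN `^ p * e1 <= K2 * e1 by apply: ler_wpM2r => //; exact: ltW.
  have K2e : K2 * e1 = e / (3 * K1) by rewrite /e1; field; rewrite !gt_eqF.
  rewrite K2e => u1; apply: (@le_trans _ _ (K1 * (e / (3 * K1) + (e / (3 * K1) + e / (3 * K1))))).
    by apply: ler_wpM2l; [exact: ltW|slra].
  by rewrite le_eqVlt; apply/orP; left; apply/eqP; field; rewrite gt_eqF.
- split; first by apply: measurableU => //; exact: measurableI.
  apply: le_trans (measureU2 _ _ _) _ => //; first exact: measurableI.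
  by apply: (le_trans (leeD SW Sbe)); rewrite -EFinD lee_fin; move: e2b; slra.
- move=> x xr nS; have [i xi] := pcov x xr.
  have xW : W x by rewrite /W /dball/=; slra.
  have nx : ~ Sf x by move=> sx; apply: nS; left.
  have nbad : (mu (Sf `&` B (pt i) (2 * tau)) < (mB (pt i) tau / (2 * Cd))%:E)%E.
    rewrite ltNge; apply/negP => hb; by apply: nS; right; rewrite /Sb (bigD1 i) //=; left; rewrite /dball/= (distC metric).
  have mm : mB (pt i) tau / (2 * Cd) <= mB x tau / 2.
    have hh : mB (pt i) tau <= Cd ^+ 1 * mB x tau by apply: (mB_iter metric borel dbl); rewrite expr1; slra.
    rewrite ler_pdivrMr ?mulr_gt0//; move: hh; rewrite expr1; slra.
  have hit (E : set X) : measurable E -> ((mB x tau / 2)%:E <= mu (B x tau `&` E))%E -> exists z, [/\ dist x z < tau, E z & ~ Sf z].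
    move=> mE hE; apply: contrapT => no; move: nbad; rewrite ltNge => /negP; apply.
    apply: (@le_trans _ _ (mB x tau / 2)%:E); first by rewrite lee_fin.
    apply: (le_trans hE); apply: le_measure; rewrite ?inE; [exact: measurableI|exact: measurableI|].
    move=> z [zb Ez]; split; first by apply: contrapT => nz; apply: no; exists z.
    by apply: (dball_sub metric (x := x) (r := tau)) => //; rewrite (distC metric); slra.
  have fvx := fv x nx; have e40 : 0 < e / 4 by rewrite divr_gt0.
  have [M1 M2] := mP x _ e40.
  have [z1 [z1x /= z1v z1S]] := hit _ (measurable_sub_le mv _) M1.
  have [z2 [z2x /= z2v z2S]] := hit _ (measurable_sup_ge mv _) M2.
  have f1 := fv z1 z1S; have f2 := fv z2 z2S; have l1 := fl x z1; have l2 := fl x z2.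
  have l1' := ler_wpM2l Lf0 (ltW z1x); have l2' := ler_wpM2l Lf0 (ltW z2x).
  move: fvx f1 f2 l1 l2; rewrite !ler_norml => /andP[? ?] /andP[? ?] /andP[? ?] /andP[? ?] /andP[? ?].
  by apply/andP; split; slra.
- move=> c ac ci ec; have mc : (`|m (cmap c 0) - m (cmap c (clen c))|%:E <= line_int (fun x => (4 * Cq)%:E * amax tau pt g x) c)%E.
    by apply: median_chain => //; exact: le_trans tc ec.
  apply: (le_trans mc); apply: (line_mono metric borel ac).
  + by apply: bn_scale => //; exact: bA.
  + by apply: bn_add => //; apply: bn_scale => //; rewrite lee_fin !mulr_ge0// ltW.
  move=> x; apply: (le_trans (lee_wpmul2l C40 (ptw x))); rewrite ge0_muleDr; [|by apply: mule_ge0; [rewrite lee_fin ltW|exact: bg.2]|exact: bw0.2].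
  by apply: leeD => //; rewrite muleA -EFinM.
Qed.
End Step.

(** * Passage to the limit *)

Section Elimsup.
Variable R : realType.
Implicit Types a b : nat -> R.

(* The set of eventual upper bounds is empty or unbounded below when the upper limit is infinite; [inf] is then 0. *)
Definition elimsup a : R := inf [set t | exists N : nat, forall k, (N <= k)%N -> a k <= t].

(** Shifting by [del] maps the eventual upper bounds of either sequence into those of the other, so
    the two sets degenerate together and the convention for infinite upper limits respects the
    comparison. *)
Lemma elimsup_le a b del : (exists N : nat, forall k, (N <= k)%N -> `|a k - b k| <= del) ->
  elimsup a <= elimsup b + del.
Proof.
have local_context : True by [].
move=> [N hN]; rewrite /elimsup.
set Ea := [set t | _]; set Eb := [set t | _].
have ab t : Eb t -> Ea (t + del).
  move=> [M hM]; exists (maxn N M) => k; rewrite geq_max => /andP[k1 k2].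
  have := hM k k2; have := hN k k1; have := ler_norm (a k - b k); slra.
have ba t : Ea t -> Eb (t + del).
  move=> [M hM]; exists (maxn N M) => k; rewrite geq_max => /andP[k1 k2].
  by have := hM k k2; have := hN k k1; rewrite distrC; have := ler_norm (b k - a k); slra.
have d0 : 0 <= del by apply: le_trans (hN N (leqnn N)).
have [[[s Ebs] [l lb]]|nb] := pselect (has_inf Eb).
  have hb : has_inf Eb by split; [exists s|exists l].
  have ha : has_inf Ea.
    split; [by exists (s + del); exact: ab|exists (l - del) => t /ba/lb; slra].
  apply/ler_addgt0Pr => e e0; have [t Et te] := inf_adherent e0 hb.
  have := ge_inf ha.2 (ab t Et); slra.
have na : ~ has_inf Ea.
  move=> [[s Eas] [l lb]]; apply: nb; split; first by exists (s + del); exact: ba.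
  by exists (l - del) => t /ab/lb; slra.
by rewrite (inf_out na) (inf_out nb) add0r.
Qed.

Lemma elimsup_dist a b del : (exists N : nat, forall k, (N <= k)%N -> `|a k - b k| <= del) ->
  `|elimsup a - elimsup b| <= del.
Proof.
move=> H; have h1 := elimsup_le H.
have h2 : elimsup b <= elimsup a + del.
  by apply: elimsup_le; have [N hN] := H; exists N => k kN; rewrite distrC; exact: hN.
by rewrite ler_norml; apply/andP; split; lra.
Qed.

Lemma elimsup_cst l : elimsup (fun=> l) = l.
Proof.
rewrite /elimsup (_ : [set t | _] = [set t | l <= t]).
  apply/eqP; rewrite eq_le; apply/andP; split.
    by apply: ge_inf; [exists l => t|exact: lexx].
  by apply: lb_le_inf; [exists l; exact: lexx|move=> t].
by apply/seteqP; split => t /=; [move=> [N hN]; exact: (hN N (leqnn N))|move=> lt; exists 0%N].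
Qed.

Lemma elimsup_lim a l : (forall e, 0 < e -> exists N : nat, forall k, (N <= k)%N -> `|a k - l| <= e) -> elimsup a = l.
Proof.
move=> H; apply/eqP; rewrite -subr_eq0 -normr_le0; apply/ler_addgt0Pr => e e0; rewrite add0r.
have := elimsup_dist (b := fun=> l) (H e e0); by rewrite elimsup_cst.
Qed.
End Elimsup.

Section Limit.
Variables (R : realType) (d : measure_display) (X : measurableType d) (dist : X -> X -> R).
Hypothesis metric : is_metric dist.
Hypothesis borel : borel_for dist.
Variable mu : {measure set X -> \bar R}.
Local Notation B := (dball dist).
Variables (p : R) (v : X -> R) (G : X -> \bar R) (x0 : X) (rho : nat -> R).
Hypothesis p1 : 1 <= p.
Hypothesis bG : borel_nonneg G.
Hypothesis rho_mono : forall i j, (i <= j)%N -> rho i <= rho j.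
Hypothesis H : forall k e, 0 < e -> exists (m : X -> R) (w : X -> \bar R) (S : set X),
  [/\ borel_nonneg w, (\int[mu]_x (w x `^ p) <= e%:E)%E, measurable S /\ (mu S <= e%:E)%E,
      forall x, dist x0 x < rho k -> ~ S x -> `|m x - v x| <= e &
      forall c, arc_curve dist c -> curve_in (B x0 (rho k)) c -> e <= clen c ->
        (`|m (cmap c 0) - m (cmap c (clen c))|%:E <= line_int (fun x => G x + w x) c)%E].

(** Because [w k] enters [lpsum p f] with the factor [k + 1], its integral along a curve on which
    [lpsum p f] has finite integral is at most a constant over [k + 1] and disappears in the limit.
    Elsewhere the term with [kap] is infinite, however small [kap] is. *)
Lemma limit_function : exists (v' : X -> R) (r : X -> \bar R),
  [/\ borel_nonneg r, (\int[mu]_x (r x `^ p) < +oo)%E,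
      onull mu [set x | (exists k, dist x0 x < rho k) /\ v' x <> v x] &
      forall k kap c, 0 < kap -> arc_curve dist c -> curve_in (B x0 (rho k)) c ->
        ug_ineq v' (fun x => G x + kap%:E * r x)%E c].
Proof.
have pp : 0 <= p by exact: le_trans p1.
pose a k : R := 1 / (2 ^ k.+1)%:R / (k.+1%:R `^ p).
have kp k : 0 < (k.+1%:R : R) `^ p by rewrite powR_gt0.
have a0 k : 0 < a k by rewrite !divr_gt0// ltr0n expn_gt0.
have k1 k : 1 <= (k.+1%:R : R) `^ p.
  have h1 : (1 : R) `^ p = 1 by rewrite powR1.
  by rewrite -[leLHS]h1; apply: ge0_ler_powR; rewrite ?nnegrE ?ler1n.
have a1 k : a k <= 1 / (2 ^ k.+1)%:R.
  rewrite /a ler_pdivrMr//; apply: ler_peMr => //.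
have a2 k : a k <= k.+1%:R^-1.
  apply: (le_trans (a1 k)); rewrite div1r lef_pV2 ?posrE ?ltr0n ?expn_gt0// ler_nat.
  by apply: ltnW; exact: ltn_expl.
have [m hm] := choice (fun k => H k (a0 k)).
have [w hw] := choice hm.
have [S hS] := choice hw.
have bw k : borel_nonneg (w k) by have [] := hS k.
pose f k x := (k.+1%:R%:E * w k x)%E.
have bf k : borel_nonneg (f k) by apply: bn_scale; [rewrite lee_fin|].
have small (e : R) : 0 < e -> exists N : nat, forall k, (N <= k)%N -> k.+1%:R^-1 <= e.
  move=> e0; exists (Num.truncn e^-1) => k kN; rewrite -[leRHS]invrK lef_pV2 ?posrE ?invr_gt0//.
  have e'0 : 0 <= e^-1 by rewrite invr_ge0 ltW.
  have /andP[_ h] := truncn_itv e'0.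
  by apply: (le_trans (ltW h)); rewrite ler_nat ltnS.
exists (fun x => elimsup (fun k => m k x)), (lpsum p f); split.
- exact: bn_lpsum.
- apply: (@le_lt_trans _ _ 1%:E); last exact: ltry.
  rewrite int_lpsum//; apply: nneseries_geo => //.
    by move=> n; apply: int_ge0; exact: bn_pow.
  move=> k; have [_ ir _ _ _] := hS k.
  rewrite (eq_integral (fun x => (k.+1%:R `^ p)%:E * w k x `^ p)%E); last first.
    by move=> x _; rewrite poweRM ?lee_fin ?poweR_EFin//; exact: (bw k).2.
  rewrite int_scale ?lee_fin ?powR_ge0//; last exact: bn_pow.
  apply: le_trans (lee_wpmul2l _ ir) _; first by rewrite lee_fin ltW.
  by rewrite -EFinM lee_fin /a mulrC divfK// gt_eqF.
- have mS k : measurable (S k) by have [_ _ []] := hS k.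
  (* Borel-Cantelli: the sets [S k] have summable measures, so almost every point lies in finitely
     many of them. *)
  exists (lim_sup_set S); split.
  + by apply: bigcap_measurable => // n _; apply: bigcup_measurable.
  + apply: lim_sup_set_cvg0 => //; apply: (@le_lt_trans _ _ 1%:E); last exact: ltry.
    apply: nneseries_geo => // k; have [_ _ [_ h] _ _] := hS k.
    by apply: (le_trans h); rewrite lee_fin.
  move=> x [[k0 xk] ne]; apply: contrapT => nl; apply: ne.
  have [N hN] : exists N, forall k, (N <= k)%N -> ~ S k x.
    apply: contrapT => no; apply: nl => n _; apply: contrapT => nb; apply: no; exists n => k kn Sx.
    by apply: nb; exists k.
  apply: elimsup_lim => e e0; have [M hM] := small e e0.
  exists (maxn k0 (maxn N M)) => k; rewrite !geq_max => /andP[g1 /andP[g2 g3]].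
  have [_ _ _ hx _] := hS k; apply: (le_trans (hx x _ (hN k g2))).
    by apply: (lt_le_trans xk); exact: rho_mono.
  by apply: (le_trans (a2 k)); exact: hM.
move=> k0 kap c kap0 ac ci; have [l0 _] := ac.
have bl := bn_lpsum p bf; have kE : (0 <= kap%:E :> \bar R)%E by rewrite lee_fin ltW.
rewrite /ug_ineq (line_add metric borel ac bG (bn_scale kE bl)) (line_scale metric borel ac bl kE).
have J0 := line_ge0 c bG; have M0 := line_ge0 c bl.
have [Jf|Ji] := ltP (line_int G c) +oo%E; last first.
  have -> : line_int G c = +oo%E by apply/eqP; rewrite eq_le leey.
  by rewrite addye ?leey// gt_eqF// (lt_le_trans ltNy0)// mule_ge0.
have [Mf|Mi] := ltP (line_int (lpsum p f) c) +oo%E; last first.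
  have -> : line_int (lpsum p f) c = +oo%E by apply/eqP; rewrite eq_le leey.
  rewrite gt0_muley ?lte_fin// addey ?leey// gt_eqF// (lt_le_trans ltNy0)//.
have JE : line_int G c = (fine (line_int G c))%:E by rewrite fineK// ge0_fin_numE.
have ME : line_int (lpsum p f) c = (fine (line_int (lpsum p f) c))%:E by rewrite fineK// ge0_fin_numE.
set J := fine _ in JE; set M := fine _ in ME.
have M0' : 0 <= M by exact: fine_ge0.
apply: (@le_trans _ _ (line_int G c)); last by rewrite leeDl// mule_ge0.
rewrite JE lee_fin; apply/ler_addgt0Pr => e e0; apply: elimsup_dist.
have M1 : 0 < M + 1 by move: M0'; lra.
have [N1 hN1] := small _ l0; have [N2 hN2] := small (e / (M + 1)) (divr_gt0 e0 M1).
exists (maxn k0 (maxn N1 N2)) => k; rewrite !geq_max => /andP[g1 /andP[g2 g3]].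
have [_ _ _ _ hc] := hS k.
have cik : curve_in (B x0 (rho k)) c.
  by move=> t t0 tl; apply: (lt_le_trans (ci t t0 tl)); exact: rho_mono.
have := hc c ac cik (le_trans (a2 k) (hN1 k g2)).
rewrite (line_add metric borel ac bG (bw k)) JE.
have wk : (line_int (w k) c <= (M / k.+1%:R)%:E)%E.
  have : (k.+1%:R%:E * line_int (w k) c <= M%:E)%E.
    rewrite -ME -(line_scale metric borel ac (bw k)) ?lee_fin//; apply: (line_mono metric borel ac (bf k) bl) => x.
    exact: (le_lpsum p1 k x bf).
  by rewrite -lee_pdivlMl ?ltr0n// mulrC EFinM muleC.
move=> h; have {}h := le_trans h (leeD2l _ wk).
rewrite -EFinD lee_fin in h; apply: (le_trans h); rewrite lerD2l.
have hh := hN2 k g3; rewrite ler_pdivlMr// in hh.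
have i0 : 0 <= k.+1%:R^-1 :> R by rewrite invr_ge0.
by apply: le_trans hh; rewrite mulrC ler_wpM2l// lerDl.
Qed.
End Limit.

(** * Removability and the Poincare inequality off [A] *)

Section Osc.
Variables (R : realType) (d : measure_display) (X : measurableType d).
Variable mu : {measure set X -> \bar R}.

(** The mean value differs from any constant [m] by at most the average of the distance of [v] to
    [m], hence the factor 2. *)
Lemma osc_avg_le (D : set X) (b m : R) (v : X -> R) (K : \bar R) : measurable D -> mu D = b%:E -> 0 < b ->
  mu.-integrable setT (EFin \o v) -> (\int[mu]_(y in D) (`|v y - m|)%:E <= K)%E ->
  (osc_avg mu D v <= (2 / b)%:E * K)%E.
Proof.
move=> mD Db b0 iv hK; rewrite /osc_avg Db inver gt_eqF//.
have ivD : mu.-integrable D (EFin \o v) by apply: integrableS iv.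
have mv : measurable_fun setT v by apply/measurable_EFinP; exact: measurable_int iv.
have icst (k : R) : mu.-integrable D (EFin \o (fun _ : X => k)).
  apply/integrableP; split; first by apply/measurable_EFinP.
  rewrite (_ : (fun x => _) = cst (`|k|%:E)); last by apply/funext.
  by rewrite integral_cst// Db -EFinM ltry.
set I := (\int[mu]_(y in D) (v y)%:E)%E.
have If : I \is a fin_num by exact: (integrable_fin_num mD ivD).
set u := fine _; have uE : u = fine I / b by rewrite /u -(fineK If) -EFinM.
have bn (k : R) : borel_nonneg (fun y => (`|v y - k|)%:E : \bar R).
  split=> [|y]; last by rewrite lee_fin.
  by apply/measurable_EFinP; apply: measurableT_comp => //; exact: measurable_funB.
have hm : (`|m - u|%:E * b%:E <= K)%E.
  apply: le_trans hK.
  have e1 : ((fine I - m * b)%:E = \int[mu]_(y in D) ((v y)%:E - m%:E))%E.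
    rewrite (integralB_EFin mD ivD (icst m)).
    by rewrite (integral_cst mu mD) Db EFinB EFinM fineK.
  rewrite -EFinM (_ : `|m - u| * b = `|fine I - m * b|); last first.
    rewrite -[X in _ * X](gtr0_norm b0) -normrM distrC; congr (`|_|).
    by rewrite uE mulrBl divfK// gt_eqF.
  rewrite -abse_EFin e1; apply: le_trans (le_abse_integral _ _ _) _ => //.
  by apply: emeasurable_funB; apply: measurable_funTS; apply/measurable_EFinP.
have -> : ((2 / b)%:E * K = (b^-1)%:E * (K + K))%E.
  by rewrite -mule2n -mule_natl muleA -EFinM mulrC.
rewrite muleC; apply: lee_wpmul2l; first by rewrite lee_fin invr_ge0 ltW.
have bc : borel_nonneg (fun _ : X => (`|m - u|)%:E) by apply: bn_cst.
apply: (@le_trans _ _ (\int[mu]_(y in D) (`|v y - m|%:E + `|m - u|%:E))%E).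
  apply: int_mono => //; first exact: bn_add.
  by move=> y _; rewrite -EFinD lee_fin ler_distD.
rewrite (int_add _ mD (bn m) bc); apply: leeD => //.
by rewrite integral_cst// Db.
Qed.
End Osc.

Section Final.
Variables (R : realType) (d : measure_display) (X : measurableType d) (dist : X -> X -> R).
Hypothesis metric : is_metric dist.
Hypothesis borel : borel_for dist.
Variable mu : {measure set X -> \bar R}.
Variables Cd CP lam : R.
Hypothesis dbl : doubling dist mu Cd.
Hypothesis PI : PI11 dist mu CP lam.
Local Notation B := (dball dist).
Local Notation mB := (mB dist mu).
Variables (Cq Lq : R) (A : set X).
Hypothesis Cq0 : 0 < Cq.
Hypothesis Lq1 : 1 <= Lq.
Hypothesis A0 : onull mu A.
Hypothesis HQ : forall (x0 : X) r u v g Z t1 t2, 0 < r -> is_ug dist (~` A) u g -> measurable_fun setT v ->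
  measurable Z -> mu Z = 0%E -> (forall y, ~ Z y -> u y = v y) -> t1 < t2 ->
  ((mB x0 r / (4 * Cd ^+ 5))%:E <= mu (B x0 r `&` [set z | (v z <= t1)%R]))%E ->
  ((mB x0 r / (4 * Cd ^+ 5))%:E <= mu (B x0 r `&` [set z | (t2 <= v z)%R]))%E ->
  (((t2 - t1) * mB x0 r)%:E <= (Cq * r)%:E * \int[mu]_(z in B x0 (Lq * r)) g z)%E.

Definition kap : nat := projT1 (cid (expr2_large (2 * Lq + 1))).
Definition ug_const : R := 4 * Cq * Cd ^+ kap.

(** The gradient [g1] agrees with [g] only near the balls of radius [rho k]. This serves both a
    gradient integrable on the whole space and one cut off to a ball. *)
Lemma extension p u v g g1 Z x0 (rho : nat -> R) sigma : 1 <= p -> is_ug dist (~` A) u g ->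
  measurable_fun setT v -> measurable Z -> mu Z = 0%E -> (forall y, ~ Z y -> u y = v y) ->
  borel_nonneg g1 -> (\int[mu]_x (g1 x `^ p) < +oo)%E -> 0 < sigma ->
  (forall i j, (i <= j)%N -> rho i <= rho j) ->
  (forall k y, dist x0 y < rho k + Lq * sigma -> g y = g1 y) ->
  exists (v' : X -> R) (r : X -> \bar R),
  [/\ borel_nonneg r, (\int[mu]_x (r x `^ p) < +oo)%E,
      onull mu [set x | (exists k, dist x0 x < rho k) /\ v' x <> v x] &
      forall k kap c, 0 < kap -> arc_curve dist c -> curve_in (B x0 (rho k)) c ->
        ug_ineq v' (fun x => ug_const%:E * g1 x + kap%:E * r x)%E c].
Proof.
move=> p1 ug mv mZ Z0 uv bg1 gint s0 rm gg1.
have C1 := Cd_ge1 metric borel dbl x0.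
have uc0 : (0 <= ug_const%:E :> \bar R)%E.
  by rewrite lee_fin /ug_const mulr_ge0 ?exprn_ge0 ?mulr_ge0// ?ltW// (lt_le_trans ltr01).
have bG : borel_nonneg (fun x => ug_const%:E * g1 x)%E by exact: bn_scale.
apply: (limit_function metric borel p1 bG rm) => k e e0.
apply: (step metric borel dbl p1 Cq0 Lq1 _ mv bg1 s0) => //.
- exact: projT2 (cid (expr2_large (2 * Lq + 1))).
- by apply: le_lt_trans gint; apply: int_sub => //; [exact: dball_measurable|exact: bn_pow].
- move=> y s t1 t2 yr s1 s2 t12 h1 h2.
  have := HQ s1 ug mv mZ Z0 uv t12 h1 h2.
  have -> : (\int[mu]_(z in B y (Lq * s)) g z = \int[mu]_(z in B y (Lq * s)) g1 z)%E; last by [].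
  apply: eq_integral => z; rewrite inE => zb; apply: (gg1 k).
  have zb' : dist y z < Lq * s by exact: zb.
  have l0 : 0 < Lq by exact: lt_le_trans Lq1.
  have : Lq * s <= Lq * sigma by rewrite ler_pM2l// ltW.
  by have := dist_tri metric x0 y z; lra.
Qed.

Lemma onull_measure0 (E : set X) : measurable E -> onull mu E -> mu E = 0%E.
Proof.
move=> mE [N [mN N0 EN]]; apply/eqP; rewrite eq_le measure_ge0 andbT -N0.
by apply: le_measure; rewrite ?inE.
Qed.

Lemma int_conull (E : set X) f : measurable E -> mu (~` E) = 0%E -> borel_nonneg f ->
  (\int[mu]_x f x = \int[mu]_(x in E) f x)%E.
Proof.
move=> mE E0 bf; have mC : measurable (~` E) by exact: measurableC.
rewrite -(setUv E) ge0_integral_setU//; last 3 first.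
- exact: measurable_funTS bf.1.
- by move=> x _; exact: bf.2.
- by rewrite disj_set2E setICr.
by rewrite (int_null mC E0 bf) adde0.
Qed.

Lemma mversion_conull (E : set X) : mversion mu (~` A) E -> mu (~` E) = 0%E.
Proof.
move=> [mE En]; apply: onull_measure0; first exact: measurableC.
apply: onull_sub (onullU En A0) _ => x nE; have [Ax|nA] := pselect (A x); first by right.
by left; left.
Qed.

Lemma mversionT : mversion mu setT setT.
Proof.
by split; [exact: measurableT|exists set0; split; [exact: measurable0|exact: measure0|rewrite setDv setU0]].
Qed.

Lemma modulus_set0 p : 1 <= p -> modulus dist mu p set0 = 0%E.
Proof.
move=> p1; apply/eqP; rewrite eq_le; apply/andP; split.
  apply: ereal_inf_lbound; exists (fun=> 0%E); first by split => //; apply: bn_cst.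
  rewrite (eq_integral (fun=> 0%E)) ?integral0// => x _.
  by rewrite (poweR_EFin 0) powR0// gt_eqF// (lt_le_trans ltr01).
by apply: le_ereal_inf_tmp => _ [rho [br _] <-]; apply: int_ge0; exact: bn_pow.
Qed.

Lemma removable_of (x0 : X) p : 1 <= p -> removable dist mu p A.
Proof.
move=> p1; split=> // u [[E [w0 [Ev [mw0 w0u] wint]]] [g0 [pw [E' [Ev' gint]]]]].
have pp : 0 <= p by exact: le_trans p1.
have [g [ug _ gle]] := pwug_ug metric borel p1 pw ltr01.
have bg := ug.1; have bgp := bn_pow p bg.
have gfin : (\int[mu]_x (g x `^ p) < +oo)%E.
  rewrite (int_conull Ev'.1 (mversion_conull Ev') bgp).
  by apply: le_lt_trans (gle _ Ev'.1) _; rewrite lte_add_pinfty// ltry.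
have [Z [mZ Z0 ZS]] := onullU A0 w0u.
have uv y : ~ Z y -> u y = w0 y.
  move=> nZ; apply: contrapT => ne; apply: nZ; apply: ZS.
  by have [Ay|nA] := pselect (A y); [left|right].
have rm i j : (i <= j)%N -> i.+1%:R <= j.+1%:R :> R by rewrite ler_nat ltnS.
(* The balls of radius [k + 1] exhaust the space and every curve lies in one of them. For membership
   in the Sobolev space the single value [kap = 1] is taken. *)
have [v' [r [br ri vn ug']]] := extension (rho := fun k => k.+1%:R) (x0 := x0) p1 ug mw0 mZ Z0 uv bg gfin ltr01 rm (fun _ _ _ => erefl).
have vn' : onull mu [set x | v' x <> w0 x].
  apply: onull_sub vn _ => x ne; split => //; exists (Num.truncn (dist x0 x)).
  by have /andP[_] := truncn_itv (dist_ge0 metric x0 x).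
have uc0 : (0 <= ug_const%:E :> \bar R)%E.
  have C1 := Cd_ge1 metric borel dbl x0.
  by rewrite lee_fin /ug_const mulr_ge0 ?exprn_ge0 ?mulr_ge0// ?ltW// (lt_le_trans ltr01).
have bG : borel_nonneg (fun x => ug_const%:E * g x)%E by exact: bn_scale.
have b1r : borel_nonneg (fun x => 1%:E * r x)%E by apply: bn_scale.
exists v'; split; last first.
  apply: onull_sub (onullU vn' w0u) _ => x [nA ne].
  by have [e|ne'] := pselect (v' x = w0 x); [right; split => //; rewrite -e => e'; apply: ne|left].
split.
  exists setT, w0; split; first exact: mversionT.
  - by split => //; apply: onull_sub vn' _ => x [_].
  - have bw : borel_nonneg (fun x => (`|w0 x|)%:E : \bar R).
      by split=> [|x]; [apply/measurable_EFinP; exact: measurableT_comp|rewrite lee_fin].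
    by rewrite (int_conull Ev.1 (mversion_conull Ev) (bn_pow p bw)).
exists (fun x => ug_const%:E * g x + 1%:E * r x)%E; split.
  split; first exact: bn_add.
  exists set0; split; first exact: modulus_set0.
  move=> c ac _ _.
  pose M := dist x0 (cmap c 0) + clen c.
  apply: (ug' (Num.truncn M)) => // t t0 tl; have [l0 _] := ac.
  have M0 : 0 <= M by rewrite addr_ge0 ?(dist_ge0 metric)// ltW.
  have /andP[_ h] := truncn_itv M0; rewrite /dball/=; apply: le_lt_trans h.
  have := ext_lip ac t0; rewrite (extE (lexx 0) (ltW l0)) (extE t0 tl).
  by have := dist_tri metric x0 (cmap c 0) (cmap c t); rewrite /M; lra.
exists setT; split; first exact: mversionT.
apply: (@le_lt_trans _ _ (\int[mu]_x ((2 `^ p)%:E * ((ug_const%:E * g x) `^ p + (1%:E * r x) `^ p)))%E).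
  apply: int_mono => //; first by apply: bn_pow; exact: bn_add.
    apply: bn_scale; first by rewrite lee_fin powR_ge0.
    by apply: bn_add; exact: bn_pow.
  by move=> x _; apply: poweRD_le => //; [exact: bG.2|exact: b1r.2].
have bGr := bn_add (bn_pow p bG) (bn_pow p b1r).
have p20 : (0 <= (2 `^ p)%:E :> \bar R)%E by rewrite lee_fin powR_ge0.
rewrite (int_scale _ measurableT p20 bGr).
rewrite (int_add _ measurableT (bn_pow p bG) (bn_pow p b1r)).
apply: lte_mul_pinfty; rewrite ?lee_fin ?powR_ge0//; apply: lte_add_pinfty.
  rewrite (eq_integral (fun x => (ug_const `^ p)%:E * (g x `^ p))%E); last first.
    by move=> x _; rewrite poweRM ?poweR_EFin//; exact: bg.2.
  rewrite int_scale ?lee_fin ?powR_ge0//.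
  by apply: lte_mul_pinfty; rewrite ?lee_fin ?powR_ge0.
by under eq_integral do rewrite mul1e.
Qed.

(** The gradient may fail to be integrable far away, so it is cut off to the ball [D] before
    extending. The extension obeys the Poincare inequality of the whole space with gradient
    [ug_const * g1 + kp * r1]; the constant must not see [r1], so [kp] tends to 0 at the end. *)
Lemma PI_compl_of : PI_compl dist mu 1 A.
Proof.
have local_context : True by [].
split=> //; pose l2 := lam2 lam; have l21 : 1 <= l2 by exact: lam2_ge1.
pose j := projT1 (cid (expr2_large (3 * l2))); have hj : 3 * l2 <= 2 ^+ j by exact: projT2 (cid (expr2_large (3 * l2))).
exists (Num.max 1 (2 * CP2 Cd CP lam * ug_const * Cd ^+ j)), (3 * l2); split; first by rewrite le_max lexx.
split; first by slra.
set CP' := Num.max _ _; move=> x nA r r0 u v g fuv iv ug.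
have C1 := Cd_ge1 metric borel dbl x; have c2 := CP2_ge1 metric borel CP lam dbl x.
have ucR : 0 <= ug_const.
  by rewrite /ug_const mulr_ge0 ?exprn_ge0 ?mulr_ge0// ?ltW// (lt_le_trans ltr01).
have uc0 : (0 <= ug_const%:E :> \bar R)%E by rewrite lee_fin.
have CP0 : 0 < CP' by rewrite lt_max ltr01.
have bg := ug.1; have lr0 : 0 < 3 * l2 * r by rewrite mulr_gt0//; slra.
set D := B x (3 * l2 * r).
have mDD : measurable D by exact: dball_measurable.
rewrite (eq_integral g); last by move=> y _; rewrite poweRe1//; exact: bg.2.
have m3 := mB_gt0 metric dbl x lr0; have m1 := mB_gt0 metric dbl x r0.
set I := (\int[mu]_(y in D) g y)%E; have I0 : (0 <= I)%E by exact: int_ge0.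
have im0 : (0 <= ((mB x (3 * l2 * r))^-1)%:E :> \bar R)%E by rewrite lee_fin invr_ge0 ltW.
rewrite invr1 /D (mBE metric dbl) inver gt_eqF// poweRe1; last by apply: mule_ge0.
have [If|Ii] := ltP I +oo%E; last first.
  have -> : I = +oo%E by apply/eqP; rewrite eq_le leey.
  by rewrite gt0_mulye ?lte_fin ?invr_gt0// gt0_muley ?leey// lte_fin mulr_gt0.
have IE : I = (fine I)%:E by rewrite fineK// ge0_fin_numE.
have [mv [Z [mZ Z0 ZS]]] := fuv.
have uv y : ~ Z y -> u y = v y.
  by move=> nZ; apply: contrapT => ne; apply: nZ; apply: ZS.
pose g1 y := (g y * (\1_D y)%:E)%E.
have bg1 : borel_nonneg g1.
  split=> [|y]; last by apply: mule_ge0; [exact: bg.2|rewrite lee_fin].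
  by apply: emeasurable_funM; [exact: bg.1|exact: (bn_indic R mDD).1].
have g1D y : D y -> g1 y = g y by move=> Dy; rewrite /g1 indicE mem_set// mule1.
have g1I : (\int[mu]_y (g1 y) = I)%E.
  rewrite /I [RHS]integral_mkcond; apply: eq_integral => y _; rewrite patchE /g1 indicE.
  by case: (y \in D); rewrite ?mule1 ?mule0.
have g1f : (\int[mu]_y (g1 y `^ 1) < +oo)%E.
  by rewrite (eq_integral g1) ?g1I// => y _; rewrite poweRe1//; exact: bg1.2.
(* At scales below [r / Lq] the quantile inequality reaches at most distance [r], so from the ball
   of radius [2 * (l2 * r)] it stays inside [D], where [g1] and [g] agree. *)
have sg : 0 < r / Lq by rewrite divr_gt0//; exact: lt_le_trans Lq1.
have l2r : r <= l2 * r by rewrite ler_peMl// ltW.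
have lqr : Lq * (r / Lq) = r by rewrite mulrC divfK// gt_eqF// (lt_le_trans ltr01).
have near (k : nat) y : dist x y < 2 * (l2 * r) + Lq * (r / Lq) -> g y = g1 y.
  by rewrite lqr => h; rewrite g1D// /D /dball/=; slra.
have [v' [r1 [br1 r1f vn ug']]] := extension (rho := fun=> 2 * (l2 * r)) (x0 := x) (lexx 1) ug mv mZ Z0 uv bg1 g1f sg (fun _ _ _ => lexx _) near.
have r1E : (\int[mu]_y (r1 y `^ 1) = \int[mu]_y (r1 y))%E.
  by apply: eq_integral => y _; rewrite poweRe1//; exact: br1.2.
rewrite r1E in r1f; set Q := (\int[mu]_y r1 y)%E in r1f.
have Q0 : (0 <= Q)%E by exact: int_ge0.
have QE : Q = (fine Q)%:E by rewrite fineK// ge0_fin_numE.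
have q0 : 0 <= fine Q by exact: fine_ge0.
have i0 : 0 <= fine I by exact: fine_ge0.
set T := B x (2 * (l2 * r)); have mT : measurable T by exact: dball_measurable.
have bG : borel_nonneg (fun y => ug_const%:E * g1 y)%E by exact: bn_scale.
have lr : 0 < l2 * r by rewrite mulr_gt0//; slra.
have osc kp : 0 < kp -> (osc_avg mu (B x r) v <= (2 / mB x r * (CP2 Cd CP lam * r) * (ug_const * fine I + kp * fine Q))%:E)%E.
  move=> kp0; have kpE : (0 <= kp%:E :> \bar R)%E by rewrite lee_fin ltW.
  have bk : borel_nonneg (fun y => kp%:E * r1 y)%E by exact: bn_scale.
  have ugT : is_ug dist T v' (fun y => ug_const%:E * g1 y + kp%:E * r1 y)%E.
    by split; [exact: bn_add|move=> c ac ci; exact: (ug' 0%N)].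
  have st : l2 * r < 2 * (l2 * r) by slra.
  have ug2 := local_ug metric borel lr st ugT.
  have bT := bn_indic R mT.
  have mvT : measurable_fun setT (fun y => v y * \1_T y) by apply: measurable_funM.
  have fv : fversion mu setT (fun y => v' y * \1_T y) (fun y => v y * \1_T y).
    split => //; apply: onull_sub vn _ => y [_]; rewrite indicE.
    have [yT|yT] := boolP (y \in T); last by rewrite !mulr0.
    rewrite !mulr1 => ne; split => //; exists 0%N; exact: (set_mem yT).
  have ivT : mu.-integrable setT (EFin \o (fun y => v y * \1_T y)).
    apply: (le_integrable measurableT _ _ iv); first exact/measurable_EFinP.
    move=> y _ /=; rewrite lee_fin normrM ler_piMr// indicE; case: (y \in T); rewrite ?normr1 ?normr0//.
  have [m hm] := PI_osc metric borel dbl PI x r0 fv ivT ug2.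
  have rT : B x r `<=` T by apply: dball_sub => //; rewrite (distxx metric); slra.
  have hm2 : (\int[mu]_(y in B x r) (`|v y - m|)%:E <= (CP2 Cd CP lam * r)%:E * (ug_const * fine I + kp * fine Q)%:E)%E.
    rewrite (eq_integral (fun y => (`|v y * \1_T y - m|)%:E)); last first.
      by move=> y; rewrite inE => yb; rewrite indicE mem_set ?mulr1//; exact: rT.
    apply: (le_trans hm); apply: lee_wpmul2l; first by rewrite lee_fin mulr_ge0 ?(ltW r0)//; slra.
    rewrite -/l2 (eq_integral (fun y => ug_const%:E * g1 y + kp%:E * r1 y)%E); last first.
      move=> y yb; rewrite indicE (_ : (y \in ~` B x (l2 * r)) = false) ?mule0 ?adde0//.
      by apply/negbTE; rewrite notin_setE => h; apply: h; rewrite inE in yb.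
    rewrite (int_add _ (dball_measurable metric borel _ _) bG bk) EFinD.
    rewrite (int_scale _ (dball_measurable metric borel _ _) uc0 bg1) (int_scale _ (dball_measurable metric borel _ _) kpE br1).
    rewrite !EFinM -IE -QE; apply: leeD; apply: lee_wpmul2l => //.
      by rewrite -g1I; apply: int_sub => //; exact: dball_measurable.
    by apply: int_sub => //; exact: dball_measurable.
  have := osc_avg_le (dball_measurable metric borel x r) (mBE metric dbl x r) m1 iv hm2.
  by rewrite muleA -!EFinM.
have main : (osc_avg mu (B x r) v <= (2 / mB x r * (CP2 Cd CP lam * r) * (ug_const * fine I))%:E)%E.
  apply/lee_addgt0Pr => e e0; set a := 2 / mB x r * (CP2 Cd CP lam * r).
  have cp0 : 0 <= CP2 Cd CP lam by exact: le_trans c2.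
  have a0 : 0 <= a.
    by rewrite /a; apply: mulr_ge0; apply: mulr_ge0 => //; rewrite ?invr_ge0 ltW.
  have aq : 0 <= a * fine Q by rewrite mulr_ge0.
  have aq1 : 0 < a * fine Q + 1 by slra.
  apply: (le_trans (osc (e / (a * fine Q + 1)) (divr_gt0 e0 aq1))); rewrite -/a -EFinD lee_fin mulrDr lerD2l.
  rewrite mulrCA -mulrA -[leRHS](divfK (lt0r_neq0 aq1)) -mulrA; apply: ler_wpM2l; first exact: ltW.
  by apply: ler_wpM2l; [rewrite invr_ge0 ltW|rewrite lerDl].
apply: (le_trans main); rewrite IE -!EFinM lee_fin.
have mm : mB x (3 * l2 * r) <= Cd ^+ j * mB x r.
  by apply: (mB_iter metric borel dbl); rewrite (distxx metric) add0r ler_pM2r.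
have ratio : (mB x r)^-1 <= Cd ^+ j * (mB x (3 * l2 * r))^-1.
  by rewrite ler_pdivlMr// ler_pdivrMl// [X in _ <= X]mulrC.
have k0 : 0 <= 2 * CP2 Cd CP lam * ug_const * r * fine I.
  by rewrite mulr_ge0// mulr_ge0 ?(ltW r0)// mulr_ge0// mulr_ge0//; slra.
apply: (@le_trans _ _ (2 * CP2 Cd CP lam * ug_const * r * fine I * (Cd ^+ j * (mB x (3 * l2 * r))^-1))).
  apply: le_trans (ler_wpM2l k0 ratio); rewrite le_eqVlt; apply/orP; left; apply/eqP; ring.
rewrite (_ : _ * _ = 2 * CP2 Cd CP lam * ug_const * Cd ^+ j * (r * (fine I * (mB x (3 * l2 * r))^-1))); last by ring.
rewrite -[leRHS]mulrA; apply: ler_wpM2r; last by rewrite le_max lexx orbT.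
by rewrite !mulr_ge0 ?invr_ge0 ?(ltW r0) ?(ltW m3).
Qed.
End Final.

Theorem theorem1p1 (R : realType) (Cd CP lam : R) :
  exists cstar : R, 0 < cstar /\
  forall (d : measure_display) (X : measurableType d) (dist : X -> X -> R)
         (mu : {measure set X -> \bar R}),
    is_metric dist -> borel_for dist -> dcomplete dist ->
    (exists x y : X, 0 < dist x y) ->
    doubling dist mu Cd ->
    PI11 dist mu CP lam ->
    forall A : set X,
      qe1 dist mu (fun x =>
        (liminf0 (fun r : R =>
           (capp dist mu 1 (A `&` dball dist x r) (dball dist x (2 * r))
            / capp dist mu 1 (dball dist x r) (dball dist x (2 * r)))%E)
         < cstar%:E)%E) ->
      (forall p : R, 1 <= p -> removable dist mu p A) /\
      PI_compl dist mu 1 A.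
Proof.
(* A doubling constant below 1 contradicts [Cd_ge1] as soon as the space has a point, so any
   threshold will do. *)
have [C1|C1] := leP 1 Cd; last first.
  exists 1; split => // d X dist mu metric borel _ [x _] dbl.
  by have := Cd_ge1 metric borel dbl x; rewrite leNgt C1.
have [cs [Lq [Cq [cs0 Lq1 Cq0 csmall Q]]]] := quantile CP lam C1.
exists cs; split => // d X dist mu metric borel cplt diam dbl PI A [N [N0 Ngood]].
have A0 := A_null metric borel cplt diam dbl PI cs0 csmall (cap1_null metric borel N0) Ngood.
have HQ := Q d X dist mu metric borel cplt diam dbl PI A N N0 Ngood.
split=> [p p1|]; last exact: (PI_compl_of metric borel dbl PI Cq0 Lq1 A0 HQ).
by have [x _] := diam; exact: (removable_of metric borel dbl Cq0 Lq1 A0 HQ x p1).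
Qed.
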